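(* There exists a system of Beurling primes $q=\{q_n\}_{n\geq1}$, with Beurling integers $\{\nu_n\}_{n\geq1}$, such that: (i) $\zeta_q(s)$ has an analytic continuation to $\{\Re s>1/2\}$ except for a simple pole at $s=1$; (ii) $\zeta_q(s)$ has no zeros in $\{\Re s>1/2\}$; (iii) $\pi_q(x)=\mathrm{li}(x)+O(1)$; (iv) there is $a>0$ such that for every $\varepsilon>0$, $N_q(x)=ax+O_\varepsilon(x^{1/2+\varepsilon})$; (v) Bohr's condition holds: there exist $c_1,c_2>0$ with $\nu_{n+1}-\nu_n\geq c_1\nu_{n+1}^{-c_2}$ for all $n\in\mathbb{N}$.
   Context: A system of Beurling primes is an increasing sequence $q=\{q_n\}$ of real numbers with $1<q_n\to\infty$ such that $\{\log q_n\}$ is linearly independent over $\mathbb{Q}$. The Beurling integers are all finite products of elements of $q$ (including $1$), listed increasingly as $\nu_1<\nu_2<\cdots$. $\zeta_q(s)=\sum_{n}\nu_n^{-s}=\prod_n(1-q_n^{-s})^{-1}$ for $\Re s$ large. $N_q(x)=\#\{n:\nu_n\leq x\}$, $\pi_q(x)=\#\{n:q_n\leq x\}$, and $\mathrm{li}(x)=\int_1^x(1-u^{-1})(\log u)^{-1}\,du$. *)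

(* Defs.v *)
From Stdlib Require Import Reals List QArith Qreals.
From Coquelicot Require Import Coquelicot.
Open Scope R_scope.

Definition has_card {T : Type} (P : T -> Prop) (m : nat) : Prop :=
  exists l : list T, NoDup l /\ length l = m /\ (forall t, In t l <-> P t).

Definition rsum (K : nat) (f : nat -> R) : R :=
  fold_right Rplus 0 (map f (seq 0 K)).
Definition rprod (K : nat) (f : nat -> R) : R :=
  fold_right Rmult 1 (map f (seq 0 K)).

Definition beurling_primes (q : nat -> R) : Prop :=
  (forall n, q n < q (S n)) /\
  (forall n, 1 < q n) /\
  (forall M : R, exists N : nat, forall n, (N <= n)%nat -> M < q n) /\
  (forall (K : nat) (c : nat -> Q),
      rsum K (fun k => Q2R (c k) * ln (q k)) = 0 ->
      forall k, (k < K)%nat -> Q2R (c k) = 0).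

Definition beurling_integer (q : nat -> R) (y : R) : Prop :=
  exists (K : nat) (e : nat -> nat), y = rprod K (fun k => q k ^ e k).

(** nu lists the Beurling integers increasingly (nu 0 = 1 = nu_1 of the paper). *)
Definition lists_beurling_integers (q nu : nat -> R) : Prop :=
  (forall n, nu n < nu (S n)) /\
  (forall y, beurling_integer q y <-> exists n, nu n = y).

Definition cpow (x : R) (s : C) : C :=
  (exp (Re s * ln x) * cos (Im s * ln x),
   exp (Re s * ln x) * sin (Im s * ln x)).

Definition holomorphic_on (f : C -> C) (U : C -> Prop) : Prop :=
  forall z, U z -> @ex_derive C_AbsRing C_NormedModule f z.

Definition li (x : R) : R := RInt (fun u => (1 - / u) / ln u) 1 x.

(* Main.v *)
(* Write [lam n = log q_n] and divide the half-line into intervals [[Y n, Y (n+1)]] of unit mass for the density of [li (exp y)].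
   Any choice of [lam n] in the n-th interval gives (iii). Bohr's condition and linear independence only require [lam n] to avoid small
   neighbourhoods of the numbers [(log b - log a) / k], where [a, b] are monomials in the earlier primes; the total length of these is small.
   For the analytic continuation up to the critical line, choosing [lam n] at random with the density of [li] would make [sum_n (q_n^(-s) - mean)]
   a martingale with square-summable increments for [Re s > 1/2]; the choice is derandomised by keeping bounded a weighted sum of
   integrals of [exp (2 Re sum)] along the lines [Re s = 1/2 + 1/(k+2)]. The potential and the excluded set are handled together by bisection.

   The resulting function [W], with [zeta s = exp (W s) * s / (s - 1)], is analytic for [Re s > 1/2], which gives (i) and (ii). The potential bounds
   the mean square of [exp W] on every line [Re s = 1/2 + 1/(k+2)], with weight [1 / (t log^2 t)]. Shifting a Gaussian-smoothed Perron
   integral to that line compares [N (exp z) exp (- z)] at [z] and at [w] in [[z, 2z]] up to a factor [1 + O (exp (- z (1/2 - eps)))];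
   chaining the comparisons gives (iv). The density is positive because there are at least as many integers as primes. *)

Require Import Defs.
From Stdlib Require Import Reals List FinFun Arith Lra Lia Psatz ClassicalEpsilon QArith Qreals.
From Coquelicot Require Import Coquelicot.
Open Scope R_scope.

(** The n-th interval has length at most [exp (- Y n / 2)], so replacing a prime by the mean over
    its interval costs [O (|s| exp (- (Re s + 1/2) Y n))]: the series for [W] converges absolutely
    for [Re s > 1/2] wherever the primes lie in their intervals. But this only yields
    [W = O (1 + |s|)], hence a zeta function that might grow like [exp (K |t|)]. The potential
    supplies what is missing, a mean square bound on vertical lines; the crude bound still serves on
    the horizontal sides of the contour, where the height tends to infinity at a fixed smoothing
    length and the Gaussian factor wins. No residue is computed. Differentiating the Perron integral
    in its parameter [y] brings down the factor [s - 1] and removes the pole; the contour is shifted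
    for the derivative, and integrating back compares two values of [y]. The price is that the
    density does not appear as a residue. It is a limit, found by the Cauchy criterion for
    [ln (1 + N (exp z) exp (- z))]; the logarithm turns factors [1 + e] into additive errors, so no
    prior bound on the count is required. Positivity of the limit is then a separate matter. *)

(** * Real calculus: continuity, integrals, parameters under the integral sign *)

Lemma continuous_Rplus (f g : R -> R) x : continuous f x -> continuous g x -> continuous (fun x => f x + g x) x.
Proof. intros; apply (continuous_plus f g); assumption. Qed.
Lemma continuous_Rminus (f g : R -> R) x : continuous f x -> continuous g x -> continuous (fun x => f x - g x) x.
Proof. intros; apply (continuous_minus f g); assumption. Qed.
Lemma continuous_Rmult (f g : R -> R) x : continuous f x -> continuous g x -> continuous (fun x => f x * g x) x.
Proof. intros; apply (continuous_mult (K:=R_AbsRing) f g); assumption. Qed.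
Lemma continuous_Ropp (f : R -> R) x : continuous f x -> continuous (fun x => - f x) x.
Proof. intros; apply (continuous_opp f); assumption. Qed.
Lemma continuous_Rcomp (g f : R -> R) x : (forall y, continuous g y) -> continuous f x -> continuous (fun x => g (f x)) x.
Proof. intros; apply (continuous_comp f g); auto. Qed.
Lemma continuous_Rexp x : continuous exp x.
Proof. apply (ex_derive_continuous exp); auto_derive; auto. Qed.
Lemma continuous_Rcos x : continuous cos x.
Proof. apply (ex_derive_continuous cos); auto_derive; auto. Qed.
Lemma continuous_Rsin x : continuous sin x.
Proof. apply (ex_derive_continuous sin); auto_derive; auto. Qed.

Ltac cont_tac :=
  repeat first
  [ match goal with |- continuous (fun _ => ?c) _ => apply continuous_const end
  | match goal with |- continuous (fun x => x) _ => apply continuous_id end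
  | match goal with |- continuous (fun x => @?f x + @?g x) _ => apply (continuous_Rplus f g) end
  | match goal with |- continuous (fun x => @?f x - @?g x) _ => apply (continuous_Rminus f g) end
  | match goal with |- continuous (fun x => @?f x * @?g x) _ => apply (continuous_Rmult f g) end
  | match goal with |- continuous (fun x => - @?f x) _ => apply (continuous_Ropp f) end
  | match goal with |- continuous (fun x => exp (@?f x)) _ => apply (continuous_Rcomp exp f); [intros; apply continuous_Rexp|] end
  | match goal with |- continuous (fun x => cos (@?f x)) _ => apply (continuous_Rcomp cos f); [intros; apply continuous_Rcos|] end
  | match goal with |- continuous (fun x => sin (@?f x)) _ => apply (continuous_Rcomp sin f); [intros; apply continuous_Rsin|] end
  | match goal with |- continuous exp _ => apply continuous_Rexp end
  | assumption
  | match goal with H : forall y, continuous ?f y |- continuous ?f _ => apply H end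
  | match goal with H : forall y, continuous ?f y |- continuous (fun x => ?f x) _ => apply H end ].

Lemma ex_RInt_cont (f : R -> R) a b : (forall x, continuous f x) -> ex_RInt f a b.
Proof. intros H; apply (ex_RInt_continuous (V:=R_CompleteNormedModule)); intros; apply H. Qed.

Lemma ex_RInt_cont_on (f : R -> R) a b : a <= b -> (forall x, a <= x <= b -> continuous f x) -> ex_RInt f a b.
Proof.
  intros Hab H; apply (ex_RInt_continuous (V:=R_CompleteNormedModule)); intros z Hz.
  rewrite Rmin_left, Rmax_right in Hz by lra. apply H; lra.
Qed.

Lemma RInt_le_cont (f g : R -> R) a b : a <= b -> (forall x, a <= x <= b -> continuous f x) -> (forall x, a <= x <= b -> continuous g x) ->
  (forall x, a < x < b -> f x <= g x) -> RInt f a b <= RInt g a b.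
Proof. intros; apply RInt_le; auto using ex_RInt_cont_on. Qed.

Lemma RInt_abs_le_cont (f g : R -> R) a b : a <= b -> (forall x, a <= x <= b -> continuous f x) -> (forall x, a <= x <= b -> continuous g x) ->
  (forall x, a < x < b -> Rabs (f x) <= g x) -> Rabs (RInt f a b) <= RInt g a b.
Proof.
  intros Hab Hf Hg H. apply Rabs_le. split.
  - rewrite <- (Ropp_involutive (RInt f a b)). apply Ropp_le_contravar.
    change (- RInt f a b) with (opp (RInt f a b)).
    rewrite <- (RInt_opp (V:=R_CompleteNormedModule) f a b) by (apply ex_RInt_cont_on; auto).
    apply RInt_le_cont; auto. intros; apply (continuous_opp f); auto.
    intros x Hx. specialize (H x Hx). unfold opp; simpl. apply Rabs_le_between in H. lra.
  - apply RInt_le_cont; auto. intros x Hx. specialize (H x Hx). apply Rabs_le_between in H. lra.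
Qed.

Lemma RInt_Rplus (f g : R -> R) a b : ex_RInt f a b -> ex_RInt g a b -> RInt (fun x => f x + g x) a b = RInt f a b + RInt g a b.
Proof. intros; apply (RInt_plus f g); auto. Qed.
Lemma RInt_Rminus (f g : R -> R) a b : ex_RInt f a b -> ex_RInt g a b -> RInt (fun x => f x - g x) a b = RInt f a b - RInt g a b.
Proof. intros; apply (RInt_minus f g); auto. Qed.
Lemma RInt_Rscal (f : R -> R) c a b : ex_RInt f a b -> RInt (fun x => c * f x) a b = c * RInt f a b.
Proof. intros; apply (RInt_scal f); auto. Qed.
Lemma RInt_Rconst (c a b : R) : RInt (fun _ => c) a b = c * (b - a).
Proof. rewrite RInt_const. unfold scal; simpl; unfold mult; simpl. ring. Qed.
Lemma RInt_cat (f : R -> R) a b c : ex_RInt f a b -> ex_RInt f b c -> RInt f a b + RInt f b c = RInt f a c.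
Proof. intros; apply (RInt_Chasles f); auto. Qed.
Lemma RInt_nonneg (f : R -> R) a b : a <= b -> (forall x, a <= x <= b -> continuous f x) -> (forall x, a < x < b -> 0 <= f x) -> 0 <= RInt f a b.
Proof. intros; apply RInt_ge_0; auto using ex_RInt_cont_on. Qed.
Lemma RInt_FTC (F f : R -> R) a b : a <= b -> (forall x, a <= x <= b -> is_derive F x (f x)) -> (forall x, a <= x <= b -> continuous f x) ->
  RInt f a b = F b - F a.
Proof.
  intros Hab HF Hf. apply is_RInt_unique.
  apply (is_RInt_derive F f); intros x; rewrite Rmin_left, Rmax_right by lra; auto.
Qed.

Lemma is_derive_RInt_cont (f : R -> R) a x : (forall y, continuous f y) -> is_derive (fun y => RInt f a y) x (f x).
Proof.
  intros H. apply (is_derive_RInt f (fun y => RInt f a y) a x).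
  - exists (mkposreal 1 Rlt_0_1); intros y _. apply (RInt_correct f). apply ex_RInt_cont; auto.
  - apply H.
Qed.

Lemma derive_upper (f df : R -> R) a b M : a <= b -> (forall x, a <= x <= b -> is_derive f x (df x)) -> (forall x, a <= x <= b -> df x <= M) ->
  f b - f a <= M * (b - a).
Proof.
  intros Hab Hd HM. destruct (MVT_gen f a b df) as [c [Hc Heq]].
  - intros x; rewrite Rmin_left, Rmax_right by lra; intros; apply Hd; lra.
  - intros x; rewrite Rmin_left, Rmax_right by lra; intros Hx.
    apply continuity_pt_filterlim. apply (ex_derive_continuous f). exists (df x). apply Hd; lra.
  - rewrite Rmin_left, Rmax_right in Hc by lra. rewrite Heq. apply Rmult_le_compat_r; [lra|]. apply HM; lra.
Qed.

Lemma derive_nonneg (f df : R -> R) a b : a <= b -> (forall x, a <= x <= b -> is_derive f x (df x)) -> (forall x, a <= x <= b -> 0 <= df x) ->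
  f a <= f b.
Proof.
  intros Hab Hd HM.
  assert (K := derive_upper (fun x => - f x) (fun x => - df x) a b 0 Hab).
  cut (- f b - - f a <= 0 * (b - a)); [lra|]. apply K.
  - intros; apply (is_derive_opp f). auto.
  - intros x Hx; specialize (HM x Hx); lra.
Qed.

Lemma derive_zero_const (f : R -> R) a b : a <= b -> (forall x, a <= x <= b -> is_derive f x 0) -> f a = f b.
Proof.
  intros Hab Hd. apply Rle_antisym.
  - apply (derive_nonneg f (fun _ => 0)); auto; intros; lra.
  - assert (K := derive_upper f (fun _ => 0) a b 0 Hab Hd). cut (f b - f a <= 0 * (b - a)); [lra|]. apply K; intros; lra.
Qed.

Lemma continuity_2d_swap (f : R -> R -> R) x y : continuity_2d_pt f x y -> continuity_2d_pt (fun a b => f b a) y x.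
Proof.
  intros H; apply continuity_2d_pt_filterlim. apply (filterlim_comp _ _ _ (fun z => (snd z, fst z)) (fun z => f (fst z) (snd z)) _ (locally (x,y))).
  - intros P [e He]; exists e; intros [p q] [Hp Hq]; apply He; split; auto.
  - apply continuity_2d_pt_filterlim, H.
Qed.

Lemma cont2_slice_l (f : R -> R -> R) x y : continuity_2d_pt f x y -> continuous (fun x => f x y) x.
Proof.
  intros H. apply continuity_2d_pt_filterlim in H.
  apply (filterlim_comp _ _ _ (fun x => (x, y)) (fun z => f (fst z) (snd z)) (locally x) (locally (x,y))); auto.
  intros P [d Hd]. exists d. intros z Hz. apply Hd. split; [exact Hz|apply ball_center].
Qed.
Lemma cont2_slice_r (f : R -> R -> R) x y : continuity_2d_pt f x y -> continuous (fun y => f x y) y.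
Proof.
  intros H. apply continuity_2d_pt_filterlim in H.
  apply (filterlim_comp _ _ _ (fun y => (x, y)) (fun z => f (fst z) (snd z)) (locally y) (locally (x,y))); auto.
  intros P [d Hd]. exists d. intros z Hz. apply Hd. split; [apply ball_center|exact Hz].
Qed.

Lemma continuous_RInt_param (f : R -> R -> R) a b x : a <= b -> (forall u v, continuity_2d_pt f u v) ->
  continuous (fun x => RInt (fun t => f x t) a b) x.
Proof.
  intros Hab H. apply filterlim_locally. intros eps.
  (* The [+ 1] keeps the quotient meaningful when [a = b]. *)
  assert (He : 0 < eps / (b - a + 1)). { apply Rdiv_lt_0_compat; [apply eps|lra]. }
  destruct (uniform_continuity_2d f (x-1) (x+1) a b (fun u v _ _ => H u v) (mkposreal _ He)) as [d Hd].
  assert (Hm : 0 < Rmin d 1) by (apply Rmin_pos; [apply d|lra]).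
  exists (mkposreal _ Hm). intros z Hz.
  assert (Hz' : Rabs (z - x) < Rmin d 1) by exact Hz.
  assert (Hz1 := Rmin_l d 1). assert (Hz2 := Rmin_r d 1).
  assert (Hz3 : -1 <= z - x <= 1). { apply Rabs_le_between. lra. }
  change (Rabs (RInt (fun t => f z t) a b - RInt (fun t => f x t) a b) < eps).
  assert (Cs : forall w v, continuous (fun t => f w t) v) by (intros; apply cont2_slice_r; auto).
  rewrite <- RInt_Rminus by (apply ex_RInt_cont; auto).
  apply Rle_lt_trans with (RInt (fun _ => eps / (b - a + 1)) a b).
  - apply RInt_abs_le_cont; auto. intros; apply continuous_Rminus; auto. intros; apply continuous_const.
    intros t Ht. apply Rlt_le. apply (Hd x t z t); try lra. rewrite Rminus_diag, Rabs_R0; apply d.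
  - rewrite RInt_Rconst. destruct eps as [e He0]; simpl in *.
    replace e with (e / (b - a + 1) * (b - a + 1)) at 2 by (field; lra). nra.
Qed.

(** Both sides, as functions of the upper limit of the [x]-integral, vanish at [a] and have the same
    derivative, the right-hand side by differentiation under the integral sign. *)
Lemma RInt_Fubini (f : R -> R -> R) a b c d : a <= b -> c <= d -> (forall u v, continuity_2d_pt f u v) ->
  RInt (fun x => RInt (fun y => f x y) c d) a b = RInt (fun y => RInt (fun x => f x y) a b) c d.
Proof.
  intros Hab Hcd H.
  assert (Cr : forall w v, continuous (fun t => f w t) v) by (intros; apply cont2_slice_r; auto).
  assert (Cl : forall w v, continuous (fun t => f t w) v) by (intros; apply cont2_slice_l; auto).
  assert (D1 : forall x, is_derive (fun z => RInt (fun x => RInt (fun y => f x y) c d) a z) x (RInt (fun y => f x y) c d)).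
  { intros x. apply (is_derive_RInt_cont (fun x => RInt (fun y => f x y) c d)). intros; apply continuous_RInt_param; auto. }
  assert (Dz : forall y z, is_derive (fun z => RInt (fun x => f x y) a z) z (f z y)).
  { intros y z. apply (is_derive_RInt_cont (fun x => f x y)). auto. }
  assert (D2 : forall x, is_derive (fun z => RInt (fun y => RInt (fun x => f x y) a z) c d) x (RInt (fun y => f x y) c d)).
  { intros x.
    replace (RInt (fun y => f x y) c d) with (RInt (fun y => Derive (fun z => RInt (fun x => f x y) a z) x) c d).
    apply (is_derive_RInt_param (fun z y => RInt (fun x => f x y) a z)).
    - exists (mkposreal 1 Rlt_0_1); intros z _ t _. eexists; apply Dz.
    - intros t _. apply continuity_2d_pt_ext with (2:=H x t). intros; symmetry; apply is_derive_unique, Dz.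
    - exists (mkposreal 1 Rlt_0_1); intros z _. apply ex_RInt_cont. intros y.
      (* The derivative at [x] looks at a two-sided neighbourhood, so [z] may lie to the left of
         [a], where the limits must be swapped. *)
      destruct (Rle_dec a z).
      + apply (continuous_RInt_param (fun y x => f x y)); auto. intros u v; apply continuity_2d_swap; auto.
      + apply continuous_ext with (fun y => - RInt (fun x => f x y) z a).
        { intros w. apply (opp_RInt_swap (fun x => f x w)). apply ex_RInt_swap, ex_RInt_cont; auto. }
        apply continuous_Ropp. apply (continuous_RInt_param (fun y x => f x y)); try lra. intros u v; apply continuity_2d_swap; auto.
    - apply RInt_ext; intros; apply is_derive_unique, Dz. }
  set (g := fun z => RInt (fun x => RInt (fun y => f x y) c d) a z - RInt (fun y => RInt (fun x => f x y) a z) c d).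
  assert (G : g a = g b).
  { apply derive_zero_const; auto. intros x _. replace 0 with (RInt (fun y => f x y) c d - RInt (fun y => f x y) c d) by ring.
    apply (is_derive_minus (K:=R_AbsRing) (V:=R_NormedModule)); auto. }
  assert (G0 : g a = 0).
  { unfold g. rewrite RInt_point. rewrite (RInt_ext (V:=R_CompleteNormedModule) (fun y => RInt (fun x => f x y) a a) (fun _ => 0)).
    rewrite RInt_Rconst. unfold zero; simpl; ring. intros; apply (RInt_point a (fun z => f z x)). }
  unfold g in *; lra.
Qed.

(* [RInt] is typed in the carrier of a canonical structure, which hides the type [R] from [ring] and [field]. *)
Ltac asR := match goal with |- ?a = ?b => change (@eq R a b) end.

(** * Finite sums *)

Fixpoint psum (f : nat -> R) (n : nat) : R :=
  match n with O => 0 | S m => psum f m + f m end.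

Lemma psum_le (f g : nat -> R) n : (forall k, (k < n)%nat -> f k <= g k) -> psum f n <= psum g n.
Proof. induction n; simpl; intros H; [lra|]. assert (f n <= g n) by (apply H; lia). assert (psum f n <= psum g n) by (apply IHn; intros; apply H; lia). lra. Qed.
Lemma psum_ext (f g : nat -> R) n : (forall k, (k < n)%nat -> f k = g k) -> psum f n = psum g n.
Proof. intros H; apply Rle_antisym; apply psum_le; intros; rewrite H by auto; lra. Qed.
Lemma psum_nonneg (f : nat -> R) n : (forall k, 0 <= f k) -> 0 <= psum f n.
Proof. intros H; induction n; simpl; [lra|]. specialize (H n); lra. Qed.
Lemma psum_plus f g n : psum (fun k => f k + g k) n = psum f n + psum g n.
Proof. induction n; simpl; [ring|rewrite IHn; ring]. Qed.
Lemma psum_scal c f n : psum (fun k => c * f k) n = c * psum f n.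
Proof. induction n; simpl; [ring|rewrite IHn; ring]. Qed.
Lemma psum_mono f m n : (forall k, 0 <= f k) -> (m <= n)%nat -> psum f m <= psum f n.
Proof. intros H Hmn; induction Hmn; [lra|]. simpl. specialize (H m0); lra. Qed.
Lemma psum_telescope f n : psum (fun k => f k - f (S k)) n = f O - f n.
Proof. induction n; simpl; [ring|rewrite IHn; ring]. Qed.
Lemma sum_n_psum f n : sum_n f n = psum f (S n).
Proof.
  induction n. rewrite sum_O; simpl; rewrite Rplus_0_l; reflexivity. rewrite sum_Sn, IHn. reflexivity.
Qed.

Lemma exp_le_compat x y : x <= y -> exp x <= exp y.
Proof. intros [H|H]; [left; apply exp_increasing; auto|rewrite H; lra]. Qed.

(** * The density of [li] in the logarithmic variable *)

(* [om y = (exp y - 1) / y], the density of [li (exp y)], without the singularity at [0]. *)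
Definition om (y : R) : R := RInt (fun v => exp (v * y)) 0 1.
Definition Lam (y : R) : R := RInt om 0 y.

Lemma om_continuous y : continuous om y.
Proof.
  apply (continuous_RInt_param (fun y v => exp (v * y))); [lra|]. intros u v.
  apply (continuity_1d_2d_pt_comp exp (fun x y => y * x)).
  apply derivable_continuous_pt, derivable_pt_exp.
  apply continuity_2d_pt_mult; [apply continuity_2d_pt_id2|apply continuity_2d_pt_id1].
Qed.

Lemma om_integrand y v : continuous (fun v => exp (v * y)) v.
Proof. cont_tac. Qed.

Lemma om_mult y : y * om y = exp y - 1.
Proof.
  unfold om. rewrite <- RInt_Rscal by (apply ex_RInt_cont; apply om_integrand).
  rewrite (RInt_FTC (fun v => exp (v * y))).
  - rewrite Rmult_1_l, Rmult_0_l, exp_0. ring.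
  - lra.
  - intros x _. auto_derive; auto. ring.
  - intros. cont_tac.
Qed.

(** Jensen's inequality: [exp (v * y)] lies above its tangent at [v = 1/2], and the linear term
    integrates to zero over [[0, 1]]. *)
Lemma om_ge_exp_half y : exp (y / 2) <= om y.
Proof.
  replace (exp (y/2)) with (RInt (fun v => exp (y/2) * (1 + (v - /2) * y)) 0 1).
  - apply RInt_le_cont; [lra| | |].
    + intros; cont_tac.
    + intros; apply om_integrand.
    + intros v _. replace (v * y) with (y / 2 + (v - /2) * y) by field. rewrite exp_plus.
      apply Rmult_le_compat_l; [apply Rlt_le, exp_pos|apply exp_ineq1_le].
  - rewrite (RInt_FTC (fun v => exp (y/2) * (v + (v * v / 2 - v / 2) * y))).
    + asR. field.
    + lra.
    + intros x _. set (e := exp (y/2)). auto_derive; auto. field.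
    + intros. cont_tac.
Qed.

Lemma om_pos y : 0 < om y.
Proof. assert (H := om_ge_exp_half y). assert (K := exp_pos (y/2)). lra. Qed.

Lemma om_ge1 y : 0 <= y -> 1 <= om y.
Proof. intros H. assert (K := om_ge_exp_half y). assert (J := exp_ineq1_le (y/2)). lra. Qed.

Lemma om_le_exp y : 0 <= y -> om y <= exp y.
Proof.
  intros Hy. replace (exp y) with (RInt (fun _ => exp y) 0 1) by (rewrite RInt_Rconst; asR; ring).
  apply RInt_le_cont; [lra| | |].
  - intros; apply om_integrand.
  - intros; apply continuous_const.
  - intros v Hv. apply exp_le_compat. nra.
Qed.

Lemma Lam_derive y : is_derive Lam y (om y).
Proof. apply (is_derive_RInt_cont om). apply om_continuous. Qed.

Lemma Lam_0 : Lam 0 = 0.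
Proof. apply (RInt_point 0 om). Qed.

Lemma Lam_diff a b : RInt om a b = Lam b - Lam a.
Proof.
  unfold Lam. assert (H := RInt_cat om 0 a b). rewrite <- H by (apply ex_RInt_cont, om_continuous). lra.
Qed.

Lemma Lam_lt a b : a < b -> Lam a < Lam b.
Proof.
  intros Hab. destruct (MVT_gen Lam a b om) as [c [Hc He]].
  - intros; apply Lam_derive.
  - intros x Hx. apply continuity_pt_filterlim. apply (ex_derive_continuous Lam). exists (om x). apply Lam_derive.
  - assert (H := om_pos c). nra.
Qed.

Lemma Lam_ge y : 0 <= y -> y <= Lam y.
Proof.
  intros Hy. assert (H := derive_nonneg (fun y => Lam y - y) (fun y => om y - 1) 0 y Hy).
  cut (Lam 0 - 0 <= Lam y - y). rewrite Lam_0; lra. apply H.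
  - intros. apply (is_derive_minus (K:=R_AbsRing) (V:=R_NormedModule)). apply Lam_derive. apply (is_derive_id (K:=R_AbsRing)).
  - intros x Hx. assert (K := om_ge1 x); lra.
Qed.

Lemma Lam_le y : 0 <= y -> Lam y <= exp y - 1.
Proof.
  intros Hy. assert (H := derive_nonneg (fun y => exp y - Lam y) (fun y => exp y - om y) 0 y Hy).
  cut (exp 0 - Lam 0 <= exp y - Lam y). rewrite Lam_0, exp_0; lra. apply H.
  - intros. apply (is_derive_minus (K:=R_AbsRing) (V:=R_NormedModule)). apply is_derive_exp. apply Lam_derive.
  - intros x Hx. assert (K := om_le_exp x); lra.
Qed.

Lemma Lam_inv (c : R) : 0 <= c -> exists y, 0 <= y /\ Lam y = c.
Proof.
  intros Hc. destruct (IVT_gen Lam 0 c c) as [y [Hy He]].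
  - intros x. apply continuity_pt_filterlim. apply (ex_derive_continuous Lam). exists (om x). apply Lam_derive.
  - rewrite Lam_0, Rmin_left, Rmax_right; assert (H := Lam_ge c Hc); lra.
  - rewrite Rmin_left, Rmax_right in Hy by lra. exists y; split; lra.
Qed.

(** Mass [n + 1] rather than [n] leaves an initial interval [[0, Y 0]] of unit mass without a prime;
    it gives [exp (Y n) >= n + 2], so every prime is at least 2. *)
Definition Y (n : nat) : R :=
  proj1_sig (constructive_indefinite_description _ (Lam_inv (INR n + 1) ltac:(assert (H := pos_INR n); lra))).

Lemma Y_spec n : 0 <= Y n /\ Lam (Y n) = INR n + 1.
Proof. unfold Y. destruct constructive_indefinite_description; auto. Qed.
Lemma Y_nonneg n : 0 <= Y n.
Proof. apply Y_spec. Qed.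
Lemma Y_lt n : Y n < Y (S n).
Proof.
  destruct (Y_spec n) as [_ H1]. destruct (Y_spec (S n)) as [_ H2]. rewrite S_INR in H2.
  destruct (Rlt_le_dec (Y n) (Y (S n))) as [|[H|H]]; auto. apply Lam_lt in H; lra. rewrite H in H2; lra.
Qed.
Lemma exp_Y n : INR n + 2 <= exp (Y n).
Proof. destruct (Y_spec n) as [H1 H2]. assert (K := Lam_le _ H1). lra. Qed.
Lemma Y_mass n : RInt om (Y n) (Y (S n)) = 1.
Proof. rewrite Lam_diff. rewrite (proj2 (Y_spec n)), (proj2 (Y_spec (S n))), S_INR; asR; ring. Qed.
(** The density is at least [exp (Y n / 2)] on an interval of unit mass. This square-root saving is
    what carries the logarithm of zeta down to [Re s = 1/2]. *)
Lemma Y_gap n : Y (S n) - Y n <= exp (- (Y n / 2)).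
Proof.
  assert (H := Y_mass n). assert (L := Y_lt n).
  assert (K : RInt (fun _ => exp (Y n / 2)) (Y n) (Y (S n)) <= RInt om (Y n) (Y (S n))).
  { apply RInt_le_cont; [lra| | |]. intros; apply continuous_const. intros; apply om_continuous.
    intros x Hx. apply Rle_trans with (exp (x/2)). apply exp_le_compat; lra. apply om_ge_exp_half. }
  rewrite RInt_Rconst, H in K. rewrite exp_Ropp. assert (P := exp_pos (Y n / 2)).
  apply Rmult_le_reg_l with (exp (Y n / 2)); auto. rewrite Rinv_r; lra.
Qed.
Lemma Y_gap1 n : Y (S n) - Y n <= 1.
Proof.
  apply Rle_trans with (1 := Y_gap n). rewrite <- exp_0. apply exp_le_compat. assert (H := Y_nonneg n); lra.
Qed.

Lemma powser_step (p x : R) : 1 < p -> 1 <= x -> (p - 1) * exp (- p * ln (x + 1)) <= exp (- (p - 1) * ln x) - exp (- (p - 1) * ln (x + 1)).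
Proof.
  intros Hp Hx.
  assert (H := derive_upper (fun z => exp (- (p - 1) * ln z)) (fun z => - (p - 1) / z * exp (- (p-1) * ln z)) x (x+1) (- (p-1) * exp (- p * ln (x+1)))).
  cut (exp (- (p - 1) * ln (x + 1)) - exp (- (p - 1) * ln x) <= - (p - 1) * exp (- p * ln (x + 1)) * (x + 1 - x)); [lra|].
  apply H; [lra| |].
  - intros z Hz. auto_derive. lra. field; lra.
  - intros z Hz. replace (- (p - 1) / z * exp (- (p - 1) * ln z)) with (- (p-1) * exp (- p * ln z)).
    + assert (exp (- p * ln (x+1)) <= exp (- p * ln z)); [|nra]. apply exp_le_compat.
      assert (ln z <= ln (x+1)) by (apply ln_le; lra). nra.
    + replace (- p * ln z) with (- (p - 1) * ln z + - ln z) by ring. rewrite exp_plus, (exp_Ropp (ln z)), exp_ln by lra. field; lra.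
Qed.

(** Since [exp (Y k) >= k + 2], this is the integral test for the series of [(k + 2)^(-p)], carried
    out by telescoping [x^(1 - p)]. *)
Lemma psum_exp_Y (p : R) : 1 < p -> exists C, forall n, psum (fun k => exp (- p * Y k)) n <= C.
Proof.
  intros Hp. exists (/ (p - 1)). intros n.
  apply Rle_trans with (psum (fun k => / (p - 1) * (exp (- (p-1) * ln (INR k + 1)) - exp (- (p-1) * ln (INR (S k) + 1)))) n).
  - apply psum_le. intros k _. rewrite S_INR.
    assert (H := powser_step p (INR k + 1) Hp). assert (Hk := pos_INR k).
    apply Rmult_le_reg_l with (p-1); [lra|]. rewrite <- Rmult_assoc, Rinv_r, Rmult_1_l by lra.
    apply Rle_trans with (2 := H ltac:(lra)). apply Rmult_le_compat_l; [lra|]. apply exp_le_compat.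
    assert (ln (INR k + 1 + 1) <= Y k); [|nra]. rewrite <- (ln_exp (Y k)). apply ln_le; [lra|]. assert (K := exp_Y k); lra.
  - rewrite psum_scal. rewrite (psum_telescope (fun k => exp (- (p-1) * ln (INR k + 1)))). simpl. rewrite Rplus_0_l, ln_1, Rmult_0_r, exp_0.
    assert (H := exp_pos (- (p - 1) * ln (INR n + 1))). assert (0 < / (p-1)) by (apply Rinv_0_lt_compat; lra). nra.
Qed.

(** * Choosing a point by bisection *)

(** An interval on which every [M E] has nonpositive increment is halved so that one half inherits
    this for all [E] at once. Increments growing with [E] make that possible: a failure on the left
    at one index persists at all larger ones. *)
Lemma bisection (M : nat -> R -> R) a b : a < b ->
  (forall E E' x y, (E <= E')%nat -> a <= x -> x <= y -> y <= b -> M E y - M E x <= M E' y - M E' x) ->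
  (forall E, M E b <= M E a) ->
  exists y, a <= y <= b /\ forall eta, 0 < eta -> exists c d, a <= c <= y /\ y <= d <= b /\ c < d /\ d - c < eta /\ forall E, M E d <= M E c.
Proof.
  intros Hab Hmon H0.
  set (step := fun I : R * R => let (c, d) := I in
     if excluded_middle_informative (forall E, M E ((c+d)/2) <= M E c) then (c, (c+d)/2) else ((c+d)/2, d)).
  set (iv := fix iv n := match n with O => (a, b) | S m => step (iv m) end).
  assert (Inv : forall n, let (c, d) := iv n in a <= c /\ c < d /\ d <= b /\ d - c = (b - a) / 2 ^ n /\ forall E, M E d <= M E c).
  { induction n.
    { simpl. split; [lra|]. split; [lra|]. split; [lra|]. split; [lra|exact H0]. }
    change (iv (S n)) with (step (iv n)).
    destruct (iv n) as [c d]. destruct IHn as (A1 & A2 & A3 & A4 & A5). unfold step.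
    assert (P : 2 ^ n <> 0) by (apply pow_nonzero; lra).
    destruct excluded_middle_informative as [G|G].
    - split; [lra|]. split; [lra|]. split; [lra|]. split; [|exact G]. replace ((c+d)/2 - c) with ((d - c)/2) by field. rewrite A4. simpl. field; auto.
    - split; [lra|]. split; [lra|]. split; [lra|]. split. replace (d - (c+d)/2) with ((d - c)/2) by field. rewrite A4. simpl. field; auto.
      (* The left half fails at [E1], hence also at [max E E1]. There the whole increment is
         nonpositive, so the right half is nonpositive at [max E E1] and a fortiori at [E]. *)
      intros E. apply not_all_ex_not in G. destruct G as [E1 G]. apply Rnot_le_lt in G.
      assert (Q1 := Hmon E (max E E1) ((c+d)/2) d). assert (Q2 := Hmon E1 (max E E1) c ((c+d)/2)). assert (Q3 := A5 (max E E1)).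
      specialize (Q1 ltac:(lia) ltac:(lra) ltac:(lra) ltac:(lra)). specialize (Q2 ltac:(lia) ltac:(lra) ltac:(lra) ltac:(lra)). lra. }
  assert (Nest : forall n m, fst (iv n) <= fst (iv (n + m)%nat) /\ snd (iv (n+m)%nat) <= snd (iv n)).
  { intros n m. induction m. rewrite Nat.add_0_r; lra. rewrite Nat.add_succ_r. simpl.
    assert (K := Inv (n+m)%nat). destruct (iv (n+m)%nat) as [c d]. unfold step. destruct excluded_middle_informative; simpl in *; lra. }
  assert (Sep : forall n m, fst (iv n) <= snd (iv m)).
  { intros n m. assert (N1 := Nest n m). assert (N2 := Nest m n). rewrite (Nat.add_comm m n) in N2. assert (K := Inv (n+m)%nat).
    destruct (iv (n+m)%nat) as [c d]. simpl in *. lra. }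
  destruct (completeness (fun x => exists n, x = fst (iv n))) as [y [Hy1 Hy2]].
  - exists b. intros x [n ->]. apply (Sep n O).
  - exists a, O. reflexivity.
  - assert (B1 : forall n, fst (iv n) <= y) by (intros n; apply Hy1; exists n; auto).
    assert (B2 : forall n, y <= snd (iv n)) by (intros n; apply Hy2; intros x [m ->]; apply Sep).
    exists y. split. split; [apply (B1 O)|apply (B2 O)].
    intros eta Heta.
    destruct (pow_lt_1_zero (/2) ltac:(rewrite Rabs_pos_eq; lra) (eta / (b - a)) ltac:(apply Rdiv_lt_0_compat; lra)) as [n Hn].
    specialize (Hn n ltac:(lia)). rewrite Rabs_pos_eq in Hn by (apply pow_le; lra). rewrite pow_inv in Hn.
    exists (fst (iv n)), (snd (iv n)). specialize (B1 n). specialize (B2 n). assert (K := Inv n). destruct (iv n) as [c d]; simpl in *.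
    destruct K as (A1 & A2 & A3 & A4 & A5). split; [lra|]. split; [lra|]. split; [lra|]. split; [|exact A5].
    rewrite A4. apply Rmult_lt_compat_l with (r := b - a) in Hn; [|lra]. unfold Rdiv in *.
    replace ((b - a) * (eta * / (b - a))) with eta in Hn by (field; lra). exact Hn.
Qed.

(* [cl E x] is, up to a constant, the total length left of [x] of the E-th finite family of excluded intervals; the families increase with [E]. A point where the increments of the
   integral of [(g - bound) p] plus a multiple of [cl E] are nonpositive on shrinking intervals lies in no excluded interval. *)
Lemma choose_avoiding (g p : R -> R) (cl : nat -> R -> R) a b beta Pm H :
  a < b -> (forall x, continuous g x) -> (forall x, continuous p x) -> (forall x, 0 < p x) ->
  (forall x, a <= x <= b -> p x <= Pm) -> (forall x, a <= x <= b -> 0 <= g x) ->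
  (forall E x y, a <= x -> x <= y -> y <= b -> 0 <= cl E y - cl E x) ->
  (forall E E' x y, (E <= E')%nat -> a <= x -> x <= y -> y <= b -> cl E y - cl E x <= cl E' y - cl E' x) ->
  (forall E, cl E b - cl E a <= beta) -> RInt p a b = 1 -> RInt (fun x => g x * p x) a b <= H -> 0 < H -> Pm * beta <= / 4 ->
  exists y, a <= y <= b /\ g y <= H * (1 + 2 * Pm * beta) /\
    forall E, ~ exists r, 0 < r /\ forall c d, a <= c <= y -> y <= d <= b -> d - c < r -> d - c <= cl E d - cl E c.
Proof.
  intros Hab Cg Cp Pp HPm Hg Hcl Hmon Hbeta Hp1 HgH HH Hsmall.
  assert (HPm0 : 0 < Pm). { assert (K := HPm a ltac:(lra)). assert (J := Pp a). lra. }
  (* [S = H + Th * beta], so the total increment of [M] over [[a, b]] is at most 0. By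
     [Pm * beta <= 1/4] also [Pm * S < Th]: on an excluded interval the penalty outweighs the lowest
     possible value [- S * Pm] of the integrand. *)
  set (S := H * (1 + 2 * Pm * beta)). set (Th := 2 * Pm * H).
  assert (C1 : forall x, continuous (fun x => (g x - S) * p x) x) by (intros; cont_tac).
  assert (Cgp : forall x, continuous (fun x => g x * p x) x) by (intros; cont_tac).
  assert (HTh : 0 < Th) by (unfold Th; apply Rmult_lt_0_compat; nra).
  assert (Hb0 : 0 <= beta) by (assert (K := Hbeta O); assert (J := Hcl O a b); lra).
  assert (HS : 0 < S) by (unfold S; apply Rmult_lt_0_compat; nra).
  assert (HTS : Pm * S < Th).
  { unfold Th, S. assert (0 < Pm * H) by nra. assert (Pm * (H * (1 + 2 * Pm * beta)) = (Pm * H) * (1 + 2 * (Pm * beta))) by ring. nra. }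
  set (M := fun E x => RInt (fun x => (g x - S) * p x) a x + Th * cl E x).
  assert (HM : forall E c d, a <= c -> c <= d -> d <= b -> M E d - M E c = RInt (fun x => (g x - S) * p x) c d + Th * (cl E d - cl E c)).
  { intros E c d _ _ _. unfold M. assert (K := RInt_cat (fun x => (g x - S) * p x) a c d). rewrite <- K by (apply ex_RInt_cont; auto). lra. }
  destruct (bisection M a b Hab) as [y [Hy HB]].
  - intros E E' x y HE Hx Hxy Hyb. rewrite 2 HM by lra. specialize (Hmon E E' x y HE Hx Hxy Hyb). nra.
  - intros E. cut (M E b - M E a <= 0); [lra|]. rewrite HM by lra.
    rewrite (RInt_ext (V:=R_CompleteNormedModule) _ (fun x => g x * p x - S * p x)) by (intros; simpl; asR; ring).
    rewrite RInt_Rminus, RInt_Rscal, Hp1 by (apply ex_RInt_cont; intros; cont_tac).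
    specialize (Hbeta E). assert (K : Th * (cl E b - cl E a) <= Th * beta) by (apply Rmult_le_compat_l; lra).
    unfold S, Th in *. nra.
  - exists y. split; [auto|]. split.
    + apply Rnot_lt_le. intros Hgt. fold S in Hgt.
      assert (Hloc : exists r, 0 < r /\ forall x, Rabs (x - y) < r -> S < g x).
      { assert (HU : locally (g y) (fun u => S < u)) by (apply (open_gt S); auto).
        destruct (Cg y _ HU) as [r Hr]. exists r. split; [apply r|]. intros x Hx. apply Hr. exact Hx. }
      destruct Hloc as [r [Hr Hpos]]. destruct (HB r Hr) as (c & d & Hc & Hd & Hcd & Hdc & HM0).
      specialize (HM0 O). assert (K := HM O c d ltac:(lra) ltac:(lra) ltac:(lra)).
      assert (0 < RInt (fun x => (g x - S) * p x) c d).
      { apply RInt_gt_0; auto. intros x Hx. assert (S < g x). apply Hpos. apply Rabs_def1; lra. specialize (Pp x). nra. }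
      assert (J := Hcl O c d). assert (0 <= Th * (cl O d - cl O c)) by (apply Rmult_le_pos; lra). lra.
    + intros E (r & Hr & Hbad). destruct (HB r Hr) as (c & d & Hc & Hd & Hcd & Hdc & HM0).
      specialize (HM0 E). assert (K := HM E c d ltac:(lra) ltac:(lra) ltac:(lra)). specialize (Hbad c d Hc Hd Hdc).
      assert (RInt (fun _ => - (S * Pm)) c d <= RInt (fun x => (g x - S) * p x) c d).
      { apply RInt_le_cont; auto; try lra. intros; apply continuous_const. intros x Hx.
        specialize (Hg x ltac:(lra)). specialize (HPm x ltac:(lra)). specialize (Pp x). nra. }
      rewrite RInt_Rconst in H0. nra.
Qed.

(** * Monomials in the earlier primes and their mass *)

Definition lsum {T} (f : T -> R) (l : list T) : R := fold_right (fun x acc => f x + acc) 0 l.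

Lemma lsum_app {T} (f : T -> R) l1 l2 : lsum f (l1 ++ l2) = lsum f l1 + lsum f l2.
Proof. induction l1; simpl; [ring|rewrite IHl1; ring]. Qed.
Lemma lsum_map {T U} (f : U -> R) (g : T -> U) l : lsum f (map g l) = lsum (fun x => f (g x)) l.
Proof. induction l; simpl; [ring|rewrite IHl; ring]. Qed.
Lemma lsum_le {T} (f g : T -> R) l : (forall x, In x l -> f x <= g x) -> lsum f l <= lsum g l.
Proof. induction l; simpl; intros H; [lra|]. assert (f a <= g a) by auto. assert (lsum f l <= lsum g l) by auto. lra. Qed.
Lemma lsum_ext {T} (f g : T -> R) l : (forall x, In x l -> f x = g x) -> lsum f l = lsum g l.
Proof. intros H; apply Rle_antisym; apply lsum_le; intros; rewrite H by auto; lra. Qed.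
Lemma lsum_minus {T} (f g : T -> R) l : lsum (fun x => f x - g x) l = lsum f l - lsum g l.
Proof. induction l; simpl; [ring|rewrite IHl; ring]. Qed.
Lemma lsum_scal {T} c (f : T -> R) l : lsum (fun x => c * f x) l = c * lsum f l.
Proof. induction l; simpl; [ring|rewrite IHl; ring]. Qed.
Lemma lsum_nonneg {T} (f : T -> R) l : (forall x, 0 <= f x) -> 0 <= lsum f l.
Proof. intros H; induction l; simpl; [lra|]. specialize (H a); lra. Qed.
Lemma lsum_ge_member {T} (f : T -> R) l x : (forall x, 0 <= f x) -> In x l -> f x <= lsum f l.
Proof.
  intros H; induction l; simpl; intros Hx; [contradiction|].
  destruct Hx as [->|Hx]. assert (K := lsum_nonneg f l H); lra. specialize (IHl Hx). specialize (H a); lra.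
Qed.
Lemma psum_ge_member (f : nat -> R) n k : (forall x, 0 <= f x) -> (k < n)%nat -> f k <= psum f n.
Proof.
  intros H; induction n; intros Hk; [lia|]. simpl. destruct (Nat.eq_dec k n) as [->|].
  assert (K := psum_nonneg f n H); lra. specialize (IHn ltac:(lia)). specialize (H n); lra.
Qed.
Lemma lsum_flat_map {T} (f : T -> R) (g : nat -> list T) n : lsum f (flat_map g (seq 0 n)) = psum (fun e => lsum f (g e)) n.
Proof.
  induction n; [reflexivity|]. rewrite seq_S, flat_map_app, lsum_app, IHn. simpl. rewrite app_nil_r. reflexivity.
Qed.

(* Logarithms of the monomials in [q_0, ..., q_(n-1)] with exponents at most [E]. *)
Fixpoint lmons (lam : nat -> R) (n E : nat) : list R :=
  match n with
  | O => 0 :: nil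
  | S m => flat_map (fun e => map (fun l => l + INR e * lam m) (lmons lam m E)) (seq 0 (S E))
  end.

Lemma lsum_lmons_S f lam n E : lsum f (lmons lam (S n) E) = psum (fun e => lsum (fun l => f (l + INR e * lam n)) (lmons lam n E)) (S E).
Proof.
  change (lmons lam (S n) E) with (flat_map (fun e => map (fun l => l + INR e * lam n) (lmons lam n E)) (seq 0 (S E))).
  rewrite lsum_flat_map. apply psum_ext. intros; apply lsum_map.
Qed.

Lemma lmons_ext lam lam' n E : (forall j, (j < n)%nat -> lam j = lam' j) -> lmons lam n E = lmons lam' n E.
Proof.
  induction n; intros H; [reflexivity|]. simpl. rewrite IHn by (intros; apply H; lia). rewrite H by lia. reflexivity.
Qed.

Lemma lsum_lmons_mono f lam n E E' : (forall x, 0 <= f x) -> (E <= E')%nat -> lsum f (lmons lam n E) <= lsum f (lmons lam n E').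
Proof.
  intros Hf HE. revert f Hf. induction n; intros f Hf; [simpl; lra|]. rewrite 2 lsum_lmons_S.
  apply Rle_trans with (psum (fun e => lsum (fun l => f (l + INR e * lam n)) (lmons lam n E)) (S E')).
  - apply psum_mono; [|lia]. intros; apply lsum_nonneg; auto.
  - apply psum_le. intros; apply IHn; auto.
Qed.

Lemma psum_geom_le x n : 0 <= x < 1 -> psum (fun e => x ^ e) n <= / (1 - x).
Proof.
  intros Hx. assert (K : psum (fun e => x ^ e) n = (1 - x ^ n) / (1 - x)).
  { induction n; simpl. field; lra. rewrite IHn. field; lra. }
  rewrite K. unfold Rdiv. assert (0 <= x ^ n) by (apply pow_le; lra). assert (0 < / (1 - x)) by (apply Rinv_0_lt_compat; lra). nra.
Qed.

Lemma exp_pow a n : exp (a * INR n) = exp a ^ n.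
Proof.
  induction n; [simpl; rewrite Rmult_0_r; apply exp_0|]. rewrite S_INR. replace (a * (INR n + 1)) with (a + a * INR n) by ring.
  rewrite exp_plus, IHn. reflexivity.
Qed.

(** The sum is at most the Euler product of [1 / (1 - (j + 2)^(-2))] over [j < n], whose factors
    [(j + 2)^2 / ((j + 1) (j + 3))] telescope to the stated bound. Being uniform in [n] and [E], it
    keeps the excluded length under control although the monomials are infinitely many. *)
Lemma lmons_mass lam n E : (forall j, (j < n)%nat -> INR j + 2 <= exp (lam j)) ->
  lsum (fun l => exp (- 2 * l)) (lmons lam n E) <= 2 * (INR n + 1) / (INR n + 2).
Proof.
  induction n; intros H. { simpl. rewrite Rmult_0_r, exp_0. lra. }
  rewrite lsum_lmons_S.
  set (B := lsum (fun l => exp (- 2 * l)) (lmons lam n E)).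
  set (x := exp (- 2 * lam n)). assert (Hn := pos_INR n). assert (Hl := H n ltac:(lia)).
  assert (Hx : 0 < x <= / (INR n + 2) ^ 2).
  { split; [apply exp_pos|]. unfold x. replace (-2 * lam n) with (- (lam n + lam n)) by ring. rewrite exp_Ropp, exp_plus.
    apply Rinv_le_contravar; nra. }
  rewrite (psum_ext _ (fun e => B * x ^ e)).
  2:{ intros e _. transitivity (x ^ e * B); [|ring]. unfold B. rewrite <- lsum_scal. apply lsum_ext. intros l _. unfold x. rewrite <- exp_pow, <- exp_plus. f_equal. ring. }
  rewrite psum_scal. rewrite S_INR.
  assert (HB : B <= 2 * (INR n + 1) / (INR n + 2)) by (apply IHn; intros; apply H; lia).
  assert (HB0 : 0 <= B) by (apply lsum_nonneg; intros; apply Rlt_le, exp_pos).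
  assert (Hx2 : / (INR n + 2) ^ 2 < 1). { rewrite <- Rinv_1. apply Rinv_lt_contravar; nra. }
  assert (HG : psum (fun e => x ^ e) (S E) <= (INR n + 2) ^ 2 / ((INR n + 1) * (INR n + 3))).
  { apply Rle_trans with (/ (1 - x)). apply psum_geom_le; lra.
    replace ((INR n + 2) ^ 2 / ((INR n + 1) * (INR n + 3))) with (/ (1 - / (INR n + 2) ^ 2)) by (field; nra).
    apply Rinv_le_contravar; lra. }
  assert (HG0 : 0 <= psum (fun e => x ^ e) (S E)) by (apply psum_nonneg; intros; apply pow_le; lra).
  replace (2 * (INR n + 1 + 1) / (INR n + 1 + 2)) with (2 * (INR n + 1) / (INR n + 2) * ((INR n + 2) ^ 2 / ((INR n + 1) * (INR n + 3)))) by (field; nra).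
  apply Rmult_le_compat; auto.
Qed.

Lemma lmons_mass2 lam n E : (forall j, (j < n)%nat -> INR j + 2 <= exp (lam j)) -> lsum (fun l => exp (- 2 * l)) (lmons lam n E) <= 2.
Proof.
  intros H. apply Rle_trans with (1 := lmons_mass lam n E H). assert (Hn := pos_INR n).
  apply Rmult_le_reg_r with (INR n + 2); [lra|]. unfold Rdiv. rewrite Rmult_assoc, Rinv_l; lra.
Qed.

Lemma in_lmons lam n E l : In l (lmons lam n E) <-> exists e : nat -> nat, (forall j, (j < n)%nat -> (e j <= E)%nat) /\ l = psum (fun j => INR (e j) * lam j) n.
Proof.
  revert l. induction n; intros l.
  - simpl. split. intros [<-|[]]. exists (fun _ => O); split; [intros; lia|auto]. intros (e & _ & ->); auto.
  - change (lmons lam (S n) E) with (flat_map (fun e => map (fun l => l + INR e * lam n) (lmons lam n E)) (seq 0 (S E))).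
    rewrite in_flat_map. split.
    + intros (k & Hk & Hl). apply in_map_iff in Hl. destruct Hl as (l' & <- & Hl'). apply IHn in Hl'. destruct Hl' as (e & He & ->).
      apply in_seq in Hk. exists (fun j => if Nat.eq_dec j n then k else e j). split.
      * intros j Hj. destruct Nat.eq_dec; [lia|apply He; lia].
      * simpl. destruct (Nat.eq_dec n n) as [_|N]; [|lia]. f_equal. apply psum_ext. intros j Hj. destruct Nat.eq_dec; [lia|auto].
    + intros (e & He & ->). exists (e n). split; [apply in_seq; specialize (He n ltac:(lia)); lia|].
      simpl. apply in_map_iff. eexists; split; [reflexivity|]. apply IHn. exists e; split; auto.
Qed.

(** * Excluded neighbourhoods and their total length *)

(** A primitive of the indicator function of [[z - w, z + w]], so its increments measure overlap
    with that interval. *)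
Definition clamp (z w x : R) : R := Rmax (z - w) (Rmin x (z + w)).

Lemma clamp_diff z w x y : 0 <= w -> x <= y -> 0 <= clamp z w y - clamp z w x <= 2 * w.
Proof. intros Hw Hxy. unfold clamp, Rmax, Rmin. repeat destruct Rle_dec; lra. Qed.
Lemma clamp_inside z w x y : z - w <= x -> x <= y -> y <= z + w -> clamp z w y - clamp z w x = y - x.
Proof. intros. unfold clamp, Rmax, Rmin. repeat destruct Rle_dec; lra. Qed.

(** The half-width of the interval excluded around [(lb - la) / (k + 1)]. The factors in [k], [la],
    [lb] make the sum over all triples converge; [exp (- 3 * Y (S n))] beats the density, at most
    [exp (Y (S n))] on the n-th interval, with a summable factor [exp (- 2 * Y (S n))] to spare. *)
Definition sepw (n k : nat) (la lb : R) : R := / 64 * exp (- 3 * Y (S n)) * (/ 2) ^ (S k) * exp (- 2 * la) * exp (- 2 * lb).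

Definition tsum (lam : nat -> R) (n E : nat) (f : nat -> R -> R -> R) : R :=
  psum (fun k => lsum (fun la => lsum (fun lb => f k la lb) (lmons lam n E)) (lmons lam n E)) E.

Definition badsum (lam : nat -> R) (n E : nat) (x : R) : R :=
  tsum lam n E (fun k la lb => clamp ((lb - la) / INR (S k)) (sepw n k la lb) x).

Lemma tsum_minus lam n E f g : tsum lam n E (fun k a b => f k a b - g k a b) = tsum lam n E f - tsum lam n E g.
Proof.
  unfold tsum.
  rewrite (psum_ext _ (fun k => lsum (fun la => lsum (fun lb => f k la lb) (lmons lam n E)) (lmons lam n E) + (-1) * lsum (fun la => lsum (fun lb => g k la lb) (lmons lam n E)) (lmons lam n E))).
  - rewrite psum_plus, psum_scal. ring.
  - intros k _. rewrite <- lsum_scal.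
    transitivity (lsum (fun la => lsum (fun lb => f k la lb) (lmons lam n E) - lsum (fun lb => g k la lb) (lmons lam n E)) (lmons lam n E)).
    apply lsum_ext; intros; apply lsum_minus. rewrite lsum_minus, lsum_scal. ring.
Qed.

Lemma tsum_le lam n E f g : (forall k a b, f k a b <= g k a b) -> tsum lam n E f <= tsum lam n E g.
Proof. intros H; apply psum_le; intros; apply lsum_le; intros; apply lsum_le; intros; apply H. Qed.

Lemma tsum_nonneg lam n E f : (forall k a b, 0 <= f k a b) -> 0 <= tsum lam n E f.
Proof. intros H; apply psum_nonneg; intros; apply lsum_nonneg; intros; apply lsum_nonneg; intros; apply H. Qed.

Lemma tsum_mono lam n E E' f : (forall k a b, 0 <= f k a b) -> (E <= E')%nat -> tsum lam n E f <= tsum lam n E' f.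
Proof.
  intros H HE. unfold tsum.
  apply Rle_trans with (psum (fun k => lsum (fun la => lsum (fun lb => f k la lb) (lmons lam n E)) (lmons lam n E)) E').
  - apply psum_mono; auto. intros; apply lsum_nonneg; intros; apply lsum_nonneg; auto.
  - apply psum_le; intros k _. apply Rle_trans with (lsum (fun la => lsum (fun lb => f k la lb) (lmons lam n E')) (lmons lam n E)).
    + apply lsum_le; intros; apply lsum_lmons_mono; auto.
    + apply lsum_lmons_mono; auto. intros; apply lsum_nonneg; auto.
Qed.

Lemma tsum_ge_member lam n E f k a b : (forall k a b, 0 <= f k a b) -> (k < E)%nat -> In a (lmons lam n E) -> In b (lmons lam n E) -> f k a b <= tsum lam n E f.
Proof.
  intros H Hk Ha Hb. unfold tsum.
  apply Rle_trans with (lsum (fun la => lsum (fun lb => f k la lb) (lmons lam n E)) (lmons lam n E)).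
  - apply Rle_trans with (lsum (fun lb => f k a lb) (lmons lam n E)).
    apply lsum_ge_member; auto. apply (lsum_ge_member (fun la => lsum (fun lb => f k la lb) (lmons lam n E))); auto. intros; apply lsum_nonneg; auto.
  - apply (psum_ge_member (fun k => lsum (fun la => lsum (fun lb => f k la lb) (lmons lam n E)) (lmons lam n E))); auto.
    intros; apply lsum_nonneg; intros; apply lsum_nonneg; auto.
Qed.

Lemma sepw_pos n k a b : 0 < sepw n k a b.
Proof. unfold sepw. repeat apply Rmult_lt_0_compat; try apply exp_pos; try lra. apply pow_lt; lra. Qed.

(** Each of the two monomial sums is at most 2 and the sum over [k] of [2 * (/ 2)^(k + 1)] is at
    most 2, so the total is [8 / 64] of the exponential. *)
Lemma tsum_sepw lam n E : (forall j, (j < n)%nat -> INR j + 2 <= exp (lam j)) -> tsum lam n E (fun k a b => 2 * sepw n k a b) <= / 8 * exp (- 3 * Y (S n)).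
Proof.
  intros H. set (m := lsum (fun l => exp (- 2 * l)) (lmons lam n E)). set (c := / 64 * exp (- 3 * Y (S n))).
  assert (Hc : 0 < c) by (unfold c; apply Rmult_lt_0_compat; [lra|apply exp_pos]).
  replace (tsum lam n E (fun k a b => 2 * sepw n k a b)) with (c * m * m * psum (fun k => (/2) ^ k) E).
  - assert (Hm : 0 <= m <= 2). { split. apply lsum_nonneg; intros; apply Rlt_le, exp_pos. apply lmons_mass2; auto. }
    assert (Hg := psum_geom_le (/2) E ltac:(lra)). assert (Hg0 : 0 <= psum (fun k => (/2) ^ k) E) by (apply psum_nonneg; intros; apply pow_le; lra).
    replace (/ (1 - / 2)) with 2 in Hg by field.
    assert (m * m <= 4) by nra. assert (0 <= m * m) by nra.
    replace (/ 8 * exp (-3 * Y (S n))) with (c * 4 * 2) by (unfold c; field).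
    apply Rmult_le_compat; auto. rewrite Rmult_assoc. apply Rmult_le_pos; lra. rewrite Rmult_assoc. apply Rmult_le_compat_l; lra.
  - unfold tsum. rewrite <- psum_scal. apply psum_ext. intros k _.
    rewrite (lsum_ext _ (fun la => (c * (/2)^k * m) * exp (-2 * la))).
    + rewrite lsum_scal. fold m. ring.
    + intros la _. rewrite (lsum_ext _ (fun lb => (c * (/2)^k * exp (-2 * la)) * exp (-2 * lb))).
      rewrite lsum_scal. fold m. ring. intros lb _. unfold sepw, c. simpl. field.
Qed.

Lemma badsum_diff lam n E x y : x <= y -> 0 <= badsum lam n E y - badsum lam n E x.
Proof.
  intros Hxy. unfold badsum. rewrite <- tsum_minus. apply tsum_nonneg. intros. apply clamp_diff; auto. apply Rlt_le, sepw_pos.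
Qed.
Lemma badsum_mono lam n E E' x y : (E <= E')%nat -> x <= y -> badsum lam n E y - badsum lam n E x <= badsum lam n E' y - badsum lam n E' x.
Proof.
  intros HE Hxy. unfold badsum. rewrite <- 2 tsum_minus. apply tsum_mono; auto. intros. apply clamp_diff; auto. apply Rlt_le, sepw_pos.
Qed.
Lemma badsum_total lam n E x y : (forall j, (j < n)%nat -> INR j + 2 <= exp (lam j)) -> x <= y -> badsum lam n E y - badsum lam n E x <= / 8 * exp (- 3 * Y (S n)).
Proof.
  intros H Hxy. apply Rle_trans with (2 := tsum_sepw lam n E H). unfold badsum. rewrite <- tsum_minus. apply tsum_le.
  intros. apply clamp_diff; auto. apply Rlt_le, sepw_pos.
Qed.

(** If [y] were strictly inside one of the intervals, a single [clamp] would already have slope 1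
    near [y], which is the local behaviour that the bisection rules out. *)
Lemma badsum_avoid lam n E a b y : a <= y <= b ->
  (~ exists r, 0 < r /\ forall c d, a <= c <= y -> y <= d <= b -> d - c < r -> d - c <= badsum lam n E d - badsum lam n E c) ->
  forall k la lb, (k < E)%nat -> In la (lmons lam n E) -> In lb (lmons lam n E) -> sepw n k la lb <= Rabs (y - (lb - la) / INR (S k)).
Proof.
  intros Hy Hn k la lb Hk Ha Hb. apply Rnot_lt_le. intros Hlt. apply Hn. set (z := (lb - la) / INR (S k)) in *. set (w := sepw n k la lb) in *.
  apply Rabs_def2 in Hlt. exists (Rmin (w - (y - z)) (w + (y - z))). split; [apply Rmin_pos; lra|].
  intros c d Hc Hd Hdc. assert (M1 := Rmin_l (w - (y - z)) (w + (y - z))). assert (M2 := Rmin_r (w - (y - z)) (w + (y - z))).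
  unfold badsum. rewrite <- tsum_minus.
  apply Rle_trans with (clamp z w d - clamp z w c). rewrite clamp_inside; lra.
  apply (tsum_ge_member lam n E (fun k la lb => clamp ((lb - la) / INR (S k)) (sepw n k la lb) d - clamp ((lb - la) / INR (S k)) (sepw n k la lb) c)); auto.
  intros. apply clamp_diff; [apply Rlt_le, sepw_pos|lra].
Qed.

(** * Continuity in two variables and inequalities for the exponential *)

Lemma cont2_l (f : R -> R) x y : continuous f x -> continuity_2d_pt (fun u v => f u) x y.
Proof. intros H. apply (continuity_1d_2d_pt_comp f (fun u v => u)). apply continuity_pt_filterlim, H. apply continuity_2d_pt_id1. Qed.
Lemma cont2_r (f : R -> R) x y : continuous f y -> continuity_2d_pt (fun u v => f v) x y.
Proof. intros H. apply (continuity_1d_2d_pt_comp f (fun u v => v)). apply continuity_pt_filterlim, H. apply continuity_2d_pt_id2. Qed.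
Lemma cont2_comp (f : R -> R) (g : R -> R -> R) x y : (forall z, continuous f z) -> continuity_2d_pt g x y -> continuity_2d_pt (fun u v => f (g u v)) x y.
Proof. intros H. apply continuity_1d_2d_pt_comp. apply continuity_pt_filterlim, H. Qed.

Lemma exp_sub_le z : exp z - 1 <= z * exp z.
Proof.
  assert (H := exp_ineq1_le (- z)). rewrite exp_Ropp in H. assert (P := exp_pos z).
  apply Rmult_le_compat_r with (r := exp z) in H; [|lra]. rewrite Rinv_l in H; lra.
Qed.

Lemma exp_quadratic z : exp z <= 1 + z + z ^ 2 * exp (Rabs z).
Proof.
  assert (H := exp_sub_le z). assert (P := exp_pos z). assert (K := exp_ineq1_le z). assert (A := exp_ineq1_le (Rabs z)).
  destruct (Rle_dec 0 z) as [Hz|Hz].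
  - rewrite (Rabs_pos_eq z) by lra. nra.
  - assert (0 <= Rabs z) by apply Rabs_pos. assert (0 <= z ^ 2) by nra. assert (z ^ 2 <= z ^ 2 * exp (Rabs z)) by nra. nra.
Qed.

(** * Choice of the primes *)

Definition sg (k : nat) : R := / 2 + / (INR k + 2).
Definition hh (s y t : R) : R := exp (- s * y) * cos (t * y).
Definition mm (s : R) (j : nat) (t : R) : R := RInt (fun y => hh s y t * om y) (Y j) (Y (S j)).
(** The real part at [s + i t] of the sum of [q_j^(-s - i t)] minus its mean over the j-th interval:
    the quantity that would be a martingale under a random choice. *)
Definition Ssum (lam : nat -> R) (s : R) (n : nat) (t : R) : R := psum (fun j => hh s (lam j) t - mm s j t) n.
Definition C0 : R := 16 * exp 4.
(** The exponential of the martingale, compensated so that its average over the next choice does not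
    increase. An increment [z = 2 * (hh - mm)] satisfies [|z| <= 4 r <= 4] with
    [r = exp (- s * Y j)], so [z^2 * exp |z| <= 16 * exp 4 * r^2], whence [C0]. *)
Definition Qf (lam : nat -> R) (s : R) (n : nat) (t : R) : R := exp (2 * Ssum lam s n t - C0 * psum (fun j => exp (- 2 * s * Y j)) n).
Definition Psi (t : R) : R := / ((2 + Rabs t) * (ln (2 + Rabs t) * ln (2 + Rabs t))).
Definition TT (n : nat) : R := exp (exp (5 * INR n)).
Definition ck (k : nat) : R := exp (- 5 * INR k).
Definition Phi (lam : nat -> R) (n : nat) : R := psum (fun k => ck k * RInt (fun t => Psi t * Qf lam (sg k) n t) 0 (TT n)) n.

Lemma sg_gt k : / 2 < sg k.
Proof. unfold sg. assert (0 < / (INR k + 2)); [|lra]. apply Rinv_0_lt_compat. assert (H := pos_INR k); lra. Qed.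

Lemma hh_cont_y s t y : continuous (fun y => hh s y t) y.
Proof. unfold hh. cont_tac. Qed.
Lemma hh_cont2 s y t : continuity_2d_pt (fun y t => hh s y t) y t.
Proof.
  unfold hh. apply continuity_2d_pt_mult.
  - apply (cont2_l (fun y => exp (- s * y))). cont_tac.
  - apply (cont2_comp cos). apply continuous_Rcos. apply continuity_2d_pt_mult. apply continuity_2d_pt_id2. apply continuity_2d_pt_id1.
Qed.
Lemma mm_cont s j t : continuous (mm s j) t.
Proof.
  apply (continuous_RInt_param (fun t y => hh s y t * om y)). apply Rlt_le, Y_lt. intros u v.
  apply continuity_2d_pt_mult. apply (continuity_2d_swap (fun y t => hh s y t)), hh_cont2.
  apply (cont2_r om). apply om_continuous.
Qed.
Lemma hh_cont_t s t y : continuous (fun t => hh s y t) t.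
Proof. unfold hh. cont_tac. Qed.
Lemma Ssum_cont lam s n t : continuous (Ssum lam s n) t.
Proof.
  induction n; simpl. apply continuous_const.
  apply (continuous_Rplus (Ssum lam s n) (fun t => hh s (lam n) t - mm s n t)); auto.
  apply (continuous_Rminus (fun t => hh s (lam n) t) (mm s n)). apply hh_cont_t. apply mm_cont.
Qed.
Lemma Qf_cont lam s n t : continuous (Qf lam s n) t.
Proof.
  unfold Qf. apply (continuous_Rcomp exp (fun t => 2 * Ssum lam s n t - C0 * psum (fun j => exp (- 2 * s * Y j)) n)). apply continuous_Rexp.
  assert (H := Ssum_cont lam s n). cont_tac.
Qed.
Lemma ln2_gt : / 2 < ln 2.
Proof. apply ln_lt_2. Qed.
Lemma Psi_cont t : continuous Psi t.
Proof.
  unfold Psi. assert (H : 0 <= Rabs t) by apply Rabs_pos. assert (L : / 2 < ln (2 + Rabs t)).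
  { apply Rlt_le_trans with (ln 2). apply ln2_gt. apply ln_le; lra. }
  assert (C : continuous (fun t => 2 + Rabs t) t). { apply (continuous_Rplus (fun _ => 2) Rabs). apply continuous_const. apply continuous_Rabs. }
  assert (CL : continuous (fun t => ln (2 + Rabs t)) t).
  { apply (continuous_comp (fun t => 2 + Rabs t) ln); auto. apply (ex_derive_continuous ln). auto_derive; lra. }
  apply (continuous_comp (fun t => (2 + Rabs t) * (ln (2 + Rabs t) * ln (2 + Rabs t))) Rinv).
  - apply continuous_Rmult; [exact C|]. apply continuous_Rmult; exact CL.
  - apply (ex_derive_continuous Rinv). auto_derive. apply Rmult_integral_contrapositive; split; [lra|]. apply Rmult_integral_contrapositive; split; lra.
Qed.
Lemma Psi_pos t : 0 < Psi t.
Proof.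
  unfold Psi. assert (H : 0 <= Rabs t) by apply Rabs_pos. assert (L : / 2 < ln (2 + Rabs t)).
  { apply Rlt_le_trans with (ln 2). apply ln2_gt. apply ln_le; lra. }
  apply Rinv_0_lt_compat. apply Rmult_lt_0_compat; nra.
Qed.
Lemma Psi_int a b : 0 <= a <= b -> RInt Psi a b <= / ln (2 + a).
Proof.
  intros Hab. assert (L : forall x, 0 <= x -> / 2 < ln (2 + x)).
  { intros x Hx. apply Rlt_le_trans with (ln 2). apply ln2_gt. apply ln_le; lra. }
  rewrite (RInt_FTC (fun t => - / ln (2 + t)) Psi).
  - assert (H := L b ltac:(lra)). assert (0 < / ln (2 + b)) by (apply Rinv_0_lt_compat; lra). lra.
  - lra.
  - intros x Hx. specialize (L x ltac:(lra)). unfold Psi. rewrite Rabs_pos_eq by lra. auto_derive. split; lra. field. lra.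
  - intros; apply Psi_cont.
Qed.

Lemma hh_bound s y t : Rabs (hh s y t) <= exp (- s * y).
Proof.
  unfold hh. rewrite Rabs_mult, (Rabs_pos_eq (exp _)) by (apply Rlt_le, exp_pos).
  assert (H := exp_pos (- s * y)). assert (Rabs (cos (t * y)) <= 1) by (apply Rabs_le, COS_bound). nra.
Qed.

Lemma hh_boundJ s n y t : 0 <= s -> Y n <= y -> Rabs (hh s y t) <= exp (- s * Y n).
Proof. intros Hs Hy. apply Rle_trans with (1 := hh_bound s y t). apply exp_le_compat. nra. Qed.

Lemma mm_bound s n t : 0 <= s -> Rabs (mm s n t) <= exp (- s * Y n).
Proof.
  intros Hs. unfold mm. assert (HL := Y_lt n).
  apply Rle_trans with (RInt (fun y => exp (- s * Y n) * om y) (Y n) (Y (S n))).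
  - apply RInt_abs_le_cont; [lra| | |].
    + intros x _. assert (A := hh_cont_y s t). assert (B := om_continuous). apply (continuous_Rmult (fun y => hh s y t) om); auto.
    + intros x _. assert (B := om_continuous). cont_tac.
    + intros x Hx. rewrite Rabs_mult, (Rabs_pos_eq (om x)) by (apply Rlt_le, om_pos). apply Rmult_le_compat_r; [apply Rlt_le, om_pos|].
      apply hh_boundJ; lra.
  - rewrite RInt_Rscal by (apply ex_RInt_cont, om_continuous). rewrite Y_mass. lra.
Qed.

Lemma exp_le1 x : x <= 0 -> exp x <= 1.
Proof. intros; rewrite <- exp_0; apply exp_le_compat; auto. Qed.

(** The exponential is expanded to second order: the linear term averages to zero because [mm] is
    the mean, and the quadratic term is bounded by the compensator. *)
Lemma avg_factor s n t : 0 <= s ->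
  RInt (fun y => exp (2 * (hh s y t - mm s n t)) * om y) (Y n) (Y (S n)) <= exp (C0 * exp (- 2 * s * Y n)).
Proof.
  intros Hs. set (r := exp (- s * Y n)). set (m := mm s n t).
  assert (Hr : 0 < r) by apply exp_pos. assert (Hr1 : r <= 1) by (apply exp_le1; assert (K := Y_nonneg n); nra).
  assert (Hm : Rabs m <= r) by (apply mm_bound; auto).
  assert (A := hh_cont_y s t). assert (B := om_continuous). assert (HL := Y_lt n).
  assert (Hr2 : exp (- 2 * s * Y n) = r * r) by (unfold r; rewrite <- exp_plus; f_equal; ring).
  assert (He : 0 < exp 4) by apply exp_pos.
  apply Rle_trans with (RInt (fun y => (1 + C0 * (r * r) - 2 * m) * om y + 2 * (hh s y t * om y)) (Y n) (Y (S n))).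
  - apply RInt_le_cont; [lra| | |].
    + intros x _. apply (continuous_Rmult (fun y => exp (2 * (hh s y t - m))) om); auto.
      apply (continuous_Rcomp exp (fun y => 2 * (hh s y t - m))). apply continuous_Rexp. cont_tac.
    + intros x _. cont_tac.
    + intros x Hx. assert (Hh := hh_boundJ s n x t Hs ltac:(lra)). fold r in Hh.
      set (z := 2 * (hh s x t - m)). assert (Hz : Rabs z <= 4 * r).
      { unfold z. rewrite Rabs_mult, (Rabs_pos_eq 2) by lra. assert (K := Rabs_triang (hh s x t) (- m)). rewrite Rabs_Ropp in K. unfold Rminus in *. lra. }
      assert (Hz2 : z ^ 2 <= 16 * (r * r)). { rewrite <- pow2_abs. assert (0 <= Rabs z) by apply Rabs_pos. nra. }
      assert (E := exp_quadratic z). assert (E4 : exp (Rabs z) <= exp 4) by (apply exp_le_compat; lra).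
      assert (P := exp_pos (Rabs z)). assert (z ^ 2 * exp (Rabs z) <= 16 * (r * r) * exp 4). { apply Rmult_le_compat; try lra. nra. }
      assert (O := om_pos x). replace ((1 + C0 * (r * r) - 2 * m) * om x + 2 * (hh s x t * om x)) with ((1 + z + C0 * (r * r)) * om x) by (unfold z; ring).
      apply Rmult_le_compat_r; [lra|]. unfold C0. lra.
  - rewrite RInt_Rplus by (apply ex_RInt_cont; intros; cont_tac). rewrite 2 RInt_Rscal by (apply ex_RInt_cont; intros; cont_tac).
    rewrite Y_mass. change (RInt (fun y => hh s y t * om y) (Y n) (Y (S n))) with m. rewrite Hr2.
    apply Rle_trans with (2 := exp_ineq1_le _). lra.
Qed.

Lemma Ssum_bound lam s n t : 0 <= s -> (forall j, (j < n)%nat -> 0 <= lam j) -> Rabs (Ssum lam s n t) <= 2 * INR n.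
Proof.
  intros Hs. induction n; intros H. unfold Ssum; simpl; rewrite Rabs_R0; lra.
  rewrite S_INR. simpl. specialize (IHn ltac:(intros; apply H; lia)). fold (Ssum lam s n t) in *.
  assert (A := hh_bound s (lam n) t). assert (A1 : exp (- s * lam n) <= 1) by (apply exp_le1; specialize (H n ltac:(lia)); nra).
  assert (B := mm_bound s n t Hs). assert (B1 : exp (- s * Y n) <= 1) by (apply exp_le1; assert (K := Y_nonneg n); nra).
  unfold Ssum in *. simpl.
  assert (K1 := Rabs_triang (psum (fun j => hh s (lam j) t - mm s j t) n) (hh s (lam n) t - mm s n t)).
  assert (K2 := Rabs_triang (hh s (lam n) t) (- mm s n t)). rewrite Rabs_Ropp in K2. unfold Rminus in *. lra.
Qed.

Lemma Qf_bound lam s n t : 0 <= s -> (forall j, (j < n)%nat -> 0 <= lam j) -> Qf lam s n t <= exp (4 * INR n).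
Proof.
  intros Hs H. unfold Qf. apply exp_le_compat. assert (K := Ssum_bound lam s n t Hs H). apply Rabs_le_between in K.
  assert (0 <= C0 * psum (fun j => exp (- 2 * s * Y j)) n); [|lra]. apply Rmult_le_pos. unfold C0; assert (X := exp_pos 4); lra.
  apply psum_nonneg. intros; apply Rlt_le, exp_pos.
Qed.

Lemma Qf_pos lam s n t : 0 < Qf lam s n t.
Proof. apply exp_pos. Qed.

Lemma Ssum_ext lam lam' s n t : (forall j, (j < n)%nat -> lam j = lam' j) -> Ssum lam s n t = Ssum lam' s n t.
Proof. intros H. apply psum_ext. intros; rewrite H; auto. Qed.
Lemma Qf_ext lam lam' s n t : (forall j, (j < n)%nat -> lam j = lam' j) -> Qf lam s n t = Qf lam' s n t.
Proof. intros H. unfold Qf. rewrite (Ssum_ext lam lam'); auto. Qed.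
Lemma Phi_ext lam lam' n : (forall j, (j < n)%nat -> lam j = lam' j) -> Phi lam n = Phi lam' n.
Proof. intros H. apply psum_ext. intros k _. f_equal. apply RInt_ext. intros t _. rewrite (Qf_ext lam lam'); auto. Qed.

(** The factor is the loss incurred by avoiding the excluded intervals; the added term pays for the
    new line and the new heights. *)
Fixpoint bnd (n : nat) : R :=
  match n with O => 1 | S m => bnd m * (1 + / 4 * exp (- 2 * Y m)) + 4 * exp 4 * exp (- 1 * INR m) end.

Lemma bnd_pos n : 0 < bnd n.
Proof.
  induction n; simpl; [lra|]. assert (A := exp_pos (- 2 * Y n)). assert (B := exp_pos 4). assert (C := exp_pos (-1 * INR n)).
  assert (0 < bnd n * (1 + / 4 * exp (-2 * Y n))) by (apply Rmult_lt_0_compat; lra). assert (0 < 4 * exp 4 * exp (-1 * INR n)) by (apply Rmult_lt_0_compat; lra). lra.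
Qed.

(** The factors [1 + a n] multiply to at most the exponential of a convergent sum, and the added
    terms form a geometric series. *)
Lemma bnd_bounded : exists B, forall n, bnd n <= B.
Proof.
  destruct (psum_exp_Y 2 ltac:(lra)) as [C HC].
  set (b := fun m => 4 * exp 4 * exp (- 1 * INR m)).
  set (a := fun m => / 4 * exp (- 2 * Y m)).
  assert (H : forall n, bnd n <= exp (psum a n) * (1 + psum b n)).
  { induction n. simpl; rewrite exp_0; lra. change (bnd (S n)) with (bnd n * (1 + a n) + b n).
    assert (Ha : 0 < a n) by (unfold a; assert (X := exp_pos (-2 * Y n)); lra).
    assert (Hb : 0 < b n) by (unfold b; apply Rmult_lt_0_compat; [assert (X := exp_pos 4); lra|apply exp_pos]).
    assert (Ha0 : 0 <= psum a n) by (apply psum_nonneg; intros; unfold a; assert (X := exp_pos (-2 * Y k)); lra).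
    simpl. rewrite exp_plus. assert (E1 := exp_ineq1_le (a n)). assert (E2 := exp_ineq1_le (psum a n)). assert (Bp := bnd_pos n).
    assert (bnd n * (1 + a n) <= exp (psum a n) * (1 + psum b n) * exp (a n)) by (apply Rmult_le_compat; lra).
    assert (1 <= exp (psum a n) * exp (a n)) by nra. nra. }
  exists (exp (/ 4 * C) * (1 + 4 * exp 4 * 2)). intros n. apply Rle_trans with (1 := H n).
  assert (Hb : 0 <= psum b n). { apply psum_nonneg. intros j; unfold b. apply Rmult_le_pos; [assert (X := exp_pos 4); lra|apply Rlt_le, exp_pos]. }
  apply Rmult_le_compat; try lra. apply Rlt_le, exp_pos.
  - apply exp_le_compat. unfold a. rewrite psum_scal. specialize (HC n).
    rewrite (psum_ext _ (fun k => exp (- (2) * Y k))) by (intros; f_equal; ring). lra.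
  - unfold b. rewrite psum_scal. apply Rplus_le_compat_l. apply Rmult_le_compat_l. assert (X := exp_pos 4); lra.
    rewrite (psum_ext _ (fun k => exp (-1) ^ k)) by (intros; apply exp_pow).
    assert (E := exp_pos (-1)). assert (E1 : exp (-1) <= / 2). { replace (-1) with (-(1)) by ring. rewrite exp_Ropp. apply Rinv_le_contravar; [lra|]. assert (X := exp_ineq1_le 1); lra. }
    apply Rle_trans with (/ (1 - exp (-1))). apply psum_geom_le; lra. replace 2 with (/ (1 - / 2)) by field. apply Rinv_le_contravar; lra.
Qed.

Definition upd (lam : nat -> R) (n : nat) (x : R) : nat -> R := fun j => if Nat.eq_dec j n then x else lam j.
Lemma upd_eq lam n x : upd lam n x n = x.
Proof. unfold upd. destruct Nat.eq_dec; [auto|lia]. Qed.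
Lemma upd_lt lam n x j : (j < n)%nat -> upd lam n x j = lam j.
Proof. intros. unfold upd. destruct Nat.eq_dec; [lia|auto]. Qed.

Definition Inv (lam : nat -> R) (n : nat) : Prop :=
  (forall j, (j < n)%nat -> Y j <= lam j <= Y (S j)) /\
  (forall m, (m < n)%nat -> forall k E la lb, (k < E)%nat -> In la (lmons lam m E) -> In lb (lmons lam m E) ->
     sepw m k la lb <= Rabs (lam m - (lb - la) / INR (S k))) /\
  Phi lam n <= bnd n.

Lemma Inv_ext lam lam' n : (forall j, (j < n)%nat -> lam j = lam' j) -> Inv lam n -> Inv lam' n.
Proof.
  intros H (I1 & I2 & I3). split; [|split].
  - intros j Hj. rewrite <- H by auto. auto.
  - intros m Hm k E la lb Hk Ha Hb. rewrite <- H by auto. rewrite <- (lmons_ext lam lam') in Ha, Hb by (intros; apply H; lia). eapply I2; eauto.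
  - rewrite <- (Phi_ext lam lam'); auto.
Qed.

Lemma psum_RInt (f : nat -> R -> R) a b n : a <= b -> (forall k x, continuous (f k) x) -> RInt (fun x => psum (fun k => f k x) n) a b = psum (fun k => RInt (f k) a b) n.
Proof.
  intros Hab H. assert (C : forall n x, continuous (fun x => psum (fun k => f k x) n) x).
  { clear n. intros n x. induction n; simpl. apply continuous_const. apply (continuous_Rplus (fun x => psum (fun k => f k x) n) (f n)); auto. }
  induction n; simpl. rewrite RInt_Rconst; ring. rewrite RInt_Rplus by (apply ex_RInt_cont; auto). rewrite IHn. reflexivity.
Qed.

Lemma TT_mono n : TT n <= TT (S n).
Proof. unfold TT. apply exp_le_compat, exp_le_compat. rewrite S_INR. lra. Qed.
Lemma TT_pos n : 0 < TT n.
Proof. apply exp_pos. Qed.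

Lemma psum_ck n : psum ck n <= 2.
Proof.
  assert (E := exp_pos (-5)). assert (E1 : exp (-5) <= / 2). { replace (-5) with (-(5)) by ring. rewrite exp_Ropp. apply Rinv_le_contravar; [lra|]. assert (X := exp_ineq1_le 5); lra. }
  unfold ck. rewrite (psum_ext _ (fun k => exp (-5) ^ k)) by (intros; apply exp_pow).
  apply Rle_trans with (/ (1 - exp (-5))). apply psum_geom_le; lra. replace 2 with (/ (1 - / 2)) by field. apply Rinv_le_contravar; lra.
Qed.
Lemma ck_pos k : 0 < ck k.
Proof. apply exp_pos. Qed.

(* The potential [Phi] after the choice [lam n := x], restricted to the first [n] lines and to heights at most [TT n]. *)
Definition score (lam : nat -> R) (n : nat) (x : R) : R :=
  psum (fun k => ck k * RInt (fun t => Psi t * Qf lam (sg k) n t * exp (2 * (hh (sg k) x t - mm (sg k) n t) - C0 * exp (- 2 * sg k * Y n))) 0 (TT n)) n.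

Lemma score_integrand_cont2 lam n k x t : continuity_2d_pt (fun x t => Psi t * Qf lam (sg k) n t * exp (2 * (hh (sg k) x t - mm (sg k) n t) - C0 * exp (- 2 * sg k * Y n))) x t.
Proof.
  apply continuity_2d_pt_mult. apply (cont2_r (fun t => Psi t * Qf lam (sg k) n t)). apply continuous_Rmult. apply Psi_cont. apply Qf_cont.
  apply (cont2_comp exp). apply continuous_Rexp. apply continuity_2d_pt_minus; [|apply continuity_2d_pt_const].
  apply continuity_2d_pt_mult. apply continuity_2d_pt_const. apply continuity_2d_pt_minus. apply hh_cont2. apply (cont2_r (mm (sg k) n)). apply mm_cont.
Qed.

Lemma score_cont lam n x : continuous (score lam n) x.
Proof.
  unfold score. assert (TP := TT_pos n). generalize (TT n) TP. intros T HT.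
  assert (H : forall j, continuous (fun x => psum (fun k => ck k * RInt (fun t => Psi t * Qf lam (sg k) n t * exp (2 * (hh (sg k) x t - mm (sg k) n t) - C0 * exp (- 2 * sg k * Y n))) 0 T) j) x); [|apply H].
  induction j; simpl. apply continuous_const.
  match goal with |- continuous (fun x => @?f x + @?g x) _ => apply (continuous_Rplus f g) end; auto.
  match goal with |- continuous (fun x => ?c * @?g x) _ => apply (continuous_Rmult (fun _ => c) g) end. apply continuous_const.
  apply (continuous_RInt_param (fun x t => Psi t * Qf lam (sg j) n t * exp (2 * (hh (sg j) x t - mm (sg j) n t) - C0 * exp (- 2 * sg j * Y n)))); [lra|].
  intros; apply score_integrand_cont2.
Qed.

Lemma score_nonneg lam n x : 0 <= score lam n x.
Proof.
  apply psum_nonneg. intros k. apply Rmult_le_pos. apply Rlt_le, ck_pos. apply RInt_nonneg. apply Rlt_le, TT_pos.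
  - intros t _. apply (cont2_slice_r (fun x t => Psi t * Qf lam (sg k) n t * exp (2 * (hh (sg k) x t - mm (sg k) n t) - C0 * exp (- 2 * sg k * Y n)))), score_integrand_cont2.
  - intros t _. apply Rlt_le. apply Rmult_lt_0_compat; [|apply exp_pos]. apply Rmult_lt_0_compat. apply Psi_pos. apply Qf_pos.
Qed.

(** The average over [x] is taken inside the [t]-integral by Fubini, where [avg_factor] cancels the
    compensator of the new step. This replaces taking an expectation. *)
Lemma score_mean lam n : RInt (fun x => score lam n x * om x) (Y n) (Y (S n)) <= Phi lam n.
Proof.
  assert (HL := Y_lt n). assert (TP := TT_pos n). assert (B := om_continuous).
  set (F := fun k x t => Psi t * Qf lam (sg k) n t * exp (2 * (hh (sg k) x t - mm (sg k) n t) - C0 * exp (- 2 * sg k * Y n))).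
  assert (CF : forall k x t, continuity_2d_pt (F k) x t) by (intros; apply score_integrand_cont2).
  assert (CF1 : forall k x t, continuous (fun x => F k x t) x) by (intros; apply (cont2_slice_l (F k)); auto).
  assert (CF2 : forall k x t, continuous (fun t => F k x t) t) by (intros; apply (cont2_slice_r (F k)); auto).
  rewrite (RInt_ext (V:=R_CompleteNormedModule) _ (fun x => psum (fun k => ck k * RInt (fun t => F k x t * om x) 0 (TT n)) n)).
  2:{ intros x _. unfold score. change (psum (fun k => ck k * RInt (F k x) 0 (TT n)) n * om x = psum (fun k => ck k * RInt (fun t => F k x t * om x) 0 (TT n)) n).
      rewrite Rmult_comm, <- psum_scal. apply psum_ext. intros k _.
      rewrite (RInt_ext (V:=R_CompleteNormedModule) (fun t => F k x t * om x) (fun t => om x * F k x t)) by (intros; apply Rmult_comm).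
      rewrite RInt_Rscal by (apply ex_RInt_cont, CF2). change (F k x) with (fun t => F k x t). ring. }
  assert (CFo : forall k u v, continuity_2d_pt (fun x t => F k x t * om x) u v).
  { intros. apply continuity_2d_pt_mult; auto. apply (cont2_l om), om_continuous. }
  rewrite psum_RInt; [|lra|].
  2:{ intros k x. apply (continuous_Rmult (fun _ => ck k)). apply continuous_const. apply (continuous_RInt_param (fun x t => F k x t * om x)); [lra|auto]. }
  unfold Phi. apply psum_le. intros k _.
  rewrite RInt_Rscal by (apply ex_RInt_cont; intros x; apply (continuous_RInt_param (fun x t => F k x t * om x)); [lra|auto]).
  apply Rmult_le_compat_l. apply Rlt_le, ck_pos.
  rewrite (RInt_Fubini (fun x t => F k x t * om x)); [|lra|lra|auto].
  apply RInt_le_cont; [lra| | |].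
  - intros t _. apply (continuous_RInt_param (fun t x => F k x t * om x)); [lra|]. intros; apply (continuity_2d_swap (fun x t => F k x t * om x)); auto.
  - intros t _. apply continuous_Rmult. apply Psi_cont. apply Qf_cont.
  - intros t _. set (c := Psi t * Qf lam (sg k) n t * exp (- (C0 * exp (- 2 * sg k * Y n)))).
    rewrite (RInt_ext (V:=R_CompleteNormedModule) _ (fun x => c * (exp (2 * (hh (sg k) x t - mm (sg k) n t)) * om x))).
    2:{ intros x _. unfold F, c, Rminus at 1. rewrite exp_plus. asR. ring. }
    assert (CC : forall x, continuous (fun x => exp (2 * (hh (sg k) x t - mm (sg k) n t)) * om x) x).
    { intros x. apply (continuous_Rmult (fun x => exp (2 * (hh (sg k) x t - mm (sg k) n t))) om); auto.
      apply (continuous_Rcomp exp (fun x => 2 * (hh (sg k) x t - mm (sg k) n t))). apply continuous_Rexp. assert (A := hh_cont_y (sg k) t). cont_tac. }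
    rewrite RInt_Rscal by (apply ex_RInt_cont; auto).
    assert (K := avg_factor (sg k) n t ltac:(assert (X := sg_gt k); lra)).
    assert (Hc : 0 < c) by (repeat apply Rmult_lt_0_compat; [apply Psi_pos|apply Qf_pos|apply exp_pos]).
    apply Rle_trans with (c * exp (C0 * exp (- 2 * sg k * Y n))). apply Rmult_le_compat_l; lra.
    unfold c. rewrite Rmult_assoc, <- exp_plus. rewrite Rplus_opp_l, exp_0. lra.
Qed.

(** Beyond [score] come the heights between [TT n] and [TT (S n)] on the old lines, and the whole
    new line [n]. Each costs at most [2 * exp 4 * exp (- n)]: the trivial bound [exp (4 (n + 1))] on
    [Qf] times [exp (- 5 n)]. *)
Lemma Phi_step lam n x : (forall j, (j < n)%nat -> 0 <= lam j) -> 0 <= x ->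
  Phi (upd lam n x) (S n) <= score lam n x + 4 * exp 4 * exp (- 1 * INR n).
Proof.
  intros Hl Hx. set (lam' := upd lam n x).
  assert (Hl' : forall j, (j < S n)%nat -> 0 <= lam' j).
  { intros j Hj. unfold lam', upd. destruct Nat.eq_dec; auto. apply Hl; lia. }
  assert (HQ : forall k t, Qf lam' (sg k) (S n) t = Qf lam (sg k) n t * exp (2 * (hh (sg k) x t - mm (sg k) n t) - C0 * exp (- 2 * sg k * Y n))).
  { intros k t. unfold Qf. simpl. fold (Ssum lam' (sg k) n t). change (Ssum lam' (sg k) (S n) t) with (Ssum lam' (sg k) n t + (hh (sg k) (lam' n) t - mm (sg k) n t)).
    rewrite (Ssum_ext lam' lam) by (intros; apply upd_lt; auto). unfold lam' at 1. rewrite upd_eq. rewrite <- exp_plus. f_equal. ring. }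
  set (M := exp (4 * INR (S n))).
  assert (HM : 0 < M) by apply exp_pos.
  assert (TP := TT_pos n). assert (TM := TT_mono n).
  assert (C : forall k t, continuous (fun t => Psi t * Qf lam' (sg k) (S n) t) t) by (intros; apply continuous_Rmult; [apply Psi_cont|apply Qf_cont]).
  assert (HB : forall k a b, 0 <= a <= b -> RInt (fun t => Psi t * Qf lam' (sg k) (S n) t) a b <= M * / ln (2 + a)).
  { intros k a b Hab. apply Rle_trans with (RInt (fun t => M * Psi t) a b).
    - apply RInt_le_cont; auto; [lra| |]. intros; apply (continuous_Rmult (fun _ => M) Psi). apply continuous_const. apply Psi_cont.
      intros t _. rewrite Rmult_comm. apply Rmult_le_compat_r. apply Rlt_le, Psi_pos. apply Qf_bound; auto. assert (X := sg_gt k); lra.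
    - rewrite RInt_Rscal by (apply ex_RInt_cont, Psi_cont). apply Rmult_le_compat_l; [lra|]. apply Psi_int; auto. }
  assert (L2 := ln2_gt).
  assert (E5 : exp (5 * INR n) <= ln (2 + TT n)). { rewrite <- (ln_exp (exp (5 * INR n))). apply ln_le; [apply exp_pos|unfold TT; lra]. }
  assert (E5p := exp_pos (5 * INR n)).
  assert (Hlast : ck n * RInt (fun t => Psi t * Qf lam' (sg n) (S n) t) 0 (TT (S n)) <= ck n * (M * 2)).
  { apply Rmult_le_compat_l. apply Rlt_le, ck_pos. apply Rle_trans with (1 := HB n 0 (TT (S n)) ltac:(lra)). apply Rmult_le_compat_l; [lra|].
    rewrite Rplus_0_r. rewrite <- (Rinv_inv 2) at 2. apply Rinv_le_contravar; lra. }
  assert (Hfirst : psum (fun k => ck k * RInt (fun t => Psi t * Qf lam' (sg k) (S n) t) 0 (TT (S n))) n <= score lam n x + M * exp (- 5 * INR n) * 2).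
  { apply Rle_trans with (psum (fun k => ck k * RInt (fun t => Psi t * Qf lam (sg k) n t * exp (2 * (hh (sg k) x t - mm (sg k) n t) - C0 * exp (- 2 * sg k * Y n))) 0 (TT n) + M * exp (- 5 * INR n) * ck k) n).
    - apply psum_le. intros k _. rewrite <- (RInt_cat _ 0 (TT n) (TT (S n))) by (apply ex_RInt_cont; auto).
      rewrite Rmult_plus_distr_l. apply Rplus_le_compat.
      + right. f_equal. apply RInt_ext. intros t _. rewrite HQ. asR. ring.
      + rewrite (Rmult_comm _ (ck k)). apply Rmult_le_compat_l. apply Rlt_le, ck_pos. apply Rle_trans with (1 := HB k (TT n) (TT (S n)) ltac:(lra)).
        apply Rmult_le_compat_l; [lra|]. replace (-5 * INR n) with (- (5 * INR n)) by ring. rewrite exp_Ropp. apply Rinv_le_contravar; lra.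
    - rewrite psum_plus, psum_scal. apply Rplus_le_compat_l. apply Rmult_le_compat_l. apply Rmult_le_pos; [lra|apply Rlt_le, exp_pos]. apply psum_ck. }
  unfold Phi. simpl. assert (ME : M * exp (- 5 * INR n) = exp 4 * exp (- 1 * INR n)).
  { unfold M. rewrite S_INR, <- 2 exp_plus. f_equal. ring. }
  unfold ck in Hlast at 2. unfold lam' in *. nra.
Qed.

Lemma construction_step lam n : Inv lam n -> exists x, Inv (upd lam n x) (S n).
Proof.
  intros (I1 & I2 & I3). assert (HL := Y_lt n).
  assert (Hl0 : forall j, (j < n)%nat -> 0 <= lam j) by (intros j Hj; specialize (I1 j Hj); assert (K := Y_nonneg j); lra).
  assert (Hl2 : forall j, (j < n)%nat -> INR j + 2 <= exp (lam j)).
  { intros j Hj. specialize (I1 j Hj). apply Rle_trans with (1 := exp_Y j). apply exp_le_compat; lra. }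
  (* With density bound [exp (Y (S n))] and excluded length [exp (- 3 * Y (S n)) / 8], the loss
     factor is [1 + exp (- 2 * Y (S n)) / 4], within the one allowed by [bnd]. *)
  destruct (choose_avoiding (score lam n) om (badsum lam n) (Y n) (Y (S n)) (/ 8 * exp (- 3 * Y (S n))) (exp (Y (S n))) (bnd n)) as (x & Hx & Hsc & Hbad); auto.
  - apply score_cont.
  - apply om_continuous.
  - apply om_pos.
  - intros y Hy. assert (K := Y_nonneg n). apply Rle_trans with (1 := om_le_exp y ltac:(lra)). apply exp_le_compat; lra.
  - intros; apply score_nonneg.
  - intros; apply badsum_diff; auto.
  - intros; apply badsum_mono; auto.
  - intros; apply badsum_total; auto; lra.
  - apply Y_mass.
  - apply Rle_trans with (2 := I3). apply score_mean.
  - apply bnd_pos.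
  - assert (K := Y_nonneg (S n)). replace (exp (Y (S n)) * (/ 8 * exp (-3 * Y (S n)))) with (/ 8 * exp (- 2 * Y (S n))).
    assert (exp (-2 * Y (S n)) <= 1) by (apply exp_le1; lra). lra.
    rewrite (Rmult_comm (/ 8)), (Rmult_comm (/8)), <- Rmult_assoc, <- exp_plus. do 2 f_equal. ring.
  - exists x. split; [|split].
    + intros j Hj. unfold upd. destruct Nat.eq_dec as [->|]; auto. apply I1; lia.
    + intros m Hm k E la lb Hk Ha Hb. destruct (Nat.eq_dec m n) as [->|Hne].
      * rewrite upd_eq. rewrite (lmons_ext _ lam) in Ha, Hb by (intros; apply upd_lt; auto).
        apply (badsum_avoid lam n E (Y n) (Y (S n)) x); auto.
      * rewrite upd_lt by lia. rewrite (lmons_ext _ lam) in Ha, Hb by (intros; apply upd_lt; lia). apply (I2 m ltac:(lia) k E); auto.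
    + assert (K := Y_nonneg n). apply Rle_trans with (1 := Phi_step lam n x Hl0 ltac:(lra)). simpl. apply Rplus_le_compat_r.
      apply Rle_trans with (1 := Hsc). apply Rmult_le_compat_l. apply Rlt_le, bnd_pos. apply Rplus_le_compat_l.
      replace (2 * exp (Y (S n)) * (/ 8 * exp (-3 * Y (S n)))) with (/ 4 * (exp (Y (S n)) * exp (- 3 * Y (S n)))) by field.
      rewrite <- exp_plus. apply Rmult_le_compat_l; [lra|]. apply exp_le_compat. lra.
Qed.

Lemma construction : exists lam : nat -> R, forall n, Inv lam n.
Proof.
  assert (H0 : Inv (fun _ => 0) 0). { split; [intros; lia|]. split; [intros; lia|]. unfold Phi; simpl; lra. }
  set (st := fix st n : {lam : nat -> R | Inv lam n} :=
    match n with
    | O => exist _ (fun _ => 0) H0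
    | S m => let x := constructive_indefinite_description _ (construction_step (proj1_sig (st m)) m (proj2_sig (st m))) in
             exist _ (upd (proj1_sig (st m)) m (proj1_sig x)) (proj2_sig x)
    end).
  set (L := fun n => proj1_sig (st n)).
  assert (HS : forall n, exists x, L (S n) = upd (L n) n x). { intros n. eexists. reflexivity. }
  (* Stage [S j] fixes the entry [j] for good: later stages only alter larger indices. *)
  exists (fun j => L (S j) j). intros n. apply (Inv_ext (L n)); [|apply (proj2_sig (st n))].
  assert (G : forall d j, L (S j + d)%nat j = L (S j) j).
  { induction d; intros j. rewrite Nat.add_0_r; auto. rewrite Nat.add_succ_r. destruct (HS (S j + d)%nat) as [x ->]. rewrite upd_lt by lia. apply IHd. }
  intros j Hj. replace n with (S j + (n - S j))%nat by lia. apply G.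
Qed.

(** * Separation and linear independence of the chosen logarithms *)

Definition lv (lam : nat -> R) (e : nat -> nat) (n : nat) : R := psum (fun j => INR (e j) * lam j) n.

(** These three properties are all that is used about the sequence later on. The separation is
    multiplied through by [k + 1] to be free of quotients, and the bound [C] of the last clause may
    depend on the line [k] but not on [n] or [T]. *)
Definition good (lam : nat -> R) : Prop :=
  (forall j, Y j <= lam j <= Y (S j)) /\
  (forall n k e e', sepw n k (lv lam e n) (lv lam e' n) <= Rabs (INR (S k) * lam n + lv lam e n - lv lam e' n)) /\
  (forall k, exists C, forall n T, (k < n)%nat -> 0 <= T <= TT n -> RInt (fun t => Psi t * exp (2 * Ssum lam (sg k) n t)) 0 T <= C).

Lemma nat_fun_bound (e : nat -> nat) n : exists E, forall j, (j < n)%nat -> (e j <= E)%nat.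
Proof.
  induction n. exists O; intros; lia. destruct IHn as [E HE]. exists (max E (e n)). intros j Hj.
  destruct (Nat.eq_dec j n) as [->|]; [lia|]. specialize (HE j ltac:(lia)). lia.
Qed.

Theorem exists_good : exists lam, good lam.
Proof.
  destruct construction as [lam H]. exists lam. split; [|split].
  - intros j. apply (proj1 (H (S j))). lia.
  - intros n k e e'. destruct (nat_fun_bound e n) as [E1 H1]. destruct (nat_fun_bound e' n) as [E2 H2].
    (* [E] must exceed [k] and dominate all the exponents, so that the triple belongs to the E-th
       family. *)
    set (E := max (S k) (max E1 E2)).
    assert (Hk : 0 < INR (S k)) by (apply lt_0_INR; lia).
    assert (K := proj1 (proj2 (H (S n))) n ltac:(lia) k E (lv lam e n) (lv lam e' n) ltac:(lia)).
    apply Rle_trans with (Rabs (lam n - (lv lam e' n - lv lam e n) / INR (S k))).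
    + apply K; apply in_lmons; [exists e|exists e']; split; auto; intros j Hj. specialize (H1 j Hj); lia. specialize (H2 j Hj); lia.
    + replace (INR (S k) * lam n + lv lam e n - lv lam e' n) with (INR (S k) * (lam n - (lv lam e' n - lv lam e n) / INR (S k))) by (field; lra).
      rewrite Rabs_mult, (Rabs_pos_eq (INR (S k))) by lra. rewrite S_INR. assert (P := pos_INR k).
      assert (X := Rabs_pos (lam n - (lv lam e' n - lv lam e n) / (INR k + 1))). rewrite <- S_INR in *. rewrite S_INR at 2. nra.
  - intros k. destruct bnd_bounded as [B HB]. destruct (psum_exp_Y (2 * sg k) ltac:(assert (X := sg_gt k); lra)) as [C HC].
    assert (HC0 : 0 < C0) by (unfold C0; assert (X := exp_pos 4); lra).
    assert (HL : forall j, 0 <= lam j). { intros j. assert (X := proj1 (H (S j)) j ltac:(lia)). assert (Z := Y_nonneg j). lra. }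
    exists (exp (C0 * C) * (B / ck k)). intros n T Hkn HT.
    assert (HP := proj2 (proj2 (H n))). specialize (HB n).
    assert (CQ : forall t, continuous (fun t => Psi t * Qf lam (sg k) n t) t) by (intros; apply continuous_Rmult; [apply Psi_cont|apply Qf_cont]).
    apply Rle_trans with (RInt (fun t => exp (C0 * C) * (Psi t * Qf lam (sg k) n t)) 0 T).
    { apply RInt_le_cont; [lra| | |].
      - intros t _. apply continuous_Rmult. apply Psi_cont. assert (X := Ssum_cont lam (sg k) n). apply (continuous_Rcomp exp (fun t => 2 * Ssum lam (sg k) n t)). apply continuous_Rexp. cont_tac.
      - intros t _. apply (continuous_Rmult (fun _ => exp (C0 * C))). apply continuous_const. apply CQ.
      - intros t _. rewrite (Rmult_comm (exp _)), Rmult_assoc. apply Rmult_le_compat_l. apply Rlt_le, Psi_pos. unfold Qf. rewrite <- exp_plus. apply exp_le_compat.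
        assert (psum (fun j => exp (-2 * sg k * Y j)) n <= C). { apply Rle_trans with (2 := HC n). right. apply psum_ext. intros; f_equal; ring. } nra. }
    rewrite RInt_Rscal by (apply ex_RInt_cont; auto). apply Rmult_le_compat_l. apply Rlt_le, exp_pos.
    assert (CKp := ck_pos k). apply Rmult_le_reg_l with (ck k); auto. replace (ck k * (B / ck k)) with B by (field; lra).
    apply Rle_trans with (2 := Rle_trans _ _ _ HP HB).
    apply Rle_trans with (ck k * RInt (fun t => Psi t * Qf lam (sg k) n t) 0 (TT n)).
    + apply Rmult_le_compat_l; [lra|]. rewrite <- (RInt_cat _ 0 T (TT n)) by (apply ex_RInt_cont; auto).
      assert (0 <= RInt (fun t => Psi t * Qf lam (sg k) n t) T (TT n)); [|lra]. apply RInt_nonneg; auto. lra.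
      intros; apply Rmult_le_pos; apply Rlt_le. apply Psi_pos. apply Qf_pos.
    + apply (psum_ge_member (fun k => ck k * RInt (fun t => Psi t * Qf lam (sg k) n t) 0 (TT n))); auto.
      intros j. apply Rmult_le_pos. apply Rlt_le, ck_pos. apply RInt_nonneg. apply Rlt_le, TT_pos. intros; apply continuous_Rmult; [apply Psi_cont|apply Qf_cont].
      intros; apply Rmult_le_pos; apply Rlt_le. apply Psi_pos. apply Qf_pos.
Qed.

Lemma lam_lower lam : good lam -> forall j, INR j + 2 <= exp (lam j).
Proof. intros (H & _) j. apply Rle_trans with (1 := exp_Y j). apply exp_le_compat. apply H. Qed.
Lemma lam_pos lam : good lam -> forall j, 0 < lam j.
Proof. intros G j. assert (H := lam_lower lam G j). assert (K := pos_INR j). destruct (Rlt_le_dec 0 (lam j)); auto. apply exp_le1 in r. lra. Qed.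

Lemma lv_nonneg lam e n : good lam -> 0 <= lv lam e n.
Proof. intros G. apply psum_nonneg. intros k. apply Rmult_le_pos. apply pos_INR. apply Rlt_le, lam_pos; auto. Qed.

(** [exp (- 3)] comes from [Y (S n) <= lam n + 1], which replaces the interval endpoint in [sepw] by
    the prime itself. *)
Definition c0 : R := / 64 * exp (- (3)).

(** Induction on the number of primes: where the exponents of the last prime agree it cancels, and
    otherwise their difference is some [k + 1] and the condition imposed when that prime was chosen
    applies. Every factor of [sepw] is a power of a quantity bounded by [exp M]; in particular
    [2^(-(k + 1)) >= exp (- (k + 1) * lam n)] because the prime is at least 2. *)
Lemma separation lam : good lam -> forall n e e' M, (exists j, (j < n)%nat /\ e j <> e' j) -> lv lam e n <= M -> lv lam e' n <= M ->
  c0 * exp (- 8 * M) <= Rabs (lv lam e n - lv lam e' n).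
Proof.
  intros G. assert (Key : forall n k e e' M, INR (S k) * lam n + lv lam e n <= M -> lv lam e' n <= M ->
    c0 * exp (- 8 * M) <= Rabs (INR (S k) * lam n + lv lam e n - lv lam e' n)).
  { intros n k e e' M H1 H2. destruct G as (G1 & G2 & G3). apply Rle_trans with (2 := G2 n k e e').
    assert (Gd : good lam) by (split; auto). assert (P1 := lv_nonneg lam e n Gd). assert (P2 := lv_nonneg lam e' n Gd). assert (P3 := lam_pos lam Gd n).
    assert (Hk := pos_INR k). rewrite S_INR in H1.
    unfold sepw, c0. rewrite !Rmult_assoc. apply Rmult_le_compat_l; [lra|].
    assert (H2k : exp (- (INR (S k) * lam n)) <= (/ 2) ^ S k).
    { replace (- (INR (S k) * lam n)) with (- lam n * INR (S k)) by ring. rewrite exp_pow. apply pow_incr. split. apply Rlt_le, exp_pos.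
      rewrite exp_Ropp. apply Rinv_le_contravar; [lra|]. assert (X := lam_lower lam Gd n). assert (Z := pos_INR n). lra. }
    apply Rle_trans with (exp (-3 * Y (S n)) * (exp (- (INR (S k) * lam n)) * (exp (-2 * lv lam e n) * exp (-2 * lv lam e' n)))).
    - rewrite <- !exp_plus. apply exp_le_compat. rewrite S_INR. assert (Z := Y_gap1 n). assert (W := G1 n).
      assert (L1 : lam n <= (INR k + 1) * lam n) by nra. nra.
    - apply Rmult_le_compat_l. apply Rlt_le, exp_pos. apply Rmult_le_compat_r; auto. apply Rmult_le_pos; apply Rlt_le, exp_pos. }
  induction n; intros e e' M (j & Hj & Hne) H1 H2; [lia|].
  unfold lv in H1, H2 |- *; simpl in H1, H2 |- *. fold (lv lam e n) in *. fold (lv lam e' n) in *.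
  assert (P1 := lv_nonneg lam e n G). assert (P2 := lv_nonneg lam e' n G). assert (P3 := lam_pos lam G n).
  assert (Q1 := pos_INR (e n)). assert (Q2 := pos_INR (e' n)).
  destruct (lt_eq_lt_dec (e n) (e' n)) as [[L|L]|L].
  - rewrite Rabs_minus_sym. set (k := (e' n - e n - 1)%nat). assert (Hk : INR (e' n) = INR (S k) + INR (e n)) by (rewrite <- plus_INR; f_equal; unfold k; lia).
    rewrite Hk in *. replace (lv lam e' n + (INR (S k) + INR (e n)) * lam n - (lv lam e n + INR (e n) * lam n)) with (INR (S k) * lam n + lv lam e' n - lv lam e n) by ring.
    apply Key; nra.
  - rewrite L. replace (lv lam e n + INR (e' n) * lam n - (lv lam e' n + INR (e' n) * lam n)) with (lv lam e n - lv lam e' n) by ring.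
    apply IHn; try nra. exists j. split; auto. destruct (Nat.eq_dec j n) as [->|]; [congruence|lia].
  - set (k := (e n - e' n - 1)%nat). assert (Hk : INR (e n) = INR (S k) + INR (e' n)) by (rewrite <- plus_INR; f_equal; unfold k; lia).
    rewrite Hk in *. replace (lv lam e n + (INR (S k) + INR (e' n)) * lam n - (lv lam e' n + INR (e' n) * lam n)) with (INR (S k) * lam n + lv lam e n - lv lam e' n) by ring.
    apply Key; nra.
Qed.

Lemma c0_pos : 0 < c0.
Proof. unfold c0. assert (H := exp_pos (-(3))). lra. Qed.

Lemma lv_inj lam : good lam -> forall n e e', lv lam e n = lv lam e' n -> forall j, (j < n)%nat -> e j = e' j.
Proof.
  intros G n e e' H j Hj. destruct (Nat.eq_dec (e j) (e' j)) as [|N]; auto. exfalso.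
  assert (K := separation lam G n e e' (lv lam e n) (ex_intro _ j (conj Hj N)) ltac:(lra) ltac:(lra)).
  rewrite H, Rminus_diag, Rabs_R0 in K. assert (X := exp_pos (-8 * lv lam e' n)). assert (Z := c0_pos). nra.
Qed.

Lemma lv_single lam n i : (i < n)%nat -> lv lam (fun j => if Nat.eq_dec j i then 1%nat else O) n = lam i.
Proof.
  unfold lv. induction n; intros Hi; [lia|]. simpl. destruct (Nat.eq_dec n i) as [->|N].
  - rewrite (psum_ext _ (fun j => 0 * 1)). rewrite psum_scal. simpl; ring. intros k Hk. destruct Nat.eq_dec; [lia|simpl; ring].
  - rewrite IHn by lia. simpl; ring.
Qed.

Lemma lam_increasing lam : good lam -> forall n, lam n < lam (S n).
Proof.
  intros G n. destruct (Rle_lt_or_eq_dec (lam n) (lam (S n))) as [|E]; auto.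
  - assert (H1 := proj1 G n). assert (H2 := proj1 G (S n)). lra.
  - exfalso. assert (K := lv_inj lam G (S (S n)) (fun j => if Nat.eq_dec j n then 1%nat else O) (fun j => if Nat.eq_dec j (S n) then 1%nat else O)).
    rewrite 2 lv_single in K by lia. specialize (K E n ltac:(lia)). destruct (Nat.eq_dec n n); [|lia]. destruct (Nat.eq_dec n (S n)); [lia|discriminate].
Qed.

Lemma lam_unbounded lam : good lam -> forall M, exists N, forall n, (N <= n)%nat -> M < lam n.
Proof.
  intros G M. destruct (INR_unbounded (exp M)) as [N HN]. exists N. intros n Hn. apply exp_lt_inv. apply Rlt_le_trans with (INR n + 2).
  apply le_INR in Hn. lra. apply lam_lower; auto.
Qed.

Lemma rsum_psum n f : rsum n f = psum f n.
Proof.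
  unfold rsum. induction n; [reflexivity|]. rewrite seq_S, map_app, fold_right_app. simpl. rewrite <- IHn. clear IHn.
  generalize (map f (seq 0 n)). induction l; simpl; [ring|rewrite IHl; ring].
Qed.

Lemma rprod_exp n f : rprod n (fun k => exp (f k)) = exp (psum f n).
Proof.
  unfold rprod. induction n; [simpl; rewrite exp_0; reflexivity|]. rewrite seq_S, map_app, fold_right_app. simpl. rewrite exp_plus, <- IHn. clear IHn.
  generalize (map (fun k => exp (f k)) (seq 0 n)). induction l; simpl; [ring|rewrite IHl; ring].
Qed.

Lemma clear_denominators (c : nat -> Q) K : exists (D : Z) (z : nat -> Z), (0 < D)%Z /\ forall k, (k < K)%nat -> Q2R (c k) * IZR D = IZR (z k).
Proof.
  induction K. exists 1%Z, (fun _ => 0%Z). split; [lia|intros; lia].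
  destruct IHK as (D & z & HD & Hz). set (d := Zpos (Qden (c K))).
  exists (D * d)%Z, (fun k => if Nat.eq_dec k K then (Qnum (c K) * D)%Z else (z k * d)%Z). split; [lia|].
  intros k Hk. rewrite mult_IZR. destruct Nat.eq_dec as [->|N].
  - rewrite mult_IZR. unfold Q2R. fold d. assert (IZR d <> 0) by (apply not_0_IZR; unfold d; lia). field; auto.
  - rewrite mult_IZR. rewrite <- Hz by lia. ring.
Qed.

(** After clearing denominators, positive and negative parts of the coefficients give two monomials
    with the same logarithm, and separation forces equal exponents. *)
Lemma lam_independent lam : good lam -> forall (K : nat) (c : nat -> Q), rsum K (fun k => Q2R (c k) * ln (exp (lam k))) = 0 -> forall k, (k < K)%nat -> Q2R (c k) = 0.
Proof.
  intros G K c H k Hk. destruct (clear_denominators c K) as (D & z & HD & Hz). rewrite rsum_psum in H.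
  set (e := fun k => Z.to_nat (z k)). set (e' := fun k => Z.to_nat (- z k)).
  assert (Hze : forall k, IZR (z k) = INR (e k) - INR (e' k)). { intros i. unfold e, e'. rewrite 2 INR_IZR_INZ, <- minus_IZR. f_equal. lia. }
  assert (E : lv lam e K = lv lam e' K).
  { assert (X : psum (fun k => IZR D * (Q2R (c k) * ln (exp (lam k)))) K = 0) by (rewrite psum_scal, H; ring).
    rewrite (psum_ext _ (fun k => INR (e k) * lam k + (-1) * (INR (e' k) * lam k))) in X.
    - rewrite psum_plus, psum_scal in X. unfold lv. lra.
    - intros i Hi. rewrite ln_exp. specialize (Hz i Hi). rewrite Hze in Hz. replace (IZR D * (Q2R (c i) * lam i)) with (Q2R (c i) * IZR D * lam i) by ring. rewrite Hz. ring. }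
  assert (J := lv_inj lam G K e e' E k Hk). specialize (Hz k Hk). rewrite Hze, J, Rminus_diag in Hz.
  apply Rmult_integral in Hz. destruct Hz as [|Z0]; auto. apply eq_IZR in Z0. lia.
Qed.

Lemma good_primes lam : good lam -> beurling_primes (fun n => exp (lam n)).
Proof.
  intros G. split; [|split; [|split]].
  - intros n. apply exp_increasing, lam_increasing; auto.
  - intros n. rewrite <- exp_0. apply exp_increasing, lam_pos; auto.
  - intros M. destruct (lam_unbounded lam G M) as [N HN]. exists N. intros n Hn. specialize (HN n Hn). assert (K := exp_ineq1_le (lam n)). lra.
  - apply lam_independent; auto.
Qed.

(** * The Beurling integers, their enumeration and Bohr's condition *)

Definition BL (lam : nat -> R) (l : R) : Prop := exists K e, l = lv lam e K.

Lemma BL_prime lam j : BL lam (lam j).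
Proof.
  exists (S j), (fun i => if Nat.eq_dec i j then 1%nat else 0%nat). unfold lv. simpl. destruct (Nat.eq_dec j j); [|lia].
  rewrite (psum_ext _ (fun _ => 0 * 0)). rewrite psum_scal. simpl; ring. intros i Hi. destruct (Nat.eq_dec i j); [lia|]. simpl; ring.
Qed.

Lemma beurling_integer_log lam y : beurling_integer (fun n => exp (lam n)) y <-> exists l, BL lam l /\ y = exp l.
Proof.
  assert (H : forall K e, rprod K (fun k => exp (lam k) ^ e k) = exp (lv lam e K)).
  { intros K e. unfold lv. rewrite <- rprod_exp. unfold rprod. f_equal. apply map_ext. intros k. rewrite Rmult_comm, exp_pow. reflexivity. }
  split.
  - intros (K & e & ->). exists (lv lam e K). split; [exists K, e; auto|apply H].
  - intros (l & (K & e & ->) & ->). exists K, e. symmetry; apply H.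
Qed.

Lemma lv_truncate lam e K N : (forall j, (N <= j)%nat -> (j < K)%nat -> e j = O) -> exists e', (forall j, (e' j <= e j)%nat) /\ lv lam e K = lv lam e' N.
Proof.
  intros H. exists (fun j => if lt_dec j K then e j else O). split. intros j; destruct lt_dec; lia.
  transitivity (lv lam (fun j => if lt_dec j K then e j else O) (max K N)).
  - assert (G : forall M, (K <= M)%nat -> lv lam e K = lv lam (fun j => if lt_dec j K then e j else O) M).
    { intros M HM. induction HM. unfold lv; apply psum_ext; intros k Hk; destruct lt_dec; [auto|lia].
      unfold lv in *; simpl. destruct (lt_dec m K); [lia|]. simpl. rewrite <- IHHM. ring. }
    apply G; lia.
  - assert (G : forall M, (N <= M)%nat -> lv lam (fun j => if lt_dec j K then e j else O) M = lv lam (fun j => if lt_dec j K then e j else O) N).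
    { intros M HM. induction HM; auto. unfold lv in *; simpl. rewrite IHHM. destruct (lt_dec m K). rewrite H by lia. simpl; ring. simpl; ring. }
    apply G; lia.
Qed.

Lemma lv_term lam e K j : good lam -> (j < K)%nat -> INR (e j) * lam j <= lv lam e K.
Proof.
  intros G Hj. apply (psum_ge_member (fun j => INR (e j) * lam j)); auto. intros i. apply Rmult_le_pos. apply pos_INR. apply Rlt_le, lam_pos; auto.
Qed.

Lemma lv_ge_ln2 lam j : good lam -> / 2 < lam j.
Proof.
  intros G. apply Rlt_le_trans with (ln 2). apply ln2_gt. rewrite <- (ln_exp (lam j)). apply ln_le; [lra|].
  assert (H := lam_lower lam G j). assert (K := pos_INR j). lra.
Qed.

(** A prime with logarithm above [X] cannot divide, and as every logarithm exceeds 1/2 each exponent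
    is at most [2 X]; one finite list therefore contains all integers up to [exp X]. *)
Lemma BL_bounded lam X : good lam -> exists N, forall n E l, (N <= n)%nat -> (N <= E)%nat -> BL lam l -> l <= X -> In l (lmons lam n E).
Proof.
  intros G. destruct (lam_unbounded lam G X) as [N1 H1]. destruct (INR_unbounded (2 * X)) as [N2 H2].
  exists (max N1 N2). intros n E l Hn HE (K & e & ->) HX.
  assert (Hcut : forall j, (n <= j)%nat -> (j < K)%nat -> e j = O).
  { intros j Hj HjK. assert (H0 := lv_term lam e K j G HjK). specialize (H1 j ltac:(lia)). destruct (e j) eqn:Ej; auto. exfalso.
    rewrite S_INR in H0. assert (P := pos_INR n0). assert (Q := lam_pos lam G j). nra. }
  destruct (lv_truncate lam e K n Hcut) as (e1 & He1 & E1). rewrite E1 in HX |- *.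
  apply in_lmons. exists e1. split; auto. intros j Hj. assert (H0 := lv_term lam e1 n j G Hj). assert (Q := lv_ge_ln2 lam j G).
  apply INR_le. assert (INR N2 <= INR E) by (apply le_INR; lia). assert (P := pos_INR (e1 j)). nra.
Qed.

Lemma list_min (l : list R) (P : R -> Prop) : (exists x, In x l /\ P x) -> exists m, In m l /\ P m /\ forall x, In x l -> P x -> m <= x.
Proof.
  induction l as [|a l IH]; intros (x & Hx & HP); [contradiction|].
  destruct (classic (exists x, In x l /\ P x)) as [Hl|Hl].
  - destruct (IH Hl) as (m & Hm & HPm & Hmin). destruct (classic (P a /\ a <= m)) as [[Ha Ham]|Ha].
    + exists a. split; [left; auto|]. split; auto. intros y [->|Hy] HPy; [lra|]. specialize (Hmin y Hy HPy); lra.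
    + exists m. split; [right; auto|]. split; auto. intros y [<-|Hy] HPy; auto. apply Rnot_lt_le. intros Hlt. apply Ha. split; auto; lra.
  - destruct Hx as [->|Hx]; [|exfalso; apply Hl; eauto]. exists x. split; [left; auto|]. split; auto. intros y [->|Hy] HPy; [lra|]. exfalso; apply Hl; eauto.
Qed.

(** Local finiteness gives every nonempty part of [B] a least element, so [B] is listed by passing
    repeatedly to the next one. Nothing is missed, since infinitely many terms below [y] would not
    fit in a finite list. *)
Lemma enumerate_discrete (B : R -> Prop) : (forall X, exists l, forall b, B b -> b <= X -> In b l) -> (forall X, exists b, B b /\ X < b) ->
  exists u : nat -> R, (forall n, u n < u (S n)) /\ (forall y, B y <-> exists n, u n = y).
Proof.
  intros Hfin Hinf.
  assert (Least : forall P : R -> Prop, (exists x, B x /\ P x) -> exists m, B m /\ P m /\ forall x, B x -> P x -> m <= x).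
  { intros P (x & HB & HP). destruct (Hfin x) as [l Hl]. destruct (list_min l (fun z => B z /\ P z /\ z <= x)) as (m & Hm & (H1 & H2 & H3) & Hmin).
    exists x. split. apply Hl; auto; lra. split; auto. split; auto; lra. exists m. split; auto. split; auto. intros y HBy HPy. destruct (Rle_dec y x).
    apply Hmin; auto. lra. }
  destruct (Least (fun _ => True)) as (b0 & Hb0 & _ & Hmin0). destruct (Hinf 0) as (b & Hb & _); eauto.
  assert (Nx : forall x, exists m, B m /\ x < m /\ forall y, B y -> x < y -> m <= y) by (intros x; apply Least; auto).
  set (nx := fun x => proj1_sig (constructive_indefinite_description _ (Nx x))).
  assert (Hnx : forall x, B (nx x) /\ x < nx x /\ forall y, B y -> x < y -> nx x <= y) by (intros x; apply (proj2_sig (constructive_indefinite_description _ (Nx x)))).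
  set (u := fix u n := match n with O => b0 | S m => nx (u m) end).
  assert (HuB : forall n, B (u n)) by (intros [|n]; simpl; auto; apply Hnx).
  assert (Hinc : forall n, u n < u (S n)) by (intros n; simpl; apply Hnx).
  assert (Hmono : forall m n, (m < n)%nat -> u m < u n). { intros m n Hmn. induction Hmn; auto. apply Rlt_trans with (1 := IHHmn). auto. }
  exists u. split; auto. intros y. split.
  - intros HBy. destruct (Hfin y) as [l Hl].
    assert (Hex : exists n, y < u n).
    { apply not_all_not_ex. intros Hall. assert (ND : NoDup (map u (seq 0 (S (length l))))).
      { apply Injective_map_NoDup; [|apply seq_NoDup]. intros a b' Hab. destruct (Nat.lt_trichotomy a b') as [L|[L|L]]; auto; apply Hmono in L; lra. }
      assert (Inc : incl (map u (seq 0 (S (length l)))) l). { intros z Hz. apply in_map_iff in Hz. destruct Hz as (n & <- & _). apply Hl; auto. specialize (Hall n). lra. }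
      assert (K := NoDup_incl_length ND Inc). rewrite length_map, length_seq in K. lia. }
    assert (Hfirst : exists n, u n <= y /\ y < u (S n)).
    { destruct Hex as [n Hn]. induction n. simpl in Hn. specialize (Hmin0 y HBy I). lra. destruct (Rlt_le_dec y (u n)); auto. exists n; auto. }
    destruct Hfirst as (n & H1 & H2). exists n. destruct (Rle_lt_or_eq_dec _ _ H1); auto. exfalso. simpl in H2. destruct (Hnx (u n)) as (_ & _ & K). specialize (K y HBy r). lra.
  - intros (n & <-). auto.
Qed.

Lemma BL_lam lam i : BL lam (lam i).
Proof. exists (S i), (fun j => if Nat.eq_dec j i then 1%nat else O). symmetry; apply lv_single; lia. Qed.

Lemma exists_log_integers lam : good lam -> exists mu : nat -> R, (forall n, mu n < mu (S n)) /\ (forall y, BL lam y <-> exists n, mu n = y).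
Proof.
  intros G. apply enumerate_discrete.
  - intros X. destruct (BL_bounded lam X G) as [N HN]. exists (lmons lam N N). intros; apply HN; auto.
  - intros X. destruct (lam_unbounded lam G X) as [N HN]. exists (lam N). split; [apply BL_lam|apply HN; auto].
Qed.

Lemma lists_integers lam mu : (forall n, mu n < mu (S n)) -> (forall y, BL lam y <-> exists n, mu n = y) ->
  lists_beurling_integers (fun n => exp (lam n)) (fun n => exp (mu n)).
Proof.
  intros H1 H2. split. intros n; apply exp_increasing, H1. intros y. rewrite beurling_integer_log. split.
  - intros (l & Hl & ->). apply H2 in Hl. destruct Hl as [n <-]. exists n; auto.
  - intros (n & <-). exists (mu n). split; auto. apply H2. exists n; auto.
Qed.

Lemma BL_separation lam a b : good lam -> BL lam a -> BL lam b -> a < b -> c0 * exp (- 8 * b) <= b - a.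
Proof.
  intros G (K & e & ->) (K' & e' & ->) Hab. set (N := max K K').
  destruct (lv_truncate lam e K N ltac:(intros; lia)) as (f & _ & Ef). destruct (lv_truncate lam e' K' N ltac:(intros; lia)) as (f' & _ & Ef').
  rewrite Ef, Ef' in *. rewrite <- (Rabs_pos_eq (lv lam f' N - lv lam f N)) by lra. apply separation; auto; try lra.
  apply NNPP. intros Hn. assert (lv lam f' N = lv lam f N); [|lra]. apply psum_ext. intros j Hj. destruct (Nat.eq_dec (f' j) (f j)) as [->|Ne]; auto.
  exfalso; apply Hn; eauto.
Qed.

(** The separation of logarithms carries over to the integers themselves because [exp d - 1 >= d]
    and the smaller integer is at least 1. *)
Lemma good_bohr lam mu : good lam -> (forall n, mu n < mu (S n)) -> (forall y, BL lam y <-> exists n, mu n = y) ->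
  forall n, exp (mu (S n)) - exp (mu n) >= c0 * Rpower (exp (mu (S n))) (- 8).
Proof.
  intros G H1 H2 n. unfold Rpower. rewrite ln_exp.
  assert (B1 : BL lam (mu n)) by (apply H2; eauto). assert (B2 : BL lam (mu (S n))) by (apply H2; eauto).
  assert (Sep := BL_separation lam _ _ G B1 B2 (H1 n)).
  assert (P : 0 <= mu n) by (destruct B1 as (K & e & E); rewrite E; apply lv_nonneg; auto).
  assert (E := exp_ineq1_le (mu (S n) - mu n)). assert (E0 := exp_ineq1_le (mu n)).
  assert (D : exp (mu (S n)) = exp (mu n) * exp (mu (S n) - mu n)) by (rewrite <- exp_plus; f_equal; ring).
  set (d := mu (S n) - mu n) in *. assert (0 < d) by (specialize (H1 n); unfold d; lra). rewrite D. nra.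
Qed.

(** * Counting the primes; unique factorisation *)

Lemma count_increasing (u : nat -> R) x : (forall n, u n < u (S n)) -> (exists n, x < u n) -> exists m, forall n, (n < m)%nat <-> u n <= x.
Proof.
  intros Hinc Hex.
  assert (Hmono : forall m n, (m <= n)%nat -> u m <= u n). { intros m n Hmn. induction Hmn; [lra|]. specialize (Hinc m0); lra. }
  destruct Hex as [N HN]. induction N.
  - exists O. intros n. split; [lia|]. intros H. specialize (Hmono O n ltac:(lia)). lra.
  - destruct (Rlt_le_dec x (u N)); auto. exists (S N). intros n. split.
    + intros Hn. specialize (Hmono n N ltac:(lia)). lra.
    + intros H. apply Nat.lt_nge. intros Hle. specialize (Hmono (S N) n Hle). lra.
Qed.

Lemma has_card_initial (P : nat -> Prop) m : (forall n, (n < m)%nat <-> P n) -> has_card P m.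
Proof.
  intros H. exists (seq 0 m). split; [apply seq_NoDup|]. split; [apply length_seq|]. intros t. rewrite in_seq, <- H. lia.
Qed.

(** The substitution [u = exp y] turns the integrand of [li] into [om]. *)
Lemma li_Lam x : 1 <= x -> li x = Lam (ln x).
Proof.
  intros Hx. unfold li. rewrite (RInt_ext (V:=R_CompleteNormedModule) _ (fun u => om (ln u) / u)).
  - rewrite (RInt_FTC (fun u => Lam (ln u))).
    + rewrite ln_1, Lam_0. lra.
    + lra.
    + intros z Hz. replace (om (ln z) / z) with (/ z * om (ln z)) by (field; lra).
      apply (is_derive_comp (K:=R_AbsRing) Lam ln). apply Lam_derive. apply is_derive_Reals. apply derivable_pt_lim_ln. lra.
    + intros z Hz. apply (continuous_Rmult (fun u => om (ln u)) Rinv).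
      * apply (continuous_comp ln om). apply (ex_derive_continuous ln). auto_derive; lra. apply om_continuous.
      * apply (ex_derive_continuous Rinv). auto_derive; lra.
  - intros z. rewrite Rmin_left, Rmax_right by lra. intros Hz. assert (L : 0 < ln z) by (rewrite <- ln_1; apply ln_increasing; lra).
    assert (M := om_mult (ln z)). rewrite exp_ln in M by lra. replace (om (ln z)) with ((z - 1) / ln z).
    asR; field; split; lra. rewrite <- M. field. lra.
Qed.

(** If exactly [m] primes are at most [x], then [ln x] lies between [Y (m - 1)] and [Y (S m)] (or 0
    and [Y 1] when [m = 0]), where [Lam] takes the values [m] and [m + 2]. *)
Lemma prime_count lam : good lam -> forall x, 2 <= x -> exists m, has_card (fun n => exp (lam n) <= x) m /\ Rabs (INR m - li x) <= 2.
Proof.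
  intros G x Hx. assert (L0 : 0 <= ln x) by (rewrite <- ln_1; apply ln_le; lra).
  assert (Hle : forall l, exp l <= x <-> l <= ln x).
  { intros l. split; intros H. rewrite <- (ln_exp l). apply ln_le; auto. apply exp_pos. rewrite <- (exp_ln x) by lra. apply exp_le_compat; auto. }
  destruct (count_increasing lam (ln x)) as [m Hm]. apply lam_increasing; auto.
  { destruct (lam_unbounded lam G (ln x)) as [N HN]. exists N. apply HN; auto. }
  exists m. split. apply has_card_initial. intros n. rewrite Hle. apply Hm.
  rewrite li_Lam by lra.
  assert (Lmono : forall a b, a <= b -> Lam a <= Lam b) by (intros a b [H|H]; [left; apply Lam_lt; auto|rewrite H; lra]).
  assert (U : Lam (ln x) <= INR m + 2).
  { assert (H : ln x < lam m). { apply Rnot_le_lt. intros H. apply Hm in H. lia. } assert (K := proj1 G m).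
    apply Rle_trans with (Lam (Y (S m))). apply Lmono; lra. rewrite (proj2 (Y_spec (S m))), S_INR. lra. }
  assert (D : INR m <= Lam (ln x)).
  { destruct m. simpl. rewrite <- Lam_0. apply Lmono; lra. assert (H : lam m <= ln x) by (apply Hm; lia). assert (K := proj1 G m).
    apply Rle_trans with (Lam (Y m)). rewrite (proj2 (Y_spec m)), S_INR; lra. apply Lmono; lra. }
  apply Rabs_le. lra.
Qed.

Lemma in_flat_disjoint_NoDup (g : nat -> list R) n : (forall e, NoDup (g e)) -> (forall e e' x, In x (g e) -> In x (g e') -> e = e') -> NoDup (flat_map g (seq 0 n)).
Proof.
  intros H1 H2. induction n; [constructor|]. rewrite seq_S, flat_map_app. simpl. rewrite app_nil_r. apply NoDup_app; auto.
  intros a Ha Hb. apply in_flat_map in Ha. destruct Ha as (e & He & Ha). apply in_seq in He. specialize (H2 e n a Ha Hb). lia.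
Qed.

(** Unique factorisation: a repeated entry would be one logarithm with two different exponent
    vectors. *)
Lemma lmons_NoDup lam n E : good lam -> NoDup (lmons lam n E).
Proof.
  intros G. induction n; [simpl; constructor; [intros []|constructor]|].
  change (lmons lam (S n) E) with (flat_map (fun e => map (fun l => l + INR e * lam n) (lmons lam n E)) (seq 0 (S E))).
  apply in_flat_disjoint_NoDup.
  - intros e. apply Injective_map_NoDup; auto. intros a b H; lra.
  - intros e e' x H1 H2. apply in_map_iff in H1. apply in_map_iff in H2. destruct H1 as (l & <- & H1). destruct H2 as (l' & Hx & H2).
    apply in_lmons in H1. apply in_lmons in H2. destruct H1 as (f & _ & ->). destruct H2 as (f' & _ & ->).
    assert (K := lv_inj lam G (S n) (fun j => if Nat.eq_dec j n then e else f j) (fun j => if Nat.eq_dec j n then e' else f' j)).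
    specialize (K) with (j := n). simpl in K. destruct (Nat.eq_dec n n) in K; [|lia]. apply K; [|lia].
    unfold lv; simpl. destruct (Nat.eq_dec n n); [|lia].
    rewrite (psum_ext _ (fun j => INR (f j) * lam j)) by (intros j Hj; destruct Nat.eq_dec; [lia|auto]).
    rewrite (psum_ext (fun j => INR (if Nat.eq_dec j n then e' else f' j) * lam j) (fun j => INR (f' j) * lam j)) by (intros j Hj; destruct Nat.eq_dec; [lia|auto]). lra.
Qed.

(** * The complex exponential *)

Definition cexp (z : C) : C := (exp (Re z) * cos (Im z), exp (Re z) * sin (Im z)).

Lemma cexp_plus a b : cexp (a + b)%C = (cexp a * cexp b)%C.
Proof.
  unfold cexp, Cmult, Cplus, Re, Im; simpl. rewrite exp_plus, cos_plus, sin_plus. f_equal; ring.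
Qed.
Lemma cexp_0 : cexp 0 = RtoC 1.
Proof. unfold cexp, RtoC, Re, Im; simpl. rewrite exp_0, cos_0, sin_0. f_equal; ring. Qed.
Lemma Cmod_cexp z : Cmod (cexp z) = exp (Re z).
Proof.
  unfold Cmod, cexp; simpl. transitivity (sqrt (exp (Re z) * exp (Re z))); [f_equal|apply sqrt_square, Rlt_le, exp_pos].
  assert (H := sin2_cos2 (Im z)). unfold Rsqr in H. transitivity (exp (Re z) * exp (Re z) * (sin (Im z) * sin (Im z) + cos (Im z) * cos (Im z))); [ring|rewrite H; ring].
Qed.
Lemma cexp_neq_0 z : cexp z <> 0%C.
Proof. apply Cmod_gt_0. rewrite Cmod_cexp. apply exp_pos. Qed.
Lemma Im_le_Cmod z : Rabs (Im z) <= Cmod z.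
Proof. apply Rle_trans with (2 := Rmax_Cmod z). apply Rmax_r. Qed.

Lemma Cmod_sub_sym a b : Cmod (a - b) = Cmod (b - a).
Proof. rewrite <- Cmod_opp. f_equal. ring. Qed.
Lemma Cmod_tri3 a b c : Cmod (a - c) <= Cmod (a - b) + Cmod (b - c).
Proof. replace (a - c)%C with ((a - b) + (b - c))%C by ring. apply Cmod_triangle. Qed.
Lemma Cmod_sub_le a b : Cmod (a - b) <= Cmod a + Cmod b.
Proof. unfold Cminus. rewrite <- (Cmod_opp b). apply Cmod_triangle. Qed.

(* The inner product of the increment with itself reduces the vector case to the real one. *)
Lemma complex_mean_value (f df : R -> C) a b M : a <= b ->
  (forall x, a <= x <= b -> is_derive (fun x => Re (f x)) x (Re (df x))) ->
  (forall x, a <= x <= b -> is_derive (fun x => Im (f x)) x (Im (df x))) ->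
  (forall x, a <= x <= b -> Cmod (df x) <= M) -> Cmod (f b - f a) <= M * (b - a).
Proof.
  intros Hab HR HI HM. set (w := (f b - f a)%C).
  assert (HM0 : 0 <= M). { specialize (HM a ltac:(lra)). assert (K := Cmod_ge_0 (df a)). lra. }
  assert (CS : forall u v : C, Re u * Re v + Im u * Im v <= Cmod u * Cmod v).
  { intros u v. apply Rsqr_incr_0_var; [|apply Rmult_le_pos; apply Cmod_ge_0]. unfold Rsqr.
    replace (Cmod u * Cmod v * (Cmod u * Cmod v)) with (Cmod u ^ 2 * Cmod v ^ 2) by ring. rewrite 2 Cmod2_alt.
    assert (0 <= (Re u * Im v - Im u * Re v) ^ 2) by apply pow2_ge_0. nra. }
  assert (H := derive_upper (fun x => Re w * Re (f x) + Im w * Im (f x)) (fun x => Re w * Re (df x) + Im w * Im (df x)) a b (Cmod w * M) Hab).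
  assert (K : Re w * Re (f b) + Im w * Im (f b) - (Re w * Re (f a) + Im w * Im (f a)) <= Cmod w * M * (b - a)).
  { apply H.
    - intros x Hx. apply (is_derive_plus (K:=R_AbsRing) (V:=R_NormedModule) (fun x => Re w * Re (f x)) (fun x => Im w * Im (f x))).
      apply (is_derive_scal (fun x => Re (f x))); auto. apply (is_derive_scal (fun x => Im (f x))); auto.
    - intros x Hx. apply Rle_trans with (1 := CS w (df x)). apply Rmult_le_compat_l. apply Cmod_ge_0. auto. }
  assert (E : Re w * Re (f b) + Im w * Im (f b) - (Re w * Re (f a) + Im w * Im (f a)) = Cmod w ^ 2).
  { rewrite Cmod2_alt. unfold w. unfold Cminus, Cplus, Copp, Re, Im; simpl. ring. }
  rewrite E in K. assert (P := Cmod_ge_0 w). destruct (Rle_lt_or_eq_dec _ _ P) as [Q|Q].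
  - apply Rmult_le_reg_l with (Cmod w); auto. nra.
  - rewrite <- Q. nra.
Qed.

Lemma Cmod_scalR (t : R) z : Cmod (RtoC t * z) = Rabs t * Cmod z.
Proof. rewrite Cmod_mult, Cmod_R. reflexivity. Qed.

Lemma cexp_line_derive (z : C) (x : R) :
  is_derive (fun x : R => Re (cexp (RtoC x * z))) x (Re (z * cexp (RtoC x * z))) /\
  is_derive (fun x : R => Im (cexp (RtoC x * z))) x (Im (z * cexp (RtoC x * z))).
Proof.
  destruct z as [a b].
  assert (E : forall x, cexp (RtoC x * (a, b)) = (exp (x * a) * cos (x * b), exp (x * a) * sin (x * b))).
  { intros t. unfold cexp, Cmult, RtoC, Re, Im; simpl. replace (t * a - 0 * b) with (t * a) by ring. replace (t * b + 0 * a) with (t * b) by ring. reflexivity. }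
  rewrite E. split.
  - apply is_derive_ext with (fun x => exp (x * a) * cos (x * b)). intros t; rewrite E; reflexivity.
    unfold Cmult, Re, Im; simpl. auto_derive; auto; ring.
  - apply is_derive_ext with (fun x => exp (x * a) * sin (x * b)). intros t; rewrite E; reflexivity.
    unfold Cmult, Re, Im; simpl. auto_derive; auto; ring.
Qed.

Lemma Re_le_Cmod z : Re z <= Cmod z.
Proof. assert (H := re_le_Cmod z). apply Rabs_le_between in H. lra. Qed.

Lemma cexp_line_bound z x : 0 <= x <= 1 -> Cmod (cexp (RtoC x * z)) <= exp (Cmod z).
Proof.
  intros Hx. rewrite Cmod_cexp. apply exp_le_compat. apply Rle_trans with (1 := Re_le_Cmod _). rewrite Cmod_scalR, Rabs_pos_eq by lra.
  assert (P := Cmod_ge_0 z). nra.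
Qed.

Lemma cexp_sub1 z : Cmod (cexp z - 1) <= Cmod z * exp (Cmod z).
Proof.
  assert (H := complex_mean_value (fun x => cexp (RtoC x * z)) (fun x => (z * cexp (RtoC x * z))%C) 0 1 (Cmod z * exp (Cmod z)) ltac:(lra)).
  cbv beta in H. rewrite !Cmult_0_l, !Cmult_1_l, cexp_0 in H. rewrite Rminus_0_r, Rmult_1_r in H. apply H.
  - intros; apply cexp_line_derive.
  - intros; apply cexp_line_derive.
  - intros x Hx. rewrite Cmod_mult. apply Rmult_le_compat_l. apply Cmod_ge_0. apply cexp_line_bound; auto.
Qed.

(** The mean value inequality along the ray [x * z], whose derivative is controlled by the first
    order bound [cexp_sub1]. *)
Lemma cexp_sub2 z : Cmod (cexp z - 1 - z) <= Cmod z ^ 2 * exp (Cmod z).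
Proof.
  assert (H := complex_mean_value (fun x => cexp (RtoC x * z) - RtoC x * z)%C (fun x => (z * (cexp (RtoC x * z) - 1))%C) 0 1 (Cmod z ^ 2 * exp (Cmod z)) ltac:(lra)).
  cbv beta in H. rewrite !Cmult_0_l, !Cmult_1_l, cexp_0 in H. rewrite Rminus_0_r, Rmult_1_r in H.
  replace (cexp z - 1 - z)%C with (cexp z - z - (1 - 0))%C by ring. apply H.
  - intros x _. destruct (cexp_line_derive z x) as [D1 _].
    replace (Re (z * (cexp (RtoC x * z) - 1))%C) with (Re (z * cexp (RtoC x * z)) - Re z) by (unfold Cmult, Cminus, Cplus, Copp, RtoC, Re, Im; simpl; ring).
    apply is_derive_ext with (fun x => Re (cexp (RtoC x * z)) - x * Re z).
    { intros t. unfold Cmult, Cminus, Cplus, Copp, RtoC, Re, Im; simpl. ring. }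
    apply (is_derive_minus (K:=R_AbsRing) (V:=R_NormedModule) (fun x => Re (cexp (RtoC x * z))) (fun x => x * Re z)); auto. auto_derive; auto; ring.
  - intros x _. destruct (cexp_line_derive z x) as [_ D1].
    replace (Im (z * (cexp (RtoC x * z) - 1))%C) with (Im (z * cexp (RtoC x * z)) - Im z) by (unfold Cmult, Cminus, Cplus, Copp, RtoC, Re, Im; simpl; ring).
    apply is_derive_ext with (fun x => Im (cexp (RtoC x * z)) - x * Im z).
    { intros t. unfold Cmult, Cminus, Cplus, Copp, RtoC, Re, Im; simpl. ring. }
    apply (is_derive_minus (K:=R_AbsRing) (V:=R_NormedModule) (fun x => Im (cexp (RtoC x * z))) (fun x => x * Im z)); auto. auto_derive; auto; ring.
  - intros x Hx. rewrite Cmod_mult. replace (Cmod z ^ 2 * exp (Cmod z)) with (Cmod z * (Cmod z * exp (Cmod z))) by ring.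
    apply Rmult_le_compat_l. apply Cmod_ge_0. apply Rle_trans with (1 := cexp_sub1 _). rewrite Cmod_scalR, Rabs_pos_eq by lra.
    assert (P := Cmod_ge_0 z). apply Rmult_le_compat; try nra. apply Rlt_le, exp_pos. apply exp_le_compat. nra.
Qed.

(** * Functions with a locally uniform first order expansion *)

(** Holomorphy is carried in this quantitative form: a remainder [B |h|^2], with one constant for
    all base points of a disc. It survives products and composition with the exponential, and a
    series is differentiated termwise by just adding up the constants [B]. Continuity of the
    derivative is built in. *)
Definition qd_at (f d : C -> C) (s0 : C) (r B : R) : Prop :=
  forall s h, Cmod (s - s0) <= r -> Cmod h <= r -> Cmod (f (s + h)%C - f s - h * d s) <= B * Cmod h ^ 2.

Definition qd (U : C -> Prop) (f d : C -> C) : Prop :=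
  forall s0, U s0 -> exists r B, 0 < r /\ 0 <= B /\ qd_at f d s0 r B.

Lemma qd_at_shrink f d s0 r B r' : r' <= r -> qd_at f d s0 r B -> qd_at f d s0 r' B.
Proof. intros Hr H s h Hs Hh. apply H; lra. Qed.

Lemma Cmod_0_sub s : Cmod (s - s) = 0.
Proof. rewrite <- Cmod_0. f_equal. ring. Qed.

(** Adding the expansion from [s0] to [s0 + h] and the one back cancels the values of [f] and leaves
    [h * (d (s0 + h) - d s0)]. *)
Lemma qd_at_d_lip f d s0 r B h : qd_at f d s0 r B -> Cmod h <= r -> Cmod (d (s0 + h)%C - d s0) <= 2 * B * Cmod h.
Proof.
  intros H Hh. assert (P := Cmod_ge_0 h).
  destruct (Rle_lt_or_eq_dec _ _ P) as [Q|Q].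
  2:{ rewrite <- Q. symmetry in Q. apply Cmod_eq_0 in Q. subst h. rewrite Cplus_0_r. rewrite Cmod_0_sub. lra. }
  assert (H1 := H s0 h ltac:(rewrite Cmod_0_sub; lra) Hh).
  assert (H2 := H (s0 + h)%C (- h)%C ltac:(replace (s0 + h - s0)%C with h by ring; auto) ltac:(rewrite Cmod_opp; auto)).
  rewrite Cmod_opp in H2. replace (s0 + h + - h)%C with s0 in H2 by ring.
  apply Rmult_le_reg_l with (Cmod h); auto. rewrite <- Cmod_mult.
  replace (h * (d (s0 + h) - d s0))%C with ((f (s0 + h) - f s0 - h * d s0) + (f s0 - f (s0 + h) - - h * d (s0 + h)))%C by ring.
  apply Rle_trans with (1 := Cmod_triangle _ _). nra.
Qed.

Lemma qd_at_bounds f d s0 r B : 0 < r -> 0 <= B -> qd_at f d s0 r B -> exists K, 0 <= K /\ forall s, Cmod (s - s0) <= r -> Cmod (f s) <= K /\ Cmod (d s) <= K.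
Proof.
  intros Hr HB H. exists (Cmod (f s0) + Cmod (d s0) * (1 + r) + 2 * B * r + B * r ^ 2). assert (P1 := Cmod_ge_0 (f s0)). assert (P2 := Cmod_ge_0 (d s0)).
  assert (Z1 : 0 <= 2 * B * r) by nra. assert (Z2 : 0 <= B * r ^ 2) by nra. assert (Z3 : 0 <= Cmod (d s0) * r) by nra.
  split; [lra|]. intros s Hs. set (h := (s - s0)%C) in *. assert (Es : s = (s0 + h)%C) by (unfold h; ring). rewrite Es.
  assert (P := Cmod_ge_0 h). split.
  - assert (H1 := H s0 h ltac:(rewrite Cmod_0_sub; lra) Hs).
    replace (f (s0 + h)%C) with ((f (s0 + h) - f s0 - h * d s0) + (f s0 + h * d s0))%C by ring.
    apply Rle_trans with (1 := Cmod_triangle _ _). assert (T := Cmod_triangle (f s0) (h * d s0)). rewrite Cmod_mult in T.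
    assert (B * Cmod h ^ 2 <= B * r ^ 2) by (apply Rmult_le_compat_l; [auto|apply pow_incr; lra]). assert (Cmod h * Cmod (d s0) <= r * Cmod (d s0)) by (apply Rmult_le_compat_r; lra). lra.
  - assert (H1 := qd_at_d_lip f d s0 r B h H Hs). replace (d (s0 + h)%C) with ((d (s0 + h) - d s0) + d s0)%C by ring.
    apply Rle_trans with (1 := Cmod_triangle _ _). assert (2 * B * Cmod h <= 2 * B * r) by nra. lra.
Qed.

Lemma qd_plus U f d g e : qd U f d -> qd U g e -> qd U (fun s => f s + g s)%C (fun s => d s + e s)%C.
Proof.
  intros Hf Hg s0 Hs. destruct (Hf s0 Hs) as (r1 & B1 & R1 & Q1 & H1). destruct (Hg s0 Hs) as (r2 & B2 & R2 & Q2 & H2).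
  exists (Rmin r1 r2), (B1 + B2). split; [apply Rmin_pos; auto|]. split; [lra|]. assert (M1 := Rmin_l r1 r2). assert (M2 := Rmin_r r1 r2).
  intros s h Hss Hh. specialize (H1 s h ltac:(lra) ltac:(lra)). specialize (H2 s h ltac:(lra) ltac:(lra)).
  replace (f (s + h) + g (s + h) - (f s + g s) - h * (d s + e s))%C with ((f (s + h) - f s - h * d s) + (g (s + h) - g s - h * e s))%C by ring.
  apply Rle_trans with (1 := Cmod_triangle _ _). lra.
Qed.

Lemma qd_at_increment f d s0 r B K : qd_at f d s0 r B -> (forall s, Cmod (s - s0) <= r -> Cmod (d s) <= K) -> 0 <= B ->
  forall s h, Cmod (s - s0) <= r -> Cmod h <= r -> Cmod (f (s + h)%C - f s) <= (K + B * r) * Cmod h.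
Proof.
  intros H HK HB s h Hs Hh. specialize (H s h Hs Hh). specialize (HK s Hs). assert (P := Cmod_ge_0 h).
  replace (f (s + h) - f s)%C with ((f (s + h) - f s - h * d s) + h * d s)%C by ring.
  apply Rle_trans with (1 := Cmod_triangle _ _). rewrite Cmod_mult.
  assert (Cmod h * Cmod (d s) <= Cmod h * K) by (apply Rmult_le_compat_l; lra). assert (Hc : B * Cmod h * Cmod h <= B * Cmod h * r) by (apply Rmult_le_compat_l; [apply Rmult_le_pos; lra|lra]).
  replace (B * Cmod h ^ 2) with (B * Cmod h * Cmod h) in H by ring. lra.
Qed.

Lemma qd_mult U f d g e : qd U f d -> qd U g e -> qd U (fun s => f s * g s)%C (fun s => d s * g s + f s * e s)%C.
Proof.
  intros Hf Hg s0 Hs. destruct (Hf s0 Hs) as (r1 & B1 & R1 & Q1 & H1). destruct (Hg s0 Hs) as (r2 & B2 & R2 & Q2 & H2).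
  assert (M1 := Rmin_l r1 r2). assert (M2 := Rmin_r r1 r2). assert (M3 := Rmin_pos _ _ R1 R2). set (r := Rmin r1 r2) in *.
  apply qd_at_shrink with (r' := r) in H1; auto. apply qd_at_shrink with (r' := r) in H2; auto.
  destruct (qd_at_bounds _ _ _ _ _ M3 Q1 H1) as (K1 & P1 & HK1). destruct (qd_at_bounds _ _ _ _ _ M3 Q2 H2) as (K2 & P2 & HK2).
  set (D1 := K1 + B1 * r). set (D2 := K2 + B2 * r).
  exists r, (B1 * K2 + K1 * B2 + D1 * D2). split; auto. assert (0 <= D1) by (unfold D1; nra). assert (0 <= D2) by (unfold D2; nra). split; [nra|].
  intros s h Hss Hh. assert (I1 := qd_at_increment f d s0 r B1 K1 H1 ltac:(intros; apply HK1; auto) Q1 s h Hss Hh).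
  assert (I2 := qd_at_increment g e s0 r B2 K2 H2 ltac:(intros; apply HK2; auto) Q2 s h Hss Hh). fold D1 in I1. fold D2 in I2.
  specialize (H1 s h Hss Hh). specialize (H2 s h Hss Hh). destruct (HK1 s Hss) as [F1 _]. destruct (HK2 s Hss) as [F2 _].
  replace (f (s + h) * g (s + h) - f s * g s - h * (d s * g s + f s * e s))%C with
    ((f (s + h) - f s - h * d s) * g s + f s * (g (s + h) - g s - h * e s) + (f (s + h) - f s) * (g (s + h) - g s))%C by ring.
  apply Rle_trans with (1 := Cmod_triangle _ _). apply Rle_trans with (1 := Rplus_le_compat_r _ _ _ (Cmod_triangle _ _)). rewrite 3 Cmod_mult.
  replace ((B1 * K2 + K1 * B2 + D1 * D2) * Cmod h ^ 2) with (B1 * Cmod h ^ 2 * K2 + K1 * (B2 * Cmod h ^ 2) + (D1 * Cmod h) * (D2 * Cmod h)) by ring.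
  apply Rplus_le_compat; [apply Rplus_le_compat|]; apply Rmult_le_compat; auto; apply Cmod_ge_0.
Qed.

Lemma qd_cexp U f d : qd U f d -> qd U (fun s => cexp (f s)) (fun s => d s * cexp (f s))%C.
Proof.
  intros Hf s0 Hs. destruct (Hf s0 Hs) as (r & B & Hr & HB & H).
  destruct (qd_at_bounds _ _ _ _ _ Hr HB H) as (K & HK & HKb). set (D := K + B * r). assert (HD : 0 <= D) by (unfold D; nra).
  exists r, (exp K * (B + D ^ 2 * exp (D * r))). assert (EK := exp_pos K). assert (ED := exp_pos (D * r)).
  split; auto. split. apply Rmult_le_pos; nra.
  intros s h Hss Hh. assert (I := qd_at_increment f d s0 r B K H ltac:(intros; apply HKb; auto) HB s h Hss Hh). fold D in I.
  specialize (H s h Hss Hh). destruct (HKb s Hss) as [F _]. assert (P := Cmod_ge_0 h). set (Dl := (f (s + h) - f s)%C) in *.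
  replace (f (s + h)%C) with (f s + Dl)%C by (unfold Dl; ring). rewrite cexp_plus.
  replace (cexp (f s) * cexp Dl - cexp (f s) - h * (d s * cexp (f s)))%C with (cexp (f s) * ((cexp Dl - 1 - Dl) + (Dl - h * d s)))%C by ring.
  rewrite Cmod_mult, Rmult_assoc. apply Rmult_le_compat; try apply Cmod_ge_0.
  - rewrite Cmod_cexp. apply exp_le_compat. apply Rle_trans with (2 := F). apply Re_le_Cmod.
  - apply Rle_trans with (1 := Cmod_triangle _ _). rewrite Rplus_comm, Rmult_plus_distr_r. apply Rplus_le_compat; auto.
    apply Rle_trans with (1 := cexp_sub2 Dl). assert (PD := Cmod_ge_0 Dl).
    replace (D ^ 2 * exp (D * r) * Cmod h ^ 2) with ((D * Cmod h) ^ 2 * exp (D * r)) by ring.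
    apply Rmult_le_compat. apply pow2_ge_0. apply Rlt_le, exp_pos. apply pow_incr; lra. apply exp_le_compat. nra.
Qed.

Lemma qd_ext U f d f' d' : (forall s, f s = f' s) -> (forall s, d s = d' s) -> qd U f d -> qd U f' d'.
Proof.
  intros Ef Ed H s0 Hs. destruct (H s0 Hs) as (r & B & Hr & HB & Hq). exists r, B. repeat split; auto. intros s h Hss Hh. rewrite <- !Ef, <- Ed. auto.
Qed.
Lemma qd_sub (U V : C -> Prop) f d : (forall s, V s -> U s) -> qd U f d -> qd V f d.
Proof. intros H Hq s0 Hs. apply Hq; auto. Qed.

Lemma qd_poly U (a b c : C) : qd U (fun s => a + b * s + c * (s * s))%C (fun s => b + c * (s + s))%C.
Proof.
  intros s0 _. exists 1, (Cmod c). split; [lra|]. split; [apply Cmod_ge_0|]. intros s h _ _.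
  right. rewrite <- Cmod_pow, <- Cmod_mult. f_equal. simpl. ring.
Qed.

Lemma qd_inv : qd (fun s => s <> 1%C) (fun s => / (s - 1))%C (fun s => - / ((s - 1) * (s - 1)))%C.
Proof.
  intros s0 Hs0. set (m := Cmod (s0 - 1)). assert (Hm : 0 < m). { apply Cmod_gt_0. intros E. apply Hs0. replace s0 with (s0 - 1 + 1)%C by ring. rewrite E. ring. }
  exists (m / 4), (/ ((m/2) ^ 3)). split; [lra|]. assert (Hm3 : 0 < (m / 2) ^ 3) by (apply pow_lt; lra). split. apply Rlt_le, Rinv_0_lt_compat; auto.
  assert (Low : forall s, Cmod (s - s0) <= m / 2 -> m / 2 <= Cmod (s - 1)).
  { intros s Hs. assert (T := Cmod_tri3 s0 s 1). fold m in T. rewrite Cmod_sub_sym in Hs. lra. }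
  intros s h Hs Hh. assert (L1 := Low s ltac:(lra)). assert (L2 := Low (s + h)%C ltac:(replace (s + h - s0)%C with ((s - s0) + h)%C by ring; assert (T := Cmod_triangle (s - s0) h); lra)).
  assert (N1 : (s - 1)%C <> 0%C) by (apply Cmod_gt_0; lra). assert (N2 : (s + h - 1)%C <> 0%C) by (apply Cmod_gt_0; lra).
  replace (/ (s + h - 1) - / (s - 1) - h * - / ((s - 1) * (s - 1)))%C with (h * h * / ((s - 1) * (s - 1) * (s + h - 1)))%C by (field; auto).
  rewrite Cmod_mult, Cmod_inv, !Cmod_mult by (repeat apply Cmult_neq_0; auto).
  rewrite Rmult_comm. replace (Cmod h ^ 2) with (Cmod h * Cmod h) by ring. apply Rmult_le_compat_r. assert (P := Cmod_ge_0 h); nra.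
  apply Rinv_le_contravar; auto. replace ((m / 2) ^ 3) with (m / 2 * (m / 2) * (m / 2)) by ring.
  apply Rmult_le_compat; try lra; [nra|]. apply Rmult_le_compat; lra.
Qed.

Lemma qd_holomorphic U f d s : qd U f d -> U s -> @ex_derive C_AbsRing C_NormedModule f s.
Proof.
  intros H Hs. exists (d s). split. apply is_linear_scal_l.
  intros x Hx eps. assert (Ex : x = s). { symmetry. apply (is_filter_lim_locally_unique (K:=C_AbsRing) (V:=AbsRing_NormedModule C_AbsRing)). exact Hx. }
  subst x. destruct (H s Hs) as (r & B & Hr & HB & Hq).
  assert (Hm : 0 < Rmin r (eps / (B + 1))). { apply Rmin_pos; auto. apply Rdiv_lt_0_compat; [apply eps|lra]. }
  assert (Main : forall y : C, Cmod (y - s) < Rmin r (eps / (B + 1)) -> Cmod (f y - f s - (y - s) * d s) <= eps * Cmod (y - s)).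
  { intros y Hy. assert (M1 := Rmin_l r (eps / (B + 1))). assert (M2 := Rmin_r r (eps / (B + 1))).
    specialize (Hq s (y - s)%C ltac:(rewrite Cmod_0_sub; lra) ltac:(lra)). replace (s + (y - s))%C with y in Hq by ring.
    apply Rle_trans with (1 := Hq). assert (P := Cmod_ge_0 (y - s)). replace (B * Cmod (y - s) ^ 2) with (B * Cmod (y - s) * Cmod (y - s)) by ring.
    apply Rmult_le_compat_r; auto. assert (Cmod (y - s) * (B + 1) <= eps). { apply Rle_trans with (eps / (B + 1) * (B + 1)). apply Rmult_le_compat_r; lra. right; field; lra. } nra. }
  exists (mkposreal _ Hm). intros y Hy. apply (Main y Hy).
Qed.

(** * Complex sums, limits and series *)

Fixpoint cpsum (f : nat -> C) (n : nat) : C :=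
  match n with O => RtoC 0 | S m => (cpsum f m + f m)%C end.

Lemma cpsum_bound f b n : (forall k, (k < n)%nat -> Cmod (f k) <= b k) -> Cmod (cpsum f n) <= psum b n.
Proof.
  induction n; simpl; intros H. rewrite Cmod_0; lra. apply Rle_trans with (1 := Cmod_triangle _ _).
  apply Rplus_le_compat. apply IHn; intros; apply H; lia. apply H; lia.
Qed.
Lemma cpsum_scal c f n : cpsum (fun k => c * f k)%C n = (c * cpsum f n)%C.
Proof. induction n; simpl; [ring|rewrite IHn; ring]. Qed.
Lemma cpsum_ext f g n : (forall k, (k < n)%nat -> f k = g k) -> cpsum f n = cpsum g n.
Proof. induction n; simpl; intros H; auto. rewrite IHn, H; auto. Qed.
Lemma cpsum_Re f n : Re (cpsum f n) = psum (fun k => Re (f k)) n.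
Proof. induction n; simpl; auto. rewrite <- IHn. reflexivity. Qed.
Lemma cpsum_Im f n : Im (cpsum f n) = psum (fun k => Im (f k)) n.
Proof. induction n; simpl; auto. rewrite <- IHn. reflexivity. Qed.

Lemma cpsum_tail f b m n : (m <= n)%nat -> (forall k, Cmod (f k) <= b k) -> Cmod (cpsum f n - cpsum f m) <= psum b n - psum b m.
Proof.
  intros Hmn H. induction Hmn. rewrite Cmod_0_sub; lra. simpl.
  replace (cpsum f m0 + f m0 - cpsum f m)%C with ((cpsum f m0 - cpsum f m) + f m0)%C by ring.
  apply Rle_trans with (1 := Cmod_triangle _ _). specialize (H m0). lra.
Qed.

Definition clim (u : nat -> C) (l : C) : Prop := forall eps, 0 < eps -> exists N, forall n, (N <= n)%nat -> Cmod (u n - l) < eps.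

Lemma clim_const c : clim (fun _ => c) c.
Proof. intros eps He. exists O. intros. rewrite Cmod_0_sub; auto. Qed.
Lemma clim_ext u v l : (forall n, u n = v n) -> clim u l -> clim v l.
Proof. intros E H eps He. destruct (H eps He) as [N HN]. exists N; intros; rewrite <- E; auto. Qed.
Lemma clim_plus u v l m : clim u l -> clim v m -> clim (fun n => u n + v n)%C (l + m)%C.
Proof.
  intros Hu Hv eps He. destruct (Hu (eps/2) ltac:(lra)) as [N1 H1]. destruct (Hv (eps/2) ltac:(lra)) as [N2 H2].
  exists (max N1 N2). intros n Hn. specialize (H1 n ltac:(lia)). specialize (H2 n ltac:(lia)).
  replace (u n + v n - (l + m))%C with ((u n - l) + (v n - m))%C by ring. apply Rle_lt_trans with (1 := Cmod_triangle _ _). lra.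
Qed.
Lemma clim_bound_dist u l a K N : clim u l -> (forall n, (N <= n)%nat -> Cmod (u n - a) <= K) -> Cmod (l - a) <= K.
Proof.
  intros Hu H. apply Rnot_lt_le. intros Hlt. destruct (Hu (Cmod (l - a) - K) ltac:(lra)) as [N1 H1].
  specialize (H1 (max N N1) ltac:(lia)). specialize (H (max N N1) ltac:(lia)). assert (T := Cmod_tri3 l (u (max N N1)) a). rewrite (Cmod_sub_sym l (u _)) in T. lra.
Qed.
Lemma clim_bound u l K : clim u l -> (forall n, Cmod (u n) <= K) -> Cmod l <= K.
Proof.
  intros Hu H. replace l with (l - 0)%C by ring. apply (clim_bound_dist u l 0 K 0 Hu). intros n _. replace (u n - 0)%C with (u n) by ring. auto.
Qed.
Lemma clim_unique u l m : clim u l -> clim u m -> l = m.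
Proof.
  intros Hl Hm. assert (E : (l - m)%C = RtoC 0). { apply Cmod_eq_0. apply Rle_antisym; [|apply Cmod_ge_0].
  apply Rnot_lt_le. intros Hlt. destruct (Hm (Cmod (l - m) / 2) ltac:(lra)) as [N HN].
  assert (K := clim_bound_dist u l m (Cmod (l - m) / 2) N Hl ltac:(intros; apply Rlt_le, HN; auto)). lra. }
  replace l with (l - m + m)%C by ring. rewrite E. ring.
Qed.
Lemma clim_mult u v l m : clim u l -> clim v m -> clim (fun n => u n * v n)%C (l * m)%C.
Proof.
  intros Hu Hv eps He. assert (P1 := Cmod_ge_0 l). assert (P2 := Cmod_ge_0 m).
  set (e := Rmin 1 (eps / (Cmod l + Cmod m + 2))). assert (Hq : 0 < eps / (Cmod l + Cmod m + 2)) by (apply Rdiv_lt_0_compat; lra).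
  assert (He0 : 0 < e) by (apply Rmin_pos; lra). assert (M1 : e <= 1) by apply Rmin_l. assert (M2 : e <= eps / (Cmod l + Cmod m + 2)) by apply Rmin_r.
  destruct (Hu e He0) as [N1 H1]. destruct (Hv e He0) as [N2 H2]. exists (max N1 N2). intros n Hn. specialize (H1 n ltac:(lia)). specialize (H2 n ltac:(lia)).
  replace (u n * v n - l * m)%C with ((u n - l) * (v n - m) + ((u n - l) * m + l * (v n - m)))%C by ring.
  apply Rle_lt_trans with (1 := Cmod_triangle _ _). apply Rle_lt_trans with (1 := Rplus_le_compat_l _ _ _ (Cmod_triangle _ _)). rewrite 3 Cmod_mult.
  assert (Q1 := Cmod_ge_0 (u n - l)). assert (Q2 := Cmod_ge_0 (v n - m)).
  apply Rle_lt_trans with (e * (Cmod l + Cmod m + 1)). nra.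
  apply Rlt_le_trans with (e * (Cmod l + Cmod m + 2)). nra. apply Rle_trans with (eps / (Cmod l + Cmod m + 2) * (Cmod l + Cmod m + 2)). apply Rmult_le_compat_r; lra. right; field; lra.
Qed.
Lemma clim_scal c u l : clim u l -> clim (fun n => c * u n)%C (c * l)%C.
Proof. intros H. apply clim_mult; auto. apply clim_const. Qed.
Lemma clim_minus u v l m : clim u l -> clim v m -> clim (fun n => u n - v n)%C (l - m)%C.
Proof.
  intros Hu Hv. apply clim_ext with (fun n => u n + (RtoC (-1)) * v n)%C. intros; ring.
  replace (l - m)%C with (l + RtoC (-1) * m)%C by ring. apply clim_plus; auto. apply clim_scal; auto.
Qed.
Lemma clim_cexp u l : clim u l -> clim (fun n => cexp (u n)) (cexp l).
Proof.
  intros H eps He. set (E := exp (Re l)). assert (HE : 0 < E) by apply exp_pos. assert (X := exp_pos 1).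
  set (e := Rmin 1 (eps / (E * exp 1 + 1))). assert (Hq : 0 < eps / (E * exp 1 + 1)) by (apply Rdiv_lt_0_compat; nra).
  assert (He0 : 0 < e) by (apply Rmin_pos; lra). assert (M1 : e <= 1) by apply Rmin_l. assert (M2 : e <= eps / (E * exp 1 + 1)) by apply Rmin_r.
  destruct (H e He0) as [N HN]. exists N. intros n Hn. specialize (HN n Hn).
  replace (u n) with (l + (u n - l))%C by ring. rewrite cexp_plus. replace (cexp l * cexp (u n - l) - cexp l)%C with (cexp l * (cexp (u n - l) - 1))%C by ring.
  rewrite Cmod_mult, Cmod_cexp. fold E. assert (P := Cmod_ge_0 (u n - l)). assert (B := cexp_sub1 (u n - l)%C).
  assert (B2 : Cmod (u n - l) * exp (Cmod (u n - l)) <= e * exp 1) by (apply Rmult_le_compat; try lra; [apply Rlt_le, exp_pos|apply exp_le_compat; lra]).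
  apply Rle_lt_trans with (E * (e * exp 1)). apply Rmult_le_compat_l; lra.
  assert (0 < E * exp 1) by nra. apply Rlt_le_trans with (e * (E * exp 1 + 1)). nra.
  apply Rle_trans with (eps / (E * exp 1 + 1) * (E * exp 1 + 1)). apply Rmult_le_compat_r; lra. right; field; lra.
Qed.

(** A total function, defined by coordinates; its use as a limit always goes through a real majorant
    as in [Csum_clim]. *)
Definition Csum (f : nat -> C) : C := (Series (fun n => Re (f n)), Series (fun n => Im (f n))).

Lemma ex_series_bounded b B : (forall k, 0 <= b k) -> (forall n, psum b n <= B) -> ex_series b.
Proof.
  intros Hb HB. destruct (ex_finite_lim_seq_incr (sum_n b) B) as [l Hl].
  - intros n. rewrite 2 sum_n_psum. simpl. specialize (Hb (S n)). lra.
  - intros n. rewrite sum_n_psum. auto.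
  - exists l. exact Hl.
Qed.

Lemma Csum_clim f b B : (forall k, Cmod (f k) <= b k) -> (forall n, psum b n <= B) -> clim (cpsum f) (Csum f).
Proof.
  intros Hf HB. assert (Hb : forall k, 0 <= b k) by (intros k; apply Rle_trans with (2 := Hf k); apply Cmod_ge_0).
  assert (Eb := ex_series_bounded b B Hb HB).
  assert (ER : ex_series (fun n => Re (f n))). { apply (ex_series_le (K:=R_AbsRing) (V:=R_CompleteNormedModule) _ b); auto. intros n. apply Rle_trans with (2 := Hf n). apply re_le_Cmod. }
  assert (EI : ex_series (fun n => Im (f n))). { apply (ex_series_le (K:=R_AbsRing) (V:=R_CompleteNormedModule) _ b); auto. intros n. apply Rle_trans with (2 := Hf n). apply Im_le_Cmod. }
  assert (LR : is_lim_seq (sum_n (fun n => Re (f n))) (Series (fun n => Re (f n)))) by apply (Series_correct _ ER).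
  assert (LI : is_lim_seq (sum_n (fun n => Im (f n))) (Series (fun n => Im (f n)))) by apply (Series_correct _ EI).
  intros eps He. apply is_lim_seq_spec in LR. apply is_lim_seq_spec in LI.
  assert (He2 : 0 < eps / 2) by lra. destruct (LR (mkposreal _ He2)) as [N1 H1]. destruct (LI (mkposreal _ He2)) as [N2 H2]. simpl in H1, H2.
  exists (S (max N1 N2)). intros n Hn. destruct n; [lia|]. specialize (H1 n ltac:(lia)). specialize (H2 n ltac:(lia)). rewrite sum_n_psum in H1, H2.
  apply Rle_lt_trans with (1 := Cmod_2Rmax _).
  assert (E1 : fst (cpsum f (S n) - Csum f)%C = psum (fun n => Re (f n)) (S n) - Series (fun n => Re (f n))) by (rewrite <- cpsum_Re; reflexivity).
  assert (E2 : snd (cpsum f (S n) - Csum f)%C = psum (fun n => Im (f n)) (S n) - Series (fun n => Im (f n))) by (rewrite <- cpsum_Im; reflexivity).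
  rewrite E1, E2. assert (S2 : sqrt 2 <= 2). { rewrite <- (sqrt_square 2) at 2 by lra. apply sqrt_le_1_alt; lra. }
  assert (0 <= sqrt 2) by apply sqrt_pos. set (m := Rmax _ _). assert (m < eps / 2) by (unfold m; apply Rmax_lub_lt; auto).
  assert (0 <= m) by (unfold m; apply Rle_trans with (2 := Rmax_l _ _); apply Rabs_pos). nra.
Qed.

Lemma Csum_bound f b B : (forall k, Cmod (f k) <= b k) -> (forall n, psum b n <= B) -> Cmod (Csum f) <= B.
Proof.
  intros Hf HB. apply (clim_bound (cpsum f)). apply (Csum_clim f b B); auto. intros n. apply Rle_trans with (2 := HB n). apply cpsum_bound; auto.
Qed.

Lemma Csum_tail f b B N T : (forall k, Cmod (f k) <= b k) -> (forall n, psum b n <= B) -> (forall n, (N <= n)%nat -> psum b n - psum b N <= T) -> Cmod (Csum f - cpsum f N) <= T.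
Proof.
  intros Hf HB HT. apply (clim_bound_dist (cpsum f) _ _ T N). apply (Csum_clim f b B); auto. intros n Hn. apply Rle_trans with (2 := HT n Hn). apply cpsum_tail; auto.
Qed.

Lemma psum_tail_small b B : (forall k, 0 <= b k) -> (forall n, psum b n <= B) -> forall eps, 0 < eps -> exists N, forall m n, (N <= m)%nat -> (m <= n)%nat -> psum b n - psum b m <= eps.
Proof.
  intros Hb HB eps He. destruct (completeness (fun x => exists n, x = psum b n)) as [l [H1 H2]].
  - exists B. intros x [n ->]. auto.
  - exists (psum b 0), O. auto.
  - assert (HN : exists N, l - eps < psum b N).
    { apply not_all_not_ex. intros Hall. assert (l <= l - eps); [|lra]. apply H2. intros x [n ->]. apply Rnot_lt_le. apply Hall. }
    destruct HN as [N HN]. exists N. intros m n Hm Hmn. assert (psum b n <= l) by (apply H1; eauto). assert (psum b N <= psum b m) by (apply psum_mono; auto). lra.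
Qed.

(** A substitute for Cauchy's estimate: the expansion with the single step [h = r] is solved for
    [d s]. *)
Lemma qd_at_deriv_bound f d s0 r B A s : 0 < r -> qd_at f d s0 r B -> (forall s, Cmod (s - s0) <= 2 * r -> Cmod (f s) <= A) -> Cmod (s - s0) <= r -> Cmod (d s) <= 2 / r * A + r * B.
Proof.
  intros Hr H HA Hs. assert (Hh : Cmod (RtoC r) = r) by (rewrite Cmod_R, Rabs_pos_eq; lra).
  specialize (H s (RtoC r) Hs ltac:(lra)). rewrite Hh in H.
  assert (A1 := HA s ltac:(lra)). assert (A2 := HA (s + RtoC r)%C).
  assert (A3 : Cmod (s + RtoC r - s0) <= 2 * r). { replace (s + RtoC r - s0)%C with ((s - s0) + RtoC r)%C by ring. apply Rle_trans with (1 := Cmod_triangle _ _). lra. }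
  specialize (A2 A3). apply Rmult_le_reg_l with r; auto. rewrite <- Hh at 1. rewrite <- Cmod_mult.
  replace (RtoC r * d s)%C with (f (s + RtoC r) - f s - (f (s + RtoC r) - f s - RtoC r * d s))%C by ring.
  apply Rle_trans with (1 := Cmod_sub_le _ _). assert (T := Cmod_sub_le (f (s + RtoC r)%C) (f s)).
  replace (r * (2 / r * A + r * B)) with (2 * A + B * r ^ 2) by (field; lra). lra.
Qed.

(** For each fixed [s] and [h] the remainder of the sum is the limit of sums of remainders.
    Summability of the derivatives follows from that of [A] and [B] by [qd_at_deriv_bound]. *)
Lemma qd_series (f d : nat -> C -> C) s0 r (A B : nat -> R) SA SB : 0 < r ->
  (forall n, qd_at (f n) (d n) s0 r (B n)) -> (forall n s, Cmod (s - s0) <= 2 * r -> Cmod (f n s) <= A n) ->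
  (forall n, psum A n <= SA) -> (forall n, psum B n <= SB) ->
  qd_at (fun s => Csum (fun n => f n s)) (fun s => Csum (fun n => d n s)) s0 r SB.
Proof.
  intros Hr Hq HA HSA HSB s h Hs Hh.
  assert (C1 : clim (cpsum (fun n => f n (s + h)%C)) (Csum (fun n => f n (s + h)%C))).
  { apply (Csum_clim _ A SA); auto. intros; apply HA. replace (s + h - s0)%C with ((s - s0) + h)%C by ring. apply Rle_trans with (1 := Cmod_triangle _ _). lra. }
  assert (C2 : clim (cpsum (fun n => f n s)) (Csum (fun n => f n s))) by (apply (Csum_clim _ A SA); auto; intros; apply HA; lra).
  assert (C3 : clim (cpsum (fun n => d n s)) (Csum (fun n => d n s))).
  { apply (Csum_clim _ (fun n => 2 / r * A n + r * B n) (2 / r * SA + r * SB)). intros k. apply (qd_at_deriv_bound (f k) (d k) s0 r (B k) (A k)); auto.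
    intros n. rewrite psum_plus, 2 psum_scal. specialize (HSA n). specialize (HSB n). assert (0 < 2 / r) by (apply Rdiv_lt_0_compat; lra). nra. }
  apply (clim_bound (fun n => cpsum (fun k => f k (s + h)%C - f k s - h * d k s)%C n)).
  - apply clim_ext with (fun n => cpsum (fun n => f n (s + h)%C) n - cpsum (fun n => f n s) n - h * cpsum (fun n => d n s) n)%C.
    + intros n. induction n; simpl; [ring|]. rewrite <- IHn. ring.
    + apply clim_minus; [apply clim_minus; auto|apply clim_scal; auto].
  - intros n. apply Rle_trans with (psum (fun k => Cmod h ^ 2 * B k) n).
    + apply cpsum_bound. intros k _. rewrite Rmult_comm. apply Hq; auto.
    + rewrite psum_scal, Rmult_comm. apply Rmult_le_compat_r. apply pow2_ge_0. auto.
Qed.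

(** * Shifting the line of integration *)

Lemma quadratic_derive (g : R -> R) x l r B : 0 < r -> (forall e, Rabs e <= r -> Rabs (g (x + e) - g x - e * l) <= B * e ^ 2) -> is_derive g x l.
Proof.
  intros Hr H. apply is_derive_Reals. intros eps He.
  assert (HB : 0 <= Rabs B) by apply Rabs_pos.
  assert (Hd : 0 < Rmin r (eps / (Rabs B + 1))) by (apply Rmin_pos; auto; apply Rdiv_lt_0_compat; lra).
  exists (mkposreal _ Hd). intros h Hh Hlt. simpl in Hlt. assert (M1 := Rmin_l r (eps / (Rabs B + 1))). assert (M2 := Rmin_r r (eps / (Rabs B + 1))).
  specialize (H h ltac:(lra)). assert (Ph : 0 < Rabs h) by (apply Rabs_pos_lt; auto).
  replace ((g (x + h) - g x) / h - l) with ((g (x + h) - g x - h * l) / h) by (field; auto).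
  unfold Rdiv. rewrite Rabs_mult, Rabs_inv. apply Rmult_lt_reg_r with (Rabs h); auto. rewrite Rmult_assoc, Rinv_l, Rmult_1_r by lra.
  apply Rle_lt_trans with (1 := H). rewrite <- pow2_abs. replace (B * Rabs h ^ 2) with (B * Rabs h * Rabs h) by ring. apply Rmult_lt_compat_r; auto.
  apply Rle_lt_trans with (Rabs B * Rabs h). apply Rmult_le_compat_r; [lra|apply Rle_abs].
  assert (Rabs h * (Rabs B + 1) < eps). { apply Rlt_le_trans with (eps / (Rabs B + 1) * (Rabs B + 1)). apply Rmult_lt_compat_r; lra. right; field; lra. } nra.
Qed.

Lemma qd_partial_re U f d x y : qd U f d -> U (x, y) -> is_derive (fun x => Re (f (x, y))) x (Re (d (x, y))).
Proof.
  intros H HU. destruct (H _ HU) as (r & B & Hr & HB & Hq). apply (quadratic_derive _ _ _ r B Hr). intros e He.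
  specialize (Hq (x, y) (RtoC e) ltac:(rewrite Cmod_0_sub; lra) ltac:(rewrite Cmod_R; auto)). rewrite Cmod_R, pow2_abs in Hq. apply Rle_trans with (2 := Hq).
  apply Rle_trans with (2 := re_le_Cmod _). right. f_equal. unfold Cmult, Cminus, Cplus, Copp, RtoC, Re, Im; simpl. rewrite Rplus_0_r. ring.
Qed.
(** With [qd_partial_re] this is the Cauchy-Riemann relation used below: the [x]-derivative of
    [Re f] and the [y]-derivative of [Im f] are both [Re d]. *)
Lemma qd_partial_im U f d x y : qd U f d -> U (x, y) -> is_derive (fun y => Im (f (x, y))) y (Re (d (x, y))).
Proof.
  intros H HU. destruct (H _ HU) as (r & B & Hr & HB & Hq). apply (quadratic_derive _ _ _ r B Hr). intros e He.
  assert (Hc : Cmod (0, e) = Rabs e). { unfold Cmod; simpl. rewrite Rmult_0_l, Rplus_0_l, Rmult_1_r. apply sqrt_Rsqr_abs. }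
  specialize (Hq (x, y) (0, e) ltac:(rewrite Cmod_0_sub; lra) ltac:(rewrite Hc; auto)). rewrite Hc, pow2_abs in Hq. apply Rle_trans with (2 := Hq).
  apply Rle_trans with (2 := Im_le_Cmod _). right. f_equal. unfold Cmult, Cminus, Cplus, Copp, RtoC, Re, Im; simpl. rewrite Rplus_0_r. ring.
Qed.

Lemma qd_cont2 U f d x y : qd U f d -> U (x, y) -> continuity_2d_pt (fun x y => Re (f (x, y))) x y /\ continuity_2d_pt (fun x y => Im (f (x, y))) x y /\ continuity_2d_pt (fun x y => Re (d (x, y))) x y.
Proof.
  intros H HU. destruct (H _ HU) as (r & B & Hr & HB & Hq). destruct (qd_at_bounds _ _ _ _ _ Hr HB Hq) as (K & HK & HKb).
  assert (Hc : forall (g : C -> C) M, 0 <= M -> (forall h, Cmod h <= r -> Cmod (g ((x,y) + h)%C - g (x,y)) <= M * Cmod h) ->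
     continuity_2d_pt (fun x y => Re (g (x, y))) x y /\ continuity_2d_pt (fun x y => Im (g (x, y))) x y).
  { intros g M HM Hg. assert (Main : forall eps : posreal, locally_2d (fun u v => Cmod (g (u, v) - g (x, y)) < eps) x y).
    { intros eps. assert (Hd : 0 < Rmin (r / 2) (eps / (2 * (M + 1)))). { apply Rmin_pos. lra. apply Rdiv_lt_0_compat; [apply eps|lra]. }
      exists (mkposreal _ Hd). simpl. intros u v Hu Hv. assert (M1 := Rmin_l (r / 2) (eps / (2 * (M + 1)))). assert (M2 := Rmin_r (r / 2) (eps / (2 * (M + 1)))).
      set (h := (u - x, v - y) : C). assert (Hh : Cmod h < 2 * Rmin (r / 2) (eps / (2 * (M + 1)))).
      { apply Rle_lt_trans with (1 := Cmod_2Rmax h). unfold h; simpl. assert (S2 : sqrt 2 <= 2). { rewrite <- (sqrt_square 2) at 2 by lra. apply sqrt_le_1_alt; lra. }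
        set (m := Rmax _ _). assert (m < Rmin (r / 2) (eps / (2 * (M + 1)))) by (unfold m; apply Rmax_lub_lt; auto).
        assert (0 <= m) by (unfold m; apply Rle_trans with (2 := Rmax_l _ _); apply Rabs_pos). assert (0 <= sqrt 2) by apply sqrt_pos. nra. }
      replace (u, v) with ((x, y) + h)%C by (unfold h, Cplus; simpl; f_equal; ring). apply Rle_lt_trans with (1 := Hg h ltac:(lra)).
      assert (Ph := Cmod_ge_0 h). assert (Cmod h * (M + 1) < eps). { apply Rlt_le_trans with (2 * (eps / (2 * (M + 1))) * (M + 1)). apply Rmult_lt_compat_r; lra. right; field; lra. } nra. }
    split; intros eps; destruct (Main eps) as [dl Hdl]; exists dl; intros u v Hu Hv; apply Rle_lt_trans with (2 := Hdl u v Hu Hv).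
    apply Rle_trans with (2 := re_le_Cmod _). right; reflexivity. apply Rle_trans with (2 := Im_le_Cmod _). right; reflexivity. }
  destruct (Hc f (K + B * r)) as [F1 F2]. nra.
  { intros h Hh. apply (qd_at_increment f d (x, y) r B K); auto. intros; apply HKb; auto. rewrite Cmod_0_sub; lra. }
  destruct (Hc d (2 * B)) as [F3 _]. lra. { intros h Hh. apply (qd_at_d_lip f d (x, y) r B); auto. }
  auto.
Qed.

(** Cauchy's theorem on a rectangle, in differentiated form: the derivative in [x] of the vertical
    integral of [Re H] is, by Cauchy-Riemann, the integral of the [t]-derivative of [Im H], so only
    the values at the two ends contribute. *)
Lemma contour_shift (H D : C -> C) c a b L M : c < a -> a <= b -> 0 <= L -> qd (fun s => c < Re s) H D ->
  (forall x, a <= x <= b -> Cmod (H (x, L)) <= M /\ Cmod (H (x, - L)) <= M) ->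
  Rabs (RInt (fun t => Re (H (b, t))) (- L) L - RInt (fun t => Re (H (a, t))) (- L) L) <= 2 * M * (b - a).
Proof.
  intros Hca Hab HL Hq HM.
  assert (C2 : forall x t, c < x -> continuity_2d_pt (fun x t => Re (H (x, t))) x t) by (intros; apply (qd_cont2 (fun s => c < Re s) H D); auto).
  assert (D2 : forall x t, c < x -> continuity_2d_pt (fun x t => Re (D (x, t))) x t) by (intros; apply (qd_cont2 (fun s => c < Re s) H D); auto).
  assert (Dx : forall x t, c < x -> is_derive (fun x => Re (H (x, t))) x (Re (D (x, t)))) by (intros; apply (qd_partial_re (fun s => c < Re s) H D); auto).
  assert (Dt : forall x t, c < x -> is_derive (fun t => Im (H (x, t))) t (Re (D (x, t)))) by (intros; apply (qd_partial_im (fun s => c < Re s) H D); auto).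
  set (J := fun x => RInt (fun t => Re (H (x, t))) (- L) L).
  assert (DJ : forall x, a <= x <= b -> is_derive J x (Im (H (x, L)) - Im (H (x, - L)))).
  { intros x Hx. replace (Im (H (x, L)) - Im (H (x, - L))) with (RInt (fun t => Derive (fun x => Re (H (x, t))) x) (- L) L).
    assert (Hloc : 0 < x - c) by lra.
    assert (Hnb : forall z, ball x (mkposreal _ Hloc) z -> c < z). { intros z Hz. change (Rabs (z - x) < x - c) in Hz. apply Rabs_def2 in Hz. lra. }
    apply (is_derive_RInt_param (fun x t => Re (H (x, t)))).
    - exists (mkposreal _ Hloc). intros z Hz t _. eexists. apply Dx. auto.
    - intros t _. apply continuity_2d_pt_ext_loc with (fun x t => Re (D (x, t))).
      exists (mkposreal _ Hloc). intros u v Hu _. symmetry. apply is_derive_unique, Dx. apply Hnb. exact Hu. apply D2. lra.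
    - exists (mkposreal _ Hloc). intros z Hz. apply ex_RInt_cont. intros t. apply (cont2_slice_r (fun x t => Re (H (x, t)))). apply C2. auto.
    - rewrite (RInt_ext (V:=R_CompleteNormedModule) _ (fun t => Re (D (x, t)))).
      + apply (RInt_FTC (fun t => Im (H (x, t)))); [lra| |]. intros; apply Dt; lra. intros; apply (cont2_slice_r (fun x t => Re (D (x, t)))), D2; lra.
      + intros t _. apply is_derive_unique, Dx. lra. }
  assert (Bd : forall x, a <= x <= b -> Rabs (Im (H (x, L)) - Im (H (x, - L))) <= 2 * M).
  { intros x Hx. destruct (HM x Hx) as [M1 M2]. assert (I1 := Im_le_Cmod (H (x, L))). assert (I2 := Im_le_Cmod (H (x, - L))).
    apply Rabs_le_between in I1. apply Rabs_le_between in I2. apply Rabs_le. lra. }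
  change (Rabs (J b - J a) <= 2 * M * (b - a)). apply Rabs_le. split.
  - assert (K := derive_upper (fun x => - J x) (fun x => - (Im (H (x, L)) - Im (H (x, - L)))) a b (2 * M) Hab).
    cut (- J b - - J a <= 2 * M * (b - a)); [lra|]. apply K. intros; apply (is_derive_opp J); auto.
    intros x Hx. specialize (Bd x Hx). apply Rabs_le_between in Bd. lra.
  - apply (derive_upper J (fun x => Im (H (x, L)) - Im (H (x, - L)))); auto. intros x Hx. specialize (Bd x Hx). apply Rabs_le_between in Bd. lra.
Qed.

(** * Complex-valued functions of a real variable *)

(** [exp (- s * y)], that is [nu^(-s)] for [nu = exp y]. *)
Definition ey (s : C) (y : R) : C := cexp (RtoC y * (- s)).

Lemma ey_Cmod s y : Cmod (ey s y) = exp (- Re s * y).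
Proof. unfold ey. rewrite Cmod_cexp. f_equal. destruct s as [a b]. unfold Cmult, Copp, RtoC, Re; simpl. ring. Qed.
Lemma ey_plus_s s h y : ey (s + h)%C y = (ey s y * ey h y)%C.
Proof. unfold ey. rewrite <- cexp_plus. f_equal. ring. Qed.
Lemma ey_plus_y s a b : ey s (a + b) = (ey s a * ey s b)%C.
Proof. unfold ey. rewrite <- cexp_plus. f_equal. rewrite RtoC_plus. ring. Qed.
Lemma ey_0 s : ey s 0 = RtoC 1.
Proof. unfold ey. rewrite Cmult_0_l. apply cexp_0. Qed.
Lemma ey_Re s y : Re (ey s y) = hh (Re s) y (Im s).
Proof. destruct s as [a b]. unfold ey, cexp, hh, Cmult, Copp, RtoC, Re, Im; simpl. rewrite Rmult_0_l, Rminus_0_r. rewrite <- (cos_neg (b * y)). f_equal; f_equal; ring. Qed.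

Definition cder (f : R -> C) (x : R) (l : C) : Prop := is_derive (fun x => Re (f x)) x (Re l) /\ is_derive (fun x => Im (f x)) x (Im l).

Lemma cder_plus f g x l m : cder f x l -> cder g x m -> cder (fun x => f x + g x)%C x (l + m)%C.
Proof.
  intros [H1 H2] [K1 K2]. split.
  - apply (is_derive_plus (K:=R_AbsRing) (V:=R_NormedModule) (fun x => Re (f x)) (fun x => Re (g x))); auto.
  - apply (is_derive_plus (K:=R_AbsRing) (V:=R_NormedModule) (fun x => Im (f x)) (fun x => Im (g x))); auto.
Qed.
Lemma cder_const c x : cder (fun _ => c) x 0%C.
Proof. split; apply (is_derive_const (K:=R_AbsRing) (V:=R_NormedModule)). Qed.
Lemma cder_id x : cder (fun x => RtoC x) x 1%C.
Proof. split; unfold RtoC, Re, Im; simpl. apply (is_derive_id (K:=R_AbsRing)). apply (is_derive_const (K:=R_AbsRing) (V:=R_NormedModule)). Qed.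
Lemma is_derive_exp_trig (a b : R -> R) x la lb : is_derive a x la -> is_derive b x lb ->
  is_derive (fun x => exp (a x) * cos (b x)) x (la * (exp (a x) * cos (b x)) - lb * (exp (a x) * sin (b x))) /\
  is_derive (fun x => exp (a x) * sin (b x)) x (la * (exp (a x) * sin (b x)) + lb * (exp (a x) * cos (b x))).
Proof.
  intros H1 H2. assert (A1 : ex_derive a x) by (eexists; eauto). assert (A2 : ex_derive b x) by (eexists; eauto).
  apply is_derive_unique in H1, H2.
  change (Derive (fun x => a x) x = la) in H1. change (Derive (fun x => b x) x = lb) in H2. split; auto_derive; auto; rewrite H1, H2; ring.
Qed.
Lemma is_derive_bilinear (a b c d : R -> R) x la lb lc ld : is_derive a x la -> is_derive b x lb -> is_derive c x lc -> is_derive d x ld ->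
  is_derive (fun x => a x * c x - b x * d x) x (la * c x + a x * lc - (lb * d x + b x * ld)) /\
  is_derive (fun x => a x * d x + b x * c x) x (la * d x + a x * ld + (lb * c x + b x * lc)).
Proof.
  intros H1 H2 H3 H4. assert (A1 : ex_derive a x) by (eexists; eauto). assert (A2 : ex_derive b x) by (eexists; eauto).
  assert (A3 : ex_derive c x) by (eexists; eauto). assert (A4 : ex_derive d x) by (eexists; eauto).
  apply is_derive_unique in H1, H2, H3, H4.
  change (Derive (fun x => a x) x = la) in H1. change (Derive (fun x => b x) x = lb) in H2.
  change (Derive (fun x => c x) x = lc) in H3. change (Derive (fun x => d x) x = ld) in H4. split; auto_derive; auto; rewrite H1, H2, H3, H4; ring.
Qed.
Lemma cder_mult f g x l m : cder f x l -> cder g x m -> cder (fun x => f x * g x)%C x (l * g x + f x * m)%C.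
Proof.
  intros [H1 H2] [K1 K2]. destruct (is_derive_bilinear _ _ _ _ _ _ _ _ _ H1 H2 K1 K2) as [B1 B2]. split.
  - replace (Re (l * g x + f x * m)%C) with (Re l * Re (g x) + Re (f x) * Re m - (Im l * Im (g x) + Im (f x) * Im m)) by (unfold Cplus, Cmult, Re, Im; simpl; ring). exact B1.
  - replace (Im (l * g x + f x * m)%C) with (Re l * Im (g x) + Re (f x) * Im m + (Im l * Re (g x) + Im (f x) * Re m)) by (unfold Cplus, Cmult, Re, Im; simpl; ring). exact B2.
Qed.
Lemma cder_scal c f x l : cder f x l -> cder (fun x => c * f x)%C x (c * l)%C.
Proof. intros H. replace (c * l)%C with (0 * f x + c * l)%C by ring. apply (cder_mult (fun _ => c) f); auto. apply cder_const. Qed.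
Lemma cder_cexp f x l : cder f x l -> cder (fun x => cexp (f x)) x (l * cexp (f x))%C.
Proof. intros [H1 H2]. exact (is_derive_exp_trig _ _ _ _ _ H1 H2). Qed.
Lemma cder_ey s y : cder (ey s) y (- s * ey s y)%C.
Proof. apply (cexp_line_derive (- s)%C y). Qed.
Lemma cder_mean_value f df a b M : a <= b -> (forall x, a <= x <= b -> cder f x (df x)) -> (forall x, a <= x <= b -> Cmod (df x) <= M) -> Cmod (f b - f a) <= M * (b - a).
Proof. intros Hab H HM. apply (complex_mean_value f df); auto; intros; apply H; auto. Qed.

Definition ccont (f : R -> C) : Prop := (forall x, continuous (fun x => Re (f x)) x) /\ (forall x, continuous (fun x => Im (f x)) x).
Lemma cder_ccont f df : (forall x, cder f x (df x)) -> ccont f.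
Proof.
  intros H. split; intros x; destruct (H x) as [H1 H2].
  apply (ex_derive_continuous (fun x => Re (f x))). eexists; apply H1. apply (ex_derive_continuous (fun x => Im (f x))). eexists; apply H2.
Qed.
Lemma ccont_scal c f : ccont f -> ccont (fun x => c * f x)%C.
Proof.
  intros [H1 H2]. split; intros x.
  - apply continuous_ext with (fun x => Re c * Re (f x) - Im c * Im (f x)). intros; reflexivity. cont_tac.
  - apply continuous_ext with (fun x => Re c * Im (f x) + Im c * Re (f x)). intros; reflexivity. cont_tac.
Qed.
Lemma ccont_plus f g : ccont f -> ccont g -> ccont (fun x => f x + g x)%C.
Proof.
  intros [H1 H2] [K1 K2]. split; intros x.
  - apply continuous_ext with (fun x => Re (f x) + Re (g x)). intros; reflexivity. cont_tac.
  - apply continuous_ext with (fun x => Im (f x) + Im (g x)). intros; reflexivity. cont_tac.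
Qed.
Lemma ccont_multR f (g : R -> R) : ccont f -> (forall x, continuous g x) -> ccont (fun x => f x * RtoC (g x))%C.
Proof.
  intros [H1 H2] K. split; intros x.
  - apply continuous_ext with (fun x => Re (f x) * g x). intros; unfold Cmult, RtoC, Re, Im; simpl; ring. cont_tac.
  - apply continuous_ext with (fun x => Im (f x) * g x). intros; unfold Cmult, RtoC, Re, Im; simpl; ring. cont_tac.
Qed.
Lemma ccont_const c : ccont (fun _ => c).
Proof. split; intros; apply continuous_const. Qed.

Definition cint (f : R -> C) (a b : R) : C := (RInt (fun y => Re (f y)) a b, RInt (fun y => Im (f y)) a b).

Lemma cint_plus f g a b : ccont f -> ccont g -> cint (fun y => f y + g y)%C a b = (cint f a b + cint g a b)%C.
Proof.
  intros [H1 H2] [K1 K2]. unfold cint, Cplus; simpl. f_equal.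
  - apply (RInt_Rplus (fun y => Re (f y)) (fun y => Re (g y))); apply ex_RInt_cont; auto.
  - apply (RInt_Rplus (fun y => Im (f y)) (fun y => Im (g y))); apply ex_RInt_cont; auto.
Qed.
Lemma cint_scal c f a b : ccont f -> cint (fun y => c * f y)%C a b = (c * cint f a b)%C.
Proof.
  intros [H1 H2]. unfold cint, Cmult; simpl. f_equal.
  - transitivity (RInt (fun y => Re c * Re (f y) - Im c * Im (f y)) a b). reflexivity.
    rewrite RInt_Rminus, 2 RInt_Rscal by (apply ex_RInt_cont; intros; cont_tac). reflexivity.
  - transitivity (RInt (fun y => Re c * Im (f y) + Im c * Re (f y)) a b). reflexivity.
    rewrite RInt_Rplus, 2 RInt_Rscal by (apply ex_RInt_cont; intros; cont_tac). reflexivity.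
Qed.
Lemma cint_ext f g a b : (forall y, Rmin a b < y < Rmax a b -> f y = g y) -> cint f a b = cint g a b.
Proof. intros H. unfold cint. f_equal; apply RInt_ext; intros; rewrite H; auto. Qed.
Lemma cint_cat f a b c : ccont f -> (cint f a b + cint f b c)%C = cint f a c.
Proof. intros [H1 H2]. unfold cint, Cplus; simpl. f_equal; apply (RInt_cat (fun y => _ (f y))); apply ex_RInt_cont; auto. Qed.

Lemma cint_bound f g a b : a <= b -> ccont f -> (forall x, continuous g x) -> (forall x, a <= x <= b -> Cmod (f x) <= g x) -> Cmod (cint f a b) <= RInt g a b.
Proof.
  intros Hab [H1 H2] Hg H. set (w := cint f a b).
  assert (E : Cmod w ^ 2 = RInt (fun y => Re w * Re (f y) + Im w * Im (f y)) a b).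
  { rewrite RInt_Rplus, 2 RInt_Rscal by (apply ex_RInt_cont; intros; cont_tac). rewrite Cmod2_alt. unfold w at 1 3; unfold cint; simpl. fold w. unfold w, cint, Re, Im; simpl. ring. }
  assert (CS : forall u v : C, Re u * Re v + Im u * Im v <= Cmod u * Cmod v).
  { intros u v. apply Rsqr_incr_0_var; [|apply Rmult_le_pos; apply Cmod_ge_0]. unfold Rsqr.
    replace (Cmod u * Cmod v * (Cmod u * Cmod v)) with (Cmod u ^ 2 * Cmod v ^ 2) by ring. rewrite 2 Cmod2_alt.
    assert (0 <= (Re u * Im v - Im u * Re v) ^ 2) by apply pow2_ge_0. nra. }
  assert (P := Cmod_ge_0 w).
  assert (K : RInt (fun y => Re w * Re (f y) + Im w * Im (f y)) a b <= RInt (fun y => Cmod w * g y) a b).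
  { apply RInt_le_cont; auto; intros; cont_tac. apply Rle_trans with (1 := CS w (f x)). apply Rmult_le_compat_l; auto. apply H; lra. }
  rewrite <- E, RInt_Rscal in K by (apply ex_RInt_cont; auto).
  assert (G0 : 0 <= RInt g a b). { apply RInt_nonneg; auto. intros x Hx. apply Rle_trans with (2 := H x ltac:(lra)). apply Cmod_ge_0. }
  destruct (Rle_lt_or_eq_dec _ _ P) as [Q|Q]; [|lra]. apply Rmult_le_reg_l with (Cmod w); auto. nra.
Qed.

Lemma cint_FTC F f a b : a <= b -> (forall x, cder F x (f x)) -> ccont f -> cint f a b = (F b - F a)%C.
Proof.
  intros Hab HF [H1 H2]. unfold cint. rewrite (RInt_FTC (fun y => Re (F y)) (fun y => Re (f y))), (RInt_FTC (fun y => Im (F y)) (fun y => Im (f y))); auto; try (intros; apply HF).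
Qed.

(** * Prime terms with their means removed *)

Definition TF (lam : nat -> R) (n : nat) (f : R -> C) : C := (f (lam n) - cint (fun y => f y * RtoC (om y)) (Y n) (Y (S n)))%C.

(** As the interval has unit mass, the difference is the mean of [f (lam n) - f y], bounded by the
    derivative times the length of the interval. *)
Lemma TF_bound lam n f df M : good lam -> (forall x, cder f x (df x)) -> (forall y, Y n <= y <= Y (S n) -> Cmod (df y) <= M) -> Cmod (TF lam n f) <= M * exp (- (Y n / 2)).
Proof.
  intros G Hd HM. assert (CF := cder_ccont f df Hd). assert (HL := Y_lt n). assert (Hl := proj1 G n). set (l := lam n) in *.
  assert (HM0 : 0 <= M). { apply Rle_trans with (2 := HM l Hl). apply Cmod_ge_0. }
  replace (TF lam n f) with (cint (fun y => (f l + (-1) * f y) * RtoC (om y))%C (Y n) (Y (S n))).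
  - apply Rle_trans with (RInt (fun y => M * exp (- (Y n / 2)) * om y) (Y n) (Y (S n))).
    + apply cint_bound; [lra| | |].
      * apply ccont_multR; [|apply om_continuous]. apply ccont_plus. apply ccont_const. apply ccont_scal; auto.
      * intros. assert (X := om_continuous). cont_tac.
      * intros y Hy. rewrite Cmod_mult, Cmod_R, Rabs_pos_eq by (apply Rlt_le, om_pos). apply Rmult_le_compat_r. apply Rlt_le, om_pos.
        replace (f l + -1 * f y)%C with (f l - f y)%C by ring.
        assert (Gp := Y_gap n). assert (Hd2 : Rabs (l - y) <= exp (- (Y n / 2))) by (apply Rabs_le; lra).
        apply Rle_trans with (M * Rabs (l - y)); [|apply Rmult_le_compat_l; auto].
        destruct (Rle_dec y l).
        { rewrite Rabs_pos_eq by lra. apply (cder_mean_value f df); auto. intros; apply HM; lra. }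
        { rewrite Cmod_sub_sym, Rabs_left1 by lra. replace (- (l - y)) with (y - l) by ring. apply (cder_mean_value f df); auto; [lra|]. intros; apply HM; lra. }
    + rewrite RInt_Rscal by (apply ex_RInt_cont, om_continuous). rewrite Y_mass. lra.
  - unfold TF. fold l.
    rewrite (cint_ext _ (fun y => f l * RtoC (om y) + (-1) * (f y * RtoC (om y)))%C) by (intros; ring).
    assert (Co : ccont (fun y => RtoC (om y))). { split; intros. apply om_continuous. apply continuous_const. }
    rewrite cint_plus, 2 cint_scal; auto using ccont_scal, ccont_multR, om_continuous.
    replace (cint (fun y => RtoC (om y)) (Y n) (Y (S n))) with (RtoC 1). ring.
    unfold cint, RtoC, Re, Im; simpl. rewrite Y_mass, RInt_Rconst. f_equal. ring.
Qed.

Lemma TF_plus lam n f g : ccont f -> ccont g -> TF lam n (fun y => f y + g y)%C = (TF lam n f + TF lam n g)%C.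
Proof.
  intros Hf Hg. unfold TF. rewrite (cint_ext _ (fun y => f y * RtoC (om y) + g y * RtoC (om y))%C) by (intros; ring).
  rewrite cint_plus by (apply ccont_multR; auto; apply om_continuous). ring.
Qed.
Lemma TF_scal lam n c f : ccont f -> TF lam n (fun y => c * f y)%C = (c * TF lam n f)%C.
Proof.
  intros Hf. unfold TF. rewrite (cint_ext _ (fun y => c * (f y * RtoC (om y)))%C) by (intros; ring).
  rewrite cint_scal by (apply ccont_multR; auto; apply om_continuous). ring.
Qed.
Definition eterm (lam : nat -> R) (n : nat) (s : C) : C := TF lam n (ey s).
Definition eterm' (lam : nat -> R) (n : nat) (s : C) : C := TF lam n (fun y => (-1) * (RtoC y * ey s y))%C.

Lemma ccont_ey s : ccont (ey s).
Proof. apply (cder_ccont _ _ (cder_ey s)). Qed.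
Lemma cder_yey s y : cder (fun y => RtoC y * ey s y)%C y (ey s y + RtoC y * (- s * ey s y))%C.
Proof. replace (ey s y + RtoC y * (- s * ey s y))%C with (1 * ey s y + RtoC y * (- s * ey s y))%C by ring. apply (cder_mult (fun y => RtoC y) (ey s)). apply cder_id. apply cder_ey. Qed.

Lemma eterm_bound lam n s : good lam -> 0 <= Re s -> Cmod (eterm lam n s) <= Cmod s * exp (- Re s * Y n) * exp (- (Y n / 2)).
Proof.
  intros G Hs. apply (TF_bound lam n (ey s) (fun y => - s * ey s y)%C); auto. apply cder_ey.
  intros y Hy. rewrite Cmod_mult, Cmod_opp, ey_Cmod. apply Rmult_le_compat_l. apply Cmod_ge_0. apply exp_le_compat. nra.
Qed.

Lemma remainder_bound s h y : 0 <= y -> Cmod (ey h y - 1 + h * RtoC y) <= Cmod h ^ 2 * y ^ 2 * exp (Cmod h * y) /\ Cmod (ey h y - 1) <= Cmod h * y * exp (Cmod h * y) /\ Cmod (ey s y) = exp (- Re s * y).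
Proof.
  intros Hy. assert (E : Cmod (RtoC y * (- h)) = Cmod h * y) by (rewrite Cmod_scalR, Cmod_opp, Rabs_pos_eq; [ring|auto]).
  split; [|split; [|apply ey_Cmod]].
  - assert (K := cexp_sub2 (RtoC y * (- h))). rewrite E in K. unfold ey. replace (cexp (RtoC y * - h) - 1 + h * RtoC y)%C with (cexp (RtoC y * - h) - 1 - RtoC y * - h)%C by ring.
    apply Rle_trans with (1 := K). right; ring.
  - assert (K := cexp_sub1 (RtoC y * (- h))). rewrite E in K. exact K.
Qed.

(** By linearity the remainder in [s] is [TF] of one function of [y]. Its [y]-derivative regroups
    into terms containing [ey h y - 1 + h * y] and [h * (ey h y - 1)], both of second order in
    [h]. *)
Lemma eterm_qd lam n s h K sp : good lam -> Cmod s <= K -> sp <= Re s - Cmod h -> 0 <= sp ->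
  Cmod (eterm lam n (s + h)%C - eterm lam n s - h * eterm' lam n s) <= (K + 1) * (Y n + 2) ^ 2 * exp (- sp * Y n) * exp (- (Y n / 2)) * Cmod h ^ 2.
Proof.
  intros G HK Hsp Hsp0. set (rho := fun y => (ey (s + h)%C y + ((-1) * ey s y + h * (RtoC y * ey s y)))%C).
  replace (eterm lam n (s + h)%C - eterm lam n s - h * eterm' lam n s)%C with (TF lam n rho).
  - set (drho := fun y => (- (s + h) * ey (s + h)%C y + ((-1) * (- s * ey s y) + h * (ey s y + RtoC y * (- s * ey s y))))%C).
    assert (HD : forall y, cder rho y (drho y)).
    { intros y. apply cder_plus. apply cder_ey. apply cder_plus. apply cder_scal, cder_ey. apply (cder_scal h (fun y => RtoC y * ey s y)%C). apply cder_yey. }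
    assert (Yn := Y_nonneg n). assert (Hg := Y_gap1 n).
    apply Rle_trans with ((Cmod h ^ 2 * ((K + 1) * (Y n + 2) ^ 2) * exp (- sp * Y n)) * exp (- (Y n / 2))); [|right; ring].
    apply (TF_bound lam n rho drho); auto.
    intros y Hy. unfold drho. rewrite ey_plus_s.
    replace (- (s + h) * (ey s y * ey h y) + (-1 * (- s * ey s y) + h * (ey s y + RtoC y * (- s * ey s y))))%C with
      ((- s) * (ey s y * (ey h y - 1 + h * RtoC y)) + (- h) * (ey s y * (ey h y - 1)))%C by ring.
    destruct (remainder_bound s h y ltac:(lra)) as (R1 & R2 & R3).
    apply Rle_trans with (1 := Cmod_triangle _ _). rewrite !Cmod_mult, !Cmod_opp, R3.
    assert (Ph := Cmod_ge_0 h). assert (Ps := Cmod_ge_0 s). assert (E1 := exp_pos (- Re s * y)).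
    set (X := exp (- Re s * y) * exp (Cmod h * y)).
    assert (HX : X <= exp (- sp * Y n)). { unfold X. rewrite <- exp_plus. apply exp_le_compat. nra. }
    assert (X0 : 0 < X) by (apply Rmult_lt_0_compat; apply exp_pos).
    assert (T1 : Cmod s * (exp (- Re s * y) * Cmod (ey h y - 1 + h * RtoC y)) <= K * (Cmod h ^ 2 * (Y n + 2) ^ 2 * X)).
    { apply Rmult_le_compat; auto. apply Rmult_le_pos; [lra|apply Cmod_ge_0].
      apply Rle_trans with (exp (- Re s * y) * (Cmod h ^ 2 * y ^ 2 * exp (Cmod h * y))). apply Rmult_le_compat_l; lra.
      replace (exp (- Re s * y) * (Cmod h ^ 2 * y ^ 2 * exp (Cmod h * y))) with (Cmod h ^ 2 * y ^ 2 * X) by (unfold X; ring).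
      apply Rmult_le_compat_r; [lra|]. apply Rmult_le_compat_l. apply pow2_ge_0. apply pow_incr; lra. }
    assert (T2 : Cmod h * (exp (- Re s * y) * Cmod (ey h y - 1)) <= Cmod h ^ 2 * (Y n + 2) ^ 2 * X).
    { apply Rle_trans with (Cmod h * (exp (- Re s * y) * (Cmod h * y * exp (Cmod h * y)))). apply Rmult_le_compat_l; auto. apply Rmult_le_compat_l; lra.
      replace (Cmod h * (exp (- Re s * y) * (Cmod h * y * exp (Cmod h * y)))) with (Cmod h ^ 2 * y * X) by (unfold X; ring).
      apply Rmult_le_compat_r; [lra|]. apply Rmult_le_compat_l. apply pow2_ge_0. nra. }
    assert (Q : 0 <= Cmod h ^ 2 * (Y n + 2) ^ 2) by (apply Rmult_le_pos; apply pow2_ge_0).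
    apply Rle_trans with ((K + 1) * (Cmod h ^ 2 * (Y n + 2) ^ 2 * X)); [lra|].
    replace (Cmod h ^ 2 * ((K + 1) * (Y n + 2) ^ 2) * exp (- sp * Y n)) with ((K + 1) * (Cmod h ^ 2 * (Y n + 2) ^ 2 * exp (- sp * Y n))) by ring.
    apply Rmult_le_compat_l; [lra|]. apply Rmult_le_compat_l; auto.
  - assert (C1 := ccont_ey s). assert (C2 := ccont_ey (s + h)%C). assert (C3 : ccont (fun y => RtoC y * ey s y)%C) by (apply (cder_ccont _ _ (cder_yey s))).
    unfold rho, eterm, eterm'. rewrite TF_plus, TF_plus, !TF_scal; auto using ccont_scal, ccont_plus. ring.
Qed.

(** * Proper prime powers *)

Lemma ey_pow s l m : ey s (INR m * l) = Cpow (ey s l) m.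
Proof.
  induction m; [simpl; rewrite Rmult_0_l; apply ey_0|]. rewrite S_INR. replace ((INR m + 1) * l) with (l + INR m * l) by ring.
  rewrite ey_plus_y, IHm. reflexivity.
Qed.

(* The part of [- log (1 - exp (- l s))] coming from proper prime powers. *)
Definition pl (l : R) (s : C) : C := Csum (fun j => RtoC (/ INR (j + 2)) * ey s (INR (j + 2) * l))%C.
Definition pl' (l : R) (s : C) : C := Csum (fun j => RtoC (- l) * ey s (INR (j + 2) * l))%C.

Lemma sqrt2_inv x : 0 <= x -> x * x <= / 2 -> x <= 71 / 100.
Proof. intros. nra. Qed.

(** [71/100] is a rational above [2^(-1/2)], the largest possible modulus of a prime power term on
    [Re s >= 1/2]. *)
Lemma exp_half_bound l sp : 2 <= exp l -> / 2 <= sp -> 0 <= l -> 0 < exp (- sp * l) <= 71 / 100.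
Proof.
  intros Hl Hs Hl0. split; [apply exp_pos|]. apply Rle_trans with (exp (- / 2 * l)). apply exp_le_compat; nra.
  apply sqrt2_inv. apply Rlt_le, exp_pos. rewrite <- exp_plus. replace (- / 2 * l + - / 2 * l) with (- l) by field. rewrite exp_Ropp. apply Rinv_le_contravar; lra.
Qed.

(** Trades the linear factor for a larger ratio. The induction step needs
    [(j + 3) / (j + 2) <= 93/71], true only from [j = 2] on, hence the separate small cases. *)
Lemma geom_weight j : INR (j + 2) * (71/100) ^ j <= 7 * (93/100) ^ j.
Proof.
  induction j. simpl; lra. replace (S j + 2)%nat with (S (j + 2)) by lia. rewrite S_INR. simpl.
  assert (H : 0 < (71/100) ^ j) by (apply pow_lt; lra).
  assert (K := pos_INR j). rewrite plus_INR in *. simpl INR in *.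
  destruct (Nat.eq_dec j 0) as [->|N0]. simpl; lra.
  destruct (Nat.eq_dec j 1) as [->|N1]. simpl; lra.
  assert (2 <= INR j). { replace 2 with (INR 2) by (simpl; ring). apply le_INR. lia. }
  apply Rle_trans with (93/100 * ((INR j + 2) * (71/100)^j)). nra. nra.
Qed.

Lemma pl_term_bound l s j : 2 <= exp l -> 0 <= l -> / 2 <= Re s ->
  Cmod (RtoC (/ INR (j + 2)) * ey s (INR (j + 2) * l)) <= exp (- 2 * Re s * l) * (71/100) ^ j.
Proof.
  intros Hl Hl0 Hs. rewrite Cmod_mult, Cmod_R, ey_Cmod. assert (Hj : 1 <= INR (j + 2)) by (rewrite plus_INR; simpl; assert (K := pos_INR j); lra).
  rewrite Rabs_pos_eq by (apply Rlt_le, Rinv_0_lt_compat; lra).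
  replace (- Re s * (INR (j + 2) * l)) with (- 2 * Re s * l + (- Re s * l) * INR j) by (rewrite plus_INR; simpl; ring).
  rewrite exp_plus, exp_pow. destruct (exp_half_bound l (Re s) Hl Hs Hl0) as [X1 X2].
  assert (P := exp_pos (- 2 * Re s * l)). assert (Q : exp (- Re s * l) ^ j <= (71/100) ^ j) by (apply pow_incr; lra).
  assert (Q0 : 0 <= exp (- Re s * l) ^ j) by (apply pow_le; lra).
  assert (/ INR (j + 2) <= 1) by (rewrite <- Rinv_1; apply Rinv_le_contravar; lra). assert (0 < / INR (j + 2)) by (apply Rinv_0_lt_compat; lra).
  rewrite <- (Rmult_1_l (exp _ * (71/100)^j)). apply Rmult_le_compat; try lra. nra. apply Rmult_le_compat_l; lra.
Qed.

Lemma pl_majorant l s n : psum (fun j => exp (- 2 * Re s * l) * (71/100) ^ j) n <= 4 * exp (- 2 * Re s * l).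
Proof.
  rewrite psum_scal. assert (P := exp_pos (- 2 * Re s * l)). assert (K := psum_geom_le (71/100) n ltac:(lra)). replace (/ (1 - 71/100)) with (100/29) in K by field. change (psum (pow (71/100)) n <= 100/29) in K. rewrite (Rmult_comm 4). apply Rmult_le_compat_l; [lra|]. lra.
Qed.

Lemma pl_bound l s : 2 <= exp l -> 0 <= l -> / 2 <= Re s -> Cmod (pl l s) <= 4 * exp (- 2 * Re s * l).
Proof.
  intros Hl Hl0 Hs. apply (Csum_bound _ (fun j => exp (- 2 * Re s * l) * (71/100) ^ j)). intros; apply pl_term_bound; auto. intros; apply pl_majorant.
Qed.

Lemma Re_minus_Cmod s s0 : Re s0 - Cmod (s - s0) <= Re s.
Proof. assert (H := re_le_Cmod (s - s0)). apply Rabs_le_between in H. replace (Re (s - s0)%C) with (Re s - Re s0) in H by reflexivity. lra. Qed.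

Lemma pl_qd l s0 r sp : 2 <= exp l -> 0 <= l -> 0 < r -> / 2 <= sp -> sp <= Re s0 - 2 * r -> qd_at (pl l) (pl' l) s0 r (100 * l ^ 2 * exp (- 2 * sp * l)).
Proof.
  intros Hl Hl0 Hr Hsp Hs0. destruct (exp_half_bound l sp Hl Hsp Hl0) as [X1 X2]. set (x := exp (- sp * l)) in *.
  assert (P := exp_pos (- 2 * sp * l)).
  apply (qd_series (fun j s => RtoC (/ INR (j + 2)) * ey s (INR (j + 2) * l))%C (fun j s => RtoC (- l) * ey s (INR (j + 2) * l))%C s0 r
    (* The second order remainder of the term of index [m = j + 2] is [m^2 l^2] times its
       coefficient [1/m]; the linear weight that is left is summed by [geom_weight], and
       [7 * 100/7 = 100]. *)
    (fun j => exp (- 2 * sp * l) * (71/100) ^ j) (fun j => l ^ 2 * exp (- 2 * sp * l) * (7 * (93/100) ^ j)) (4 * exp (- 2 * sp * l)) (100 * l ^ 2 * exp (- 2 * sp * l))); auto.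
  - intros j s h Hs Hh. set (m := INR (j + 2)). assert (Hj : 1 <= m) by (unfold m; rewrite plus_INR; simpl; assert (K := pos_INR j); lra).
    assert (Hml : 0 <= m * l) by nra.
    rewrite ey_plus_s. replace (RtoC (/ m) * (ey s (m * l) * ey h (m * l)) - RtoC (/ m) * ey s (m * l) - h * (RtoC (- l) * ey s (m * l)))%C with
      (RtoC (/ m) * ey s (m * l) * (ey h (m * l) - 1 + h * RtoC (m * l)))%C.
    2:{ rewrite RtoC_mult, RtoC_inv, RtoC_opp by lra. field. intros E. apply RtoC_inj in E. lra. }
    destruct (remainder_bound s h (m * l) Hml) as (R1 & _ & R3). rewrite 2 Cmod_mult, R3, Cmod_R, (Rabs_pos_eq (/ m)) by (apply Rlt_le, Rinv_0_lt_compat; lra).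
    assert (Hi : 0 < / m) by (apply Rinv_0_lt_compat; lra). assert (E1 := exp_pos (- Re s * (m * l))).
    apply Rle_trans with (/ m * exp (- Re s * (m * l)) * (Cmod h ^ 2 * (m * l) ^ 2 * exp (Cmod h * (m * l)))).
    { apply Rmult_le_compat_l; auto. apply Rmult_le_pos; lra. }
    replace (/ m * exp (- Re s * (m * l)) * (Cmod h ^ 2 * (m * l) ^ 2 * exp (Cmod h * (m * l)))) with (l ^ 2 * (m * (exp (- Re s * (m * l)) * exp (Cmod h * (m * l)))) * Cmod h ^ 2) by (field; lra).
    rewrite <- exp_plus. apply Rmult_le_compat_r. apply pow2_ge_0. rewrite Rmult_assoc. apply Rmult_le_compat_l. apply pow2_ge_0.
    assert (Hre := Re_minus_Cmod s s0).
    apply Rle_trans with (m * (exp (- 2 * sp * l) * x ^ j)).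
    { apply Rmult_le_compat_l; [lra|]. unfold x. rewrite <- exp_pow, <- exp_plus. apply exp_le_compat.
      assert (sp * (m * l) <= (Re s - Cmod h) * (m * l)) by (apply Rmult_le_compat_r; lra).
      replace (-2 * sp * l + - sp * l * INR j) with (- (sp * (m * l))) by (unfold m; rewrite plus_INR; simpl; ring). lra. }
    rewrite <- Rmult_assoc, (Rmult_comm m), Rmult_assoc. apply Rmult_le_compat_l; [lra|].
    apply Rle_trans with (2 := geom_weight j). fold m. apply Rmult_le_compat_l; [lra|]. apply pow_incr; lra.
  - intros j s Hs. assert (Hre := Re_minus_Cmod s s0). apply Rle_trans with (1 := pl_term_bound l s j Hl Hl0 ltac:(lra)).
    apply Rmult_le_compat_r. apply pow_le; lra. apply exp_le_compat. nra.
  - intros n. rewrite psum_scal. assert (K := psum_geom_le (71/100) n ltac:(lra)). replace (/ (1 - 71/100)) with (100/29) in K by field. change (psum (pow (71/100)) n <= 100/29) in K. rewrite (Rmult_comm 4). apply Rmult_le_compat_l; lra.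
  - intros n. rewrite psum_scal, psum_scal. assert (K := psum_geom_le (93/100) n ltac:(lra)). replace (/ (1 - 93/100)) with (100/7) in K by field. change (psum (pow (93/100)) n <= 100/7) in K. assert (K0 : 0 <= psum (pow (93/100)) n) by (apply psum_nonneg; intros; apply pow_le; lra).
    assert (0 <= l ^ 2 * exp (-2 * sp * l)) by (apply Rmult_le_pos; [apply pow2_ge_0|lra]).
    replace (100 * l ^ 2 * exp (-2 * sp * l)) with (l ^ 2 * exp (-2 * sp * l) * 100) by ring. apply Rmult_le_compat_l; auto. lra.
Qed.

(** * The logarithm of the normalised zeta function *)

Definition wterm (lam : nat -> R) (n : nat) (s : C) : C := (eterm lam n s + pl (lam n) s)%C.
Definition wterm' (lam : nat -> R) (n : nat) (s : C) : C := (eterm' lam n s + pl' (lam n) s)%C.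
Definition Linit (a b : R) (s : C) : C := cint (fun y => ey s y * RtoC (om y))%C a b.
Definition Linit' (a b : R) (s : C) : C := cint (fun y => (-1) * (RtoC y * ey s y) * RtoC (om y))%C a b.
(* [exp (W s) = zeta s * (s - 1) / s]: the initial integral and the subtracted means add up to [log (s / (s - 1))]. *)
Definition W (lam : nat -> R) (s : C) : C := ((-1) * Linit 0 (Y 0) s + Csum (fun n => wterm lam n s))%C.
Definition W' (lam : nat -> R) (s : C) : C := ((-1) * Linit' 0 (Y 0) s + Csum (fun n => wterm' lam n s))%C.

Lemma good_exp2 lam n : good lam -> 2 <= exp (lam n).
Proof. intros G. assert (H := lam_lower lam G n). assert (K := pos_INR n). lra. Qed.

Lemma poly_exp eta y : 0 < eta -> 0 <= y -> (y + 2) ^ 2 <= (2 / eta + 2) ^ 2 * exp (eta * y).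
Proof.
  intros He Hy. assert (H := exp_ineq1_le (eta / 2 * y)). replace (eta * y) with (eta / 2 * y + eta / 2 * y) by field. rewrite exp_plus.
  assert (Q : 0 < 2 / eta) by (apply Rdiv_lt_0_compat; lra). assert (E := exp_pos (eta / 2 * y)).
  assert (K : y + 2 <= (2 / eta + 2) * exp (eta / 2 * y)).
  { assert (2 / eta * (1 + eta / 2 * y) <= 2 / eta * exp (eta / 2 * y)) by (apply Rmult_le_compat_l; lra). replace (2 / eta * (1 + eta / 2 * y)) with (2 / eta + y) in H0 by (field; lra).
    assert (0 <= eta / 2 * y) by nra. nra. }
  replace ((2 / eta + 2) ^ 2 * (exp (eta / 2 * y) * exp (eta / 2 * y))) with (((2 / eta + 2) * exp (eta / 2 * y)) ^ 2) by ring. apply pow_incr. lra.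
Qed.

(** The exponent [Re s + 1/2] exceeds 1 exactly when [Re s > 1/2], so [psum_exp_Y] gives absolute
    convergence there. The factor [|s|] limits the resulting bound on [W] to linear growth. *)
Lemma wterm_bound lam n s : good lam -> / 2 <= Re s -> Cmod (wterm lam n s) <= (Cmod s + 4) * exp (- (Re s + / 2) * Y n).
Proof.
  intros G Hs. unfold wterm. apply Rle_trans with (1 := Cmod_triangle _ _). rewrite Rmult_plus_distr_r. apply Rplus_le_compat.
  - apply Rle_trans with (1 := eterm_bound lam n s G ltac:(lra)). rewrite Rmult_assoc, <- exp_plus. apply Rmult_le_compat_l. apply Cmod_ge_0. apply exp_le_compat. lra.
  - assert (L0 := Rlt_le _ _ (lam_pos lam G n)). apply Rle_trans with (1 := pl_bound (lam n) s (good_exp2 lam n G) L0 Hs). apply Rmult_le_compat_l; [lra|]. apply exp_le_compat.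
    assert (H := proj1 G n). assert (Y0 := Y_nonneg n). nra.
Qed.

Lemma wterm_qd lam s0 : good lam -> / 2 < Re s0 -> exists r B, 0 < r /\ 2 * r <= Re s0 - / 2 /\ (forall n, 0 <= B n) /\ (forall n, qd_at (wterm lam n) (wterm' lam n) s0 r (B n)) /\ exists SB, forall n, psum B n <= SB.
Proof.
  (* The margin [g] is spent in portions: on the radius, on the real part lost in the disc ([sp]),
     and on the polynomial factors ([eta]). A rate [1 + g / 4], still above 1, remains. *)
  intros G Hs0. set (g := Re s0 - / 2). set (r := g / 4). set (sp := / 2 + g / 2). set (eta := g / 4).
  set (K := Cmod s0 + r). set (KK := (2 / eta + 2) ^ 2). set (c := (K + 1) * KK + 100 * KK).
  assert (Hg : 0 < g) by (unfold g; lra). assert (HK : 0 <= K) by (unfold K, r; assert (X := Cmod_ge_0 s0); lra).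
  assert (HKK : 0 <= KK) by apply pow2_ge_0. assert (Hc : 0 <= c) by (unfold c; nra).
  exists r, (fun n => c * exp (- (1 + g / 4) * Y n)). split; [unfold r; lra|]. split; [unfold r; lra|].
  split. { intros n. apply Rmult_le_pos; auto. apply Rlt_le, exp_pos. }
  split.
  - intros n s h Hs Hh. assert (Hre := Re_minus_Cmod s s0).
    assert (HsK : Cmod s <= K). { unfold K. replace s with (s0 + (s - s0))%C by ring. apply Rle_trans with (1 := Cmod_triangle _ _). lra. }
    assert (L0 := Rlt_le _ _ (lam_pos lam G n)).
    assert (Q1 := eterm_qd lam n s h K sp G HsK ltac:(unfold sp, r, g in *; lra) ltac:(unfold sp; lra)).
    assert (Q2 := pl_qd (lam n) s0 r sp (good_exp2 lam n G) L0 ltac:(unfold r; lra) ltac:(unfold sp; lra) ltac:(unfold sp, r, g; lra) s h Hs Hh).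
    unfold wterm, wterm'.
    replace (eterm lam n (s + h) + pl (lam n) (s + h) - (eterm lam n s + pl (lam n) s) - h * (eterm' lam n s + pl' (lam n) s))%C with
      ((eterm lam n (s + h) - eterm lam n s - h * eterm' lam n s) + (pl (lam n) (s + h) - pl (lam n) s - h * pl' (lam n) s))%C by ring.
    apply Rle_trans with (1 := Cmod_triangle _ _). apply Rle_trans with (1 := Rplus_le_compat _ _ _ _ Q1 Q2).
    rewrite <- Rmult_plus_distr_r. apply Rmult_le_compat_r. apply pow2_ge_0.
    unfold c. replace (((K + 1) * KK + 100 * KK) * exp (- (1 + g / 4) * Y n)) with ((K + 1) * KK * exp (- (1 + g / 4) * Y n) + 100 * KK * exp (- (1 + g / 4) * Y n)) by ring. assert (Yn := Y_nonneg n). assert (Hl := proj1 G n).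
    assert (PE := poly_exp eta (Y n) ltac:(unfold eta; lra) Yn). assert (PL := poly_exp eta (lam n) ltac:(unfold eta; lra) L0). fold KK in PE, PL.
    apply Rplus_le_compat.
    + replace ((K + 1) * KK * exp (- (1 + g / 4) * Y n)) with ((K + 1) * (KK * exp (eta * Y n)) * (exp (- sp * Y n) * exp (- (Y n / 2)))).
      * rewrite (Rmult_assoc ((K + 1) * (Y n + 2) ^ 2)). apply Rmult_le_compat_r. apply Rmult_le_pos; apply Rlt_le, exp_pos. apply Rmult_le_compat_l; lra.
      * rewrite <- exp_plus. replace ((K + 1) * (KK * exp (eta * Y n)) * exp (- sp * Y n + - (Y n / 2))) with ((K + 1) * KK * (exp (eta * Y n) * exp (- sp * Y n + - (Y n / 2)))) by ring.
        rewrite <- exp_plus. f_equal. f_equal. unfold eta, sp. field.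
    + apply Rle_trans with (100 * (KK * exp (eta * lam n)) * exp (- 2 * sp * lam n)).
      * apply Rmult_le_compat_r. apply Rlt_le, exp_pos. apply Rmult_le_compat_l; [lra|]. nra.
      * replace (100 * (KK * exp (eta * lam n)) * exp (-2 * sp * lam n)) with (100 * KK * (exp (eta * lam n) * exp (-2 * sp * lam n))) by ring. rewrite <- exp_plus.
        apply Rmult_le_compat_l; [lra|]. apply exp_le_compat. unfold eta, sp. nra.
  - destruct (psum_exp_Y (1 + g / 4) ltac:(lra)) as [C HC]. exists (c * C). intros n. rewrite psum_scal. apply Rmult_le_compat_l; auto.
Qed.

Lemma Linit_bound s : 0 <= Re s -> Cmod (Linit 0 (Y 0) s) <= 1.
Proof.
  intros Hs. assert (Y0 := Y_nonneg 0). apply Rle_trans with (RInt om 0 (Y 0)).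
  - apply cint_bound; auto. apply ccont_multR. apply ccont_ey. apply om_continuous. apply om_continuous.
    intros y Hy. rewrite Cmod_mult, ey_Cmod, Cmod_R, Rabs_pos_eq by (apply Rlt_le, om_pos). assert (O := om_pos y). assert (exp (- Re s * y) <= 1) by (apply exp_le1; nra). nra.
  - fold (Lam (Y 0)). rewrite (proj2 (Y_spec 0)). simpl; lra.
Qed.

Lemma Linit_qd a b s0 r : 0 <= a <= b -> exists B, 0 <= B /\ qd_at (Linit a b) (Linit' a b) s0 r B.
Proof.
  intros Hab. set (K := Cmod s0 + r). set (g := fun y => exp (K * b) * b ^ 2 * exp (Rabs r * b) * om y).
  assert (Cg : forall y, continuous g y) by (intros; unfold g; assert (X := om_continuous); cont_tac).
  assert (C3 : forall s, ccont (fun y => RtoC y * ey s y)%C) by (intros s; apply (cder_ccont _ _ (cder_yey s))).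
  exists (RInt g a b). split.
  - apply RInt_nonneg; auto; [lra|]. intros. unfold g. apply Rmult_le_pos; [|apply Rlt_le, om_pos]. apply Rmult_le_pos; [|apply Rlt_le, exp_pos]. apply Rmult_le_pos; [apply Rlt_le, exp_pos|apply pow2_ge_0].
  - intros s h Hs Hh. replace (Linit a b (s + h) - Linit a b s - h * Linit' a b s)%C with (cint (fun y => ey s y * (ey h y - 1 + h * RtoC y) * RtoC (om y))%C a b).
    + rewrite Rmult_comm. rewrite <- RInt_Rscal by (apply ex_RInt_cont; auto).
      assert (CC : ccont (fun y => ey s y * (ey h y - 1 + h * RtoC y) * RtoC (om y))%C).
      { apply ccont_multR; [|apply om_continuous].
        assert (CD : ccont (fun y => ey (s + h)%C y + ((-1) * ey s y + h * (RtoC y * ey s y)))%C) by (apply ccont_plus; [apply ccont_ey|apply ccont_plus; apply ccont_scal; [apply ccont_ey|apply C3]]).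
        destruct CD as [D1 D2]. assert (EE : forall y, (ey (s + h)%C y + ((-1) * ey s y + h * (RtoC y * ey s y)))%C = (ey s y * (ey h y - 1 + h * RtoC y))%C) by (intros; rewrite ey_plus_s; ring).
        split; intros y. apply continuous_ext with (2 := D1 y). intros; rewrite EE; auto. apply continuous_ext with (2 := D2 y). intros; rewrite EE; auto. }
      apply cint_bound; [lra|auto| |]. { intros; cont_tac. }
      intros y Hy. destruct (remainder_bound s h y ltac:(lra)) as (R1 & _ & R3). rewrite 2 Cmod_mult, R3, Cmod_R, Rabs_pos_eq by (apply Rlt_le, om_pos).
      assert (Ph := Cmod_ge_0 h). unfold g.
      replace (Cmod h ^ 2 * (exp (K * b) * b ^ 2 * exp (Rabs r * b) * om y)) with (exp (K * b) * (Cmod h ^ 2 * b ^ 2 * exp (Rabs r * b)) * om y) by ring.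
      apply Rmult_le_compat_r. apply Rlt_le, om_pos. apply Rmult_le_compat; [apply Rlt_le, exp_pos|apply Cmod_ge_0| |].
      * apply exp_le_compat. assert (HsK : Cmod s <= K). { unfold K. replace s with (s0 + (s - s0))%C by ring. apply Rle_trans with (1 := Cmod_triangle _ _). lra. }
        assert (X := re_le_Cmod s). apply Rabs_le_between in X. assert (Y0 := Cmod_ge_0 s). nra.
      * apply Rle_trans with (1 := R1). assert (Hr : Cmod h <= Rabs r) by (assert (X := Rle_abs r); lra).
        apply Rmult_le_compat. apply Rmult_le_pos; apply pow2_ge_0. apply Rlt_le, exp_pos. apply Rmult_le_compat_l. apply pow2_ge_0. apply pow_incr; lra.
        apply exp_le_compat. assert (0 <= Rabs r) by apply Rabs_pos. nra.
    + unfold Linit, Linit'. assert (C1 : forall s, ccont (fun y => ey s y * RtoC (om y))%C) by (intros; apply ccont_multR; [apply ccont_ey|apply om_continuous]).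
      assert (C4 : ccont (fun y => RtoC y * ey s y * RtoC (om y))%C) by (apply ccont_multR; [apply C3|apply om_continuous]).
      rewrite (cint_ext (fun y => -1 * (RtoC y * ey s y) * RtoC (om y))%C (fun y => (-1) * (RtoC y * ey s y * RtoC (om y)))%C) by (intros; ring).
      rewrite cint_scal by auto.
      rewrite (cint_ext _ (fun y => ey (s + h)%C y * RtoC (om y) + ((-1) * (ey s y * RtoC (om y)) + h * (RtoC y * ey s y * RtoC (om y))))%C) by (intros; rewrite ey_plus_s; ring).
      rewrite cint_plus, cint_plus, 2 cint_scal; auto using ccont_scal, ccont_plus. ring.
Qed.

Definition rhalf (s : C) : Prop := / 2 < Re s.

Lemma W_qd lam : good lam -> qd rhalf (W lam) (W' lam).
Proof.
  intros G. apply (qd_plus _ (fun s => (-1) * Linit 0 (Y 0) s)%C (fun s => (-1) * Linit' 0 (Y 0) s)%C).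
  - intros s0 Hs0. destruct (Linit_qd 0 (Y 0) s0 1) as (B & HB & H). assert (X := Y_nonneg 0); lra.
    exists 1, B. split; [lra|]. split; auto. intros s h Hs Hh. specialize (H s h Hs Hh).
    replace (-1 * Linit 0 (Y 0) (s + h) - -1 * Linit 0 (Y 0) s - h * (-1 * Linit' 0 (Y 0) s))%C with (- (Linit 0 (Y 0) (s + h) - Linit 0 (Y 0) s - h * Linit' 0 (Y 0) s))%C by ring.
    rewrite Cmod_opp. auto.
  - intros s0 Hs0. destruct (wterm_qd lam s0 G Hs0) as (r & B & Hr & Hr2 & HB & Hq & SB & HSB). unfold rhalf in Hs0.
    destruct (psum_exp_Y (1 + (Re s0 - / 2) / 4) ltac:(lra)) as [C HC].
    exists (r / 2), SB. split; [lra|]. split. { specialize (HSB O). simpl in HSB. auto. }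
    apply (qd_series (wterm lam) (wterm' lam) s0 (r / 2) (fun n => (Cmod s0 + r + 4) * exp (- (1 + (Re s0 - / 2) / 4) * Y n)) B ((Cmod s0 + r + 4) * C) SB); auto; [lra| | |].
    + intros n. apply qd_at_shrink with r; auto; lra.
    + intros n s Hs. assert (Hre := Re_minus_Cmod s s0). apply Rle_trans with (1 := wterm_bound lam n s G ltac:(lra)).
      assert (HsK : Cmod s <= Cmod s0 + r). { replace s with (s0 + (s - s0))%C by ring. apply Rle_trans with (1 := Cmod_triangle _ _). lra. }
      assert (P := Cmod_ge_0 s). apply Rmult_le_compat; try lra. apply Rlt_le, exp_pos. apply exp_le_compat. assert (Yn := Y_nonneg n). nra.
    + intros n. rewrite psum_scal. apply Rmult_le_compat_l; auto. assert (P := Cmod_ge_0 s0). lra.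
Qed.

Lemma wterm_sum lam s1 : good lam -> / 2 < s1 -> exists C, 0 <= C /\ forall s, s1 <= Re s -> (forall n, Cmod (wterm lam n s) <= (Cmod s + 4) * exp (- (s1 + / 2) * Y n)) /\ forall n, psum (fun n => (Cmod s + 4) * exp (- (s1 + / 2) * Y n)) n <= (Cmod s + 4) * C.
Proof.
  intros G Hs1. destruct (psum_exp_Y (s1 + / 2) ltac:(lra)) as [C HC]. exists C. split. { specialize (HC O). simpl in HC; auto. } intros s Hs. split.
  - intros n. apply Rle_trans with (1 := wterm_bound lam n s G ltac:(lra)). apply Rmult_le_compat_l. assert (P := Cmod_ge_0 s); lra. apply exp_le_compat. assert (Yn := Y_nonneg n). nra.
  - intros n. rewrite psum_scal. apply Rmult_le_compat_l; auto. assert (P := Cmod_ge_0 s); lra.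
Qed.

Lemma W_bound lam s1 : good lam -> / 2 < s1 -> exists K, 0 <= K /\ forall s, s1 <= Re s -> Cmod (W lam s) <= K * (1 + Cmod s).
Proof.
  intros G Hs1. destruct (wterm_sum lam s1 G Hs1) as (C & HC & H). exists (1 + 4 * C). split; [lra|]. intros s Hs. destruct (H s Hs) as [H1 H2].
  unfold W. apply Rle_trans with (1 := Cmod_triangle _ _). rewrite Cmod_mult. replace (Cmod (-1)) with 1 by (rewrite Cmod_R, Rabs_left; lra).
  assert (K1 := Linit_bound s ltac:(lra)). assert (K2 := Csum_bound _ _ _ H1 H2). assert (P := Cmod_ge_0 s). nra.
Qed.

Definition Wpart (lam : nat -> R) (n : nat) (s : C) : C := ((-1) * Linit 0 (Y 0) s + cpsum (fun j => wterm lam j s) n)%C.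

Lemma Wpart_clim lam s : good lam -> / 2 < Re s -> clim (fun n => Wpart lam n s) (W lam s).
Proof.
  intros G Hs. destruct (wterm_sum lam (Re s) G Hs) as (C & HC & H). destruct (H s ltac:(lra)) as [H1 H2].
  apply clim_plus. apply clim_const. apply (Csum_clim _ _ _ H1 H2).
Qed.

Lemma eterm_Re lam n s : Re (eterm lam n s) = hh (Re s) (lam n) (Im s) - mm (Re s) n (Im s).
Proof.
  unfold eterm, TF. change (Re (ey s (lam n)) - RInt (fun y => Re (ey s y * RtoC (om y))) (Y n) (Y (S n)) = hh (Re s) (lam n) (Im s) - mm (Re s) n (Im s)).
  rewrite ey_Re. f_equal. unfold mm. apply RInt_ext. intros y _. rewrite <- ey_Re. unfold Cmult, RtoC, Re, Im; simpl. asR. ring.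
Qed.

(** Passes from the finite sums controlled by the potential to the full series. The tail is not
    uniformly small in [t], only [eps * (1 + |t|)], which is harmless on a bounded range of heights;
    the prime powers and the initial integral account for [C]. *)
Lemma W_vs_Ssum lam s1 : good lam -> / 2 < s1 -> exists C, forall eps, 0 < eps -> exists N, forall n, (N <= n)%nat -> forall t,
  Re (W lam (s1, t)) <= Ssum lam s1 n t + C + eps * (1 + Rabs t).
Proof.
  intros G Hs1. destruct (wterm_sum lam s1 G Hs1) as (C2 & HC2 & H).
  destruct (psum_exp_Y (s1 + / 2) ltac:(lra)) as [C1 HC1].
  exists (1 + 4 * C1). intros eps He.
  destruct (psum_tail_small (fun n => exp (- (s1 + / 2) * Y n)) C1 ltac:(intros; apply Rlt_le, exp_pos) HC1 (eps / (s1 + 5)) ltac:(apply Rdiv_lt_0_compat; lra)) as [N HN].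
  exists N. intros n Hn t. set (s := (s1, t) : C). destruct (H s ltac:(simpl; lra)) as [H1 H2].
  assert (Hsm : Cmod s <= s1 + Rabs t). { apply Rle_trans with (Cmod (RtoC s1) + Cmod (0, t)). replace s with (RtoC s1 + (0, t))%C by (unfold s, Cplus, RtoC; simpl; f_equal; ring). apply Cmod_triangle.
    rewrite Cmod_R, Rabs_pos_eq by lra. apply Rplus_le_compat_l. unfold Cmod; simpl. right. rewrite Rmult_0_l, Rplus_0_l, Rmult_1_r. apply sqrt_Rsqr_abs. }
  assert (T : Cmod (Csum (fun n => wterm lam n s) - cpsum (fun n => wterm lam n s) n) <= (Cmod s + 4) * (eps / (s1 + 5))).
  { apply (Csum_tail _ _ _ _ _ H1 H2). intros m Hm. rewrite 2 psum_scal, <- Rmult_minus_distr_l. apply Rmult_le_compat_l. assert (P := Cmod_ge_0 s); lra. apply HN; lia. }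
  assert (T2 : (Cmod s + 4) * (eps / (s1 + 5)) <= eps * (1 + Rabs t)).
  { apply Rle_trans with ((s1 + Rabs t + 4) * (eps / (s1 + 5))). apply Rmult_le_compat_r. apply Rlt_le, Rdiv_lt_0_compat; lra. lra.
    apply Rmult_le_reg_r with (s1 + 5); [lra|]. replace ((s1 + Rabs t + 4) * (eps / (s1 + 5)) * (s1 + 5)) with ((s1 + Rabs t + 4) * eps) by (field; lra). assert (P := Rabs_pos t).
    rewrite (Rmult_comm _ eps), Rmult_assoc. apply Rmult_le_compat_l; [lra|]. nra. }
  assert (E : Re (cpsum (fun n => wterm lam n s) n) <= Ssum lam s1 n t + 4 * C1).
  { rewrite cpsum_Re. unfold Ssum. apply Rle_trans with (psum (fun j => (hh s1 (lam j) t - mm s1 j t) + 4 * exp (- (s1 + / 2) * Y j)) n).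
    - apply psum_le. intros j _. unfold wterm. change (Re (eterm lam j s + pl (lam j) s)%C) with (Re (eterm lam j s) + Re (pl (lam j) s)). rewrite eterm_Re.
      apply Rplus_le_compat_l. apply Rle_trans with (1 := Re_le_Cmod _). assert (L0 := Rlt_le _ _ (lam_pos lam G j)).
      apply Rle_trans with (1 := pl_bound (lam j) s (good_exp2 lam j G) L0 ltac:(simpl; lra)). apply Rmult_le_compat_l; [lra|]. apply exp_le_compat. simpl.
      assert (Hl := proj1 G j). assert (Y0 := Y_nonneg j). nra.
    - rewrite psum_plus, psum_scal. specialize (HC1 n). lra. }
  assert (I := Linit_bound s ltac:(simpl; lra)). assert (I2 := re_le_Cmod (Linit 0 (Y 0) s)). apply Rabs_le_between in I2.
  assert (T3 := Re_le_Cmod (Csum (fun n => wterm lam n s) - cpsum (fun n => wterm lam n s) n)).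
  assert (EW : Re (W lam s) = - Re (Linit 0 (Y 0) s) + (Re (cpsum (fun n => wterm lam n s) n) + Re (Csum (fun n => wterm lam n s) - cpsum (fun n => wterm lam n s) n)%C)).
  { unfold W, Cplus, Cminus, Copp, Cmult, RtoC, Re, Im; simpl. ring. }
  rewrite EW. lra.
Qed.

(** * Euler product *)

Lemma qd_cder U f d x y : qd U f d -> U (x, y) -> cder (fun x => f (x, y)) x (d (x, y)).
Proof.
  intros H HU. destruct (H _ HU) as (r & B & Hr & HB & Hq).
  assert (K : forall e, Rabs e <= r -> Cmod (f (x + e, y) - f (x, y) - RtoC e * d (x, y)) <= B * e ^ 2).
  { intros e He. specialize (Hq (x, y) (RtoC e) ltac:(rewrite Cmod_0_sub; lra) ltac:(rewrite Cmod_R; auto)). rewrite Cmod_R, pow2_abs in Hq.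
    replace ((x, y) + RtoC e)%C with ((x + e, y) : C) in Hq by (unfold Cplus, RtoC; simpl; f_equal; ring). exact Hq. }
  split; apply (quadratic_derive _ _ _ r B Hr); intros e He; apply Rle_trans with (2 := K e He).
  - apply Rle_trans with (2 := re_le_Cmod _). right. f_equal. unfold Cmult, Cminus, Cplus, Copp, RtoC, Re, Im; simpl. ring.
  - apply Rle_trans with (2 := Im_le_Cmod _). right. f_equal. unfold Cmult, Cminus, Cplus, Copp, RtoC, Re, Im; simpl. ring.
Qed.

Lemma cder_zero_const f a b : a <= b -> (forall x, a <= x <= b -> cder f x 0%C) -> f a = f b.
Proof.
  intros Hab H. assert (E1 : Re (f a) = Re (f b)) by (apply (derive_zero_const (fun x => Re (f x))); auto; intros; apply H; auto).
  assert (E2 : Im (f a) = Im (f b)) by (apply (derive_zero_const (fun x => Im (f x))); auto; intros; apply H; auto).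
  apply injective_projections; auto.
Qed.

Lemma qd_ey l U : qd U (fun s => ey s l) (fun s => RtoC (- l) * ey s l)%C.
Proof.
  apply (qd_ext U (fun s => cexp (0 + RtoC (- l) * s + 0 * (s * s))%C) (fun s => (RtoC (- l) + 0 * (s + s)) * cexp (0 + RtoC (- l) * s + 0 * (s * s)))%C).
  - intros s. unfold ey. f_equal. rewrite RtoC_opp. ring.
  - intros s. unfold ey. f_equal. ring. f_equal. rewrite RtoC_opp. ring.
  - apply qd_cexp. apply qd_poly.
Qed.

Lemma qd_pl l : 2 <= exp l -> 0 <= l -> qd rhalf (pl l) (pl' l).
Proof.
  intros Hl Hl0 s0 Hs0. unfold rhalf in Hs0. exists ((Re s0 - / 2) / 2), (100 * l ^ 2 * exp (- 2 * / 2 * l)). split; [lra|].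
  split. apply Rmult_le_pos; [|apply Rlt_le, exp_pos]. assert (X := pow2_ge_0 l); lra. apply pl_qd; auto; lra.
Qed.

Lemma clim_squeeze u b : (forall n, Cmod (u n) <= b n) -> is_lim_seq b 0 -> clim u 0%C.
Proof.
  intros H Hb eps He. apply is_lim_seq_spec in Hb. destruct (Hb (mkposreal _ He)) as [N HN]. exists N. intros n Hn. specialize (HN n Hn). simpl in HN.
  replace (u n - 0)%C with (u n) by ring. specialize (H n). assert (P := Cmod_ge_0 (u n)). rewrite Rminus_0_r in HN. apply Rabs_def2 in HN. lra.
Qed.

Lemma clim_pow z : Cmod z < 1 -> clim (fun n => Cpow z n) 0%C.
Proof.
  intros H. apply (clim_squeeze _ (fun n => Cmod z ^ n)). intros n. rewrite Cmod_pow. lra. apply is_lim_seq_geom. rewrite Rabs_pos_eq; auto. apply Cmod_ge_0.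
Qed.

Lemma geom_clim z : Cmod z < 1 -> clim (fun n => cpsum (fun e => Cpow z e) (S n)) (/ (1 - z))%C.
Proof.
  intros H. assert (N : (1 - z)%C <> 0%C). { intros E. assert (z = 1%C) by (replace z with (1 - (1 - z))%C by ring; rewrite E; ring). subst. rewrite Cmod_1 in H. lra. }
  apply clim_ext with (fun n => (1 - z * Cpow z n) * / (1 - z))%C.
  - intros n. assert (E : forall n, cpsum (fun e => Cpow z e) n = ((1 - Cpow z n) / (1 - z))%C). { clear n. induction n; simpl. field; auto. rewrite IHn. field; auto. }
    rewrite E. reflexivity.
  - assert (K : clim (fun n => (1 - z * Cpow z n) * / (1 - z))%C ((1 - z * 0) * / (1 - z))%C).
    { apply clim_mult; [|apply clim_const]. apply clim_minus. apply clim_const. apply clim_scal. apply clim_pow; auto. }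
    replace ((1 - z * 0) * / (1 - z))%C with (/ (1 - z))%C in K by (field; auto). exact K.
Qed.

Lemma ey_small l s : 2 <= exp l -> 0 <= l -> / 2 <= Re s -> Cmod (ey s l) <= 71 / 100.
Proof. intros Hl Hl0 Hs. rewrite ey_Cmod. apply exp_half_bound; auto. Qed.

(** A geometric series of ratio [ey s l], stated with the denominator multiplied out. *)
Lemma pl'_formula l s : 2 <= exp l -> 0 <= l -> / 2 <= Re s -> (pl' l s * (1 - ey s l))%C = (RtoC (- l) * (ey s l * ey s l))%C.
Proof.
  intros Hl Hl0 Hs. set (z := ey s l). assert (Hz := ey_small l s Hl Hl0 Hs). fold z in Hz. assert (Pz := Cmod_ge_0 z).
  assert (E : forall j, (RtoC (- l) * ey s (INR (j + 2) * l))%C = (RtoC (- l) * (z * z) * Cpow z j)%C).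
  { intros j. rewrite ey_pow. fold z. replace (j + 2)%nat with (S (S j)) by lia. simpl. ring. }
  assert (C1 : clim (cpsum (fun j => RtoC (- l) * ey s (INR (j + 2) * l))%C) (pl' l s)).
  { apply (Csum_clim _ (fun j => l * (71/100) ^ j) (l * 4)).
    - intros j. rewrite E, 3 Cmod_mult, Cmod_pow, Cmod_R, Rabs_Ropp, (Rabs_pos_eq l) by auto. rewrite Rmult_assoc. apply Rmult_le_compat_l; auto.
      assert (Q : Cmod z ^ j <= (71/100) ^ j) by (apply pow_incr; lra). assert (0 <= Cmod z ^ j) by (apply pow_le; lra). assert (Cmod z * Cmod z <= 1) by nra. apply Rle_trans with (1 * Cmod z ^ j); [apply Rmult_le_compat_r; auto|lra].
    - intros n. rewrite psum_scal. apply Rmult_le_compat_l; auto. apply Rle_trans with (1 := psum_geom_le (71/100) n ltac:(lra)). replace (/ (1 - 71/100)) with (100/29) by field. lra. }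
  apply (clim_unique (fun n => (cpsum (fun j => RtoC (- l) * ey s (INR (j + 2) * l)) n * (1 - z))%C)).
  - apply clim_mult; auto. apply clim_const.
  - apply clim_ext with (fun n => RtoC (- l) * (z * z) * (1 - Cpow z n))%C.
    + intros n. rewrite (cpsum_ext _ (fun j => RtoC (- l) * (z * z) * Cpow z j)%C) by auto. rewrite cpsum_scal.
      assert (G : (cpsum (Cpow z) n * (1 - z))%C = (1 - Cpow z n)%C). { induction n; simpl; [ring|]. replace ((cpsum (Cpow z) n + Cpow z n) * (1 - z))%C with (cpsum (Cpow z) n * (1 - z) + Cpow z n * (1 - z))%C by ring. rewrite IHn. ring. }
      rewrite <- G. ring.
    + assert (K : clim (fun n => RtoC (- l) * (z * z) * (1 - Cpow z n))%C (RtoC (- l) * (z * z) * (1 - 0))%C).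
      { apply clim_scal. apply clim_minus. apply clim_const. apply clim_pow; lra. }
      replace (RtoC (- l) * (z * z) * (1 - 0))%C with (RtoC (- l) * (z * z))%C in K by ring. exact K.
Qed.

(** No complex logarithm is used: the left side has zero derivative in the real direction by
    [pl'_formula], and tends to 1 along [s + n]. *)
Lemma euler_factor l s : 2 <= exp l -> 0 <= l -> / 2 < Re s -> (cexp (ey s l + pl l s) * (1 - ey s l))%C = 1%C.
Proof.
  intros Hl Hl0 Hs. set (Ph := fun s => (cexp (ey s l + pl l s) * (1 + (-1) * ey s l))%C).
  assert (Qe : qd rhalf (fun s => (1 + (-1) * ey s l)%C) (fun s => (0 + (-1) * (RtoC (- l) * ey s l))%C)).
  { intros s0 Hs0. destruct (qd_ey l rhalf s0 Hs0) as (r & B & Hr & HB & Hq). exists r, B. repeat split; auto. intros t h Ht Hh.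
    replace (1 + -1 * ey (t + h) l - (1 + -1 * ey t l) - h * (0 + -1 * (RtoC (- l) * ey t l)))%C with (- (ey (t + h) l - ey t l - h * (RtoC (- l) * ey t l)))%C by ring. rewrite Cmod_opp. auto. }
  assert (QP : qd rhalf Ph (fun s => ((RtoC (- l) * ey s l + pl' l s) * cexp (ey s l + pl l s) * (1 + (-1) * ey s l) + cexp (ey s l + pl l s) * (0 + (-1) * (RtoC (- l) * ey s l)))%C)).
  { apply (qd_mult rhalf (fun s => cexp (ey s l + pl l s)) (fun s => (RtoC (- l) * ey s l + pl' l s) * cexp (ey s l + pl l s))%C); auto.
    apply (qd_cexp rhalf (fun s => ey s l + pl l s)%C). apply qd_plus. apply qd_ey. apply qd_pl; auto. }
  assert (Const : forall x, 0 <= x -> Ph s = Ph (s + RtoC x)%C).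
  { intros x Hx. destruct s as [a b]. replace ((a, b) + RtoC x)%C with ((a + x, b) : C) by (unfold Cplus, RtoC; simpl; f_equal; ring).
    apply (cder_zero_const (fun u => Ph (u, b)) a (a + x)); [lra|]. intros u Hu. simpl in Hs.
    assert (D := qd_cder rhalf Ph _ u b QP ltac:(unfold rhalf; simpl; lra)). cbv beta in D.
    assert (F := pl'_formula l (u, b) Hl Hl0 ltac:(simpl; lra)). set (z := ey (u, b) l) in *. set (e := cexp _) in *.
    assert (Z : ((RtoC (- l) * z + pl' l (u, b)) * e * (1 + -1 * z) + e * (0 + -1 * (RtoC (- l) * z)))%C = 0%C).
    { transitivity (e * (pl' l (u, b) * (1 - z) - RtoC (- l) * (z * z)))%C; [ring|]. rewrite F. ring. }
    rewrite Z in D. exact D. }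
  replace (cexp (ey s l + pl l s) * (1 - ey s l))%C with (Ph s) by (unfold Ph; f_equal; ring).
  assert (He : forall n, exp (- Re (s + RtoC (INR n))%C * l) <= (/ 2) ^ n).
  { intros n. replace (Re (s + RtoC (INR n))%C) with (Re s + INR n) by reflexivity. replace (- (Re s + INR n) * l) with (- (Re s * l) + (- l) * INR n) by ring. rewrite exp_plus, exp_pow.
    assert (exp (- (Re s * l)) <= 1) by (apply exp_le1; nra). assert (exp (- l) <= / 2) by (rewrite exp_Ropp; apply Rinv_le_contravar; lra).
    assert (exp (- l) ^ n <= (/ 2) ^ n) by (apply pow_incr; split; [apply Rlt_le, exp_pos|auto]). assert (0 <= exp (- l) ^ n) by (apply pow_le, Rlt_le, exp_pos). assert (P := exp_pos (- (Re s * l))). nra. }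
  assert (G0 : is_lim_seq (fun n => (/ 2) ^ n) 0) by (apply is_lim_seq_geom; rewrite Rabs_pos_eq; lra).
  assert (L1 : clim (fun n => ey (s + RtoC (INR n))%C l) 0%C). { apply (clim_squeeze _ (fun n => (/ 2) ^ n)); auto. intros n. rewrite ey_Cmod. auto. }
  assert (L2 : clim (fun n => pl l (s + RtoC (INR n))%C) 0%C).
  { apply (clim_squeeze _ (fun n => 4 * (/ 2) ^ n)).
    - intros n. assert (Hn := pos_INR n). apply Rle_trans with (1 := pl_bound l (s + RtoC (INR n))%C Hl Hl0 ltac:(replace (Re (s + RtoC (INR n))%C) with (Re s + INR n) by reflexivity; lra)).
      apply Rmult_le_compat_l; [lra|]. replace (-2 * Re (s + RtoC (INR n))%C * l) with (- Re (s + RtoC (INR n))%C * l + - Re (s + RtoC (INR n))%C * l) by ring. rewrite exp_plus.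
      specialize (He n). assert (P := exp_pos (- Re (s + RtoC (INR n))%C * l)). assert ((/ 2) ^ n <= 1) by (rewrite <- (pow1 n); apply pow_incr; lra). nra.
    - assert (K := is_lim_seq_scal_l _ 4 _ G0). simpl in K. rewrite Rmult_0_r in K. exact K. }
  apply (clim_unique (fun n => Ph (s + RtoC (INR n))%C)).
  - apply clim_ext with (fun _ => Ph s). intros n; apply Const, pos_INR. apply clim_const.
  - assert (K : clim (fun n => Ph (s + RtoC (INR n))%C) (cexp (0 + 0) * (1 + (-1) * 0))%C).
    { apply clim_mult. apply clim_cexp. apply clim_plus; auto. apply clim_plus. apply clim_const. apply clim_scal; auto. }
    assert (Z : (cexp (0 + 0) * (1 + (-1) * 0))%C = RtoC 1) by (rewrite Cplus_0_r, cexp_0; ring). rewrite Z in K. exact K.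
Qed.

Fixpoint cprod (f : nat -> C) (n : nat) : C := match n with O => RtoC 1 | S m => (cprod f m * f m)%C end.

Lemma clim_cprod (f : nat -> nat -> C) g n : (forall j, (j < n)%nat -> clim (fun E => f E j) (g j)) -> clim (fun E => cprod (f E) n) (cprod g n).
Proof. induction n; intros H; simpl. apply clim_const. apply clim_mult; auto. Qed.

Definition clsum {T} (f : T -> C) (l : list T) : C := fold_right (fun x acc => f x + acc)%C (RtoC 0) l.
Lemma clsum_app {T} (f : T -> C) l1 l2 : clsum f (l1 ++ l2) = (clsum f l1 + clsum f l2)%C.
Proof. induction l1; simpl; [ring|rewrite IHl1; ring]. Qed.
Lemma clsum_map {T U} (f : U -> C) (g : T -> U) l : clsum f (map g l) = clsum (fun x => f (g x)) l.
Proof. induction l; simpl; [ring|rewrite IHl; ring]. Qed.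
Lemma clsum_scal {T} c (f : T -> C) l : clsum (fun x => f x * c)%C l = (clsum f l * c)%C.
Proof. induction l; simpl; [ring|rewrite IHl; ring]. Qed.
Lemma clsum_ext {T} (f g : T -> C) l : (forall x, f x = g x) -> clsum f l = clsum g l.
Proof. intros H; induction l; simpl; auto. rewrite H, IHl; auto. Qed.
Lemma clsum_seq f n : clsum f (seq 0 n) = cpsum f n.
Proof. induction n; auto. rewrite seq_S, clsum_app, IHn. simpl. ring. Qed.

(** The truncated Euler product multiplied out. *)
Lemma clsum_lmons lam n E s : clsum (ey s) (lmons lam n E) = cprod (fun j => cpsum (fun e => Cpow (ey s (lam j)) e) (S E)) n.
Proof.
  induction n. simpl. rewrite ey_0. ring.
  change (lmons lam (S n) E) with (flat_map (fun e => map (fun l => l + INR e * lam n) (lmons lam n E)) (seq 0 (S E))).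
  change (cprod (fun j => cpsum (fun e => Cpow (ey s (lam j)) e) (S E)) (S n)) with (cprod (fun j => cpsum (fun e => Cpow (ey s (lam j)) e) (S E)) n * cpsum (fun e => Cpow (ey s (lam n)) e) (S E))%C.
  rewrite <- IHn. generalize (S E) as m. induction m; [simpl; ring|].
  rewrite seq_S, flat_map_app, clsum_app, IHm. cbn [flat_map plus cpsum]. rewrite app_nil_r, clsum_map. rewrite Nat.add_0_l.
  rewrite (clsum_ext (fun l => ey s (l + INR m * lam n)) (fun l => ey s l * Cpow (ey s (lam n)) m)%C). rewrite clsum_scal. ring. intros l. rewrite ey_plus_y, ey_pow. reflexivity.
Qed.

Lemma lsum_incl (f : R -> R) l1 l2 : (forall x, 0 <= f x) -> NoDup l1 -> incl l1 l2 -> lsum f l1 <= lsum f l2.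
Proof.
  intros Hf. revert l2. induction l1 as [|a l1 IH]; intros l2 ND Hi. simpl; apply lsum_nonneg; auto.
  inversion ND; subst. assert (Ha : In a l2) by (apply Hi; left; auto). apply in_split in Ha. destruct Ha as (u & v & ->).
  assert (K : lsum f l1 <= lsum f (u ++ v)). { apply IH; auto. intros x Hx. assert (Hx2 : In x (u ++ a :: v)) by (apply Hi; right; auto). apply in_app_iff in Hx2. simpl in Hx2.
    apply in_app_iff. destruct Hx2 as [|[<-|]]; auto. contradiction. }
  rewrite lsum_app in *. simpl in *. lra.
Qed.

Lemma clsum_incl (f : R -> C) l1 l2 : NoDup l1 -> incl l1 l2 -> Cmod (clsum f l2 - clsum f l1) <= lsum (fun x => Cmod (f x)) l2 - lsum (fun x => Cmod (f x)) l1.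
Proof.
  revert l2. induction l1 as [|a l1 IH]; intros l2 ND Hi.
  - simpl. replace (clsum f l2 - 0)%C with (clsum f l2) by ring. rewrite Rminus_0_r. clear. induction l2; simpl. rewrite Cmod_0; lra. apply Rle_trans with (1 := Cmod_triangle _ _). lra.
  - inversion ND; subst. assert (Ha : In a l2) by (apply Hi; left; auto). apply in_split in Ha. destruct Ha as (u & v & ->).
    assert (K : Cmod (clsum f (u ++ v) - clsum f l1) <= lsum (fun x => Cmod (f x)) (u ++ v) - lsum (fun x => Cmod (f x)) l1).
    { apply IH; auto. intros x Hx. assert (Hx2 : In x (u ++ a :: v)) by (apply Hi; right; auto). apply in_app_iff in Hx2. simpl in Hx2.
      apply in_app_iff. destruct Hx2 as [|[<-|]]; auto. contradiction. }
    rewrite clsum_app, lsum_app in *. simpl.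
    replace (clsum f u + (f a + clsum f v) - (f a + clsum f l1))%C with (clsum f u + clsum f v - clsum f l1)%C by ring. lra.
Qed.

Definition enumerates (lam mu : nat -> R) : Prop := (forall n, mu n < mu (S n)) /\ (forall y, BL lam y <-> exists n, mu n = y).

Lemma enum_mono lam mu : enumerates lam mu -> forall m n, (m < n)%nat -> mu m < mu n.
Proof. intros [H _] m n Hmn. induction Hmn; auto. apply Rlt_trans with (1 := IHHmn). auto. Qed.
Lemma enum_NoDup lam mu M : enumerates lam mu -> NoDup (map mu (seq 0 M)).
Proof.
  intros H. apply Injective_map_NoDup; [|apply seq_NoDup]. intros a b Hab. destruct (Nat.lt_trichotomy a b) as [L|[L|L]]; auto; apply (enum_mono lam mu H) in L; lra.
Qed.
Lemma lsum_seq f n : lsum f (seq 0 n) = psum f n.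
Proof. induction n; auto. rewrite seq_S, lsum_app, IHn. simpl. ring. Qed.

Lemma enum_in_lmons lam mu M : good lam -> enumerates lam mu -> exists N, forall n E, (N <= n)%nat -> (N <= E)%nat -> incl (map mu (seq 0 M)) (lmons lam n E).
Proof.
  intros G He. destruct (BL_bounded lam (mu M) G) as [N HN]. exists N. intros n E Hn HE x Hx. apply in_map_iff in Hx. destruct Hx as (m & <- & Hm). apply in_seq in Hm.
  apply HN; auto. apply (proj2 He); eauto. apply Rlt_le, (enum_mono lam mu He). lia.
Qed.

(** Finitely many distinct integers sit inside one list of monomials, whose mass is at most 2. *)
Lemma psum_mu2 lam mu : good lam -> enumerates lam mu -> forall n, psum (fun m => exp (- 2 * mu m)) n <= 2.
Proof.
  intros G He M. destruct (enum_in_lmons lam mu M G He) as [N HN]. rewrite <- lsum_seq, <- (lsum_map (fun l => exp (- 2 * l)) mu).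
  apply Rle_trans with (lsum (fun l => exp (- 2 * l)) (lmons lam N N)).
  - apply lsum_incl. intros; apply Rlt_le, exp_pos. apply (enum_NoDup lam mu M He). apply HN; lia.
  - apply lmons_mass2. intros; apply lam_lower; auto.
Qed.

Lemma mu_nonneg lam mu : good lam -> enumerates lam mu -> forall n, 0 <= mu n.
Proof. intros G He n. assert (H : BL lam (mu n)) by (apply (proj2 He); eauto). destruct H as (K & e & ->). apply lv_nonneg; auto. Qed.

Definition zeta (mu : nat -> R) (s : C) : C := Csum (fun m => ey s (mu m)).

Lemma zeta_term lam mu s n : good lam -> enumerates lam mu -> 2 <= Re s -> Cmod (ey s (mu n)) <= exp (- 2 * mu n).
Proof. intros G He Hs. rewrite ey_Cmod. apply exp_le_compat. assert (H := mu_nonneg lam mu G He n). nra. Qed.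

Lemma zeta_clim lam mu s : good lam -> enumerates lam mu -> 2 <= Re s -> clim (cpsum (fun m => ey s (mu m))) (zeta mu s).
Proof. intros G He Hs. apply (Csum_clim _ (fun m => exp (- 2 * mu m)) 2). intros; apply (zeta_term lam); auto. apply (psum_mu2 lam mu G He). Qed.

Lemma list_index_bound (mu : nat -> R) l : (forall x, In x l -> exists n, mu n = x) -> exists M, forall M', (M <= M')%nat -> incl l (map mu (seq 0 M')).
Proof.
  induction l as [|a l IH]; intros H. exists O. intros M' _ x []. destruct IH as [M HM]. intros; apply H; right; auto. destruct (H a (or_introl eq_refl)) as [n Hn].
  exists (max M (S n)). intros M' HM' x [<-|Hx]. rewrite <- Hn. apply in_map. apply in_seq; lia. apply HM; auto; lia.
Qed.

(** The monomial list lies between two initial segments of the enumeration, so the difference from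
    zeta is bounded by tails of an absolutely convergent series. Uniformity in [n] and [E] later
    allows the limits to be taken one after the other. *)
Lemma zeta_lmons lam mu s : good lam -> enumerates lam mu -> 2 <= Re s -> forall eps, 0 < eps -> exists N, forall n E, (N <= n)%nat -> (N <= E)%nat ->
  Cmod (clsum (ey s) (lmons lam n E) - zeta mu s) <= eps.
Proof.
  intros G He Hs eps Heps. set (b := fun m => Cmod (ey s (mu m))).
  assert (Hb0 : forall m, 0 <= b m) by (intros; apply Cmod_ge_0).
  assert (Hb : forall n, psum b n <= 2). { intros n. apply Rle_trans with (2 := psum_mu2 lam mu G He n). apply psum_le. intros; apply (zeta_term lam); auto. }
  destruct (psum_tail_small b 2 Hb0 Hb (eps / 2) ltac:(lra)) as [M HM]. destruct (enum_in_lmons lam mu M G He) as [N HN]. exists N. intros n E Hn HE.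
  destruct (list_index_bound mu (lmons lam n E)) as [M1 HM1]. { intros x Hx. apply (proj2 He). apply in_lmons in Hx. destruct Hx as (e & _ & ->). exists n, e. reflexivity. }
  set (M2 := max M M1). specialize (HM1 M2 ltac:(lia)). specialize (HN n E Hn HE).
  assert (ND := lmons_NoDup lam n E G). assert (K1 := clsum_incl (ey s) _ _ ND HM1). rewrite clsum_map, lsum_map, clsum_seq, lsum_seq in K1. fold b in K1.
  assert (K2 := lsum_incl (fun x => Cmod (ey s x)) _ _ ltac:(intros; apply Cmod_ge_0) (enum_NoDup lam mu M He) HN). rewrite lsum_map, lsum_seq in K2. fold b in K2.
  assert (K3 := HM M M2 ltac:(lia) ltac:(lia)).
  assert (K4 : Cmod (zeta mu s - cpsum (fun m => ey s (mu m)) M2) <= eps / 2). { apply (Csum_tail _ b 2); auto. intros; unfold b; lra. intros; apply HM; lia. }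
  assert (T := Cmod_tri3 (zeta mu s) (cpsum (fun m => ey s (mu m)) M2) (clsum (ey s) (lmons lam n E))).
  rewrite Cmod_sub_sym. lra.
Qed.

Lemma euler_partial lam n s : good lam -> / 2 < Re s -> (cexp (cpsum (fun j => ey s (lam j) + pl (lam j) s) n) = cprod (fun j => / (1 - ey s (lam j))) n)%C.
Proof.
  intros G Hs. induction n; simpl. apply cexp_0. rewrite cexp_plus, IHn. f_equal.
  assert (L0 := Rlt_le _ _ (lam_pos lam G n)). assert (F := euler_factor (lam n) s (good_exp2 lam n G) L0 Hs). set (z := ey s (lam n)) in *.
  assert (N : (1 - z)%C <> 0%C). { intros E. rewrite E in F. rewrite Cmult_0_r in F. apply RtoC_inj in F. lra. }
  replace (cexp (z + pl (lam n) s)) with (cexp (z + pl (lam n) s) * (1 - z) * / (1 - z))%C by (field; auto). rewrite F. ring.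
Qed.

Lemma Wpart_Linit lam n s : (Wpart lam n s + Linit 0 (Y n) s)%C = cpsum (fun j => ey s (lam j) + pl (lam j) s)%C n.
Proof.
  unfold Wpart. induction n; simpl. ring.
  rewrite <- IHn. unfold wterm, eterm, TF. fold (Linit (Y n) (Y (S n)) s).
  replace (Linit 0 (Y (S n)) s) with (Linit 0 (Y n) s + Linit (Y n) (Y (S n)) s)%C. ring.
  apply cint_cat. apply ccont_multR. apply ccont_ey. apply om_continuous.
Qed.

(** * The identity [exp (int_0^oo e^(-sy) om(y) dy) = s / (s - 1)] *)

Lemma laplace_exp (w : C) T : w <> RtoC 0 -> 0 <= T -> cint (fun y => ey w y) 0 T = ((1 - ey w T) / w)%C.
Proof.
  intros Hw HT. rewrite (cint_FTC (fun y => (- / w) * ey w y)%C); auto.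
  - rewrite ey_0. field; auto.
  - intros x. replace (ey w x) with ((- / w) * (- w * ey w x))%C by (field; auto). apply cder_scal. apply cder_ey.
  - apply ccont_ey.
Qed.

Lemma cont2_hh_exp s u v : continuity_2d_pt (fun y v => Re (ey s y) * exp (v * y)) u v /\ continuity_2d_pt (fun y v => Im (ey s y) * exp (v * y)) u v.
Proof.
  destruct (ccont_ey s) as [C1 C2]. assert (E : continuity_2d_pt (fun y v => exp (v * y)) u v).
  { apply (cont2_comp exp (fun y v => v * y)). apply continuous_Rexp. apply continuity_2d_pt_mult. apply continuity_2d_pt_id2. apply continuity_2d_pt_id1. }
  split; apply continuity_2d_pt_mult; auto. apply (cont2_l (fun y => Re (ey s y))); auto. apply (cont2_l (fun y => Im (ey s y))); auto.
Qed.

Lemma ey_shift s v y : ey (s - RtoC v) y = (ey s y * RtoC (exp (v * y)))%C.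
Proof.
  replace (s - RtoC v)%C with (s + RtoC (- v))%C by (rewrite RtoC_opp; ring). rewrite ey_plus_s. f_equal.
  unfold ey, cexp, Cmult, Copp, RtoC, Re, Im; simpl.
  replace (y * - - v - 0 * - 0) with (v * y) by ring. replace (y * - 0 + 0 * - - v) with 0 by ring. rewrite cos_0, sin_0. f_equal; ring.
Qed.

(** Writing [om y] as the integral of [exp (v * y)] over [[0, 1]] and exchanging the integrals; as
    [T] grows the inner integral tends to [1 / (s - v)], whose integral is the logarithm of
    [s / (s - 1)]. *)
Lemma Linit_param s T : 0 <= T -> Linit 0 T s = cint (fun v => cint (fun y => ey (s - RtoC v) y) 0 T) 0 1.
Proof.
  intros HT. unfold Linit. unfold cint at 1 2. f_equal.
  - transitivity (RInt (fun y => RInt (fun v => Re (ey s y) * exp (v * y)) 0 1) 0 T).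
    + apply RInt_ext. intros y _. rewrite RInt_Rscal by (apply ex_RInt_cont; apply om_integrand). unfold om, Cmult, RtoC, Re, Im; simpl. asR. ring.
    + rewrite (RInt_Fubini (fun y v => Re (ey s y) * exp (v * y))); [|lra|lra|intros; apply cont2_hh_exp].
      apply RInt_ext. intros v _. change (RInt (fun y => Re (ey s y) * exp (v * y)) 0 T = RInt (fun y => Re (ey (s - RtoC v) y)) 0 T). apply RInt_ext. intros y _. rewrite ey_shift. unfold Cmult, RtoC, Re, Im; simpl. asR. ring.
  - transitivity (RInt (fun y => RInt (fun v => Im (ey s y) * exp (v * y)) 0 1) 0 T).
    + apply RInt_ext. intros y _. rewrite RInt_Rscal by (apply ex_RInt_cont; apply om_integrand). unfold om, Cmult, RtoC, Re, Im; simpl. asR. ring.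
    + rewrite (RInt_Fubini (fun y v => Im (ey s y) * exp (v * y))); [|lra|lra|intros; apply cont2_hh_exp].
      apply RInt_ext. intros v _. change (RInt (fun y => Im (ey s y) * exp (v * y)) 0 T = RInt (fun y => Im (ey (s - RtoC v) y)) 0 T). apply RInt_ext. intros y _. rewrite ey_shift. unfold Cmult, RtoC, Re, Im; simpl. asR. ring.
Qed.

Lemma laplace_ccont s T : 0 <= T -> ccont (fun v => cint (fun y => ey (s - RtoC v) y) 0 T).
Proof.
  intros HT. split; intros v.
  - apply continuous_ext with (fun v => RInt (fun y => Re (ey s y) * exp (v * y)) 0 T).
    + intros u. change (RInt (fun y => Re (ey s y) * exp (u * y)) 0 T = RInt (fun y => Re (ey (s - RtoC u) y)) 0 T). apply RInt_ext. intros y _. rewrite ey_shift. unfold Cmult, RtoC, Re, Im; simpl. asR. ring.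
    + apply (continuous_RInt_param (fun v y => Re (ey s y) * exp (v * y))); auto. intros a b. apply (continuity_2d_swap (fun y v => Re (ey s y) * exp (v * y))). apply cont2_hh_exp.
  - apply continuous_ext with (fun v => RInt (fun y => Im (ey s y) * exp (v * y)) 0 T).
    + intros u. change (RInt (fun y => Im (ey s y) * exp (u * y)) 0 T = RInt (fun y => Im (ey (s - RtoC u) y)) 0 T). apply RInt_ext. intros y _. rewrite ey_shift. unfold Cmult, RtoC, Re, Im; simpl. asR. ring.
    + apply (continuous_RInt_param (fun v y => Im (ey s y) * exp (v * y))); auto. intros a b. apply (continuity_2d_swap (fun y v => Im (ey s y) * exp (v * y))). apply cont2_hh_exp.
Qed.

(* [exp (int_0^v J) (s - v)] has derivative [- exp (int_0^v J) e^(-(s-v)T)], which is negligible. *)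
Lemma laplace_li s T : 2 <= Re s -> 0 <= T -> Cmod (cexp (Linit 0 T s) * (s - 1) - s) <= exp 2 * exp (- T).
Proof.
  intros Hs HT. rewrite Linit_param by auto. set (J := fun v => cint (fun y => ey (s - RtoC v) y) 0 T).
  assert (CJ : ccont J) by exact (laplace_ccont s T HT). destruct CJ as [CJ1 CJ2].
  assert (HN : forall v, 0 <= v <= 1 -> 1 <= Cmod (s - RtoC v)).
  { intros v Hv. apply Rle_trans with (2 := Re_le_Cmod _). replace (Re (s - RtoC v)%C) with (Re s - v) by reflexivity. lra. }
  assert (N : forall v, 0 <= v <= 1 -> (s - RtoC v)%C <> 0%C) by (intros v Hv; apply Cmod_gt_0; specialize (HN v Hv); lra).
  assert (HJ : forall v, 0 <= v <= 1 -> J v = ((1 - ey (s - RtoC v) T) / (s - RtoC v))%C) by (intros v Hv; exact (laplace_exp (s - RtoC v)%C T (N v Hv) HT)).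
  assert (He : forall v, 0 <= v <= 1 -> Cmod (ey (s - RtoC v) T) <= exp (- T)).
  { intros v Hv. rewrite ey_Cmod. apply exp_le_compat. replace (Re (s - RtoC v)%C) with (Re s - v) by reflexivity. nra. }
  assert (BJ : forall v, 0 <= v <= 1 -> Cmod (J v) <= 2).
  { intros v Hv. rewrite HJ by auto. rewrite Cmod_div by auto. specialize (HN v Hv). specialize (He v Hv). assert (T1 := Cmod_sub_le 1 (ey (s - RtoC v) T)). rewrite Cmod_1 in T1.
    assert (exp (- T) <= 1) by (apply exp_le1; lra). apply Rmult_le_reg_r with (Cmod (s - RtoC v)); [lra|]. unfold Rdiv. rewrite Rmult_assoc, Rinv_l by lra. lra. }
  set (I := fun v => cint J 0 v).
  assert (DI : forall v, cder I v (J v)). { intros v. split. apply (is_derive_RInt_cont (fun y => Re (J y))); auto. apply (is_derive_RInt_cont (fun y => Im (J y))); auto. }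
  set (psi := fun v => (cexp (I v) * (s + (-1) * RtoC v))%C).
  assert (Dp : forall v, cder psi v ((J v * cexp (I v)) * (s + (-1) * RtoC v) + cexp (I v) * (0 + (-1) * 1))%C).
  { intros v. apply (cder_mult (fun v => cexp (I v)) (fun v => s + (-1) * RtoC v)%C). apply cder_cexp, DI. apply (cder_plus (fun _ => s)). apply cder_const. apply (cder_scal (-1)%C (fun v => RtoC v)). apply cder_id. }
  assert (E0 : psi 0 = s). { unfold psi, I. replace (cint J 0 0) with (RtoC 0). rewrite cexp_0. ring. unfold cint. rewrite (RInt_point 0 (fun y => Re (J y))), (RInt_point 0 (fun y => Im (J y))). reflexivity. }
  assert (E1 : psi 1 = (cexp (cint J 0 1) * (s - 1))%C) by (unfold psi, I; ring).
  change (Cmod (cexp (cint J 0 1) * (s - 1) - s) <= exp 2 * exp (- T)). rewrite <- E1, <- E0. replace (exp 2 * exp (- T)) with (exp 2 * exp (- T) * (1 - 0)) by ring.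
  apply (cder_mean_value psi (fun v => (J v * cexp (I v)) * (s + (-1) * RtoC v) + cexp (I v) * (0 + (-1) * 1))%C 0 1 (exp 2 * exp (- T))); [lra|intros; apply Dp|]. cbv beta.
  intros v Hv. replace (J v * cexp (I v) * (s + -1 * RtoC v) + cexp (I v) * (0 + -1 * 1))%C with (cexp (I v) * (- ey (s - RtoC v) T))%C.
  2:{ rewrite HJ by auto. field. auto. }
  rewrite Cmod_mult, Cmod_opp, Cmod_cexp. apply Rmult_le_compat; auto. apply Rlt_le, exp_pos. apply Cmod_ge_0.
  apply exp_le_compat. apply Rle_trans with (1 := Re_le_Cmod _). apply Rle_trans with (2 * (v - 0)); [|lra].
  replace (I v) with (I v - I 0)%C. apply (cder_mean_value I J); [lra|intros; apply DI|intros; apply BJ; lra].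
  unfold I. replace (cint J 0 0) with (RtoC 0). ring. unfold cint. rewrite (RInt_point 0 (fun y => Re (J y))), (RInt_point 0 (fun y => Im (J y))). reflexivity.
Qed.

Lemma exp_neg_Y_lim : is_lim_seq (fun n => exp (- Y n)) 0.
Proof.
  apply (is_lim_seq_le_le (fun _ => 0) _ (fun n => / (INR n + 2))).
  - intros n. split. apply Rlt_le, exp_pos. rewrite exp_Ropp. apply Rinv_le_contravar. assert (K := pos_INR n); lra. apply exp_Y.
  - apply is_lim_seq_const.
  - replace (Finite 0) with (Rbar_inv p_infty) by reflexivity. apply is_lim_seq_inv; [|discriminate].
    apply (is_lim_seq_plus _ _ p_infty 2). apply is_lim_seq_INR. apply is_lim_seq_const. reflexivity.
Qed.

Lemma frullani s : 2 <= Re s -> clim (fun n => cexp (Linit 0 (Y n) s)) (s / (s - 1))%C.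
Proof.
  intros Hs. assert (HN : (s - 1)%C <> 0%C). { intros E. assert (X : Re (s - 1)%C = 0) by (rewrite E; reflexivity). replace (Re (s - 1)%C) with (Re s - 1) in X by reflexivity. lra. }
  assert (H0 : clim (fun n => cexp (Linit 0 (Y n) s) * (s - 1) - s)%C 0%C).
  { apply (clim_squeeze _ (fun n => exp 2 * exp (- Y n))). intros n. apply laplace_li; auto. apply Y_nonneg.
    assert (K := is_lim_seq_scal_l _ (exp 2) _ exp_neg_Y_lim). simpl in K. rewrite Rmult_0_r in K. exact K. }
  assert (K : clim (fun n => ((cexp (Linit 0 (Y n) s) * (s - 1) - s) + s) * / (s - 1))%C ((0 + s) * / (s - 1))%C) by (apply clim_mult; [apply clim_plus; auto; apply clim_const|apply clim_const]).
  assert (Z : ((0 + s) * / (s - 1))%C = (s / (s - 1))%C) by (field; auto). rewrite Z in K. apply clim_ext with (2 := K). intros n. field; auto.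
Qed.

(** Two limits of the same partial Euler products: they tend to zeta by expansion into monomials,
    and they split as [exp (Wpart)] times the exponential of the accumulated means, whose limit is
    [s / (s - 1)]. *)
Lemma zeta_formula lam mu s : good lam -> enumerates lam mu -> 2 <= Re s -> zeta mu s = (cexp (W lam s) * (s / (s - 1)))%C.
Proof.
  intros G He Hs.
  apply (clim_unique (fun n => cexp (cpsum (fun j => ey s (lam j) + pl (lam j) s)%C n))).
  - intros eps Heps. destruct (zeta_lmons lam mu s G He Hs (eps / 2) ltac:(lra)) as [N HN]. exists N. intros n Hn.
    apply Rle_lt_trans with (eps / 2); [|lra]. rewrite (euler_partial lam n s G ltac:(lra)).
    apply (clim_bound_dist (fun E => clsum (ey s) (lmons lam n E)) _ _ _ N).
    + apply clim_ext with (fun E => cprod (fun j => cpsum (fun e => Cpow (ey s (lam j)) e) (S E)) n). intros E; symmetry; apply clsum_lmons.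
      apply (clim_cprod (fun E j => cpsum (fun e => Cpow (ey s (lam j)) e) (S E))). intros j _. apply geom_clim.
      apply Rle_lt_trans with (71/100); [|lra]. apply ey_small; [apply good_exp2; auto|apply Rlt_le, lam_pos; auto|lra].
    + intros E HE. apply HN; auto.
  - apply clim_ext with (fun n => cexp (Wpart lam n s) * cexp (Linit 0 (Y n) s))%C.
    + intros n. rewrite <- cexp_plus, Wpart_Linit. reflexivity.
    + apply clim_mult. apply clim_cexp, Wpart_clim; auto; lra. apply frullani; auto.
Qed.

(** * A Gaussian kernel with truncated frequency range *)

Definition gs (d t : R) : R := exp (- (d * d * (t * t)) / 2).
(** The Fourier transform of the Gaussian, cut off at height [L]: close to a multiple of
    [exp (- v^2 / (2 d^2))]. *)
Definition gw (d L v : R) : R := RInt (fun t => gs d t * cos (t * v)) (- L) L.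
(* [(3 cos (t v) + t sin (t v)) / (9 + t^2)] is the real part of [exp (i t v) / (3 + i t)]. *)
Definition gK (d L v : R) : R := RInt (fun t => gs d t * ((3 * cos (t * v) + t * sin (t * v)) / (9 + t * t))) (- L) L.
(** The smoothed Perron kernel on [Re s = 3], a step function in [v] blurred at scale [d], up to a
    constant factor. *)
Definition Ht (d L v : R) : R := exp (3 * v) * gK d L v.

Lemma gs_pos d t : 0 < gs d t.
Proof. apply exp_pos. Qed.
Lemma gs_le1 d t : gs d t <= 1.
Proof. apply exp_le1. assert (0 <= (d * t) * (d * t)) by nra. replace (d * d * (t * t)) with ((d * t) * (d * t)) by ring. lra. Qed.
Lemma gs_cont d t : continuous (gs d) t.
Proof. unfold gs. apply (ex_derive_continuous (fun t => exp (- (d * d * (t * t)) / 2))). auto_derive. auto. Qed.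

Lemma cont2_tv (f : R -> R) x y : (forall z, continuous f z) -> continuity_2d_pt (fun v t => f (t * v)) x y.
Proof. intros H. apply (cont2_comp f (fun v t => t * v)); auto. apply continuity_2d_pt_mult. apply continuity_2d_pt_id2. apply continuity_2d_pt_id1. Qed.

Lemma param_derive (f f' : R -> R -> R) L v : (forall v t, is_derive (fun v => f v t) v (f' v t)) -> (forall v t, continuity_2d_pt f' v t) -> (forall v t, continuous (fun t => f v t) t) ->
  is_derive (fun v => RInt (fun t => f v t) (- L) L) v (RInt (fun t => f' v t) (- L) L).
Proof.
  intros Hd Hc Hf. replace (RInt (fun t => f' v t) (- L) L) with (RInt (fun t => Derive (fun v => f v t) v) (- L) L).
  - apply (is_derive_RInt_param f).
    + exists (mkposreal 1 Rlt_0_1). intros z _ t _. eexists; apply Hd.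
    + intros t _. apply continuity_2d_pt_ext with f'. intros; symmetry; apply is_derive_unique, Hd. apply Hc.
    + exists (mkposreal 1 Rlt_0_1). intros z _. apply ex_RInt_cont; auto.
  - apply RInt_ext. intros; apply is_derive_unique, Hd.
Qed.

Lemma inv9_cont t : continuous (fun t => / (9 + t * t)) t.
Proof. apply (ex_derive_continuous (fun t => / (9 + t * t))). auto_derive. nra. Qed.

(** Differentiation brings down [3 + i t] and cancels the denominator, leaving the truncated
    Gaussian transform. *)
Lemma Ht_derive d L v : is_derive (Ht d L) v (exp (3 * v) * gw d L v).
Proof.
  assert (Ci := inv9_cont). assert (Cg := gs_cont d).
  assert (D : is_derive (gK d L) v (RInt (fun t => gs d t * ((- 3 * t * sin (t * v) + t * t * cos (t * v)) / (9 + t * t))) (- L) L)).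
  { apply (param_derive (fun v t => gs d t * ((3 * cos (t * v) + t * sin (t * v)) / (9 + t * t))) (fun v t => gs d t * ((- 3 * t * sin (t * v) + t * t * cos (t * v)) / (9 + t * t)))).
    - intros u t. set (g := gs d t). auto_derive; auto. field. nra.
    - intros u t. apply continuity_2d_pt_mult. apply (cont2_r (gs d)); auto. apply continuity_2d_pt_mult; [|apply (cont2_r (fun t => / (9 + t * t))); auto].
      apply continuity_2d_pt_plus; (apply continuity_2d_pt_mult; [apply (cont2_r (fun t => _)); cont_tac|]). apply cont2_tv, continuous_Rsin. apply cont2_tv, continuous_Rcos.
    - intros u t. unfold Rdiv. cont_tac. }
  unfold Ht. replace (exp (3 * v) * gw d L v) with (3 * exp (3 * v) * gK d L v + exp (3 * v) * RInt (fun t => gs d t * ((- 3 * t * sin (t * v) + t * t * cos (t * v)) / (9 + t * t))) (- L) L).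
  - apply (Derive.is_derive_mult (fun v => exp (3 * v)) (gK d L)); auto. auto_derive; auto. ring.
  - replace (gw d L v) with (3 * gK d L v + RInt (fun t => gs d t * ((- 3 * t * sin (t * v) + t * t * cos (t * v)) / (9 + t * t))) (- L) L). ring.
    unfold gK, gw. rewrite <- RInt_Rscal by (apply ex_RInt_cont; intros; unfold Rdiv; cont_tac).
    rewrite <- RInt_Rplus by (apply ex_RInt_cont; intros; unfold Rdiv; cont_tac). apply RInt_ext. intros t _. asR. field. nra.
Qed.

Lemma gK_bound d L v : 0 <= L -> Rabs (gK d L v) <= 2 * L.
Proof.
  intros HL. assert (Ci := inv9_cont). assert (Cg := gs_cont d). apply Rle_trans with (RInt (fun _ => 1) (- L) L).
  - apply RInt_abs_le_cont; [lra| | |]. intros; unfold Rdiv; cont_tac. intros; apply continuous_const.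
    intros t _. rewrite Rabs_mult, (Rabs_pos_eq (gs d t)) by (apply Rlt_le, gs_pos).
    assert (B : Rabs ((3 * cos (t * v) + t * sin (t * v)) / (9 + t * t)) <= 1).
    { unfold Rdiv. rewrite Rabs_mult, (Rabs_pos_eq (/ _)) by (apply Rlt_le, Rinv_0_lt_compat; nra).
      apply Rmult_le_reg_r with (9 + t * t); [nra|]. rewrite Rmult_assoc, Rinv_l, Rmult_1_r, Rmult_1_l by nra.
      apply Rle_trans with (1 := Rabs_triang _ _). rewrite 2 Rabs_mult, (Rabs_pos_eq 3) by lra.
      assert (C1 : Rabs (cos (t * v)) <= 1) by apply Rabs_le, COS_bound. assert (C2 : Rabs (sin (t * v)) <= 1) by apply Rabs_le, SIN_bound.
      assert (P := Rabs_pos t). assert (Q := Rabs_pos (sin (t * v))). assert (T : t * t = Rabs t * Rabs t) by (rewrite <- Rabs_mult, Rabs_pos_eq; nra).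
      assert (Rabs t * Rabs (sin (t * v)) <= Rabs t) by nra. rewrite T. assert (Sq := Rle_0_sqr (Rabs t - 1)). unfold Rsqr in Sq. lra. }
    assert (G := gs_le1 d t). assert (G0 := gs_pos d t). assert (P := Rabs_pos ((3 * cos (t * v) + t * sin (t * v)) / (9 + t * t))). nra.
  - rewrite RInt_Rconst. lra.
Qed.

(** Integration by parts, as in the usual proof that a Gaussian is its own transform; the cut-off
    leaves the boundary term with [gs d L]. *)
Lemma gw_derive d L v : 0 < d -> 0 <= L -> is_derive (gw d L) v ((2 * gs d L * sin (L * v) - v * gw d L v) / (d * d)).
Proof.
  intros Hd HL. assert (Cg := gs_cont d).
  assert (D : is_derive (gw d L) v (RInt (fun t => gs d t * (- t * sin (t * v))) (- L) L)).
  { apply (param_derive (fun v t => gs d t * cos (t * v)) (fun v t => gs d t * (- t * sin (t * v)))).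
    - intros u t. set (g := gs d t). auto_derive; auto. ring.
    - intros u t. apply continuity_2d_pt_mult. apply (cont2_r (gs d)); auto. apply continuity_2d_pt_mult. apply (cont2_r (fun t => - t)). cont_tac. apply cont2_tv, continuous_Rsin.
    - intros u t. cont_tac. }
  replace ((2 * gs d L * sin (L * v) - v * gw d L v) / (d * d)) with (RInt (fun t => gs d t * (- t * sin (t * v))) (- L) L); auto.
  assert (P : RInt (fun t => d * d * (gs d t * (- t * sin (t * v))) + v * (gs d t * cos (t * v))) (- L) L = 2 * gs d L * sin (L * v)).
  { rewrite (RInt_FTC (fun t => gs d t * sin (t * v))).
    - replace (gs d (- L)) with (gs d L) by (unfold gs; f_equal; field). rewrite <- Ropp_mult_distr_l, sin_neg. asR. ring.
    - lra.
    - intros t _. replace (d * d * (gs d t * (- t * sin (t * v))) + v * (gs d t * cos (t * v))) with (- (d * d * t) * gs d t * sin (t * v) + gs d t * (v * cos (t * v))) by ring.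
      apply (Derive.is_derive_mult (gs d) (fun t => sin (t * v))). unfold gs. auto_derive; auto. unfold Rdiv. field. auto_derive; auto. ring.
    - intros t _. cont_tac. }
  rewrite RInt_Rplus, 2 RInt_Rscal in P by (apply ex_RInt_cont; intros; cont_tac). fold (gw d L v) in P.
  assert (Sol : forall A : R, d * d * A + v * gw d L v = 2 * gs d L * sin (L * v) -> A = (2 * gs d L * sin (L * v) - v * gw d L v) / (d * d)) by (intros A HA; rewrite <- HA; field; lra).
  apply Sol. exact P.
Qed.

(** The differential equation is solved with the integrating factor [E]; the boundary term
    contributes only a quantity proportional to [gs d L], negligible for large [L]. *)
Lemma gw_gaussian d L v : 0 < d -> 0 <= L -> Rabs (gw d L v - gw d L 0 * exp (- (v * v) / (2 * (d * d)))) <= 2 * gs d L / (d * d) * Rabs v.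
Proof.
  intros Hd HL. set (rho := 2 * gs d L / (d * d)). assert (Hdd : 0 < d * d) by nra. assert (G := gs_pos d L).
  assert (Hrho : 0 < rho) by (unfold rho; apply Rdiv_lt_0_compat; lra).
  set (E := fun v => exp (v * v / (2 * (d * d)))). set (u := fun v => gw d L v * E v).
  set (u' := fun v => 2 * gs d L * sin (L * v) / (d * d) * E v).
  assert (Du : forall x, is_derive u x (u' x)).
  { intros x. unfold u, u'. replace (2 * gs d L * sin (L * x) / (d * d) * E x) with ((2 * gs d L * sin (L * x) - x * gw d L x) / (d * d) * E x + gw d L x * (x / (d * d) * E x)) by (field; lra).
    apply (Derive.is_derive_mult (gw d L) E). apply gw_derive; auto. unfold E. auto_derive; auto. unfold Rdiv. field. lra. }
  assert (Bu : forall x, Rabs x <= Rabs v -> Rabs (u' x) <= rho * E v).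
  { intros x Hx. unfold u'. rewrite Rabs_mult, (Rabs_pos_eq (E x)) by (apply Rlt_le, exp_pos). apply Rmult_le_compat. apply Rabs_pos. apply Rlt_le, exp_pos.
    - replace (2 * gs d L * sin (L * x) / (d * d)) with (rho * sin (L * x)) by (unfold rho; field; lra). rewrite Rabs_mult, (Rabs_pos_eq rho) by lra.
      assert (C2 : Rabs (sin (L * x)) <= 1) by apply Rabs_le, SIN_bound. nra.
    - unfold E. apply exp_le_compat. unfold Rdiv. apply Rmult_le_compat_r. apply Rlt_le, Rinv_0_lt_compat; lra.
      rewrite <- (Rabs_pos_eq (x * x)), <- (Rabs_pos_eq (v * v)), 2 Rabs_mult by nra. assert (P := Rabs_pos x). nra. }
  assert (K := bounded_variation u u' (rho * E v) 0 v). rewrite Rminus_0_r in K.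
  assert (K' : Rabs (u v - u 0) <= rho * E v * Rabs v). { apply K. intros t Ht. rewrite Rminus_0_r in Ht. split; auto. }
  assert (E0 : E 0 = 1) by (unfold E; rewrite Rmult_0_l; unfold Rdiv; rewrite Rmult_0_l; apply exp_0).
  assert (EE : E v * exp (- (v * v) / (2 * (d * d))) = 1) by (unfold E; rewrite <- exp_plus, <- exp_0; f_equal; field; lra).
  set (e := exp (- (v * v) / (2 * (d * d)))) in *. assert (He : 0 < e) by apply exp_pos.
  replace (gw d L v - gw d L 0 * e) with ((u v - u 0) * e).
  - rewrite Rabs_mult, (Rabs_pos_eq e) by lra. apply Rle_trans with (rho * E v * Rabs v * e). apply Rmult_le_compat_r; lra.
    replace (rho * E v * Rabs v * e) with (rho * Rabs v * (E v * e)) by ring. rewrite EE. lra.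
  - unfold u. rewrite E0. replace ((gw d L v * E v - gw d L 0 * 1) * e) with (gw d L v * (E v * e) - gw d L 0 * e) by ring. rewrite EE. ring.
Qed.

(** The Gaussian is below [2 / (1 + (d t)^2)], whose integral is an arctangent; this avoids the
    exact Gaussian integral. *)
Lemma gw0_upper d L : 0 < d -> 0 <= L -> 0 <= gw d L 0 <= 8 / d.
Proof.
  intros Hd HL. assert (Cg := gs_cont d). assert (E : gw d L 0 = RInt (gs d) (- L) L). { unfold gw. apply RInt_ext. intros t _. rewrite Rmult_0_r, cos_0. asR; ring. }
  rewrite E. split. apply RInt_nonneg; auto; [lra|]. intros; apply Rlt_le, gs_pos.
  apply Rle_trans with (RInt (fun t => 2 / (1 + d * t * (d * t))) (- L) L).
  - apply RInt_le_cont; [lra|auto| |].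
    + intros t _. apply (ex_derive_continuous (fun t => 2 / (1 + d * t * (d * t)))). auto_derive. nra.
    + intros t _. unfold gs. replace (- (d * d * (t * t)) / 2) with (- (d * t * (d * t) / 2)) by field. rewrite exp_Ropp.
      assert (K := exp_ineq1_le (d * t * (d * t) / 2)). replace (2 / (1 + d * t * (d * t))) with (/ ((1 + d * t * (d * t)) / 2)) by (field; nra).
      apply Rinv_le_contravar. nra. lra.
  - rewrite (RInt_FTC (fun t => 2 / d * atan (d * t))).
    + assert (A1 := atan_bound (d * L)). assert (A2 := atan_bound (d * - L)). assert (P4 := PI_4).
      replace (8 / d) with (2 / d * 4) by (field; lra). rewrite <- Rmult_minus_distr_l. apply Rmult_le_compat_l. apply Rlt_le, Rdiv_lt_0_compat; lra. lra.
    + lra.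
    + intros t _. auto_derive; auto. simpl. field. split; nra.
    + intros t _. apply (ex_derive_continuous (fun t => 2 / (1 + d * t * (d * t)))). auto_derive. nra.
Qed.

Lemma exp_half_low : / 2 <= exp (- / 2).
Proof. assert (K := exp_ineq1_le (- / 2)). lra. Qed.

Lemma gw0_lower d L : 0 < d -> / d <= L -> / 2 / d <= gw d L 0.
Proof.
  intros Hd HL. assert (Hi : 0 < / d) by (apply Rinv_0_lt_compat; auto). assert (Cg := gs_cont d). assert (E : gw d L 0 = RInt (gs d) (- L) L). { unfold gw. apply RInt_ext. intros t _. rewrite Rmult_0_r, cos_0. asR; ring. }
  rewrite E. rewrite <- (RInt_cat (gs d) (- L) 0 L) by (apply ex_RInt_cont; auto). rewrite <- (RInt_cat (gs d) 0 (/ d) L) by (apply ex_RInt_cont; auto).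
  assert (0 <= RInt (gs d) (- L) 0) by (apply RInt_nonneg; auto; [lra|]; intros; apply Rlt_le, gs_pos).
  assert (0 <= RInt (gs d) (/ d) L) by (apply RInt_nonneg; auto; intros; apply Rlt_le, gs_pos).
  assert (RInt (fun _ => / 2) 0 (/ d) <= RInt (gs d) 0 (/ d)).
  { apply RInt_le_cont; auto; [lra| |]. intros; apply continuous_const. intros t Ht. apply Rle_trans with (1 := exp_half_low). unfold gs. apply exp_le_compat.
    assert (0 <= d * t <= 1). { split; [nra|]. apply Rle_trans with (d * / d). apply Rmult_le_compat_l; lra. rewrite Rinv_r; lra. } nra. }
  rewrite RInt_Rconst in H1. unfold Rdiv. lra.
Qed.

(** The derivative of [Ht] with the truncated transform replaced by its Gaussian. [gc] is the height
    of the resulting step across [[- eta, eta]], and [theta] collects the Gaussian mass outside and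
    the truncation error. *)
Definition gG (d L u : R) : R := exp (3 * u) * (gw d L 0 * exp (- (u * u) / (2 * (d * d)))).
Definition gc (d L eta : R) : R := RInt (gG d L) (- eta) eta.
Definition theta (d L eta : R) : R := 2 * (gw d L 0 * exp (- (eta * eta) / (2 * (d * d))) + 2 * gs d L / (d * d)).

Lemma gG_cont d L u : 0 < d -> continuous (gG d L) u.
Proof. intros Hd. unfold gG. set (w := gw d L 0). apply (ex_derive_continuous (fun u => exp (3 * u) * (w * exp (- (u * u) / (2 * (d * d)))))). auto_derive. auto. Qed.

Lemma gc_lower d L eta : 0 < d <= 1 -> / d <= L -> d <= eta -> / 8 <= gc d L eta.
Proof.
  intros Hd HL He. assert (Cg := fun u => gG_cont d L u (proj1 Hd)). assert (W := gw0_lower d L (proj1 Hd) HL).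
  assert (Hi : 0 < / d) by (apply Rinv_0_lt_compat; lra). assert (W0 : 0 <= gw d L 0) by (unfold Rdiv in W; nra).
  assert (Gp : forall u, 0 <= gG d L u) by (intros u; unfold gG; apply Rmult_le_pos; [apply Rlt_le, exp_pos|apply Rmult_le_pos; [auto|apply Rlt_le, exp_pos]]).
  unfold gc. rewrite <- (RInt_cat (gG d L) (- eta) 0 eta) by (apply ex_RInt_cont; auto). rewrite <- (RInt_cat (gG d L) 0 d eta) by (apply ex_RInt_cont; auto).
  assert (0 <= RInt (gG d L) (- eta) 0) by (apply RInt_nonneg; auto; lra). assert (0 <= RInt (gG d L) d eta) by (apply RInt_nonneg; auto).
  assert (RInt (fun _ => / 2 / d * / 2) 0 d <= RInt (gG d L) 0 d).
  { apply RInt_le_cont; auto; [lra| |]. intros; apply continuous_const. intros u Hu. unfold gG.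
    assert (E1 : 1 <= exp (3 * u)) by (assert (X := exp_ineq1_le (3 * u)); lra).
    assert (E2 : / 2 <= exp (- (u * u) / (2 * (d * d)))). { apply Rle_trans with (1 := exp_half_low). apply exp_le_compat. apply Rmult_le_reg_r with (2 * (d * d)); [nra|]. replace (- (u * u) / (2 * (d * d)) * (2 * (d * d))) with (- (u * u)) by (field; nra). nra. }
    assert (E3 : / 2 / d * / 2 <= gw d L 0 * exp (- (u * u) / (2 * (d * d)))). { apply Rmult_le_compat; lra. }
    assert (0 <= / 2 / d * / 2) by (unfold Rdiv; nra). nra. }
  rewrite RInt_Rconst in H1. replace (/ 2 / d * / 2 * (d - 0)) with (/ 4) in H1 by (field; lra). lra.
Qed.

(** Replaces the weights [exp (3 u)] and [|u| * exp (3 u)] by pure exponentials. Both exponents are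
    at least 2, so the errors can be summed over the integers. *)
Lemma exp23 u : exp (3 * u) <= exp (2 * u) + exp (4 * u) /\ Rabs u * exp (3 * u) <= exp (2 * u) + exp (4 * u).
Proof.
  assert (H : Rabs u <= exp (- u) + exp u).
  { assert (A := exp_ineq1_le u). assert (B := exp_ineq1_le (- u)). assert (PA := exp_pos u). assert (PB := exp_pos (- u)). unfold Rabs. destruct Rcase_abs; lra. }
  assert (H1 : 1 <= exp (- u) + exp u). { assert (A := exp_ineq1_le u). assert (B := exp_ineq1_le (- u)). lra. }
  assert (E2 : exp (2 * u) = exp (- u) * exp (3 * u)) by (rewrite <- exp_plus; f_equal; ring).
  assert (E4 : exp (4 * u) = exp u * exp (3 * u)) by (rewrite <- exp_plus; f_equal; ring).
  assert (P := exp_pos (3 * u)). rewrite E2, E4. split; nra.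
Qed.

(** [Ht] is 0 to the left of [- eta], [gc] to the right of [eta] and in between elsewhere, up to
    errors. Increments are compared with those of the primitive of [gG], starting from minus
    infinity, where [Ht] vanishes thanks to [exp (3 v)]. *)
Lemma Ht_sandwich d L eta v : 0 < d -> 0 <= L -> 0 <= eta ->
  (eta <= v -> gc d L eta - theta d L eta * (exp (2 * v) + exp (4 * v)) <= Ht d L v) /\
  (v <= - eta -> Ht d L v <= theta d L eta * (exp (2 * v) + exp (4 * v))) /\
  - theta d L eta * (exp (2 * v) + exp (4 * v)) <= Ht d L v <= gc d L eta + theta d L eta * (exp (2 * v) + exp (4 * v)).
Proof.
  intros Hd HL He. assert (Cg := fun u => gG_cont d L u Hd). destruct (gw0_upper d L Hd HL) as [W0 _].
  set (kap := gw d L 0 * exp (- (eta * eta) / (2 * (d * d)))). set (rho := 2 * gs d L / (d * d)).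
  assert (Hdd : 0 < d * d) by nra.
  assert (Hrho : 0 < rho) by (unfold rho; apply Rdiv_lt_0_compat; [assert (X := gs_pos d L); lra|auto]).
  assert (Hkap : 0 <= kap) by (unfold kap; apply Rmult_le_pos; [auto|apply Rlt_le, exp_pos]).
  assert (Gp : forall u, 0 <= gG d L u) by (intros u; unfold gG; apply Rmult_le_pos; [apply Rlt_le, exp_pos|apply Rmult_le_pos; [auto|apply Rlt_le, exp_pos]]).
  assert (Gk : forall u, eta <= Rabs u -> gG d L u <= kap * exp (3 * u)).
  { intros u Hu. unfold gG. rewrite Rmult_comm. apply Rmult_le_compat_r. apply Rlt_le, exp_pos. apply Rmult_le_compat_l; auto. apply exp_le_compat.
    unfold Rdiv. apply Rmult_le_compat_r. apply Rlt_le, Rinv_0_lt_compat; lra. assert (u * u = Rabs u * Rabs u) by (rewrite <- Rabs_mult, Rabs_pos_eq; nra). nra. }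
  set (Q := fun v => exp (2 * v) + exp (4 * v)). assert (Qp : forall v, 0 < Q v) by (intros u; unfold Q; assert (A := exp_pos (2 * u)); assert (B := exp_pos (4 * u)); lra).
  assert (Qm : forall a b, a <= b -> Q a <= Q b) by (intros a b Hab; unfold Q; apply Rplus_le_compat; apply exp_le_compat; lra).
  (* increments of [Ht] and of the primitive of [gG] agree up to [rho Q] *)
  assert (Inc : forall a b, a <= b -> Rabs (Ht d L b - Ht d L a - RInt (gG d L) a b) <= rho * Q b).
  { intros a b Hab. set (D := fun x => Ht d L x - RInt (gG d L) a x).
    assert (DD : forall x, is_derive D x (exp (3 * x) * gw d L x - gG d L x)).
    { intros x. apply (is_derive_minus (K:=R_AbsRing) (V:=R_NormedModule) (Ht d L)). apply Ht_derive. apply (is_derive_RInt_cont (gG d L)); auto. }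
    set (P := fun x => rho * (exp (2 * x) / 2 + exp (4 * x) / 4)).
    assert (DP : forall x, is_derive P x (rho * Q x)) by (intros x; unfold P, Q; auto_derive; auto; field).
    assert (Bd : forall x, Rabs (exp (3 * x) * gw d L x - gG d L x) <= rho * Q x).
    { intros x. unfold gG. rewrite <- Rmult_minus_distr_l, Rabs_mult, (Rabs_pos_eq (exp _)) by (apply Rlt_le, exp_pos).
      apply Rle_trans with (exp (3 * x) * (rho * Rabs x)). apply Rmult_le_compat_l. apply Rlt_le, exp_pos. apply gw_gaussian; auto.
      destruct (exp23 x) as [_ E]. replace (exp (3 * x) * (rho * Rabs x)) with (rho * (Rabs x * exp (3 * x))) by ring. apply Rmult_le_compat_l; [lra|exact E]. }
    assert (PP : 0 <= P a /\ P b <= rho * Q b). { assert (A := exp_pos (2 * a)). assert (B := exp_pos (4 * a)). assert (A' := exp_pos (2 * b)). assert (B' := exp_pos (4 * b)). unfold P, Q. split; nra. }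
    replace (Ht d L b - Ht d L a - RInt (gG d L) a b) with (D b - D a).
    2:{ unfold D. rewrite RInt_point. unfold zero; simpl. ring. }
    assert (U : D b - P b <= D a - P a).
    { assert (K := derive_upper (fun x => D x - P x) (fun x => exp (3 * x) * gw d L x - gG d L x - rho * Q x) a b 0 Hab).
      cut (D b - P b - (D a - P a) <= 0 * (b - a)); [lra|]. apply K. intros; apply (is_derive_minus (K:=R_AbsRing) (V:=R_NormedModule) D P); auto.
      intros x _. specialize (Bd x). apply Rabs_le_between in Bd. lra. }
    assert (V : - D b - P b <= - D a - P a).
    { assert (K := derive_upper (fun x => - D x - P x) (fun x => - (exp (3 * x) * gw d L x - gG d L x) - rho * Q x) a b 0 Hab).
      cut (- D b - P b - (- D a - P a) <= 0 * (b - a)); [lra|]. apply K. intros; apply (is_derive_minus (K:=R_AbsRing) (V:=R_NormedModule) (fun x => - D x) P); auto. apply (is_derive_opp D); auto.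
      intros x _. specialize (Bd x). apply Rabs_le_between in Bd. lra. }
    apply Rabs_le. lra. }
  assert (IntK : forall a b, a <= b -> (forall u, a < u < b -> eta <= Rabs u) -> 0 <= RInt (gG d L) a b <= kap * Q b).
  { intros a b Hab H. split. apply RInt_nonneg; auto.
    apply Rle_trans with (RInt (fun u => kap * exp (3 * u)) a b).
    - apply RInt_le_cont; auto. intros; cont_tac.
    - rewrite (RInt_FTC (fun u => kap * (exp (3 * u) / 3))); auto.
      + destruct (exp23 b) as [E _]. fold (Q b) in E. assert (A := exp_pos (3 * a)). assert (B := exp_pos (3 * b)). nra.
      + intros; auto_derive; auto. field.
      + intros; cont_tac. }
  assert (Left : forall x, x <= - eta -> Rabs (Ht d L x) <= (kap + rho) * Q x).
  { intros x Hx. apply Rnot_lt_le. intros Hlt. set (gap := Rabs (Ht d L x) - (kap + rho) * Q x). assert (Hgap : 0 < gap) by (unfold gap; lra).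
    (* A point so far to the left that the crude bound [2 * L * exp (3 * a)] on [Ht] is below the
       supposed gap. *)
    set (a := Rmin x ((ln (gap / (2 * L + 1)) - 1) / 3)). assert (Hax : a <= x) by apply Rmin_l.
    assert (Ha : exp (3 * a) * (2 * L) < gap).
    { assert (Hq : 0 < gap / (2 * L + 1)) by (apply Rdiv_lt_0_compat; lra). assert (Ha2 : 3 * a < ln (gap / (2 * L + 1))). { assert (X := Rmin_r x ((ln (gap / (2 * L + 1)) - 1) / 3)). fold a in X. lra. }
      apply exp_increasing in Ha2. rewrite exp_ln in Ha2 by auto. assert (E := exp_pos (3 * a)).
      apply Rle_lt_trans with (exp (3 * a) * (2 * L + 1)). nra. apply Rlt_le_trans with (gap / (2 * L + 1) * (2 * L + 1)). apply Rmult_lt_compat_r; lra. right; field; lra. }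
    assert (I1 := Inc a x Hax). destruct (IntK a x Hax) as [I2 I3]. { intros u Hu. rewrite Rabs_left1; lra. }
    assert (B : Rabs (Ht d L a) <= exp (3 * a) * (2 * L)). { unfold Ht. rewrite Rabs_mult, (Rabs_pos_eq (exp _)) by (apply Rlt_le, exp_pos). apply Rmult_le_compat_l. apply Rlt_le, exp_pos. apply gK_bound; auto. }
    assert (T : Rabs (Ht d L x) <= Rabs (Ht d L a) + (kap * Q x + rho * Q x)).
    { apply Rabs_le_between in I1. replace (Ht d L x) with (Ht d L a + (Ht d L x - Ht d L a)) by ring. apply Rle_trans with (1 := Rabs_triang _ _). apply Rplus_le_compat_l. apply Rabs_le. lra. }
    unfold gap in *. lra. }
  assert (Hc : gc d L eta = RInt (gG d L) (- eta) eta) by reflexivity.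
  assert (Hc0 : 0 <= gc d L eta) by (rewrite Hc; apply RInt_nonneg; auto; lra).
  assert (Le := Left (- eta) ltac:(lra)). apply Rabs_le_between in Le.
  unfold theta. fold kap rho. fold (Q v).
  destruct (Rle_dec v (- eta)) as [C1|C1].
  - assert (LL := Left v C1). apply Rabs_le_between in LL. assert (Qv := Qp v).
    assert (HkQ : 0 <= kap * Q v) by nra. assert (HrQ : 0 <= rho * Q v) by nra.
    split; [|split; [|split]]; intros; try lra.
    (* only possible for [eta = v = 0] *)
    assert (E0 : eta = 0) by lra. assert (Z : gc d L eta = 0) by (rewrite Hc, E0, Ropp_0; apply (RInt_point 0 (gG d L))). lra.
  - apply Rnot_le_lt in C1. assert (I1 := Inc (- eta) v ltac:(lra)). apply Rabs_le_between in I1. assert (Qle := Qm (- eta) v ltac:(lra)). assert (Qv := Qp v). assert (Qe := Qp (- eta)).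
    assert (HQ : (kap + rho) * Q (- eta) <= (kap + rho) * Q v) by (apply Rmult_le_compat_l; lra).
    assert (HkQ : 0 <= kap * Q v) by nra. assert (HrQ : 0 <= rho * Q v) by nra.
    destruct (Rle_dec eta v) as [C2|C2].
    + destruct (IntK eta v C2) as [J1 J2]. { intros u Hu. rewrite Rabs_pos_eq; lra. }
      assert (Ca := RInt_cat (gG d L) (- eta) eta v ltac:(apply ex_RInt_cont; auto) ltac:(apply ex_RInt_cont; auto)). rewrite <- Ca, <- Hc in I1.
      split; [|split; [|split]]; intros; lra.
    + apply Rnot_le_lt in C2. assert (Ca := RInt_cat (gG d L) (- eta) v eta ltac:(apply ex_RInt_cont; auto) ltac:(apply ex_RInt_cont; auto)). rewrite <- Hc in Ca.
      assert (0 <= RInt (gG d L) v eta) by (apply RInt_nonneg; auto; lra). assert (0 <= RInt (gG d L) (- eta) v) by (apply RInt_nonneg; auto; lra).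
      split; [|split; [|split]]; intros; try lra; nra.
Qed.

(** * The smoothed Perron integral and its contour shift *)

Definition Fz (lam : nat -> R) (s : C) : C := cexp (W lam s).
(** The Gaussian is centred at 3, so that on the line of absolute convergence it is exactly the real
    weight [gs d t]. *)
Definition gz (d : R) (s : C) : C := cexp (RtoC (d * d / 2) * ((s - 3) * (s - 3))).
Definition phi (lam : nat -> R) (d x t : R) : C := (Fz lam (x, t) * gz d (x, t) * / ((x, t) - 1))%C.
Definition ez (y x t : R) : C := cexp (RtoC y * ((x, t) - 1)).
(* The integrand is [zeta s / s * exp (d^2 (s - 3)^2 / 2) * exp (y (s - 1))] at [s = x + i t]. *)
Definition BB (lam : nat -> R) (d L x y : R) : R := RInt (fun t => Re (phi lam d x t * ez y x t)) (- L) L.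

Lemma ez_formula y x t : ez y x t = (exp (y * (x - 1)) * cos (y * t), exp (y * (x - 1)) * sin (y * t)).
Proof.
  unfold ez, cexp, Cmult, Cminus, Cplus, Copp, RtoC, Re, Im; simpl.
  replace (y * (x + - (1)) - 0 * (t + - 0)) with (y * (x - 1)) by ring. replace (y * (t + - 0) + 0 * (x + - (1))) with (y * t) by ring. reflexivity.
Qed.

Lemma ez_mult_Re p y x t : Re (p * ez y x t)%C = exp (y * (x - 1)) * (Re p * cos (y * t) - Im p * sin (y * t)).
Proof. rewrite ez_formula. unfold Cmult, Re, Im; simpl. ring. Qed.

(** The derivative in [y] multiplies the integrand by [s - 1]: the device that removes the pole. *)
Lemma line_integral_derive (p : R -> C) L x y : ccont p ->
  is_derive (fun y => RInt (fun t => Re (p t * ez y x t)) (- L) L) y (RInt (fun t => Re (p t * ((x, t) - 1) * ez y x t)) (- L) L).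
Proof.
  intros [H1 H2].
  apply is_derive_ext with (fun y => RInt (fun t => exp (y * (x - 1)) * (Re (p t) * cos (y * t) - Im (p t) * sin (y * t))) (- L) L).
  { intros z. apply RInt_ext. intros t _. symmetry. apply ez_mult_Re. }
  set (f' := fun y t => exp (y * (x - 1)) * ((Re (p t) * (x - 1) - Im (p t) * t) * cos (y * t) - (Re (p t) * t + Im (p t) * (x - 1)) * sin (y * t))).
  replace (RInt (fun t => Re (p t * ((x, t) - 1) * ez y x t)) (- L) L) with (RInt (fun t => f' y t) (- L) L).
  2:{ apply RInt_ext. intros t _. rewrite ez_mult_Re. unfold f', Cmult, Cminus, Cplus, Copp, RtoC, Re, Im; simpl. asR. ring. }
  assert (Ce : forall z, continuous (fun y => exp (y * (x - 1))) z) by (intros; cont_tac).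
  assert (Ct : forall (f : R -> R) a b, (forall z, continuous f z) -> continuity_2d_pt (fun y t => f (y * t)) a b).
  { intros f a b Hf. apply (cont2_comp f (fun y t => y * t)); auto. apply continuity_2d_pt_mult. apply continuity_2d_pt_id1. apply continuity_2d_pt_id2. }
  apply (param_derive (fun y t => exp (y * (x - 1)) * (Re (p t) * cos (y * t) - Im (p t) * sin (y * t))) f').
  - intros v t. unfold f'. set (a := Re (p t)). set (b := Im (p t)). auto_derive; auto. ring.
  - intros v t. unfold f'. apply continuity_2d_pt_mult. apply (cont2_l (fun y => exp (y * (x - 1)))); auto.
    apply continuity_2d_pt_minus; apply continuity_2d_pt_mult.
    + apply (cont2_r (fun t => Re (p t) * (x - 1) - Im (p t) * t)). cont_tac.
    + apply Ct, continuous_Rcos.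
    + apply (cont2_r (fun t => Re (p t) * t + Im (p t) * (x - 1))). cont_tac.
    + apply Ct, continuous_Rsin.
  - intros v t. cont_tac.
Qed.

Lemma qd_Fg lam d : good lam -> exists D, qd rhalf (fun s => Fz lam s * gz d s)%C D.
Proof.
  intros G. eexists. apply qd_mult. apply qd_cexp. apply W_qd; auto.
  set (k := RtoC (d * d / 2)).
  apply (qd_ext rhalf (fun s => cexp (9 * k + (- (6) * k) * s + k * (s * s))%C)
    (fun s => (- (6) * k + k * (s + s)) * cexp (9 * k + (- (6) * k) * s + k * (s * s)))%C).
  - intros s. unfold gz. fold k. f_equal. ring.
  - intros s. reflexivity.
  - apply qd_cexp. apply qd_poly.
Qed.

Lemma line_ccont (U : C -> Prop) f D x : qd U f D -> (forall t, U (x, t)) -> ccont (fun t => f (x, t)).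
Proof.
  intros H HU. split; intros t; destruct (qd_cont2 U f D x t H (HU t)) as (C1 & C2 & _).
  apply (cont2_slice_r (fun x t => Re (f (x, t)))); auto. apply (cont2_slice_r (fun x t => Im (f (x, t)))); auto.
Qed.

Lemma phi_ccont lam d x : good lam -> / 2 < x -> x <> 1 -> ccont (fun t => phi lam d x t).
Proof.
  intros G Hx Hx1. destruct (qd_Fg lam d G) as [D HD].
  apply (line_ccont (fun s => rhalf s /\ s <> 1%C) (fun s => Fz lam s * gz d s * / (s - 1))%C (fun s => D s * / (s - 1) + Fz lam s * gz d s * - / ((s - 1) * (s - 1)))%C x).
  - apply (qd_mult _ (fun s => Fz lam s * gz d s)%C D). apply (qd_sub rhalf); auto. intros s [H _]; auto. apply (qd_sub (fun s => s <> 1%C)). intros s [_ H]; auto. apply qd_inv.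
  - intros t. split. exact Hx. intros E. apply Hx1. injection E. auto.
Qed.

Lemma phi_cancel lam d x t : x <> 1 -> (phi lam d x t * ((x, t) - 1))%C = (Fz lam (x, t) * gz d (x, t))%C.
Proof.
  intros Hx. unfold phi. field. intros E. apply Hx. assert (X : Re ((x, t) - 1)%C = 0) by (rewrite E; reflexivity). unfold Cminus, Cplus, Copp, RtoC, Re in X; simpl in X. lra.
Qed.

(** The [y]-derivative of [BB]; its integrand is analytic on the whole of [Re s > 1/2]. *)
Definition JJ (lam : nat -> R) (d L x y : R) : R := RInt (fun t => Re (Fz lam (x, t) * gz d (x, t) * ez y x t)) (- L) L.

Lemma BB_derive lam d L x y : good lam -> / 2 < x -> x <> 1 -> is_derive (BB lam d L x) y (JJ lam d L x y).
Proof.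
  intros G Hx Hx1. replace (JJ lam d L x y) with (RInt (fun t => Re (phi lam d x t * ((x, t) - 1) * ez y x t)) (- L) L).
  apply (line_integral_derive (fun t => phi lam d x t)). apply phi_ccont; auto.
  apply RInt_ext. intros t _. rewrite phi_cancel; auto.
Qed.

Lemma Cmod_pair a b : Cmod (a, b) <= Rabs a + Rabs b.
Proof.
  replace ((a, b) : C) with (RtoC a + RtoC b * Ci)%C by (unfold Cplus, Cmult, RtoC, Ci; simpl; f_equal; ring).
  apply Rle_trans with (1 := Cmod_triangle _ _). rewrite Cmod_mult, 2 Cmod_R, Cmod_Ci. lra.
Qed.

Lemma gz_Cmod d x t : Cmod (gz d (x, t)) = exp (d * d / 2 * ((x - 3) * (x - 3))) * gs d t.
Proof.
  unfold gz, gs. rewrite Cmod_cexp, <- exp_plus. f_equal. unfold Cmult, Cminus, Cplus, Copp, RtoC, Re; simpl. field.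
Qed.
Lemma gz_bound d x t : 0 < d <= 1 -> / 2 <= x <= 3 -> Cmod (gz d (x, t)) <= exp 4 * gs d t.
Proof.
  intros Hd Hx. rewrite gz_Cmod. apply Rmult_le_compat_r. apply Rlt_le, gs_pos. apply exp_le_compat.
  assert (H1 : d * d <= 1) by nra. assert (H2 : (x - 3) * (x - 3) <= 25 / 4) by nra. assert (0 <= (x - 3) * (x - 3)) by nra. nra.
Qed.

Lemma ez_Cmod y x t : Cmod (ez y x t) = exp (y * (x - 1)).
Proof. unfold ez. rewrite Cmod_cexp. f_equal. unfold Cmult, Cminus, Cplus, Copp, RtoC, Re; simpl. ring. Qed.

Lemma horizontal_bound lam s1 : good lam -> / 2 < s1 -> exists K, 0 <= K /\ forall d L x y t, 0 < d <= 1 -> 0 <= L -> s1 <= x <= 3 -> Rabs t = L -> 0 <= y ->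
  Cmod (Fz lam (x, t) * gz d (x, t) * ez y x t) <= exp (K * (4 + L) + 4 + 2 * y) * gs d L.
Proof.
  intros G Hs1. destruct (W_bound lam s1 G Hs1) as (K & HK & H). exists K. split; auto. intros d L x y t Hd HL Hx Ht Hy.
  rewrite 2 Cmod_mult. unfold Fz. rewrite Cmod_cexp, ez_Cmod.
  assert (Hgs : gs d L = gs d t) by (unfold gs; rewrite <- Ht; replace (Rabs t * Rabs t) with (t * t) by (rewrite <- Rabs_mult, Rabs_pos_eq; nra); reflexivity).
  assert (E1 : Re (W lam (x, t)) <= K * (4 + L)).
  { apply Rle_trans with (1 := Re_le_Cmod _). apply Rle_trans with (1 := H (x, t) ltac:(simpl; lra)). apply Rmult_le_compat_l; auto.
    assert (C := Cmod_pair x t). rewrite Ht, Rabs_pos_eq in C by lra. lra. }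
  assert (E2 := gz_bound d x t Hd ltac:(lra)). assert (E3 : y * (x - 1) <= 2 * y) by nra.
  rewrite Hgs. assert (Gp := gs_pos d t).
  replace (exp (K * (4 + L) + 4 + 2 * y) * gs d t) with (exp (K * (4 + L)) * (exp 4 * gs d t) * exp (2 * y)) by (rewrite 2 exp_plus; ring).
  apply Rmult_le_compat; [|apply Rlt_le, exp_pos| |apply exp_le_compat; lra].
  apply Rmult_le_pos; [apply Rlt_le, exp_pos|apply Cmod_ge_0].
  apply Rmult_le_compat; auto. apply Rlt_le, exp_pos. apply Cmod_ge_0. apply exp_le_compat; auto.
Qed.

(** The contour is shifted for [JJ], where no pole is crossed, and the estimate is integrated from
    [y] to [y0]. The horizontal sides have length at most 3, giving the factor [2 * 3]. *)
Lemma shift_bound lam s1 : good lam -> / 2 < s1 < 1 -> exists K, 0 <= K /\ forall d L y y0, 0 < d <= 1 -> 0 <= L -> 0 <= y -> y <= y0 ->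
  Rabs ((BB lam d L 3 y0 - BB lam d L 3 y) - (BB lam d L s1 y0 - BB lam d L s1 y)) <= 6 * (exp (K * (4 + L) + 4 + 2 * y0) * gs d L) * (y0 - y).
Proof.
  intros G Hs1. destruct (horizontal_bound lam s1 G ltac:(lra)) as (K & HK & HB). exists K. split; auto. intros d L y y0 Hd HL Hy Hyy.
  set (M := exp (K * (4 + L) + 4 + 2 * y0) * gs d L). assert (HM : 0 < M) by (apply Rmult_lt_0_compat; [apply exp_pos|apply gs_pos]).
  destruct (qd_Fg lam d G) as [D HD].
  assert (Sh : forall v, y <= v <= y0 -> Rabs (JJ lam d L 3 v - JJ lam d L s1 v) <= 6 * M).
  { intros v Hv.
    assert (Qe : qd rhalf (fun s => cexp (RtoC (- v) + RtoC v * s + 0 * (s * s))%C) (fun s => (RtoC v + 0 * (s + s)) * cexp (RtoC (- v) + RtoC v * s + 0 * (s * s)))%C) by (apply qd_cexp, qd_poly).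
    assert (Ee : forall s : C, cexp (RtoC (- v) + RtoC v * s + 0 * (s * s))%C = cexp (RtoC v * (s - 1))%C) by (intros s; f_equal; rewrite RtoC_opp; ring).
    assert (QH := qd_mult rhalf _ _ _ _ HD Qe).
    assert (K1 := contour_shift _ _ (/ 2) s1 3 L M ltac:(lra) ltac:(lra) HL QH). cbv beta in K1.
    assert (EJ : forall x, JJ lam d L x v = RInt (fun t => Re (Fz lam (x, t) * gz d (x, t) * cexp (RtoC (- v) + RtoC v * (x, t) + 0 * ((x, t) * (x, t))))%C) (- L) L).
    { intros x. apply RInt_ext. intros t _. rewrite Ee. reflexivity. }
    rewrite 2 EJ. apply Rle_trans with (2 * M * (3 - s1)); [|nra]. apply K1. intros x Hx.
    rewrite 2 Ee. assert (Mv : exp (K * (4 + L) + 4 + 2 * v) * gs d L <= M). { unfold M. apply Rmult_le_compat_r. apply Rlt_le, gs_pos. apply exp_le_compat. lra. }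
    split; apply Rle_trans with (2 := Mv); apply HB; auto; try lra. rewrite Rabs_pos_eq; lra. rewrite Rabs_Ropp, Rabs_pos_eq; lra. }
  set (f := fun v => BB lam d L 3 v - BB lam d L s1 v).
  assert (Df : forall v, is_derive f v (JJ lam d L 3 v - JJ lam d L s1 v)).
  { intros v. apply (is_derive_minus (K:=R_AbsRing) (V:=R_NormedModule) (BB lam d L 3) (BB lam d L s1)); apply BB_derive; auto; lra. }
  replace (BB lam d L 3 y0 - BB lam d L 3 y - (BB lam d L s1 y0 - BB lam d L s1 y)) with (f y0 - f y) by (unfold f; ring).
  apply Rabs_le. split.
  - assert (K1 := derive_upper (fun v => - f v) (fun v => - (JJ lam d L 3 v - JJ lam d L s1 v)) y y0 (6 * M) Hyy).
    cut (- f y0 - - f y <= 6 * M * (y0 - y)); [lra|]. apply K1. intros; apply (is_derive_opp f); auto. intros v Hv. specialize (Sh v Hv). apply Rabs_le_between in Sh. lra.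
  - apply (derive_upper f (fun v => JJ lam d L 3 v - JJ lam d L s1 v)); auto. intros v Hv. specialize (Sh v Hv). apply Rabs_le_between in Sh. lra.
Qed.

Lemma right_line_term mu_m d y t : Re (ey (3, t) mu_m * / (3, t) * gz d (3, t) * ez y 3 t)%C = exp (- y) * (exp (3 * (y - mu_m)) * (gs d t * ((3 * cos (t * (y - mu_m)) + t * sin (t * (y - mu_m))) / (9 + t * t)))).
Proof.
  assert (Eg : gz d (3, t) = RtoC (gs d t)).
  { unfold gz, gs, cexp, Cmult, Cminus, Cplus, Copp, RtoC, Re, Im; simpl. replace (d * d / 2 * ((3 + - (3)) * (3 + - (3)) - (t + - 0) * (t + - 0)) - 0 * ((3 + - (3)) * (t + - 0) + (t + - 0) * (3 + - (3)))) with (- (d * d * (t * t)) / 2) by field.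
    replace (d * d / 2 * ((3 + - (3)) * (t + - 0) + (t + - 0) * (3 + - (3))) + 0 * ((3 + - (3)) * (3 + - (3)) - (t + - 0) * (t + - 0))) with 0 by field. rewrite cos_0, sin_0. f_equal; ring. }
  rewrite Eg.
  assert (Ee : (ey (3, t) mu_m * ez y 3 t)%C = (RtoC (exp (- y)) * cexp (RtoC (y - mu_m) * (3, t)))%C).
  { replace (RtoC (exp (- y))) with (cexp (RtoC (- y))). unfold ey, ez. rewrite <- 2 cexp_plus. f_equal. rewrite RtoC_opp, RtoC_minus. ring.
    unfold cexp, RtoC, Re, Im; simpl. rewrite cos_0, sin_0. f_equal; ring. }
  replace (ey (3, t) mu_m * / (3, t) * RtoC (gs d t) * ez y 3 t)%C with (ey (3, t) mu_m * ez y 3 t * (/ (3, t) * RtoC (gs d t)))%C by ring.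
  rewrite Ee. unfold cexp, Cinv, Cmult, RtoC, Re, Im; simpl. set (v := y - mu_m).
  replace (v * 3 - 0 * t) with (3 * v) by ring. replace (v * t + 0 * 3) with (t * v) by ring. field. nra.
Qed.

(** On [Re s = 3] zeta is an absolutely convergent series, and each integer contributes one
    translate of the kernel [Ht]. *)
Lemma BB_right lam mu d L y : good lam -> enumerates lam mu -> 0 < d -> 0 <= L -> forall eps, 0 < eps -> exists N, forall n, (N <= n)%nat ->
  Rabs (BB lam d L 3 y - psum (fun m => exp (- y) * Ht d L (y - mu m)) n) <= eps.
Proof.
  intros G He Hd HL eps Heps.
  (* The [+ 1] allows [L = 0]; the rest is the length of the segment times the size of
     [exp (y (s - 1))] on it. *)
  set (c := 2 * L * exp (2 * y) + 1). assert (Ey := exp_pos (2 * y)). assert (Hc : 0 < c) by (unfold c; nra).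
  destruct (psum_tail_small (fun m => exp (- 2 * mu m)) 2 ltac:(intros; apply Rlt_le, exp_pos) (psum_mu2 lam mu G He) (eps / c) ltac:(apply Rdiv_lt_0_compat; lra)) as [N HN].
  exists N. intros n Hn.
  assert (N3 : forall t, ((3, t) : C) <> 0%C) by (intros t E; injection E; intros; lra).
  assert (N2 : forall t, ((3, t) - 1)%C <> 0%C). { intros t E. assert (X : Re ((3, t) - 1)%C = 0) by (rewrite E; reflexivity). unfold Cminus, Cplus, Copp, RtoC, Re in X; simpl in X. lra. }
  assert (Eint : forall t, phi lam d 3 t = (zeta mu (3, t) * / (3, t) * gz d (3, t))%C).
  { intros t. rewrite (zeta_formula lam mu (3, t) G He) by (simpl; lra). unfold phi, Fz. field. split; auto. }
  set (k := fun m t => exp (- y) * (exp (3 * (y - mu m)) * (gs d t * ((3 * cos (t * (y - mu m)) + t * sin (t * (y - mu m))) / (9 + t * t))))).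
  assert (Ci := inv9_cont). assert (Cg := gs_cont d).
  assert (Ck : forall m t, continuous (k m) t) by (intros m t; unfold k, Rdiv; cont_tac).
  assert (Ck1 : forall m t, continuous (fun t => gs d t * ((3 * cos (t * (y - mu m)) + t * sin (t * (y - mu m))) / (9 + t * t))) t) by (intros m t; unfold Rdiv; cont_tac).
  assert (ES : psum (fun m => exp (- y) * Ht d L (y - mu m)) n = RInt (fun t => psum (fun m => k m t) n) (- L) L).
  { rewrite psum_RInt by (auto; lra). apply psum_ext. intros m _. unfold Ht, gK, k. rewrite 2 RInt_Rscal; auto. apply ex_RInt_cont; auto. apply ex_RInt_cont. intros. apply continuous_Rmult. apply continuous_const. apply Ck1. }
  destruct (phi_ccont lam d 3 G ltac:(lra) ltac:(lra)) as [P1 P2].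
  assert (CB : forall t, continuous (fun t => Re (phi lam d 3 t * ez y 3 t)) t).
  { intros t. apply continuous_ext with (fun t => exp (y * (3 - 1)) * (Re (phi lam d 3 t) * cos (y * t) - Im (phi lam d 3 t) * sin (y * t))). intros; symmetry; apply ez_mult_Re. cont_tac. }
  assert (CS : forall t, continuous (fun t => psum (fun m => k m t) n) t).
  { clear - Ck. intros t. induction n; simpl. apply continuous_const. apply (continuous_Rplus (fun t => psum (fun m => k m t) n) (k n)); auto. }
  rewrite ES. unfold BB. rewrite <- RInt_Rminus by (apply ex_RInt_cont; auto).
  apply Rle_trans with (RInt (fun _ => eps / c * exp (2 * y)) (- L) L).
  - apply RInt_abs_le_cont; [lra| | |]. intros; apply continuous_Rminus; auto. intros; apply continuous_const.
    intros t _. rewrite Eint.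
    assert (EP : psum (fun m => k m t) n = Re (cpsum (fun m => ey (3, t) (mu m)) n * / (3, t) * gz d (3, t) * ez y 3 t)%C).
    { replace (cpsum (fun m => ey (3, t) (mu m)) n * / (3, t) * gz d (3, t) * ez y 3 t)%C with ((/ (3, t) * gz d (3, t) * ez y 3 t) * cpsum (fun m => ey (3, t) (mu m)) n)%C by ring.
      rewrite <- cpsum_scal, cpsum_Re. apply psum_ext. intros m _. unfold k. rewrite <- right_line_term. f_equal. ring. }
    rewrite EP. set (z := zeta mu (3, t)). set (zn := cpsum (fun m => ey (3, t) (mu m)) n). set (q := (/ (3, t) * gz d (3, t) * ez y 3 t)%C).
    replace (Re (z * / (3, t) * gz d (3, t) * ez y 3 t) - Re (zn * / (3, t) * gz d (3, t) * ez y 3 t)) with (Re ((z - zn) * q)%C).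
    2:{ replace ((z - zn) * q)%C with (z * / (3, t) * gz d (3, t) * ez y 3 t - zn * / (3, t) * gz d (3, t) * ez y 3 t)%C by (unfold q; ring). reflexivity. }
    apply Rle_trans with (1 := re_le_Cmod _). rewrite Cmod_mult. apply Rmult_le_compat; try apply Cmod_ge_0.
    + unfold z, zn, zeta. apply (Csum_tail _ (fun m => exp (- 2 * mu m)) 2). intros; apply (zeta_term lam); auto. simpl; lra. apply (psum_mu2 lam mu G He). intros; apply HN; lia.
    + unfold q. rewrite 2 Cmod_mult, ez_Cmod, gz_Cmod, Cmod_inv by auto.
      assert (C3 : 3 <= Cmod (3, t)) by (apply Rle_trans with (2 := Re_le_Cmod _); simpl; lra). assert (G1 := gs_le1 d t). assert (G0 := gs_pos d t).
      replace (d * d / 2 * ((3 - 3) * (3 - 3))) with 0 by field. rewrite exp_0, Rmult_1_l. replace (y * (3 - 1)) with (2 * y) by ring.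
      assert (/ Cmod (3, t) <= 1) by (rewrite <- Rinv_1; apply Rinv_le_contravar; lra). assert (0 < / Cmod (3, t)) by (apply Rinv_0_lt_compat; lra).
      rewrite <- (Rmult_1_l (exp (2 * y))) at 2. apply Rmult_le_compat_r; [lra|]. nra.
  - rewrite RInt_Rconst. replace (eps / c * exp (2 * y) * (L - - L)) with (eps / c * (c - 1)) by (unfold c; ring).
    assert (0 < eps / c) by (apply Rdiv_lt_0_compat; lra). replace eps with (eps / c * c) at 2 by (field; lra). apply Rmult_le_compat_l; lra.
Qed.

(** * Mean square of the zeta function near the critical line *)

Lemma mm_even s n t : mm s n (- t) = mm s n t.
Proof. unfold mm. apply RInt_ext. intros y _. unfold hh. replace (- t * y) with (- (t * y)) by ring. rewrite cos_neg. reflexivity. Qed.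
Lemma Ssum_even lam s n t : Ssum lam s n (- t) = Ssum lam s n t.
Proof. apply psum_ext. intros j _. rewrite mm_even. unfold hh. replace (- t * lam j) with (- (t * lam j)) by ring. rewrite cos_neg. reflexivity. Qed.

Lemma RInt_even (f : R -> R) L : 0 <= L -> (forall t, continuous f t) -> (forall t, f (- t) = f t) -> RInt f (- L) 0 = RInt f 0 L.
Proof.
  intros HL Hc He.
  assert (H : RInt f 0 0 + RInt f 0 (- 0) = RInt f 0 L + RInt f 0 (- L)).
  { apply (derive_zero_const (fun x => RInt f 0 x + RInt f 0 (- x))); auto. intros x _.
    assert (D : is_derive (fun x => RInt f 0 x + RInt f 0 (- x)) x (plus (f x) (scal (- 1) (f (- x))))).
    { apply (is_derive_plus (K:=R_AbsRing) (V:=R_NormedModule) (fun x => RInt f 0 x) (fun x => RInt f 0 (- x))). apply (is_derive_RInt_cont f); auto.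
      apply (is_derive_comp (K:=R_AbsRing) (fun x => RInt f 0 x) Ropp). apply (is_derive_RInt_cont f); auto. auto_derive; auto. }
    assert (E : plus (f x) (scal (- 1) (f (- x))) = 0) by (rewrite He; unfold plus, scal; simpl; unfold mult; simpl; ring).
    rewrite E in D. exact D. }
  rewrite Ropp_0, RInt_point in H. unfold zero in H; simpl in H.
  assert (K := RInt_cat f (- L) 0 (- L) ltac:(apply ex_RInt_cont; auto) ltac:(apply ex_RInt_cont; auto)). rewrite RInt_point in K. unfold zero in K; simpl in K. lra.
Qed.

Lemma TT_ge n : INR n <= TT n.
Proof.
  unfold TT. assert (A := exp_ineq1_le (exp (5 * INR n))). assert (B := exp_ineq1_le (5 * INR n)). assert (P := pos_INR n). lra.
Qed.

Lemma ReW_cont lam x : good lam -> / 2 < x -> forall t, continuous (fun t => Re (W lam (x, t))) t.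
Proof. intros G Hx. apply (line_ccont rhalf (W lam) (W' lam) x). apply W_qd; auto. intros; exact Hx. Qed.

(** For a given [L], [n] is taken so large that [TT n] covers the range and the tail of [W] is
    small; the bound for [Ssum] from the construction is uniform in [n]. Evenness reduces the
    symmetric range to positive heights. *)
Lemma mean_square lam k : good lam -> exists C, 0 <= C /\ forall L, 0 <= L -> RInt (fun t => Psi t * exp (2 * Re (W lam (sg k, t)))) (- L) L <= C.
Proof.
  intros G. destruct (proj2 (proj2 G) k) as [C HC]. destruct (W_vs_Ssum lam (sg k) G (sg_gt k)) as [C1 HC1].
  assert (Cw := ReW_cont lam (sg k) G (sg_gt k)).
  assert (Cf : forall t, continuous (fun t => Psi t * exp (2 * Re (W lam (sg k, t)))) t).
  { intros t. apply (continuous_Rmult Psi (fun t => exp (2 * Re (W lam (sg k, t))))). apply Psi_cont. apply (continuous_Rcomp exp (fun t => 2 * Re (W lam (sg k, t)))). apply continuous_Rexp. cont_tac. }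
  assert (H : forall L, 0 <= L -> RInt (fun t => Psi t * exp (2 * Re (W lam (sg k, t)))) (- L) L <= 2 * (exp (2 * (C1 + 1)) * C)).
  { intros L HL. destruct (HC1 (/ (1 + L)) ltac:(apply Rinv_0_lt_compat; lra)) as [N HN].
    destruct (INR_unbounded L) as [N2 HN2]. set (n := max N (max N2 (S k))). specialize (HN n ltac:(lia)).
    assert (HT : L <= TT n). { apply Rle_trans with (2 := TT_ge n). assert (INR N2 <= INR n) by (apply le_INR; lia). lra. }
    specialize (HC n L ltac:(lia) ltac:(lra)).
    assert (HB : forall t, Rabs t <= L -> Psi t * exp (2 * Re (W lam (sg k, t))) <= exp (2 * (C1 + 1)) * (Psi t * exp (2 * Ssum lam (sg k) n t))).
    { intros t Ht. rewrite <- Rmult_assoc, (Rmult_comm _ (Psi t)), Rmult_assoc. apply Rmult_le_compat_l. apply Rlt_le, Psi_pos. rewrite <- exp_plus. apply exp_le_compat.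
      specialize (HN t). assert (/ (1 + L) * (1 + Rabs t) <= 1). { apply Rle_trans with (/ (1 + L) * (1 + L)). apply Rmult_le_compat_l. apply Rlt_le, Rinv_0_lt_compat; lra. lra. rewrite Rinv_l; lra. } lra. }
    assert (CS : forall t, continuous (fun t => Psi t * exp (2 * Ssum lam (sg k) n t)) t).
    { intros t. apply (continuous_Rmult Psi (fun t => exp (2 * Ssum lam (sg k) n t))). apply Psi_cont. apply (continuous_Rcomp exp (fun t => 2 * Ssum lam (sg k) n t)). apply continuous_Rexp. assert (X := Ssum_cont lam (sg k) n). cont_tac. }
    apply Rle_trans with (RInt (fun t => exp (2 * (C1 + 1)) * (Psi t * exp (2 * Ssum lam (sg k) n t))) (- L) L).
    { apply RInt_le_cont; auto; [lra| |]. intros; apply (continuous_Rmult (fun _ => _)); auto; apply continuous_const. intros t Ht. apply HB. apply Rabs_le. lra. }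
    rewrite RInt_Rscal by (apply ex_RInt_cont; auto).
    rewrite <- (RInt_cat _ (- L) 0 L) by (apply ex_RInt_cont; auto).
    assert (Ev : RInt (fun t => Psi t * exp (2 * Ssum lam (sg k) n t)) (- L) 0 = RInt (fun t => Psi t * exp (2 * Ssum lam (sg k) n t)) 0 L).
    { apply RInt_even; auto. intros t. rewrite Ssum_even. unfold Psi. rewrite Rabs_Ropp. reflexivity. }
    rewrite Ev. assert (E := exp_pos (2 * (C1 + 1))). nra. }
  exists (2 * (exp (2 * (C1 + 1)) * C)). split; auto.
  specialize (H 0 ltac:(lra)). rewrite Ropp_0 in H. rewrite RInt_point in H. exact H.
Qed.

(** The squared logarithm hidden in [Psi] is absorbed by the Gaussian, at the cost of a squared
    logarithm of [1 / d^2]: below that height it is trivially bounded, and above it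
    [gs d t <= exp (- t / 2)]. *)
Lemma log_gauss d t : 0 < d -> 0 <= t -> ln (2 + t) * ln (2 + t) * gs d t <= 32 + ln (2 + / (d * d)) * ln (2 + / (d * d)).
Proof.
  intros Hd Ht. assert (Hi : 0 < / (d * d)) by (apply Rinv_0_lt_compat; nra).
  assert (L0 : 0 <= ln (2 + t)) by (rewrite <- ln_1; apply ln_le; lra). assert (L1 : 0 <= ln (2 + / (d * d))) by (rewrite <- ln_1; apply ln_le; lra).
  assert (G1 := gs_le1 d t). assert (G0 := gs_pos d t).
  destruct (Rle_dec t (/ (d * d))) as [C|C].
  - assert (ln (2 + t) <= ln (2 + / (d * d))) by (apply ln_le; lra). assert (ln (2 + t) * ln (2 + t) <= ln (2 + / (d * d)) * ln (2 + / (d * d))) by (apply Rmult_le_compat; lra). nra.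
  - assert (H : gs d t <= exp (- (t / 2))). { unfold gs. apply exp_le_compat. assert (1 <= d * d * t). { apply Rle_trans with (d * d * / (d * d)). rewrite Rinv_r; [lra|nra]. apply Rmult_le_compat_l; [nra|lra]. } nra. }
    assert (Hl : ln (2 + t) <= 1 + t). { rewrite <- (ln_exp (1 + t)). apply ln_le; [lra|]. assert (X := exp_ineq1_le (1 + t)). lra. }
    assert (Q : (1 + t) <= 4 * exp ((1 + t) / 4)) by (assert (X := exp_ineq1_le ((1 + t) / 4)); lra).
    assert (Q2 : (1 + t) * (1 + t) <= 16 * exp ((1 + t) / 2)). { replace ((1 + t) / 2) with ((1 + t) / 4 + (1 + t) / 4) by field. rewrite exp_plus. nra. }
    assert (E : exp ((1 + t) / 2) * exp (- (t / 2)) <= 2). { rewrite <- exp_plus. replace ((1 + t) / 2 + - (t / 2)) with (/ 2) by field. assert (X := exp_half_low). rewrite exp_Ropp in X.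
      assert (P := exp_pos (/ 2)). apply (Rmult_le_compat_r (exp (/ 2))) in X; [|lra]. rewrite Rinv_l in X; lra. }
    assert (P := exp_pos (- (t / 2))). assert (P2 := exp_pos ((1 + t) / 2)).
    apply Rle_trans with ((1 + t) * (1 + t) * exp (- (t / 2))). { apply Rmult_le_compat; try lra. nra. apply Rmult_le_compat; lra. }
    apply Rle_trans with (16 * exp ((1 + t) / 2) * exp (- (t / 2))). apply Rmult_le_compat_r; lra. nra.
Qed.

(** [exp (y (s - 1))] decays like [exp (- (1 - sg k) * y)] on this line, and the remaining integral
    is bounded by the mean square uniformly in [L]. *)
Lemma BB_left lam k : good lam -> sg k < 1 -> exists C, 0 <= C /\ forall d L y, 0 < d <= 1 -> 0 <= L ->
  Rabs (BB lam d L (sg k) y) <= C * (32 + ln (2 + / (d * d)) * ln (2 + / (d * d))) * exp (- (1 - sg k) * y).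
Proof.
  intros G Hk. assert (Hs := sg_gt k). set (s := sg k) in *. destruct (mean_square lam k G) as (C & HC & HM). fold s in HM.
  set (kp := 1 - s). assert (Hkp : 0 < kp) by (unfold kp; lra). exists (exp 4 * (4 / kp) * (4 + C)).
  assert (E4 := exp_pos 4). assert (K4 : 0 < 4 / kp) by (apply Rdiv_lt_0_compat; lra). split. { apply Rmult_le_pos; [|lra]. apply Rmult_le_pos; lra. }
  intros d L y Hd HL. set (Lm := 32 + ln (2 + / (d * d)) * ln (2 + / (d * d))). assert (HLm : 0 <= Lm) by (unfold Lm; nra).
  set (ee := exp (- kp * y)). assert (He : 0 < ee) by apply exp_pos.
  assert (Cw := ReW_cont lam s G Hs).
  assert (Cf : forall t, continuous (fun t => Psi t * exp (2 * Re (W lam (s, t)))) t).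
  { intros t. apply (continuous_Rmult Psi (fun t => exp (2 * Re (W lam (s, t))))). apply Psi_cont. apply (continuous_Rcomp exp (fun t => 2 * Re (W lam (s, t)))). apply continuous_Rexp. cont_tac. }
  assert (Cg : forall t, continuous (fun t => exp 4 * (4 / kp) * Lm * ee * (Psi t + Psi t * exp (2 * Re (W lam (s, t))))) t).
  { intros t. apply (continuous_Rmult (fun _ => _) (fun t => Psi t + Psi t * exp (2 * Re (W lam (s, t))))). apply continuous_const. apply (continuous_Rplus Psi (fun t => Psi t * exp (2 * Re (W lam (s, t))))). apply Psi_cont. auto. }
  destruct (phi_ccont lam d s G Hs ltac:(lra)) as [P1 P2].
  unfold BB. apply Rle_trans with (RInt (fun t => exp 4 * (4 / kp) * Lm * ee * (Psi t + Psi t * exp (2 * Re (W lam (s, t))))) (- L) L).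
  - apply RInt_abs_le_cont; [lra| |auto|].
    + intros t _. apply continuous_ext with (fun t => exp (y * (s - 1)) * (Re (phi lam d s t) * cos (y * t) - Im (phi lam d s t) * sin (y * t))). intros; symmetry; apply ez_mult_Re. cont_tac.
    + intros t _. apply Rle_trans with (1 := re_le_Cmod _). unfold phi.
      assert (HP := Rabs_pos t).
      assert (Hden : kp / 4 * (2 + Rabs t) <= Cmod ((s, t) - 1)).
      { assert (A := re_le_Cmod ((s, t) - 1)). assert (B := Im_le_Cmod ((s, t) - 1)).
        replace (Re ((s, t) - 1)%C) with (- kp) in A by (unfold Cminus, Cplus, Copp, RtoC, Re, kp; simpl; ring). replace (Im ((s, t) - 1)%C) with t in B by (unfold Cminus, Cplus, Copp, RtoC, Im; simpl; ring).
        rewrite Rabs_Ropp, Rabs_pos_eq in A by lra. assert (kp <= 1) by (unfold kp; lra). nra. }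
      assert (Hd0 : 0 < kp / 4 * (2 + Rabs t)) by (apply Rmult_lt_0_compat; lra).
      assert (Nz : ((s, t) - 1)%C <> 0%C) by (apply Cmod_gt_0; lra).
      rewrite !Cmod_mult, Cmod_inv, ez_Cmod by auto. unfold Fz. rewrite Cmod_cexp. set (w := Re (W lam (s, t))).
      replace (exp (y * (s - 1))) with ee by (unfold ee, kp; f_equal; ring).
      assert (Hg := gz_bound d s t Hd ltac:(lra)). assert (Gp := gs_pos d t).
      (* Passes from the modulus of [exp W] to its square, in place of the Cauchy-Schwarz
         inequality. *)
      assert (Hw : exp w <= 1 + exp (2 * w)). { replace (2 * w) with (w + w) by ring. rewrite exp_plus. assert (P := exp_pos w). nra. }
      assert (Hinv : / Cmod ((s, t) - 1) <= 4 / kp * / (2 + Rabs t)). { replace (4 / kp * / (2 + Rabs t)) with (/ (kp / 4 * (2 + Rabs t))) by (field; split; lra). apply Rinv_le_contravar; auto. }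
      assert (Hinv0 : 0 < / Cmod ((s, t) - 1)) by (apply Rinv_0_lt_compat; lra).
      assert (HPsi : gs d t * / (2 + Rabs t) <= Lm * Psi t).
      { assert (LG := log_gauss d (Rabs t) (proj1 Hd) HP). replace (gs d (Rabs t)) with (gs d t) in LG by (unfold gs; replace (Rabs t * Rabs t) with (t * t) by (rewrite <- Rabs_mult, Rabs_pos_eq; nra); reflexivity). fold Lm in LG.
        assert (Hl : / 2 < ln (2 + Rabs t)). { apply Rlt_le_trans with (ln 2). apply ln2_gt. apply ln_le; lra. }
        replace (gs d t * / (2 + Rabs t)) with (ln (2 + Rabs t) * ln (2 + Rabs t) * gs d t * Psi t) by (unfold Psi; field; split; lra).
        apply Rmult_le_compat_r. apply Rlt_le, Psi_pos. exact LG. }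
      apply Rle_trans with ((1 + exp (2 * w)) * (exp 4 * gs d t) * (4 / kp * / (2 + Rabs t)) * ee).
      { apply Rmult_le_compat_r; [lra|]. apply Rmult_le_compat; try lra. apply Rmult_le_pos. apply Rlt_le, exp_pos. apply Cmod_ge_0.
        apply Rmult_le_compat; try lra. apply Rlt_le, exp_pos. apply Cmod_ge_0. }
      replace ((1 + exp (2 * w)) * (exp 4 * gs d t) * (4 / kp * / (2 + Rabs t)) * ee) with (exp 4 * (4 / kp) * ee * (1 + exp (2 * w)) * (gs d t * / (2 + Rabs t))) by ring.
      replace (exp 4 * (4 / kp) * Lm * ee * (Psi t + Psi t * exp (2 * w))) with (exp 4 * (4 / kp) * ee * (1 + exp (2 * w)) * (Lm * Psi t)) by ring.
      apply Rmult_le_compat_l; auto. assert (P := exp_pos (2 * w)). repeat apply Rmult_le_pos; lra.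
  - rewrite RInt_Rscal by (apply ex_RInt_cont; intros; apply (continuous_Rplus Psi (fun t => Psi t * exp (2 * Re (W lam (s, t))))); auto using Psi_cont).
    rewrite RInt_Rplus by (apply ex_RInt_cont; auto using Psi_cont).
    assert (HPi : RInt Psi (- L) L <= 4).
    { rewrite <- (RInt_cat Psi (- L) 0 L) by (apply ex_RInt_cont; apply Psi_cont).
      assert (H0 : forall b, 0 <= b -> RInt Psi 0 b <= 2). { intros b Hb. apply Rle_trans with (1 := Psi_int 0 b ltac:(lra)). rewrite Rplus_0_r. rewrite <- (Rinv_inv 2) at 2. apply Rinv_le_contravar. lra. apply Rlt_le, ln2_gt. }
      assert (Ev : RInt Psi (- L) 0 = RInt Psi 0 L).
      { apply RInt_even; auto using Psi_cont. intros t. unfold Psi. rewrite Rabs_Ropp. reflexivity. }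
      rewrite Ev. specialize (H0 L HL). lra. }
    specialize (HM L HL). fold kp ee.
    replace (exp 4 * (4 / kp) * (4 + C) * Lm * ee) with (exp 4 * (4 / kp) * Lm * ee * (4 + C)) by ring. apply Rmult_le_compat_l; [|lra]. repeat apply Rmult_le_pos; lra.
Qed.

(** * Tauberian argument *)

Definition counts (mu : nat -> R) (N : R -> nat) : Prop := forall z n, (n < N z)%nat <-> mu n <= z.

Lemma exists_counts lam mu : good lam -> enumerates lam mu -> exists N, counts mu N.
Proof.
  intros G He.
  assert (H : forall z, exists m, forall n, (n < m)%nat <-> mu n <= z).
  { intros z. apply count_increasing. apply He. destruct (lam_unbounded lam G z) as [j Hj].
    assert (B := BL_prime lam j). apply (proj2 He) in B. destruct B as [n Hn]. exists n. rewrite Hn. apply Hj; lia. }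
  exists (fun z => proj1_sig (constructive_indefinite_description _ (H z))). intros z n. destruct constructive_indefinite_description; auto.
Qed.

Lemma psum_indicator m n : (m <= n)%nat -> psum (fun i => if lt_dec i m then 1 else 0) n = INR m.
Proof.
  intros H. induction H.
  - induction m. reflexivity. rewrite S_INR, <- IHm at 1. cbn [psum]. destruct (lt_dec m (S m)); [|lia]. f_equal.
    apply psum_ext. intros i Hi. destruct (lt_dec i (S m)), (lt_dec i m); lia || auto.
  - simpl. destruct (lt_dec m0 m); [lia|]. rewrite IHle. ring.
Qed.

(** The kernel bounds are summed over all integers: those outside the blurred zone count fully or
    not at all, and monotonicity of the count places the blurred ones between [N (y - eta)] and
    [N (y + eta)]. *)
Lemma BB_sandwich lam mu N d L eta y : good lam -> enumerates lam mu -> counts mu N -> 0 < d <= 1 -> / d <= L -> d <= eta -> 0 <= y ->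
  exp (- y) * (gc d L eta * INR (N (y - eta)) - theta d L eta * (4 * exp (4 * y))) <= BB lam d L 3 y /\
  BB lam d L 3 y <= exp (- y) * (gc d L eta * INR (N (y + eta)) + theta d L eta * (4 * exp (4 * y))).
Proof.
  intros G He HN Hd HL Het Hy.
  assert (Hid : 0 < / d) by (apply Rinv_0_lt_compat; lra).
  assert (Hc := gc_lower d L eta Hd HL Het). set (c := gc d L eta) in *.
  assert (Hth : 0 <= theta d L eta).
  { destruct (gw0_upper d L) as [W _]; try lra. assert (P := exp_pos (- (eta * eta) / (2 * (d * d)))). assert (Q : 0 < gs d L / (d * d)) by (apply Rdiv_lt_0_compat; [apply gs_pos|nra]).
    unfold theta. unfold Rdiv in *. nra. }
  set (th := theta d L eta) in *. assert (Ey := exp_pos (- y)).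
  (* For [mu >= 0] and [y >= 0] both exponentials are at most [exp (4 * y) * exp (- 2 * mu)], and
     the sum of [exp (- 2 * mu)] is at most 2. *)
  assert (HQ : forall n, psum (fun m => exp (2 * (y - mu m)) + exp (4 * (y - mu m))) n <= 4 * exp (4 * y)).
  { intros n. apply Rle_trans with (psum (fun m => (2 * exp (4 * y)) * exp (- 2 * mu m)) n).
    - apply psum_le. intros m _. assert (Hm := mu_nonneg lam mu G He m).
      assert (exp (2 * (y - mu m)) <= exp (4 * y) * exp (- 2 * mu m)) by (rewrite <- exp_plus; apply exp_le_compat; lra).
      assert (exp (4 * (y - mu m)) <= exp (4 * y) * exp (- 2 * mu m)) by (rewrite <- exp_plus; apply exp_le_compat; lra). lra.
    - rewrite psum_scal. assert (X := psum_mu2 lam mu G He n). assert (P := exp_pos (4 * y)). nra. }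
  assert (HB := BB_right lam mu d L y G He ltac:(lra) ltac:(lra)).
  split; apply le_epsilon; intros eps Heps; destruct (HB eps Heps) as [M HM].
  - specialize (HM (max M (N (y - eta))) ltac:(lia)). set (n := max M _) in *. rewrite psum_scal in HM.
    assert (S1 : c * INR (N (y - eta)) - th * (4 * exp (4 * y)) <= psum (fun m => Ht d L (y - mu m)) n).
    { apply Rle_trans with (psum (fun m => c * (if lt_dec m (N (y - eta)) then 1 else 0) + - th * (exp (2 * (y - mu m)) + exp (4 * (y - mu m)))) n).
      - rewrite psum_plus, (psum_scal c), (psum_scal (- th)), psum_indicator by lia. specialize (HQ n). assert (X := Rmult_le_compat_l th _ _ Hth HQ). lra.
      - apply psum_le. intros m _. destruct (Ht_sandwich d L eta (y - mu m)) as (A & B & D); try lra. fold c th in A, B, D.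
        destruct (lt_dec m (N (y - eta))) as [Q|Q]. apply HN in Q. specialize (A ltac:(lra)). lra. lra. }
    apply (Rmult_le_compat_l _ _ _ (Rlt_le _ _ Ey)) in S1. apply Rabs_le_between in HM. lra.
  - specialize (HM (max M (N (y + eta))) ltac:(lia)). set (n := max M _) in *. rewrite psum_scal in HM.
    assert (S1 : psum (fun m => Ht d L (y - mu m)) n <= c * INR (N (y + eta)) + th * (4 * exp (4 * y))).
    { apply Rle_trans with (psum (fun m => c * (if lt_dec m (N (y + eta)) then 1 else 0) + th * (exp (2 * (y - mu m)) + exp (4 * (y - mu m)))) n).
      - apply psum_le. intros m _. destruct (Ht_sandwich d L eta (y - mu m)) as (A & B & D); try lra. fold c th in A, B, D.
        destruct (lt_dec m (N (y + eta))) as [Q|Q]. lra. assert (Q2 : y + eta < mu m) by (apply Rnot_le_lt; intros Z; apply Q, HN; auto). specialize (B ltac:(lra)). lra.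
      - rewrite psum_plus, (psum_scal c), (psum_scal th), psum_indicator by lia. specialize (HQ n). assert (X := Rmult_le_compat_l th _ _ Hth HQ). lra. }
    apply (Rmult_le_compat_l _ _ _ (Rlt_le _ _ Ey)) in S1. apply Rabs_le_between in HM. lra.
Qed.

(** A Gaussian of fixed width beats any exponential in [L]; this disposes of the horizontal sides
    and of the truncation error at once. *)
Lemma gs_beats_exp d K A B L0 eps : 0 < d -> 0 <= K -> 0 <= B -> 0 < eps -> exists L, L0 <= L /\ 0 <= L /\ exp (A + K * L) * gs d L * B <= eps.
Proof.
  intros Hd HK HB He. set (L := Rmax (Rmax L0 0) (Rmax (2 * (K + 1) / (d * d)) (exp A * B / eps))).
  assert (H1 : L0 <= L) by (unfold L; apply Rle_trans with (2 := Rmax_l _ _); apply Rmax_l).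
  assert (H2 : 0 <= L) by (unfold L; apply Rle_trans with (2 := Rmax_l _ _); apply Rmax_r).
  assert (H3 : 2 * (K + 1) / (d * d) <= L) by (unfold L; apply Rle_trans with (2 := Rmax_r _ _); apply Rmax_l).
  assert (H4 : exp A * B / eps <= L) by (unfold L; apply Rle_trans with (2 := Rmax_r _ _); apply Rmax_r).
  exists L. split; [auto|]. split; [auto|].
  assert (D : 0 < d * d) by nra. assert (H5 : 2 * (K + 1) <= L * (d * d)). { apply (Rmult_le_compat_r (d * d)) in H3; [|lra]. unfold Rdiv in H3. rewrite Rmult_assoc, Rinv_l in H3 by lra. lra. }
  assert (H6 : exp A * B <= L * eps). { apply (Rmult_le_compat_r eps) in H4; [|lra]. unfold Rdiv in H4. rewrite Rmult_assoc, Rinv_l in H4 by lra. lra. }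
  assert (E : exp (A + K * L) * gs d L <= exp A * exp (- L)). { unfold gs. rewrite <- !exp_plus. apply exp_le_compat. nra. }
  assert (X := exp_ineq1_le L). assert (P := exp_pos (- L)). assert (PA := exp_pos A).
  apply Rle_trans with (exp A * exp (- L) * B). apply Rmult_le_compat_r; auto.
  replace (exp A * exp (- L) * B) with (exp A * B * exp (- L)) by ring.
  apply Rle_trans with (exp L * eps * exp (- L)). { apply Rmult_le_compat_r; [lra|]. nra. }
  replace (exp L * eps * exp (- L)) with (eps * (exp L * exp (- L))) by ring. rewrite <- exp_plus, Rplus_opp_r, exp_0. lra.
Qed.

Lemma smoothed_comparison lam mu N k : good lam -> enumerates lam mu -> counts mu N -> (1 <= k)%nat ->
  exists C, 0 <= C /\ forall d eta y y0, 0 < d <= 1 -> d <= eta -> 0 <= y -> y <= y0 ->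
  let E := C * (32 + ln (2 + / (d * d)) * ln (2 + / (d * d))) * exp (- (1 - sg k) * y) + 1024 * (/ d * exp (- (eta * eta) / (2 * (d * d))) * exp (3 * y0)) in
  exp (- y0) * INR (N (y0 - eta)) <= exp (- y) * INR (N (y + eta)) + E /\
  exp (- y) * INR (N (y - eta)) <= exp (- y0) * INR (N (y0 + eta)) + E.
Proof.
  intros G He HN Hk.
  assert (Hs : / 2 < sg k < 1). { split. apply sg_gt. unfold sg. assert (1 <= INR k) by (apply (le_INR 1); auto). assert (/ (INR k + 2) <= / 3) by (apply Rinv_le_contravar; lra). lra. }
  destruct (shift_bound lam (sg k) G Hs) as (K & HK & HS). destruct (BB_left lam k G ltac:(lra)) as (C & HC & HBL).
  (* [16 = 8 * 2], two left-line integrals divided by [gc]; likewise [1024 = 8 * (2 * 4) * 16], two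
     kernel errors with the bound [16 * (/ d * g)] for [theta]. *)
  exists (16 * C). split; [lra|]. intros d eta y y0 Hd Het Hy Hyy E.
  assert (Hid : 0 < / d) by (apply Rinv_0_lt_compat; lra). assert (Hidd : 0 < / (d * d)) by (apply Rinv_0_lt_compat; nra).
  set (Lm := 32 + ln (2 + / (d * d)) * ln (2 + / (d * d))) in *. assert (HLm : 0 <= Lm) by (unfold Lm; nra).
  set (g := exp (- (eta * eta) / (2 * (d * d)))) in *. assert (Hg : 0 < g) by apply exp_pos.
  assert (Hexp : exp (- (1 - sg k) * y0) <= exp (- (1 - sg k) * y)) by (apply exp_le_compat; nra).
  assert (T3 := exp_pos (3 * y0)). assert (T3' : exp (3 * y) <= exp (3 * y0)) by (apply exp_le_compat; lra).
  cut (forall eps, 0 < eps -> exp (- y0) * INR (N (y0 - eta)) <= exp (- y) * INR (N (y + eta)) + E + eps /\ exp (- y) * INR (N (y - eta)) <= exp (- y0) * INR (N (y0 + eta)) + E + eps).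
  { intros H. split; apply le_epsilon; intros eps Heps; apply (H eps Heps). }
  intros eps Heps.
  (* [B] gathers the coefficients of everything that vanishes with [gs d L]: the horizontal sides
     and the truncation part of [theta]. *)
  set (A := 4 * K + 4 + 2 * y0). set (B := 48 * (y0 - y) + 256 * / (d * d) * exp (3 * y0)).
  assert (HB0 : 0 <= B). { unfold B. assert (0 < / (d * d) * exp (3 * y0)) by (apply Rmult_lt_0_compat; auto). lra. }
  destruct (gs_beats_exp d K A B (/ d) eps ltac:(lra) HK HB0 Heps) as (L & HL & HL0 & HLe).
  assert (Gp := gs_pos d L).
  assert (HA : 1 <= exp (A + K * L)). { rewrite <- exp_0. apply exp_le_compat. unfold A. nra. }
  specialize (HS d L y y0 Hd HL0 Hy Hyy).
  replace (K * (4 + L) + 4 + 2 * y0) with (A + K * L) in HS by (unfold A; ring). set (M := exp (A + K * L)) in *.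
  assert (B1 := HBL d L y Hd HL0). assert (B2 := HBL d L y0 Hd HL0). fold Lm in B1, B2.
  assert (B3 : Rabs (BB lam d L (sg k) y0) <= C * Lm * exp (- (1 - sg k) * y)). { apply Rle_trans with (1 := B2). apply Rmult_le_compat_l; auto. apply Rmult_le_pos; auto. }
  destruct (BB_sandwich lam mu N d L eta y G He HN Hd HL Het Hy) as [S1 S2].
  destruct (BB_sandwich lam mu N d L eta y0 G He HN Hd HL Het ltac:(lra)) as [S3 S4].
  assert (Hc := gc_lower d L eta Hd HL Het). set (c := gc d L eta) in *.
  assert (Hth : theta d L eta <= 16 * (/ d * g) + 4 * (gs d L * / (d * d))).
  { destruct (gw0_upper d L ltac:(lra) HL0) as [W0 W]. unfold theta. fold g. assert (gw d L 0 * g <= 8 / d * g) by (apply Rmult_le_compat_r; lra). unfold Rdiv in *. lra. }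
  set (th := theta d L eta) in *.
  assert (EE : forall z, exp (- z) * exp (4 * z) = exp (3 * z)) by (intros z; rewrite <- exp_plus; f_equal; ring).
  assert (U1 : exp (- y) * (th * (4 * exp (4 * y))) <= 4 * (16 * (/ d * g) + 4 * (gs d L * / (d * d))) * exp (3 * y0)).
  { replace (exp (- y) * (th * (4 * exp (4 * y)))) with (4 * th * (exp (- y) * exp (4 * y))) by ring. rewrite EE.
    assert (P := exp_pos (3 * y)). apply Rle_trans with (4 * (16 * (/ d * g) + 4 * (gs d L * / (d * d))) * exp (3 * y)). apply Rmult_le_compat_r; lra.
    apply Rmult_le_compat_l; auto. assert (0 < / d * g) by (apply Rmult_lt_0_compat; auto). assert (0 < gs d L * / (d * d)) by (apply Rmult_lt_0_compat; auto). lra. }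
  assert (U2 : exp (- y0) * (th * (4 * exp (4 * y0))) <= 4 * (16 * (/ d * g) + 4 * (gs d L * / (d * d))) * exp (3 * y0)).
  { replace (exp (- y0) * (th * (4 * exp (4 * y0)))) with (4 * th * (exp (- y0) * exp (4 * y0))) by ring. rewrite EE. apply Rmult_le_compat_r; lra. }
  apply Rabs_le_between in HS. apply Rabs_le_between in B1. apply Rabs_le_between in B3.
  set (eL := C * Lm * exp (- (1 - sg k) * y)) in *.
  assert (HX : M * gs d L * B = 48 * (M * gs d L) * (y0 - y) + 256 * (M * gs d L) * / (d * d) * exp (3 * y0)) by (unfold B; ring).
  assert (HM : gs d L <= M * gs d L) by nra.
  assert (HM2 : 256 * gs d L * / (d * d) * exp (3 * y0) <= 256 * (M * gs d L) * / (d * d) * exp (3 * y0)). { apply Rmult_le_compat_r; [lra|]. apply Rmult_le_compat_r; lra. }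
  set (X := 6 * (M * gs d L) * (y0 - y) + 2 * eL + 8 * (16 * (/ d * g) + 4 * (gs d L * / (d * d))) * exp (3 * y0)).
  assert (HE : E = 16 * eL + 1024 * (/ d * g * exp (3 * y0))) by (unfold E, eL; ring).
  assert (HX8 : 8 * X <= E + eps). { rewrite HE. unfold X. lra. }
  assert (Fin : forall a b, 0 <= X -> c * a <= c * b + X -> a <= b + 8 * X). { intros a b P Q. destruct (Rle_dec a b). lra. apply Rnot_le_lt in n. nra. }
  assert (X0 : 0 <= X). { unfold X. assert (0 <= eL) by (unfold eL; apply Rmult_le_pos; [apply Rmult_le_pos; auto|apply Rlt_le, exp_pos]).
    assert (0 <= (M * gs d L) * (y0 - y)) by (apply Rmult_le_pos; nra). assert (0 < / d * g) by (apply Rmult_lt_0_compat; auto). assert (0 < gs d L * / (d * d)) by (apply Rmult_lt_0_compat; auto).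
    assert (0 <= (16 * (/ d * g) + 4 * (gs d L * / (d * d))) * exp (3 * y0)) by (apply Rmult_le_pos; lra). lra. }
  split.
  - apply Rle_trans with (exp (- y) * INR (N (y + eta)) + 8 * X); [|lra]. apply Fin; auto. unfold X. lra.
  - apply Rle_trans with (exp (- y0) * INR (N (y0 + eta)) + 8 * X); [|lra]. apply Fin; auto. unfold X. lra.
Qed.

Lemma square_le_exp del z : 0 < del <= 1 -> 0 <= z -> (1 + z) * (1 + z) <= / (del * del) * exp (2 * del * z).
Proof.
  intros Hd Hz. assert (X := exp_ineq1_le (del * z)). assert (H : del * (1 + z) <= exp (del * z)) by nra.
  assert (D : 0 < del * del) by nra. apply Rmult_le_reg_l with (del * del); auto. rewrite <- (Rmult_assoc (del * del) (/ (del * del))), Rinv_r, Rmult_1_l by lra.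
  replace (2 * del * z) with (del * z + del * z) by ring. rewrite exp_plus. assert (0 <= del * (1 + z)) by nra. nra.
Qed.

Lemma counts_mono mu N a b : counts mu N -> a <= b -> INR (N a) <= INR (N b).
Proof.
  intros HN Hab. apply le_INR. destruct (le_lt_dec (N a) (N b)) as [|H]; auto. exfalso. apply HN in H. assert (Q : (N b < N b)%nat) by (apply HN; lra). lia.
Qed.

(* The smoothing lengths are [d = exp (- z / 2)] and [eta = (z + 14) d]; the Gaussian tail [exp (- (z + 14) ^ 2 / 2)] then beats the factor [exp (3 y0)]. *)
Lemma dyadic_comparison lam mu N k : good lam -> enumerates lam mu -> counts mu N -> (3 <= k)%nat ->
  exists A z0, 0 <= A /\ 1 <= z0 /\ forall z w, z0 <= z -> z <= w -> w <= 2 * z ->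
  let e := A * exp (- (/ 2 - 2 / (INR k + 2)) * z) in
  exp (- w) * INR (N w) <= (1 + e) * (exp (- z) * INR (N z)) + e /\ exp (- z) * INR (N z) <= (1 + e) * (exp (- w) * INR (N w)) + e.
Proof.
  intros G He HN Hk. destruct (smoothed_comparison lam mu N k G He HN ltac:(lia)) as (C & HC & H).
  set (r := / (INR k + 2)). assert (Hk3 : 3 <= INR k) by (apply (le_INR 3) in Hk; simpl in Hk; lra).
  assert (Hr0 : 0 < r) by (apply Rinv_0_lt_compat; lra). assert (Hr : r <= / 5) by (apply Rinv_le_contravar; lra).
  assert (Hsg : 1 - sg k = / 2 - r) by (unfold sg, r; lra).
  replace (/ 2 - 2 / (INR k + 2)) with (/ 2 - 2 * r) by (unfold r, Rdiv; ring).
  (* The squared logarithm, of size [(1 + z)^2], is absorbed into [exp (2 * del * z) = exp (r * z)];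
     together with [1 - sg k = 1/2 - r] this leaves the exponent [1/2 - 2 r]. *)
  set (del := r / 2). set (Q := / (del * del)). assert (HQ : 0 < Q) by (apply Rinv_0_lt_compat; unfold del; nra).
  assert (Hz0 : exists z0, 1 <= z0 /\ forall z, z0 <= z -> (z + 14) * exp (- (z / 2)) <= / 4).
  { exists 1000. split; [lra|]. intros z Hz. assert (X := exp_ineq1_le (z / 4)). assert (P := exp_pos (- (z / 2))).
    assert (Y2 : (1 + z / 4) * (1 + z / 4) <= exp (z / 2)). { replace (z / 2) with (z / 4 + z / 4) by field. rewrite exp_plus. nra. }
    assert (Y3 : 4 * (z + 14) <= exp (z / 2)) by nra. apply (Rmult_le_compat_r (exp (- (z / 2)))) in Y3; [|lra]. rewrite <- exp_plus, Rplus_opp_r, exp_0 in Y3. lra. }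
  destruct Hz0 as (z0 & Hz1 & Hz0). exists ((56 + 2 * (C * 36 * exp 1 + 1024 * exp 3)) * Q), z0.
  assert (E1 := exp_pos 1). assert (E3 := exp_pos 3).
  split. { apply Rmult_le_pos; [|lra]. assert (0 <= C * 36 * exp 1) by (apply Rmult_le_pos; lra). lra. } split; auto.
  intros z w Hz Hzw Hw e. specialize (Hz0 z Hz).
  set (d := exp (- (z / 2))) in *. assert (Hd : 0 < d) by apply exp_pos. assert (Hd1 : d <= 1) by (apply exp_le1; lra).
  set (eta := (z + 14) * d) in *. assert (Het : d <= eta) by (unfold eta; nra). assert (Het0 : 0 < eta) by lra.
  assert (Hdd : / (d * d) = exp z). { unfold d. rewrite <- exp_plus, <- exp_Ropp. f_equal. field. }
  assert (Hd' : / d = exp (z / 2)). { unfold d. rewrite <- exp_Ropp. f_equal. ring. }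
  set (S := (1 + z) * (1 + z) * exp (- (/ 2 - r) * z)).
  assert (HS0 : 0 < S). { unfold S. apply Rmult_lt_0_compat. nra. apply exp_pos. }
  assert (HS : S <= Q * exp (- (/ 2 - 2 * r) * z)).
  { unfold S. replace (- (/ 2 - 2 * r) * z) with (2 * del * z + - (/ 2 - r) * z) by (unfold del; field). rewrite exp_plus, <- Rmult_assoc. apply Rmult_le_compat_r. apply Rlt_le, exp_pos.
    apply square_le_exp; [unfold del|]; lra. }
  assert (HLn : 32 + ln (2 + / (d * d)) * ln (2 + / (d * d)) <= 36 * ((1 + z) * (1 + z))).
  { rewrite Hdd. assert (P := exp_pos z). assert (L0 : 0 <= ln (2 + exp z)) by (rewrite <- ln_1; apply ln_le; lra).
    assert (L1 : ln (2 + exp z) <= z + 2). { rewrite <- (ln_exp (z + 2)). apply ln_le; [lra|]. rewrite exp_plus. assert (X := exp_ineq1_le 2). assert (X2 := exp_ineq1_le z). nra. }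
    nra. }
  set (F := (C * 36 * exp 1 + 1024 * exp 3) * S).
  assert (HF : forall y y0, z - / 2 <= y -> y0 <= 2 * z + / 2 ->
    C * (32 + ln (2 + / (d * d)) * ln (2 + / (d * d))) * exp (- (1 - sg k) * y) + 1024 * (/ d * exp (- (eta * eta) / (2 * (d * d))) * exp (3 * y0)) <= F).
  { intros y y0 Hy Hy0. unfold F. rewrite Rmult_plus_distr_r. apply Rplus_le_compat.
    - rewrite Hsg. assert (B : exp (- (/ 2 - r) * y) <= exp 1 * exp (- (/ 2 - r) * z)) by (rewrite <- exp_plus; apply exp_le_compat; nra).
      assert (P := exp_pos (- (/ 2 - r) * y)).
      replace (C * 36 * exp 1 * S) with (C * (36 * ((1 + z) * (1 + z))) * (exp 1 * exp (- (/ 2 - r) * z))) by (unfold S; ring).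
      apply Rmult_le_compat; auto; [|lra|]. apply Rmult_le_pos; auto. set (l := ln _). nra. apply Rmult_le_compat_l; auto.
    - rewrite (Rmult_assoc 1024 (exp 3)). apply Rmult_le_compat_l; [lra|]. rewrite Hd'.
      replace (- (eta * eta) / (2 * (d * d))) with (- ((z + 14) * (z + 14) / 2)) by (unfold eta; field; lra).
      apply Rle_trans with (exp 3 * exp (- (/ 2 - r) * z)).
      { rewrite <- !exp_plus. apply exp_le_compat. nra. }
      apply Rmult_le_compat_l; [lra|]. unfold S. assert (P := exp_pos (- (/ 2 - r) * z)). nra. }
  assert (HEta : 4 * eta <= 56 * S).
  { unfold eta, S. assert (D : d <= exp (- (/ 2 - r) * z)) by (unfold d; apply exp_le_compat; nra). nra. }
  assert (Hexp2 : exp (2 * eta) <= 1 + 4 * eta).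
  { assert (X := exp_ineq1_le (- (2 * eta))). rewrite exp_Ropp in X. assert (P := exp_pos (2 * eta)). assert (Y2 : exp (2 * eta) * (1 - 2 * eta) <= 1).
    { apply (Rmult_le_compat_l (exp (2 * eta))) in X; [|lra]. rewrite Rinv_r in X; lra. }
    apply Rmult_le_reg_r with (1 - 2 * eta); [lra|]. nra. }
  assert (Hexp1 : exp eta <= 2). { apply Rle_trans with (exp (2 * eta)); [apply exp_le_compat; lra|lra]. }
  assert (HF0 : 0 <= F). { unfold F. apply Rmult_le_pos; [|lra]. assert (0 <= C * 36 * exp 1) by (apply Rmult_le_pos; lra). lra. }
  assert (HeF : 4 * eta <= e /\ 2 * F <= e).
  { assert (HSe : (56 + 2 * (C * 36 * exp 1 + 1024 * exp 3)) * S <= e).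
    { unfold e. rewrite (Rmult_assoc _ Q). apply Rmult_le_compat_l; auto. assert (0 <= C * 36 * exp 1) by (apply Rmult_le_pos; lra). lra. }
    unfold F in *. split; lra. }
  assert (Fin : forall p q bp bq u v, 0 <= bp -> 0 <= bq -> bp = exp (- p) * u -> bq = exp (- q) * v ->
     exp (- p - eta) * u <= exp (- q + eta) * v + F -> bp <= (1 + e) * bq + e).
  { intros p q bp bq u v Hp Hq Ep Eq HH. replace (exp (- p - eta) * u) with (exp (- eta) * bp) in HH by (rewrite Ep; unfold Rminus; rewrite exp_plus; ring).
    replace (exp (- q + eta) * v) with (exp eta * bq) in HH by (rewrite Eq, exp_plus; ring).
    assert (Pe := exp_pos eta). apply (Rmult_le_compat_l (exp eta)) in HH; [|lra].
    replace (exp eta * (exp (- eta) * bp)) with bp in HH by (rewrite <- Rmult_assoc, <- exp_plus, Rplus_opp_r, exp_0; ring).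
    replace (2 * eta) with (eta + eta) in Hexp2 by ring. rewrite exp_plus in Hexp2.
    assert (exp eta * F <= 2 * F) by (apply Rmult_le_compat_r; lra). assert (exp eta * exp eta * bq <= (1 + e) * bq) by (apply Rmult_le_compat_r; lra). lra. }
  assert (Nn : forall x, 0 <= exp (- x) * INR (N x)) by (intros x; apply Rmult_le_pos; [apply Rlt_le, exp_pos|apply pos_INR]).
  split.
  - apply (Fin w z _ _ (INR (N w)) (INR (N z))); auto.
    destruct (H d eta (z - eta) (w + eta)) as [K _]; try lra.
    replace (w + eta - eta) with w in K by ring. replace (z - eta + eta) with z in K by ring.
    replace (- w - eta) with (- (w + eta)) by ring. replace (- z + eta) with (- (z - eta)) by ring.
    apply Rle_trans with (1 := K). apply Rplus_le_compat_l. apply HF; lra.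
  (* The comparison is applied at [z + eta] and [w - eta], which must be in order. When [w] is
     closer to [z] than that, monotonicity of the count is enough. *)
  - destruct (Rle_dec (z + 2 * eta) w) as [D|D].
    + apply (Fin z w _ _ (INR (N z)) (INR (N w))); auto.
      destruct (H d eta (z + eta) (w - eta)) as [_ K]; try lra.
      replace (w - eta + eta) with w in K by ring. replace (z + eta - eta) with z in K by ring.
      replace (- z - eta) with (- (z + eta)) by ring. replace (- w + eta) with (- (w - eta)) by ring.
      apply Rle_trans with (1 := K). apply Rplus_le_compat_l. apply HF; lra.
    + assert (M := counts_mono mu N z w HN Hzw). assert (Nw := Nn w). assert (Q1 : exp (- z) <= exp (2 * eta) * exp (- w)) by (rewrite <- exp_plus; apply exp_le_compat; lra).
      assert (P := pos_INR (N z)). assert (Pz := exp_pos (- z)). apply Rle_trans with (exp (2 * eta) * exp (- w) * INR (N w)). apply Rmult_le_compat; lra.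
      rewrite Rmult_assoc. apply Rle_trans with ((1 + e) * (exp (- w) * INR (N w))); [|lra]. apply Rmult_le_compat_r; lra.
Qed.

(** Each doubling of [z >= 1] shrinks the error by at least the factor [exp (- gam)], so the chain
    is dominated by a geometric series. *)
Lemma dyadic_chain (l : R -> R) A gam z0 : 0 <= A -> 0 < gam -> 1 <= z0 ->
  (forall z w, z0 <= z -> z <= w -> w <= 2 * z -> Rabs (l w - l z) <= A * exp (- gam * z)) ->
  forall z w, z0 <= z -> z <= w -> Rabs (l w - l z) <= A / (1 - exp (- gam)) * exp (- gam * z).
Proof.
  intros HA Hg Hz0 H. assert (Hq : exp (- gam) < 1) by (rewrite <- exp_0; apply exp_increasing; lra). assert (Hq0 := exp_pos (- gam)).
  set (q := exp (- gam)) in *. set (A' := A / (1 - q)). assert (HA' : A' * (1 - q) = A) by (unfold A'; field; lra). assert (HA0 : 0 <= A') by (apply Rdiv_le_0_compat; lra).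
  assert (Hn : forall n z w, z0 <= z -> z <= w -> w <= 2 ^ n * z -> Rabs (l w - l z) <= A' * exp (- gam * z)).
  { induction n; intros z w Hz Hzw Hw.
    - simpl in Hw. replace w with z by lra. rewrite Rminus_diag, Rabs_R0. apply Rmult_le_pos; auto. apply Rlt_le, exp_pos.
    - assert (Pz := exp_pos (- gam * z)). destruct (Rle_dec w (2 * z)) as [D|D].
      + apply Rle_trans with (1 := H z w Hz Hzw D). apply Rmult_le_compat_r; [lra|]. nra.
      + assert (I := IHn (2 * z) w ltac:(lra) ltac:(lra) ltac:(simpl in Hw; lra)). assert (J := H z (2 * z) Hz ltac:(lra) ltac:(lra)).
        replace (l w - l z) with ((l w - l (2 * z)) + (l (2 * z) - l z)) by ring. apply Rle_trans with (1 := Rabs_triang _ _).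
        assert (E : exp (- gam * (2 * z)) <= q * exp (- gam * z)) by (unfold q; rewrite <- exp_plus; apply exp_le_compat; nra).
        assert (A' * exp (- gam * (2 * z)) <= A' * (q * exp (- gam * z))) by (apply Rmult_le_compat_l; auto). nra. }
  intros z w Hz Hzw. destruct (Pow_x_infinity 2 ltac:(rewrite Rabs_pos_eq; lra) w) as [n Hn0]. apply (Hn n); auto.
  specialize (Hn0 n ltac:(lia)). rewrite Rabs_pos_eq in Hn0 by (apply pow_le; lra). assert (0 < 2 ^ n) by (apply pow_lt; lra). nra.
Qed.

Lemma limit_with_rate (l : R -> R) A gam z0 : 0 < gam -> 0 <= A ->
  (forall z w, z0 <= z -> z <= w -> Rabs (l w - l z) <= A * exp (- gam * z)) ->
  exists a, forall z, z0 <= z -> Rabs (l z - a) <= A * exp (- gam * z).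
Proof.
  intros Hg HA H. destruct (Rcomplete.R_complete (fun n : nat => l (INR n))) as [a Ha].
  { intros eps He. destruct (INR_unbounded (Rmax (Rmax z0 0) (A / eps / gam))) as [M HM].
    assert (M1 : z0 < INR M) by (apply Rle_lt_trans with (2 := HM); apply Rle_trans with (2 := Rmax_l _ _); apply Rmax_l).
    assert (M2 : A / eps / gam < INR M) by (apply Rle_lt_trans with (2 := HM); apply Rmax_r).
    assert (M3 : A < eps * (gam * INR M)). { apply (Rmult_lt_compat_r (eps * gam)) in M2; [|nra]. replace (A / eps / gam * (eps * gam)) with A in M2 by (field; lra). lra. }
    assert (S : forall n, (M <= n)%nat -> A * exp (- gam * INR n) < eps).
    { intros n Hn. apply le_INR in Hn. replace (- gam * INR n) with (- (gam * INR n)) by ring. assert (X := exp_ineq1_le (gam * INR n)). assert (P := exp_pos (- (gam * INR n))).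
      assert (A < eps * exp (gam * INR n)). { apply Rlt_le_trans with (1 := M3). apply Rmult_le_compat_l; [lra|]. nra. }
      apply (Rmult_lt_compat_r (exp (- (gam * INR n)))) in H0; [|lra]. rewrite Rmult_assoc, <- exp_plus, Rplus_opp_r, exp_0 in H0. lra. }
    exists M. assert (W : forall n m, (M <= n)%nat -> (n <= m)%nat -> Rabs (l (INR m) - l (INR n)) < eps).
    { intros n m Hn Hm. apply Rle_lt_trans with (2 := S n Hn). apply H. apply le_INR in Hn; lra. apply le_INR; auto. }
    intros n m Hn Hm. unfold Rdist. destruct (le_lt_dec n m). rewrite Rabs_minus_sym. apply W; auto. apply W; auto; lia. }
  exists a. intros z Hz. apply le_epsilon. intros eps He. destruct (Ha eps He) as [M HM]. destruct (INR_unbounded z) as [n Hn].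
  specialize (HM (max M n) ltac:(lia)). unfold Rdist in HM. specialize (H z (INR (max M n)) Hz). assert (INR n <= INR (max M n)) by (apply le_INR; lia).
  specialize (H ltac:(lra)). rewrite Rabs_minus_sym in H. replace (l z - a) with ((l z - l (INR (max M n))) + (l (INR (max M n)) - a)) by ring.
  apply Rle_trans with (1 := Rabs_triang _ _). lra.
Qed.

(** [1 + b <= (1 + e) (1 + c)], so the mixed multiplicative and additive error becomes a purely
    additive one for [ln (1 + b)]. *)
Lemma ln_ratio_bound b c e : 0 <= b -> 0 <= c -> b <= (1 + e) * c + e -> 0 <= e -> ln (1 + b) - ln (1 + c) <= e.
Proof.
  intros Hb Hc H He. assert (X := exp_ineq1_le e). assert (Q : 1 + b <= exp e * (1 + c)) by nra.
  apply ln_le in Q; [|lra]. rewrite ln_mult, ln_exp in Q by (apply exp_pos || lra). lra.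
Qed.

Lemma exp_diff_bound u v M : u <= M -> v <= M -> Rabs (exp u - exp v) <= exp M * Rabs (u - v).
Proof.
  assert (W : forall u v, u <= v -> v <= M -> exp v - exp u <= exp M * (v - u)).
  { intros a b Hab Hb. assert (X := exp_ineq1_le (a - b)). assert (E : exp a = exp b * exp (a - b)) by (rewrite <- exp_plus; f_equal; ring).
    assert (P := exp_pos b). assert (exp b <= exp M) by (apply exp_le_compat; lra). rewrite E. apply Rle_trans with (exp b * (b - a)). nra. apply Rmult_le_compat_r; lra. }
  intros Hu Hv. destruct (Rle_dec u v) as [D|D].
  - rewrite (Rabs_minus_sym (exp u)), (Rabs_minus_sym u). rewrite (Rabs_pos_eq (v - u)) by lra. rewrite Rabs_pos_eq. apply W; auto. apply exp_le_compat in D; lra.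
  - rewrite !Rabs_pos_eq; try lra. apply W; lra. assert (v <= u) by lra. apply exp_le_compat in H; lra.
Qed.

(** The chain applies to [ln (1 + b)], which therefore converges at the required rate;
    exponentiating keeps the rate. At this stage the limit may depend on [k]. *)
Lemma count_asymptotic lam mu N k : good lam -> enumerates lam mu -> counts mu N -> (3 <= k)%nat ->
  exists a C z0, 0 <= C /\ 1 <= z0 /\ forall z, z0 <= z -> Rabs (exp (- z) * INR (N z) - a) <= C * exp (- (/ 2 - 2 / (INR k + 2)) * z).
Proof.
  intros G He HN Hk. destruct (dyadic_comparison lam mu N k G He HN Hk) as (A & z0 & HA & Hz0 & H).
  assert (Hg : 0 < / 2 - 2 / (INR k + 2)). { assert (Hk3 : 3 <= INR k) by (apply (le_INR 3) in Hk; simpl in Hk; lra). assert (/ (INR k + 2) <= / 5) by (apply Rinv_le_contravar; lra). unfold Rdiv. lra. }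
  set (gam := / 2 - 2 / (INR k + 2)) in *. set (b := fun z => exp (- z) * INR (N z)).
  assert (Nn : forall x, 0 <= b x) by (intros x; apply Rmult_le_pos; [apply Rlt_le, exp_pos|apply pos_INR]).
  set (l := fun z => ln (1 + b z)).
  assert (D := dyadic_chain l A gam z0 HA Hg Hz0).
  assert (Hq : exp (- gam) < 1) by (rewrite <- exp_0; apply exp_increasing; lra).
  set (A' := A / (1 - exp (- gam))) in *. assert (HA' : 0 <= A') by (apply Rdiv_le_0_compat; lra).
  destruct (limit_with_rate l A' gam z0 Hg HA') as [a Ha].
  { apply D. intros z w Hz Hzw Hw. destruct (H z w Hz Hzw Hw) as [H1 H2]. assert (P : 0 <= A * exp (- gam * z)) by (apply Rmult_le_pos; [auto|apply Rlt_le, exp_pos]).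
    apply Rabs_le. assert (X1 := ln_ratio_bound _ _ _ (Nn w) (Nn z) H1 P). assert (X2 := ln_ratio_bound _ _ _ (Nn z) (Nn w) H2 P). unfold l, b in *. lra. }
  exists (exp a - 1), (exp (a + A') * A'), z0. split. apply Rmult_le_pos; [apply Rlt_le, exp_pos|auto]. split; auto. intros z Hz.
  specialize (Ha z Hz). assert (Pz := exp_pos (- gam * z)). assert (Pz1 : exp (- gam * z) <= 1) by (apply exp_le1; nra).
  replace (exp (- z) * INR (N z) - (exp a - 1)) with (exp (l z) - exp a). 2: { unfold l. rewrite exp_ln. unfold b. ring. specialize (Nn z); lra. }
  assert (Hl : l z <= a + A'). { apply Rabs_le_between in Ha. nra. }
  apply Rle_trans with (1 := exp_diff_bound (l z) a (a + A') Hl ltac:(lra)). rewrite Rmult_assoc. apply Rmult_le_compat_l; auto. apply Rlt_le, exp_pos.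
Qed.

(** * Positivity of the density *)

Lemma prime_index_le lam mu : good lam -> enumerates lam mu -> forall j, exists i, mu i = lam j /\ (j <= i)%nat.
Proof.
  intros G He.
  assert (HB : forall j, exists i, mu i = lam j).
  { intros j. apply (proj2 He), BL_prime. }
  induction j. destruct (HB 0%nat) as [i Hi]. exists i. split; [auto|lia].
  destruct IHj as (i & Hi & Hij). destruct (HB (S j)) as [i' Hi']. exists i'. split; auto.
  destruct (le_lt_dec i' i) as [Q|Q]; [|lia]. assert (L := lam_increasing lam G j).
  assert (mu i' <= mu i). { destruct (Nat.eq_dec i' i) as [->|]. lra. apply Rlt_le, (enum_mono lam mu He). lia. } lra.
Qed.

(** Keeps only the last unit interval, where the numerator of [om] is at least [exp (y - 1) - 1] and
    the denominator at most [y]. *)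
Lemma Lam_lower y : 2 <= y -> (exp (y - 1) - 1) / y <= Lam y.
Proof.
  intros Hy. assert (L0 := Lam_lt 0 (y - 1) ltac:(lra)). rewrite Lam_0 in L0.
  cut ((exp (y - 1) - 1) / y <= RInt om (y - 1) y). { rewrite Lam_diff. lra. }
  apply Rle_trans with (RInt (fun _ => (exp (y - 1) - 1) / y) (y - 1) y). { rewrite RInt_Rconst. right. asR; ring. }
  apply RInt_le_cont; [lra| | |]. intros; apply continuous_const. intros; apply om_continuous.
  intros v Hv. assert (E := om_mult v). assert (P := om_pos v). assert (X : exp (y - 1) <= exp v) by (apply exp_le_compat; lra).
  apply Rmult_le_reg_r with y; [lra|]. unfold Rdiv. rewrite Rmult_assoc, Rinv_l by lra. nra.
Qed.

(* The integers are at least as numerous as the primes, and [N(z) = O(exp (9 z / 10))] would contradict the prime count. *)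
Lemma density_pos lam mu N a C z0 : good lam -> enumerates lam mu -> counts mu N -> 0 <= C -> 1 <= z0 ->
  (forall z, z0 <= z -> Rabs (exp (- z) * INR (N z) - a) <= C * exp (- / 10 * z)) -> 0 < a.
Proof.
  intros G He HN HC Hz0 H. apply Rnot_le_lt. intros Ha.
  assert (HU : forall z, z0 <= z -> INR (N z) <= C * exp (9 / 10 * z)).
  { intros z Hz. specialize (H z Hz). apply Rabs_le_between in H. assert (P := exp_pos z). assert (B : exp (- z) * INR (N z) <= C * exp (- / 10 * z)) by lra.
    apply (Rmult_le_compat_l (exp z)) in B; [|lra]. rewrite <- Rmult_assoc, <- exp_plus, Rplus_opp_r, exp_0, Rmult_1_l in B.
    replace (C * exp (9 / 10 * z)) with (exp z * (C * exp (- / 10 * z))); auto. replace (9 / 10 * z) with (z + - / 10 * z) by field. rewrite exp_plus. ring. }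
  destruct (lam_unbounded lam G (z0 + 100 * (100 * (1 + C)) * exp 1 + 100)) as [j Hj]. specialize (Hj j ltac:(lia)).
  assert (E1 := exp_pos 1). assert (HCE : 0 <= (1 + C) * exp 1) by (apply Rmult_le_pos; lra).
  set (y := Y (S j)). destruct (proj1 G j) as [_ Hly]. fold y in Hly.
  destruct (prime_index_le lam mu G He j) as (i & Hi & Hji). assert (Hc : (i < N (lam j))%nat) by (apply HN; lra).
  assert (Hc2 : INR j + 1 <= INR (N (lam j))) by (rewrite <- S_INR; apply le_INR; lia).
  specialize (HU (lam j) ltac:(lra)). assert (M : exp (9 / 10 * lam j) <= exp (9 / 10 * y)) by (apply exp_le_compat; lra).
  assert (HL := Lam_lower y ltac:(lra)). assert (HLy := proj2 (Y_spec (S j))). fold y in HLy. rewrite S_INR in HLy. rewrite HLy in HL.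
  assert (P9 := exp_pos (9 / 10 * y)). assert (P91 : 1 <= exp (9 / 10 * y)) by (rewrite <- exp_0; apply exp_le_compat; lra).
  assert (B : (exp (y - 1) - 1) / y <= (1 + C) * exp (9 / 10 * y)) by nra.
  apply (Rmult_le_compat_r y) in B; [|lra]. unfold Rdiv in B. rewrite Rmult_assoc, Rinv_l, Rmult_1_r in B by lra.
  assert (B2 : exp (y - 1) <= (2 + C) * y * exp (9 / 10 * y)) by nra.
  assert (B3 : exp y <= exp 1 * ((2 + C) * y * exp (9 / 10 * y))). { replace y with (1 + (y - 1)) at 1 by ring. rewrite exp_plus. apply Rmult_le_compat_l; lra. }
  replace y with (/ 10 * y + 9 / 10 * y) in B3 at 1 by field. rewrite exp_plus in B3.
  assert (B4 : exp (/ 10 * y) <= exp 1 * ((2 + C) * y)). { apply Rmult_le_reg_r with (exp (9 / 10 * y)); auto. lra. }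
  assert (X := exp_ineq1_le (/ 20 * y)). assert (B5 : (/ 20 * y) * (/ 20 * y) <= exp (/ 10 * y)). { replace (/ 10 * y) with (/ 20 * y + / 20 * y) by field. rewrite exp_plus. nra. }
  assert (B6 : y * y <= 400 * (exp 1 * (2 + C)) * y) by lra. assert (B7 : y <= 400 * (exp 1 * (2 + C))) by nra. nra.
Qed.

(** * Uniqueness of the density and assembly of the statement *)

Lemma cpow_ey l s : cpow (exp l) (Copp s) = ey s l.
Proof.
  unfold cpow, ey, cexp. rewrite ln_exp. destruct s as [a b]. unfold Cmult, Copp, RtoC, Re, Im; simpl.
  replace (l * - a - 0 * - b) with (- a * l) by ring. replace (l * - b + 0 * - a) with (- b * l) by ring. reflexivity.
Qed.

Lemma clim_is_series (f : nat -> C) l : clim (cpsum f) l -> @is_series C_AbsRing C_NormedModule f l.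
Proof.
  intros H. assert (E : forall n, sum_n f n = cpsum f (S n)).
  { induction n. rewrite sum_O. simpl. unfold plus; simpl. ring. rewrite sum_Sn, IHn. reflexivity. }
  apply (filterlim_locally (F := eventually)). intros eps. destruct (H (eps / 2) ltac:(assert (P := cond_pos eps); lra)) as [N HN]. exists N. intros n Hn.
  apply (norm_compat1 (V:=C_NormedModule)). rewrite E. specialize (HN (S n) ltac:(lia)). assert (P := cond_pos eps).
  apply Rle_lt_trans with (Cmod (cpsum f (S n) - l)); [right; reflexivity|lra].
Qed.

(** Serves to show that the densities found for different [k] coincide. *)
Lemma decay_zero c B g z0 : 0 < g -> (forall z, z0 <= z -> Rabs c <= B * exp (- g * z)) -> c = 0.
Proof.
  intros Hg H. assert (HB : 0 <= B). { specialize (H z0 ltac:(lra)). assert (P := exp_pos (- g * z0)). assert (Q := Rabs_pos c). apply Rnot_lt_le. intros L. nra. }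
  destruct (Req_dec c 0) as [|Hc]; auto. exfalso. apply Rabs_pos_lt in Hc. set (z := Rmax z0 ((B / Rabs c) / g)).
  specialize (H z (Rmax_l _ _)). assert (Hz : (B / Rabs c) / g <= z) by apply Rmax_r.
  assert (X := exp_ineq1_le (g * z)). assert (P := exp_pos (- g * z)).
  assert (B <= Rabs c * (g * z)). { apply (Rmult_le_compat_r (Rabs c * g)) in Hz; [|nra]. replace (B / Rabs c / g * (Rabs c * g)) with B in Hz by (field; lra). lra. }
  assert (B < Rabs c * exp (g * z)) by nra.
  apply (Rmult_lt_compat_r (exp (- g * z))) in H1; [|lra]. rewrite Rmult_assoc, <- exp_plus in H1. replace (g * z + - g * z) with 0 in H1 by ring. rewrite exp_0 in H1. lra.
Qed.

(** The density must not depend on [eps]: it is fixed by [k = 3], where the error exponent is 1/10,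
    and the density obtained from the large [k] suited to [eps] is identified with it. *)
Lemma integer_count lam mu : good lam -> enumerates lam mu -> exists a, 0 < a /\ forall eps, 0 < eps -> exists C0 x0, 0 < x0 /\ forall x, x0 <= x ->
  exists m, has_card (fun n => exp (mu n) <= x) m /\ Rabs (INR m - a * x) <= C0 * Rpower x (1 / 2 + eps).
Proof.
  intros G He. destruct (exists_counts lam mu G He) as [N HN].
  destruct (count_asymptotic lam mu N 3 G He HN ltac:(lia)) as (a & C & z0 & HC & Hz0 & H).
  replace (/ 2 - 2 / (INR 3 + 2)) with (/ 10) in H by (simpl; field). exists a. split. apply (density_pos lam mu N a C z0); auto.
  (* The loss [2 / (k + 2)] in the exponent must be at most [eps]. *)
  intros eps Heps. destruct (INR_unbounded (3 + 2 / eps)) as [k Hk].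
  assert (Hq : 0 < 2 / eps) by (apply Rdiv_lt_0_compat; lra).
  assert (Hk3 : (3 <= k)%nat) by (apply INR_le; simpl; lra).
  destruct (count_asymptotic lam mu N k G He HN Hk3) as (a' & C' & z1 & HC' & Hz1 & H').
  assert (Hi : 0 < / (INR k + 2) <= / 5) by (split; [apply Rinv_0_lt_compat|apply Rinv_le_contravar]; lra).
  assert (Hke : 2 / (INR k + 2) <= eps). { apply Rmult_le_reg_r with (INR k + 2); [lra|]. unfold Rdiv at 1. rewrite Rmult_assoc, Rinv_l by lra.
    assert (2 / eps * eps = 2) by (field; lra). nra. }
  set (g := / 2 - 2 / (INR k + 2)) in *. assert (Hg : / 10 <= g) by (unfold g, Rdiv; lra).
  assert (Ea : a' = a). { cut (a' - a = 0); [lra|]. apply (decay_zero _ (C + C') (/ 10) (Rmax z0 z1)). lra. intros z Hz.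
    assert (z0 <= z) by (apply Rle_trans with (2 := Hz), Rmax_l). assert (z1 <= z) by (apply Rle_trans with (2 := Hz), Rmax_r).
    specialize (H z ltac:(lra)). specialize (H' z ltac:(lra)). set (b := exp (- z) * INR (N z)) in *.
    assert (exp (- g * z) <= exp (- / 10 * z)) by (apply exp_le_compat; nra). assert (C' * exp (- g * z) <= C' * exp (- / 10 * z)) by (apply Rmult_le_compat_l; auto).
    apply Rabs_le_between in H. apply Rabs_le_between in H'. apply Rabs_le. lra. }
  rewrite Ea in H'. exists C', (exp z1). split. apply exp_pos. intros x Hx.
  assert (Hx0 : 0 < x) by (assert (P := exp_pos z1); lra). set (z := ln x). assert (Hxz : exp z = x) by (apply exp_ln; auto).
  assert (Hz : z1 <= z) by (unfold z; rewrite <- (ln_exp z1); apply ln_le; [apply exp_pos|auto]).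
  exists (N z). split.
  - apply has_card_initial. intros n. rewrite (HN z n). rewrite <- Hxz. split. apply exp_le_compat. intros Q. apply Rnot_lt_le. intros L. apply exp_increasing in L. lra.
  - specialize (H' z Hz). unfold Rpower. fold z. rewrite <- Hxz at 1. set (b := exp (- z) * INR (N z)) in *.
    replace (INR (N z) - a * exp z) with (exp z * (b - a)). 2: { unfold b. rewrite Rmult_minus_distr_l, <- Rmult_assoc, <- exp_plus, Rplus_opp_r, exp_0. ring. }
    rewrite Rabs_mult, (Rabs_pos_eq (exp z)) by apply Rlt_le, exp_pos.
    apply Rle_trans with (exp z * (C' * exp (- g * z))). apply Rmult_le_compat_l; auto. apply Rlt_le, exp_pos.
    replace (exp z * (C' * exp (- g * z))) with (C' * exp (z + - g * z)) by (rewrite exp_plus; ring). apply Rmult_le_compat_l; auto. apply exp_le_compat. unfold g. nra.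
Qed.

Theorem theorem1p3 :
  exists (q nu : nat -> R),
    beurling_primes q /\ lists_beurling_integers q nu /\
    (* (i) analytic continuation to Re s > 1/2 with a simple pole at s = 1 *)
    (exists (Z G : C -> C) (sigma0 : R),
       (forall s : C, sigma0 < Re s ->
          is_series (fun n => cpow (nu n) (Copp s)) (Z s)) /\
       holomorphic_on Z (fun s => 1/2 < Re s /\ s <> RtoC 1) /\
       holomorphic_on G (fun s => 1/2 < Re s) /\
       G (RtoC 1) <> RtoC 0 /\
       (forall s : C, 1/2 < Re s -> s <> RtoC 1 ->
          Z s = Cdiv (G s) (Cminus s (RtoC 1))) /\
       (* (ii) no zeros in Re s > 1/2 *)
       (forall s : C, 1/2 < Re s -> s <> RtoC 1 -> Z s <> RtoC 0)) /\
    (* (iii) pi_q(x) = li(x) + O(1) *)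
    (exists C0 x0 : R, forall x : R, x0 <= x ->
       exists m : nat, has_card (fun n : nat => q n <= x) m /\
                       Rabs (INR m - li x) <= C0) /\
    (* (iv) N_q(x) = a x + O_eps(x^(1/2+eps)) *)
    (exists a : R, 0 < a /\
       forall eps : R, 0 < eps ->
       exists C0 x0 : R, 0 < x0 /\ forall x : R, x0 <= x ->
         exists m : nat, has_card (fun n : nat => nu n <= x) m /\
           Rabs (INR m - a * x) <= C0 * Rpower x (1/2 + eps)) /\
    (* (v) Bohr's condition *)
    (exists c1 c2 : R, 0 < c1 /\ 0 < c2 /\
       forall n : nat, nu (S n) - nu n >= c1 * Rpower (nu (S n)) (- c2)).
Proof.
  destruct exists_good as [lam G]. destruct (exists_log_integers lam G) as (mu & Hmu). assert (He : enumerates lam mu) by exact Hmu.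
  destruct Hmu as [Hinc Hmu].
  exists (fun n => exp (lam n)), (fun n => exp (mu n)). split; [apply good_primes; auto|]. split; [apply lists_integers; auto|].
  split; [|split; [|split]].
  (* [F s = zeta s * (s - 1)], so the pole is simple because [F 1] is nonzero, and the absence of
     zeros is that of [s] and of the exponential. The Dirichlet series is compared for [Re s > 2],
     where it converges absolutely. *)
  - set (F := fun s => (s * cexp (W lam s))%C).
    assert (QF : qd rhalf F (fun s => (1 + 0 * (s + s)) * cexp (W lam s) + (0 + 1 * s + 0 * (s * s)) * (W' lam s * cexp (W lam s)))%C).
    { apply (qd_ext _ (fun s => (0 + 1 * s + 0 * (s * s)) * cexp (W lam s))%C) with (3 := qd_mult _ _ _ _ _ (qd_poly rhalf 0 1 0) (qd_cexp _ _ _ (W_qd lam G))).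
      intros s. unfold F. ring. auto. }
    assert (Hh : forall s : C, 1 / 2 < Re s -> rhalf s) by (intros s Hs; unfold rhalf; lra).
    assert (Hs1 : forall s : C, s <> RtoC 1 -> (s - 1)%C <> RtoC 0). { intros s Hs E. apply Hs. replace s with (s - 1 + 1)%C by ring. rewrite E. ring. }
    assert (HF : forall s : C, 1 / 2 < Re s -> F s <> RtoC 0).
    { intros s Hs. apply Cmult_neq_0; [|apply cexp_neq_0]. intros E. rewrite E in Hs. unfold RtoC, Re in Hs; simpl in Hs. lra. }
    exists (fun s => Cdiv (F s) (Cminus s (RtoC 1))), F, 2. split; [|split; [|split; [|split; [|split]]]].
    + intros s Hs. replace (Cdiv (F s) (Cminus s (RtoC 1))) with (zeta mu s).
      2: { rewrite (zeta_formula lam mu s G He) by lra. unfold F, Cdiv. ring. }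
      apply clim_is_series. apply clim_ext with (cpsum (fun m => ey s (mu m))).
      { induction n; simpl; auto. rewrite IHn, cpow_ey. reflexivity. }
      apply (zeta_clim lam mu s G He). lra.
    + intros s [Hs Hs']. apply (qd_holomorphic (fun s => rhalf s /\ s <> RtoC 1) _ _ s (qd_mult _ _ _ _ _ (qd_sub rhalf _ _ _ (fun s H => proj1 H) QF) (qd_sub _ _ _ _ (fun s H => proj2 H) qd_inv))). auto.
    + intros s Hs. apply (qd_holomorphic rhalf F _ s QF). auto.
    + apply HF. unfold RtoC, Re; simpl. lra.
    + auto.
    + intros s Hs Hs' E. apply (HF s Hs). replace (F s) with (F s / (s - 1) * (s - 1))%C by (field; auto). unfold Cdiv in E. unfold Cdiv. rewrite E. ring.
  - exists 2, 2. intros x Hx. apply prime_count; auto.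
  - apply (integer_count lam mu G He).
  - exists c0, 8. split; [apply c0_pos|]. split; [lra|]. apply (good_bohr lam mu G Hinc Hmu).
Qed.
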